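(* Let $N>2$, let $\Omega\subset\mathbb{R}^N$ be a bounded domain, $T>0$, $\Omega_T=\Omega\times(0,T)$ and $0<s<1$, and let the kernel $k$, with associated kernel $l$, satisfy condition (Hk) of the context. Suppose that, for $i=1,2$, $u^i$ is an entropy solution (in the sense defined in the context) of the problem $$\partial_t(k*(u-u_0))+(-\Delta)^s u=f \ \text{ in }\Omega_T,\qquad u=0\ \text{ in }(\mathbb{R}^N\setminus\Omega)\times(0,T),\qquad u(x,0)=u_0(x)\ \text{ in }\Omega$$ with $f=f^i\in L^1(\Omega_T)$ and $u_0=u_0^i\in L^1(\Omega)$. Then $$\int_0^T\!\!\int_\Omega(u^1-u^2)^+\,dx\,dt\le T\int_\Omega(u_0^1-u_0^2)^+\,dx+\|l\|_{L^1(0,T)}\int_0^T\!\!\int_\Omega(f^1-f^2)^+\,dx\,dt$$ and $$\|u^1-u^2\|_{L^1(\Omega_T)}\le T\|u_0^1-u_0^2\|_{L^1(\Omega)}+\|l\|_{L^1(0,T)}\|f^1-f^2\|_{L^1(\Omega_T)}.$$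
   Context: Convolution: for functions on the positive half-line (time variable), $(k*v)(t)=\int_0^t k(t-\tau)v(\tau)\,d\tau$, $t\ge 0$. $r^+=\max(r,0)$. Condition (Hk) on the kernel $k\in L^1_{loc}([0,\infty))$: $k$ is non-negative and non-increasing, and there exists a kernel $l\in L^1_{loc}([0,\infty))$ whose restriction to $(0,T)$ lies in $L^p(0,T)$ for some $p>1$, such that $k*l=1$ in $(0,\infty)$. Fractional Laplacian: $(-\Delta)^s u(x,t)=\mathrm{P.V.}\int_{\mathbb{R}^N}\frac{u(x,t)-u(y,t)}{|x-y|^{N+2s}}\,dy=\lim_{\epsilon\to0}\int_{\mathbb{R}^N\setminus B_\epsilon(x)}\frac{u(x,t)-u(y,t)}{|x-y|^{N+2s}}\,dy$. Function spaces: $\mathcal{D}_\Omega=(\mathbb{R}^N\times\mathbb{R}^N)\setminus(\mathcal{C}\Omega\times\mathcal{C}\Omega)$ with $\mathcal{C}\Omega=\mathbb{R}^N\setminus\Omega$, and $d\nu=\frac{dx\,dy}{|x-y|^{N+2s}}$. $X_0^{s,2}(\Omega)$ is the space of Lebesgue measurable functions $u:\mathbb{R}^N\to\mathbb{R}$ that vanish a.e. in $\mathcal{C}\Omega$ and satisfy $\int_\Omega|u|^2\,dx+\int_{\mathcal{D}_\Omega}|u(x)-u(y)|^2\,d\nu<\infty$, with norm $\|u\|_{X_0^{s,2}(\Omega)}=\big(\int_{\mathcal{D}_\Omega}|u(x)-u(y)|^2\,d\nu\big)^{1/2}$. $L^2(0,T;X_0^{s,2}(\Omega))$ is the set of $u\in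 L^2(\Omega_T)$ (extended by $0$ outside $\Omega$) with $\int_0^T\int_{\mathcal{D}_\Omega}|u(x,t)-u(y,t)|^2\,d\nu\,dt<\infty$. For $K>0$, $T_K(r)=\max\{\min(r,K),-K\}$. Put $\mathcal{P}=\{S\in C^1(\mathbb{R}):0\le S'\le1,\ \operatorname{supp}S'\text{ compact},\ S(0)=0\}$. $C_0^\infty([0,T))$ denotes the smooth functions with compact support in $[0,T)$. Entropy solution: a measurable function $u\in L^1(\Omega_T)$ (extended by $0$ outside $\Omega$) with $T_K(u)\in L^2(0,T;X_0^{s,2}(\Omega))$ for all $K>0$ is an entropy solution of the problem with data $f,u_0$ if $$-\int_0^T\!\!\int_\Omega\zeta_t\Big[k_1*\int_{u_0}^{u}S(\sigma-\phi)\,d\sigma\Big]dx\,dt+\int_0^T\!\!\int_\Omega\zeta\,\partial_t[k_2*(u-u_0)]\,S(u-\phi)\,dx\,dt$$ $$+\frac12\int_0^T\!\!\int_{\mathcal{D}_\Omega}(u(x,t)-u(y,t))\big(S(u(x,t)-\phi(x))-S(u(y,t)-\phi(y))\big)\zeta(t)\,d\nu\,dt\le\int_0^T\!\!\int_\Omega\zeta f\,S(u-\phi)\,dx\,dt$$ for all $\phi\in X_0^{s,2}(\Omega)\cap L^\infty(\Omega)$, all $\zeta\in C_0^\infty([0,T))$ with $\zeta\ge0$, all $S\in\mathcal{P}$, and all non-increasing non-negative $k_1,k_2\in L^1(0,T)$ with $k=k_1+k_2$ and $k_2(0^+)<\infty$. *)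

(* Defs.v *)
From HB Require Import structures.
From mathcomp Require Import all_boot all_order all_algebra.
From mathcomp Require Import all_classical all_reals all_analysis.

Set Implicit Arguments.
Unset Strict Implicit.
Unset Printing Implicit Defensive.

Import Order.TTheory GRing.Theory Num.Theory.
Import numFieldTopology.Exports numFieldNormedType.Exports.

Local Open Scope classical_set_scope.
Local Open Scope ring_scope.

(* 'rV[T]_n carries the sigma-algebra generated by its coordinates; for
   T = R this is the Borel sigma-algebra of R^n.  Lebesgue measurable
   functions are thus given by Borel representatives.                     *)
Definition measure_row_display : measure_display -> measure_display.
Proof. exact. Qed.

Section measurable_row.
Context {d} {T : measurableType d} (n : nat).

Let coors : 'I_n -> 'rV[T]_n -> T := fun i x => x ord0 i.

Let row_set0 : g_sigma_preimage coors set0.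
Proof. exact: sigma_algebra0. Qed.

Let row_setC A : g_sigma_preimage coors A -> g_sigma_preimage coors (~` A).
Proof. exact: sigma_algebraC. Qed.

Let row_bigcup (F : (set _)^nat) : (forall i, g_sigma_preimage coors (F i)) ->
  g_sigma_preimage coors (\bigcup_i (F i)).
Proof. exact: sigma_algebra_bigcup. Qed.

HB.instance Definition _ := @isMeasurable.Build (measure_row_display d)
  'rV[T]_n (g_sigma_preimage coors) row_set0 row_setC row_bigcup.

End measurable_row.

Lemma measurable_coord d (T : measurableType d) n (i : 'I_n) :
  measurable_fun [set: 'rV[T]_n] (fun x : 'rV[T]_n => x ord0 i).
Proof.
move=> _ Y mY; rewrite setTI; apply: sub_sigma_algebra => /=.
rewrite -bigcup_seq/=; exists i => /=; first by rewrite mem_index_enum.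
by exists Y => //; rewrite setTI.
Qed.

Lemma measurable_fun_rowP d1 d2 (T1 : measurableType d1)
    (T2 : measurableType d2) n (f : T1 -> 'rV[T2]_n) :
  (forall i, measurable_fun [set: T1] (fun x => f x ord0 i)) ->
  measurable_fun [set: T1] f.
Proof.
move=> mf; have sub : g_sigma_preimage
    (fun i => (fun x : 'rV[T2]_n => x ord0 i) \o f) `<=` measurable.
  apply: smallest_sub; first exact: sigma_algebra_measurable.
  case: n => [|n] in f mf *; first by rewrite big_ord0.
  rewrite -bigcup_mkord_ord; apply: bigcup_sub => i Ii.
  by move=> A [B mB <-]; exact: mf.
move: sub; rewrite g_sigma_preimage_comp => sub _ A mA.
by apply: sub; exists A.
Qed.

Section lebesgue_rV.
Context {R : realType}.

Section step.
Context (n : nat).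

Definition row_cons (p : measurableTypeR R * 'rV[R]_n) : 'rV[R]_n.+1 :=
  row_mx (p.1%:M : 'M[R]_1) p.2.

Definition row_uncons (x : 'rV[R]_n.+1) : measurableTypeR R * 'rV[R]_n :=
  (x ord0 ord0, \row_j x ord0 (lift ord0 j)).

Lemma row_cons0 p : row_cons p ord0 ord0 = p.1.
Proof.
rewrite /row_cons mxE; case: splitP => [j _|j]//=.
by rewrite mxE [j]ord1 mulr1n.
Qed.

Lemma row_consS p j : row_cons p ord0 (lift ord0 j) = p.2 ord0 j.
Proof.
rewrite /row_cons mxE; case: splitP => [k|k]/=.
  by case: k => -[].
by rewrite /bump/= => -[jk]; congr (p.2 _ _); exact/val_inj.
Qed.

Lemma row_consK : cancel row_cons row_uncons.
Proof.
move=> p; rewrite /row_uncons row_cons0 [RHS]surjective_pairing; congr pair.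
by apply/rowP => j; rewrite mxE row_consS.
Qed.

Lemma measurable_row_cons : measurable_fun [set: measurableTypeR R * 'rV[R]_n] row_cons.
Proof.
apply: measurable_fun_rowP => i; case: (unliftP ord0 i) => [j ->|->].
  under eq_fun do rewrite row_consS.
  exact: (measurableT_comp (measurable_coord j) measurable_snd).
by under eq_fun do rewrite row_cons0; exact: measurable_fst.
Qed.

Lemma measurable_row_uncons : measurable_fun [set: 'rV[R]_n.+1] row_uncons.
Proof.
apply: measurable_fun_pair; first exact: measurable_coord.
apply: measurable_fun_rowP => i; under eq_fun do rewrite mxE.
exact: measurable_coord.
Qed.

Context (m : {sigma_finite_measure set 'rV[R]_n -> \bar R}).

Definition leb_step : set 'rV[R]_n.+1 -> \bar R :=
  pushforward (@lebesgue_measure R \x m)%E row_cons.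

Let measurable_preimage (A : set 'rV[R]_n.+1) : measurable A -> measurable (row_cons @^-1` A).
Proof.
by move=> mA; rewrite -[X in measurable X]setTI; exact: measurable_row_cons.
Qed.

Let leb_step0 : leb_step set0 = 0%E.
Proof. by rewrite /leb_step /pushforward preimage_set0 measure0. Qed.

Let leb_step_ge0 A : (0 <= leb_step A)%E.
Proof. by rewrite /leb_step /pushforward; exact: measure_ge0. Qed.

Let leb_step_sigma_additive : semi_sigma_additive leb_step.
Proof.
move=> F mF tF mUF; rewrite /leb_step /pushforward preimage_bigcup.
apply: measure_semi_sigma_additive.
- by move=> n0; exact: measurable_preimage.
- apply/trivIsetP => /= i j _ _ ij; rewrite -preimage_setI.
  by move/trivIsetP : tF => /(_ _ _ _ _ ij) ->//; rewrite preimage_set0.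
- by rewrite -preimage_bigcup; exact: measurable_preimage.
Qed.

HB.instance Definition _ := isMeasure.Build _ _ _ leb_step
  leb_step0 leb_step_ge0 leb_step_sigma_additive.

Let leb_step_sigma_finite : sigma_finite setT leb_step.
Proof.
have /sigma_finiteP[F [TF ndF Foo]] := sigma_finiteT (@lebesgue_measure R).
have /sigma_finiteP[G [TG ndG Goo]] := sigma_finiteT m.
exists (fun i => row_uncons @^-1` (F i `*` G i)).
  rewrite -preimage_bigcup -[LHS](preimage_setT row_uncons); congr (_ @^-1` _).
  rewrite -setXTT TF TG predeqE => -[x y]; split.
    move=> [/= [i _ Fix] [j _ Gjy]]; exists (maxn i j) => //; split.
    - by move: x Fix; exact/subsetPset/ndF/leq_maxl.
    - by move: y Gjy; exact/subsetPset/ndG/leq_maxr.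
  by move=> [i _ []/= ? ?]; split; exists i.
move=> i; have [mF Foo'] := Foo i; have [mG Goo'] := Goo i; split.
  rewrite -[X in measurable X]setTI.
  by apply: measurable_row_uncons => //; exact: measurableX.
rewrite /leb_step /pushforward -comp_preimage.
rewrite (_ : row_uncons \o row_cons = id); last first.
  by apply/funext => p; exact: row_consK.
by rewrite preimage_id product_measure1E// lte_mul_pinfty// ge0_fin_numE.
Qed.

HB.instance Definition _ :=
  Measure_isSigmaFinite.Build _ _ _ leb_step leb_step_sigma_finite.

End step.

(* N-dimensional Lebesgue measure: an iterated product of the Lebesgue
   measure of R.                                                          *)
Fixpoint leb (n : nat) : {sigma_finite_measure set 'rV[R]_n -> \bar R} :=
  match n with
  | 0 => dirac (0 : 'rV[R]_0)
  | n.+1 => leb_step (leb n)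
  end.

Lemma leb_box n (A : 'I_n -> set (measurableTypeR R)) :
  (forall i, measurable (A i)) ->
  leb n [set x : 'rV[R]_n | forall i, A i (x ord0 i)] =
  (\prod_(i < n) lebesgue_measure (A i))%E.
Proof.
elim: n A => [|n IHn] A mA.
  rewrite big_ord0 /= diracE mem_set// => -[].
  by [].
rewrite big_ord_recl -IHn; last by move=> i; exact: mA.
rewrite /= /leb_step /pushforward -product_measure1E//=.
  congr (product_measure1 _ _ _); apply/seteqP; split => p /=.
    move=> Ap; split; first by have := Ap ord0; rewrite row_cons0.
    by move=> i; have := Ap (lift ord0 i); rewrite row_consS.
  move=> -[A0 AS] i; case: (unliftP ord0 i) => [j ->|->].
    by rewrite row_consS.
  by rewrite row_cons0.
rewrite (_ : mkset _ = \bigcap_(i in [set: 'I_n])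
    ((fun x : 'rV[R]_n => x ord0 i) @^-1` A (lift ord0 i))).
  apply: fin_bigcap_measurable => // i _.
  rewrite -[X in measurable X]setTI; apply: measurable_coord => //.
  exact: mA.
by apply/seteqP; split => x Ax i; [move=> _; exact: Ax|exact: (Ax i I)].
Qed.

End lebesgue_rV.

Section problem.
Context {R : realType}.

Local Notation mu := (@lebesgue_measure R).

(* The library norm `|x| of a row vector is the sup norm. *)
Definition enorm (N : nat) (x : 'rV[R]_N) : R :=
  Num.sqrt (\sum_i x ord0 i ^+ 2).

Definition bounded_domain (N : nat) (Omega : set 'rV[R]_N) : Prop :=
  [/\ Omega !=set0, open Omega, connected Omega & bounded_set Omega].

Definition cylinder (N : nat) (Omega : set 'rV[R]_N) (T : R) :
  set ('rV[R]_N * measurableTypeR R) := Omega `*` `]0, T[.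

Definition int_cyl (N : nat) (Omega : set 'rV[R]_N) (T : R)
    (g : 'rV[R]_N -> R -> R) : \bar R :=
  (\int[mu]_(t in `]0%R, T[) (\int[leb N]_(x in Omega) (g x t)%:E))%E.

Definition L1norm d (X : measurableType d) (m : set X -> \bar R) (D : set X)
    (f : X -> R) : \bar R := (\int[m]_(x in D) `|f x|%:E)%E.

Definition conv (k v : R -> R) (t : R) : R :=
  \int[mu]_(tau in `]0, t[) (k (t - tau) * v tau).

(* Integral with orientation: \int_a^b g = - \int_b^a g. *)
Definition oint (a b : R) (g : R -> R) : R :=
  if a <= b then \int[mu]_(sigma in `[a, b]) g sigma
  else - \int[mu]_(sigma in `[b, a]) g sigma.

Definition L1loc (k : R -> R) : Prop :=
  forall b : R, 0 < b -> mu.-integrable `]0, b[ (EFin \o k).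

(* The pointwise conditions are on the open half-line, as k may blow up
   at 0.  The convolution of two L1loc functions is defined almost
   everywhere, hence so is the identity k * l = 1.                        *)
Definition Hk (T : R) (k l : R -> R) : Prop :=
  [/\ L1loc k /\ L1loc l,
      forall t, 0 < t -> 0 <= k t,
      forall r t, 0 < r -> r <= t -> k t <= k r,
      exists2 p : R, 1 < p &
        (\int[mu]_(t in `]0%R, T[) (`|l t| `^ p)%:E < +oo)%E &
      {ae mu, forall t, 0 < t -> conv k l t = 1}].

Definition dom_D (N : nat) (Omega : set 'rV[R]_N) :
  set ('rV[R]_N * 'rV[R]_N) := ~` (~` Omega `*` ~` Omega).

(* Integral over D_Omega against d nu = dx dy / |x - y|^(N + 2s); on the
   diagonal, a null set, the density takes the value 0.                   *)
Definition int_nu (N : nat) (s : R) (Omega : set 'rV[R]_N)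
    (g : 'rV[R]_N -> 'rV[R]_N -> R) : \bar R :=
  (\int[leb N \x leb N]_(z in dom_D Omega)
     (g z.1 z.2 / enorm (z.1 - z.2) `^ (N%:R + 2 * s))%:E)%E.

Definition X0 (N : nat) (s : R) (Omega : set 'rV[R]_N)
    (u : 'rV[R]_N -> R) : Prop :=
  [/\ measurable_fun setT u,
      {ae leb N, forall x, ~ Omega x -> u x = 0} &
      ((\int[leb N]_(x in Omega) (u x ^+ 2)%:E)
        + int_nu s Omega (fun x y => `|u x - u y| ^+ 2)%R < +oo)%E].

Definition Linfty (N : nat) (Omega : set 'rV[R]_N) (u : 'rV[R]_N -> R) :
  Prop := exists M : R, {ae leb N, forall x, Omega x -> `|u x| <= M}.

Definition L2X0 (N : nat) (s T : R) (Omega : set 'rV[R]_N)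
    (u : 'rV[R]_N -> R -> R) : Prop :=
  [/\ measurable_fun (cylinder Omega T) (fun z => u z.1 z.2 : R),
      (\int[leb N \x mu]_(z in cylinder Omega T) (u z.1 z.2 ^+ 2)%:E < +oo)%E,
      (forall x t, ~ Omega x -> 0 < t < T -> u x t = 0) &
      (\int[mu]_(t in `]0%R, T[)
         int_nu s Omega (fun x y => `|u x t - u y t| ^+ 2)%R < +oo)%E].

Definition trunc (K r : R) : R := Num.max (Num.min r K) (- K).

Definition classP (S : R -> R) : Prop :=
  [/\ (forall r, derivable S r 1) /\ continuous (derive1 S),
      forall r, 0 <= derive1 S r <= 1,
      compact (closure [set r | derive1 S r != 0]) &
      S 0 = 0].

Definition smooth (g : R -> R) : Prop :=
  forall n t, derivable (derive1n n g) t 1.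

(* C_0^oo([0,T)): such a function does not have to vanish at 0.  Smooth
   functions on [0,T) are restrictions of smooth functions on R; the values
   on the negative half-line play no role.                                *)
Definition test0 (T : R) (zeta : R -> R) : Prop :=
  smooth zeta /\ exists2 b, b < T & forall t, b < t -> zeta t = 0.

Definition testc (T : R) (eta : R -> R) : Prop :=
  smooth eta /\ exists a b, [/\ 0 < a, b < T &
    forall t, ~~ (a <= t <= b) -> eta t = 0].

(* w is the derivative of V in the sense of L^1(0,T;L^1(Omega))-valued
   distributions on (0,T).                                                *)
Definition weak_dt (N : nat) (T : R) (Omega : set 'rV[R]_N)
    (V w : 'rV[R]_N -> R -> R) : Prop :=
  (leb N \x mu)%E.-integrable (cylinder Omega T) (fun z => (w z.1 z.2)%:E) /\
  forall eta, testc T eta ->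
    {ae leb N, forall x, Omega x ->
      \int[mu]_(t in `]0, T[) (V x t * derive1 eta t) =
      - \int[mu]_(t in `]0, T[) (w x t * eta t)}.

(* Since k2 is bounded and non-increasing and u - u0 is integrable,
   k2 * (u - u0) lies in W^{1,1}(0,T;L^1(Omega)): its weak derivative w
   exists and is unique up to null sets, so that quantifying over w only
   ranges over its representatives.
   The integral against nu is well defined in (-oo, +oo], but its finiteness is
   part of the entropy inequality, which is therefore stated in \bar R.   *)
Definition entropy_solution (N : nat) (s T : R) (Omega : set 'rV[R]_N)
    (k : R -> R) (f : 'rV[R]_N -> R -> R) (u0 : 'rV[R]_N -> R)
    (u : 'rV[R]_N -> R -> R) : Prop :=
  [/\ (leb N \x mu)%E.-integrable (cylinder Omega T)
        (fun z => (u z.1 z.2)%:E),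
      (forall x t, ~ Omega x -> 0 < t < T -> u x t = 0),
      (forall K, 0 < K -> L2X0 s T Omega (fun x t => trunc K (u x t))) &
      forall (phi : 'rV[R]_N -> R) (zeta S k1 k2 : R -> R)
             (w : 'rV[R]_N -> R -> R),
        X0 s Omega phi -> Linfty Omega phi ->
        test0 T zeta -> (forall t, 0 <= t < T -> 0 <= zeta t) ->
        classP S ->
        (forall t, 0 < t < T -> 0 <= k1 t /\ 0 <= k2 t) ->
        (forall r t, 0 < r -> r <= t -> t < T ->
           k1 t <= k1 r /\ k2 t <= k2 r) ->
        mu.-integrable `]0, T[ (EFin \o k1) ->
        mu.-integrable `]0, T[ (EFin \o k2) ->
        (forall t, 0 < t < T -> k t = k1 t + k2 t) ->
        (exists c : R, k2 t @[t --> 0^'+] --> c) ->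
        weak_dt T Omega (fun x => conv k2 (fun tau => u x tau - u0 x)) w ->
        (- int_cyl Omega T (fun x t => derive1 zeta t *
              conv k1 (fun tau => oint (u0 x) (u x tau)
                                    (fun sigma => S (sigma - phi x))) t)%R
         + int_cyl Omega T (fun x t => zeta t * w x t * S (u x t - phi x))%R
         + (2^-1)%:E * (\int[mu]_(t in `]0%R, T[)
              int_nu s Omega (fun x y =>
                (u x t - u y t) *
                (S (u x t - phi x) - S (u y t - phi y)) * zeta t)%R)
         <= int_cyl Omega T (fun x t => zeta t * f x t * S (u x t - phi x))%R
        )%E].

End problem.

(* Main.v *)
(* Only two splittings k = k1 + k2 are needed: k2 = 0 and k2 = min(k, M).  By the
   layer cake formula, the derivative of min(k, M) * g is the superposition
   int_0^M (g(t) - g(t - a(l))) dl of increments, with a(l) the length of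
   {k > l}.

   Two solutions u and v are compared by doubling the time variable: the
   inequality of u at time t is tested with phi = T_K(v(., r)), that of v at time
   r with phi = T_K(u(., t)), S being a smoothed sign and both times being
   localized near c by a mollifier.  The two nonlocal terms have a nonnegative
   sum up to the energy of u and v in the bands |u| ~ K and |v| ~ K, which
   tends to 0 for a sequence of K.  In the limit S becomes the sign function, and
   Kato's inequality for the increments above bounds from above
     int_0^M (P(c) - P(c - a(l))) dl,
   where P is the mollified integral of (u - v)^+, the solutions being continued
   by their initial values to negative times.  For M -> oo this says that the
   increments of k * (P - P(0)) are at most those of the integral of
   (f - h)^+.

   The entropy inequality tested with a cut-off in time at 0 shows that
   (1/e) int_0^e k * int_0^e |u| tends to 0; this gives a starting time near 0
   at which k * (P - P(0)) is small.  Hence k * (P - P(0)) <= B = k * (B l), and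
   a maximum principle for the increments turns this into
   int (P - P(0)) <= B int l. *)

From HB Require Import structures.
From mathcomp Require Import all_boot all_order all_algebra.
From mathcomp Require Import all_classical all_reals all_analysis.
From mathcomp Require Import measurable_realfun ring lra.
Require Import Defs.

Set Implicit Arguments.
Unset Strict Implicit.
Unset Printing Implicit Defensive.

Import Order.TTheory GRing.Theory Num.Theory.
Import numFieldTopology.Exports numFieldNormedType.Exports.

Local Open Scope classical_set_scope.
Local Open Scope ring_scope.

(** * Integrals of real-valued functions *)

(** The test function [phi] of the entropy inequality is independent of time and bounded. Hence the
    other solution can only enter frozen at a second time and truncated, and the truncation spoils
    the sign of the nonlocal terms where a solution passes the level K. The weight is a product of
    two mollifiers with a common centre [c], not a mollifier of the time difference: at a frozen
    second time it is an admissible [zeta], and a common shift of both times only moves [c]. The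
    singular part k - min(k, M) of the kernel is never differentiated. Its contribution is estimated
    by its L^1 norm, times a constant that depends on the mollifier and is proportional to sup S, so
    that it survives the passage to the sign function. This fixes the order of the limits: K to
    infinity, the width of S to 0, M to infinity, and only then the scale of the mollifier to 0. At
    a positive scale the centre [c] stays away from 0 by that scale, so nothing is known at time 0
    itself; this is why the initial value needs an estimate of its own. *)

Section pmeasure.
Context d1 d2 (T1 : measurableType d1) (T2 : measurableType d2) (R : realType).
Variable m1 : {sigma_finite_measure set T1 -> \bar R}.
Variable m2 : {sigma_finite_measure set T2 -> \bar R}.

(* The sigma-finite instance of [\x] in the library is shadowed by its
   subprobability instance; the alias [pm] restores it. *)
Definition pm : set (T1 * T2) -> \bar R := (m1 \x m2)%E.

HB.instance Definition _ := Measure.copy pm (m1 \x m2)%E.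

Let pm_sigma_finite : sigma_finite setT pm.
Proof.
have /sigma_finiteP[F [TF ndF Foo]] := sigma_finiteT m1.
have /sigma_finiteP[G [TG ndG Goo]] := sigma_finiteT m2.
exists (fun n => F n `*` G n).
 rewrite -setXTT TF TG predeqE => -[x y]; split.
    move=> [/= [n _ Fnx] [k _ Gky]]; exists (maxn n k) => //; split.
    - by move: x Fnx; exact/subsetPset/ndF/leq_maxl.
    - by move: y Gky; exact/subsetPset/ndG/leq_maxr.
  by move=> [n _ []/= ? ?]; split; exists n.
move=> k; have [? ?] := Foo k; have [? ?] := Goo k.
split; first exact: measurableX.
by rewrite /pm product_measure1E// lte_mul_pinfty// ge0_fin_numE.
Qed.

HB.instance Definition _ := Measure_isSigmaFinite.Build _ _ _ pm pm_sigma_finite.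
End pmeasure.

(** Integrals always run over the whole space: a domain of integration becomes a factor, or an
    extension by 0, inside the integrand. Fubini and the changes of variables are then free of side
    conditions on sets. *)
Definition ig d (T : measurableType d) (R : realType)
  (m : set T -> \bar R) (f : T -> R) := m.-integrable setT (EFin \o f).

Section ig.
Context d (T : measurableType d) (R : realType) (m : {measure set T -> \bar R}).
Implicit Types f g : T -> R.

Lemma ig_mfun f : ig m f -> measurable_fun setT f.
Proof. by case/integrableP => /measurable_EFinP. Qed.

Lemma ig_le f g : measurable_fun setT f -> ig m g ->
  (forall x, `|f x| <= g x) -> ig m f.
Proof.
move=> mf ig_g fg; apply: (le_integrable measurableT _ _ ig_g).
  exact/measurable_EFinP.
move=> x /=; rewrite lee_fin (@ger0_norm _ (g x))//; exact: le_trans (fg x).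
Qed.

Lemma igD f g : ig m f -> ig m g -> ig m (fun x => f x + g x).
Proof. by move=> hf hg; have := integrableD measurableT hf hg. Qed.

Lemma igB f g : ig m f -> ig m g -> ig m (fun x => f x - g x).
Proof. by move=> hf hg; have := integrableB measurableT hf hg. Qed.

Lemma igZ f c : ig m f -> ig m (fun x => c * f x).
Proof. by move=> hf; have := integrableZl measurableT c hf. Qed.

Lemma igN f : ig m f -> ig m (fun x => - f x).
Proof. by move=> /(igZ (-1)); under [X in ig _ X]eq_fun do rewrite mulN1r. Qed.

Lemma ig_abs f : ig m f -> ig m (fun x => `|f x|).
Proof. by move=> h; have := integrable_abse h. Qed.

Lemma ig_bM (b : T -> R) f (c : R) : measurable_fun setT b -> (forall x, `|b x| <= c) ->
  ig m f -> ig m (fun x => b x * f x).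
Proof.
move=> mb bc h; apply: (@ig_le _ (fun x => c * `|f x|)).
- by apply: measurable_funM => //; exact: ig_mfun.
- exact/igZ/ig_abs.
- by move=> x; rewrite normrM ler_wpM2r.
Qed.

Lemma ig_Mb (b : T -> R) f (c : R) : measurable_fun setT b -> (forall x, `|b x| <= c) ->
  ig m f -> ig m (fun x => f x * b x).
Proof.
move=> mb bc h; under [X in ig _ X]eq_fun do rewrite mulrC.
exact: (ig_bM mb bc).
Qed.

Lemma ig_fin f : measurable_fun setT f ->
  (\int[m]_x `|f x|%:E < +oo)%E -> ig m f.
Proof.
by move=> mf h; apply/integrableP; split; [exact/measurable_EFinP|exact: h].
Qed.

Lemma ig_lty f : ig m f -> (\int[m]_x `|f x|%:E < +oo)%E.
Proof. by case/integrableP. Qed.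

Lemma ig0 : ig m (fun _ => 0).
Proof. exact: integrable0. Qed.

Lemma EFin_int f : ig m f -> (\int[m]_x f x)%:E = (\int[m]_x (f x)%:E)%E.
Proof.
by move=> h; rewrite /Rintegral fineK//; exact: integrable_fin_num.
Qed.

Lemma int_le f g : ig m f -> ig m g -> (forall x, f x <= g x) ->
  \int[m]_x f x <= \int[m]_x g x.
Proof. by move=> *; exact: le_Rintegral. Qed.

Lemma int_D f g : ig m f -> ig m g ->
  \int[m]_x (f x + g x) = \int[m]_x f x + \int[m]_x g x.
Proof. by move=> *; exact: RintegralD. Qed.

Lemma int_B f g : ig m f -> ig m g ->
  \int[m]_x (f x - g x) = \int[m]_x f x - \int[m]_x g x.
Proof. by move=> *; exact: RintegralB. Qed.

Lemma int_Z f c : ig m f -> \int[m]_x (c * f x) = c * \int[m]_x f x.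
Proof. by move=> *; exact: RintegralZl. Qed.

Lemma int_N f : ig m f -> \int[m]_x (- f x) = - \int[m]_x f x.
Proof.
move=> h; rewrite -mulN1r -int_Z//; apply: eq_Rintegral => x _.
by rewrite mulN1r.
Qed.

Lemma int_ge0 f : (forall x, 0 <= f x) -> 0 <= \int[m]_x f x.
Proof. by move=> h; exact: Rintegral_ge0. Qed.

Lemma int_norm f : ig m f -> `|\int[m]_x f x| <= \int[m]_x `|f x|.
Proof. by move=> h; exact: le_normr_Rintegral. Qed.

Lemma int_ae f g : ig m f -> measurable_fun setT g ->
  {ae m, forall x, f x = g x} ->
  ig m g /\ \int[m]_x f x = \int[m]_x g x.
Proof.
move=> igf mg fg.
have mf : measurable_fun setT (EFin \o f) by apply/measurable_EFinP/ig_mfun.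
have mg' : measurable_fun setT (EFin \o g) by apply/measurable_EFinP.
split.
  apply: ig_fin => //; rewrite (_ : (\int[m]_x _)%E = (\int[m]_x `|f x|%:E)%E).
    exact: ig_lty.
  apply: ae_eq_integral => //.
  - by apply/measurable_EFinP; apply: measurableT_comp.
  - by apply/measurable_EFinP; apply: measurableT_comp => //; exact: ig_mfun.
  - by apply: filterS fg => x /= -> _.
rewrite /Rintegral; congr fine; apply: ae_eq_integral => //.
by apply: filterS fg => x /= -> _.
Qed.

Lemma ig_DCT (f_ : nat -> T -> R) f g :
  (forall n, measurable_fun setT (f_ n)) -> measurable_fun setT f ->
  (forall x, f_ n x @[n --> \oo] --> f x) -> ig m g ->
  (forall n x, `|f_ n x| <= g x) ->
  ig m f /\ \int[m]_x f_ n x @[n --> \oo] --> \int[m]_x f x.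
Proof.
move=> mf_ mf cf gi dom.
have h := @dominated_convergence _ _ _ m setT measurableT
  (fun n => EFin \o f_ n) (EFin \o f) (EFin \o g).
have [] := h.
- by move=> n; exact/measurable_EFinP.
- exact/measurable_EFinP.
- by apply/aeW => x _; apply: cvg_EFin (cf x); exact: nearW.
- exact: gi.
- by apply/aeW => x n _ /=; rewrite lee_fin.
move=> fi _ cv; split => //.
by apply: fine_cvg; rewrite EFin_int.
Qed.

End ig.

Section Fubini_real.
Context d1 d2 (T1 : measurableType d1) (T2 : measurableType d2) (R : realType).
Variable m1 : {sigma_finite_measure set T1 -> \bar R}.
Variable m2 : {sigma_finite_measure set T2 -> \bar R}.
Implicit Type f : T1 * T2 -> R.

(** Sections may fail to be integrable on a null set. There [Rintegral] returns [fine] of an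
    infinite value, which is 0, so that iterated real integrals are defined everywhere and agree
    with the integral over the product. *)
Let ig_fine d (T : measurableType d) (m : {measure set T -> \bar R})
    (F : T -> \bar R) : m.-integrable setT F -> ig m (fine \o F).
Proof.
move=> h; have mF := measurable_int _ h.
apply: (le_integrable measurableT _ _ h).
  by apply/measurable_EFinP; apply: measurableT_comp mF; exact: fine_measurable.
by move=> x /=; case: (F x) => [r| |]//=; rewrite ?normr0 ?leey.
Qed.

Lemma ig_swap f : ig (pm m1 m2) f -> ig (pm m2 m1) (fun z => f (z.2, z.1)).
Proof.
move=> h; have mf := ig_mfun h.
have mf' : measurable_fun setT (EFin \o f) by exact/measurable_EFinP.
apply: (integrable12ltyP _ _ _).2.
  apply/measurable_EFinP; apply: measurableT_comp => //.
  exact: measurable_fun_pair.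
exact: ((integrable21ltyP _ _ mf').1 h).
Qed.

Let int_G f : ig (pm m1 m2) f ->
  m2.-integrable setT (fubini_G m1 (EFin \o f)).
Proof. by move=> /ig_swap h; exact: (integrable_fubini_F h). Qed.

Lemma ig_F1 f : ig (pm m1 m2) f -> ig m1 (fun x => \int[m2]_y f (x, y)).
Proof.
move=> h; have h' : m1.-integrable setT (fubini_F m2 (EFin \o f)).
  exact: integrable_fubini_F.
exact: ig_fine h'.
Qed.

Lemma ig_F2 f : ig (pm m1 m2) f -> ig m2 (fun y => \int[m1]_x f (x, y)).
Proof.
by move=> /int_G/ig_fine.
Qed.

Let int_fine d (T : measurableType d) (m : {measure set T -> \bar R})
    (F : T -> \bar R) : m.-integrable setT F ->
  \int[m]_x fine (F x) = fine (\int[m]_x F x)%E.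
Proof.
move=> h; rewrite /Rintegral; congr fine; apply: ae_eq_integral => //.
- by apply/measurable_EFinP; exact: (ig_mfun (ig_fine h)).
- exact: measurable_int h.
have := integrable_ae measurableT h.
by apply: filterS => x /= hx _; rewrite fineK//; exact: hx.
Qed.

Lemma int_F1 f : ig (pm m1 m2) f ->
  \int[m1]_x (\int[m2]_y f (x, y)) = \int[pm m1 m2]_z f z.
Proof.
move=> h; rewrite /Rintegral -(integral12_prod_meas1 h).
exact: (int_fine (integrable_fubini_F h)).
Qed.

Lemma int_F2 f : ig (pm m1 m2) f ->
  \int[m2]_y (\int[m1]_x f (x, y)) = \int[pm m1 m2]_z f z.
Proof.
move=> h; rewrite /Rintegral -(integral21_prod_meas1 h).
exact: (int_fine (int_G h)).
Qed.

Lemma ae_ig1 f : ig (pm m1 m2) f ->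
  {ae m1, forall x, ig m2 (fun y => f (x, y))}.
Proof. by move=> h; exact: (ae_integrable1 h). Qed.

Lemma ae_ig2 f : ig (pm m1 m2) f ->
  {ae m2, forall y, ig m1 (fun x => f (x, y))}.
Proof. by move=> h; exact: (ae_integrable2 h). Qed.

Lemma ig_tensor (f : T1 -> R) (g : T2 -> R) : ig m1 f -> ig m2 g ->
  ig (pm m1 m2) (fun z => f z.1 * g z.2).
Proof.
move=> hf hg.
have mfg : measurable_fun setT (fun z : T1 * T2 => f z.1 * g z.2).
  apply: measurable_funM.
    by apply: (measurableT_comp (ig_mfun hf)).
  by apply: (measurableT_comp (ig_mfun hg)).
apply: (integrable12ltyP _ _ _).2.
  exact/measurable_EFinP.
rewrite /=.
under eq_integral => x _.
  under eq_integral do rewrite normrM EFinM.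
  rewrite ge0_integralZl//; last first.
    by apply/measurable_EFinP; apply: measurableT_comp => //; exact: ig_mfun hg.
  over.
rewrite ge0_integralZr//.
- by apply: lte_mul_pinfty; [exact: integral_ge0| |exact: ig_lty];
    rewrite ge0_fin_numE ?integral_ge0// ig_lty.
- by apply/measurable_EFinP; apply: measurableT_comp => //; exact: ig_mfun hf.
- exact: integral_ge0.
Qed.

End Fubini_real.

Lemma measurable_comp2 d d1 d2 (T : measurableType d) (T1 : measurableType d1)
    (T2 : measurableType d2) (R : realType) (u : T1 -> T2 -> R)
    (a : T -> T1) (b : T -> T2) :
  measurable_fun setT (fun z : T1 * T2 => u z.1 z.2) ->
  measurable_fun setT a -> measurable_fun setT b ->
  measurable_fun setT (fun x => u (a x) (b x)).
Proof.
move=> mu ma mb.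
exact: (measurableT_comp mu (measurable_fun_pair ma mb)).
Qed.

(** * Translation invariance of Lebesgue measure on the line *)

Section translation.
Context (R : realType).
Local Notation mu := (@lebesgue_measure R).

Definition shiftm (a : R) : measurableTypeR R -> measurableTypeR R :=
  fun x => x - a.

Lemma measurable_shiftm a : measurable_fun setT (shiftm a).
Proof. by apply: measurable_funB. Qed.

(** The image of the measure under the translation gives every interval []x, y]] its length;
    uniqueness of Lebesgue measure does the rest. *)
Lemma lebesgue_shift a (A : set (measurableTypeR R)) : measurable A ->
  pushforward mu (shiftm a) A = mu A.
Proof.
move=> mA; have H := measurable_shiftm a.
apply/esym/(@lebesgue_measure_unique R (pushforward mu (shiftm a)))
  => //= _ [[x y]] _ <-.
rewrite /pushforward (_ : shiftm a @^-1` _ = `]x + a, y + a]%classic).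
  rewrite !lebesgue_measure_itv/= !lte_fin ltrD2r.
  by case: ifPn => // _; rewrite -!EFinB; congr EFin; ring.
by apply/seteqP; split => z /=; rewrite /shiftm !in_itv/= ltrBrDr lerBlDr.
Qed.

Lemma ge0_integral_shift (a : R) (f : R -> \bar R) :
  measurable_fun setT f -> (forall x, 0 <= f x)%E ->
  (\int[mu]_x f (x - a)%R = \int[mu]_x f x)%E.
Proof.
move=> mf f0; have H := measurable_shiftm a.
transitivity (\int[pushforward mu (shiftm a)]_x f x)%E.
  by rewrite ge0_integral_pushforward//= preimage_setT.
by apply: eq_measure_integral => //= A mA _; exact: lebesgue_shift.
Qed.

Lemma measurable_shift (a : R) d (Y : measurableType d)
    (f : measurableTypeR R -> Y) : measurable_fun setT f ->
  measurable_fun setT (fun x : measurableTypeR R => f (x - a)).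
Proof. by move=> mf; apply: (measurableT_comp mf (measurable_shiftm a)). Qed.

Lemma ig_shift (a : R) (f : R -> R) : ig mu f -> ig mu (fun x : R => f (x - a)).
Proof.
move=> h; have mf := ig_mfun h; apply: ig_fin.
  exact: measurable_shift.
rewrite (ge0_integral_shift a (f := fun x => `|f x|%:E))//; first exact: ig_lty.
by apply/measurable_EFinP; apply: measurableT_comp.
Qed.

Lemma int_shift (a : R) (f : R -> R) : ig mu f ->
  \int[mu]_x f (x - a) = \int[mu]_x f x.
Proof.
move=> h; have H := measurable_shiftm a.
have mf : measurable_fun setT (EFin \o f) by apply/measurable_EFinP; exact: ig_mfun h.
have : (\int[pushforward mu (shiftm a)]_x (f x)%:E =
        \int[mu]_x (f (x - a))%:E)%E.
  rewrite (integral_pushforward H)// ?preimage_setT//.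
  exact: (ig_shift a h).
rewrite /Rintegral => <-; congr fine; apply: eq_measure_integral => //= A mA _.
exact: lebesgue_shift.
Qed.

Lemma ig_refl a (f : R -> R) : ig mu f -> ig mu (fun x => f (a - x)).
Abort.

End translation.

(** * Pointwise energy estimates for truncations *)

Section energy.
Context (R : realType).
Implicit Types a b c d x y : R.

Lemma truncE_in (K r : R) : - K <= r <= K -> trunc K r = r.
Proof.
move=> /andP[h1 h2]; rewrite /trunc; have -> : Num.min r K = r by apply/min_idPl.
by apply/max_idPl.
Qed.

Lemma truncE_hi (K r : R) : 0 <= K -> K <= r -> trunc K r = K.
Proof.
move=> K0 h; rewrite /trunc; have -> : Num.min r K = K by apply/min_idPr.
by apply/max_idPl; rewrite lerNl; lra.
Qed.

Lemma truncE_lo (K r : R) : 0 <= K -> r <= - K -> trunc K r = - K.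
Proof.
move=> K0 h; rewrite /trunc; have -> : Num.min r K = r.
  by apply/min_idPl; lra.
by apply/max_idPr.
Qed.

Variant trunc_spec (K r : R) : R -> Prop :=
| TruncIn of - K <= r & r <= K : trunc_spec K r r
| TruncHi of K < r : trunc_spec K r K
| TruncLo of r < - K : trunc_spec K r (- K).

Lemma truncP (K r : R) : 0 <= K -> trunc_spec K r (trunc K r).
Proof.
move=> K0; have [h|h] := leP r K; last first.
  by rewrite truncE_hi// ?ltW//; exact: TruncHi.
have [h'|h'] := leP (- K) r; first by rewrite truncE_in ?h'//; exact: TruncIn.
rewrite truncE_lo// ?ltW//; exact: TruncLo.
Qed.

Lemma truncN (K r : R) : 0 <= K -> trunc K (- r) = - trunc K r.
Proof.
move=> K0; case: (truncP r K0) => h; last 2 first.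
- by rewrite truncE_lo//; lra.
- by rewrite truncE_hi//; lra.
by move=> h'; rewrite truncE_in//; apply/andP; split; lra.
Qed.

Lemma trunc_le (K r : R) : 0 <= K -> `|trunc K r| <= K.
Proof.
by move=> K0; rewrite ler_norml; case: (truncP r K0) => *; apply/andP; split; lra.
Qed.

Lemma trunc_homo (K x y : R) : 0 <= K -> x <= y -> trunc K x <= trunc K y.
Proof.
by move=> K0 xy; case: (truncP x K0) => hx; case: (truncP y K0) => hy; lra.
Qed.

(* [S] is a smoothed positive sign of width [delta]. *)
Definition sstep (delta M : R) (S : R -> R) :=
  [/\ 0 < delta, 0 <= M <= delta,
      forall x y, x <= y -> S x <= S y <= S x + (y - x),
      forall x, x <= 0 -> S x = 0 &
      forall x, delta <= x -> S x = M].

(** [(x - y) * (th x - th y)] is the energy density of a pair of values that meets the levels near K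
    or -K. Inside the range of slope one, a step of length delta makes [th] vary by delta, which is
    at least the whole variation of [S]. *)
Definition band (delta K : R) (th : R -> R) :=
  [/\ 4 * delta <= K,
      forall x y, x <= y -> th x <= th y <= th x + (y - x),
      forall x, th (- x) = - th x &
      forall x y, K - 3 * delta <= x -> x <= y -> y <= K + 3 * delta ->
        th y - th x = y - x].

Section pointwise.
Variables (delta M K : R) (S th : R -> R).
Hypotheses (hS : sstep delta M S) (hth : band delta K th).

Let d0 : 0 < delta. Proof. by case: hS. Qed.
Let M0 : 0 <= M. Proof. by case: hS => _ /andP[]. Qed.
Let Md : M <= delta. Proof. by case: hS => _ /andP[]. Qed.
Let K4 : 4 * delta <= K. Proof. by case: hth. Qed.
Let K0 : 0 <= K. Proof. by have := d0; have := K4; lra. Qed.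

Let S_le x y : x <= y -> S x <= S y.
Proof. by case: hS => _ _ h _ _ /h /andP[]. Qed.
Let S_lip x y : x <= y -> S y <= S x + (y - x).
Proof. by case: hS => _ _ h _ _ /h /andP[]. Qed.
Let S0 x : x <= 0 -> S x = 0. Proof. by case: hS => _ _ _ + _; exact. Qed.
Let S1 x : delta <= x -> S x = M. Proof. by case: hS => _ _ _ _; exact. Qed.

Lemma sstep_ge0 x : 0 <= S x.
Proof.
have [/S0->//|x0] := leP x 0.
by rewrite -(S0 (lexx 0)); apply: S_le; exact: ltW.
Qed.

Lemma sstep_leM x : S x <= M.
Proof.
have [/S1->//|x0] := leP delta x.
by rewrite -(S1 (lexx delta)); apply: S_le; exact: ltW.
Qed.

Lemma sstep_dist x y : `|S x - S y| <= `|x - y|.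
Proof.
wlog xy : x y / y <= x.
  move=> h; have [|/ltW] := leP y x; first exact: h.
  by move=> /h; rewrite distrC [leRHS]distrC.
have := S_le xy; have := S_lip xy => ? ?.
by rewrite !ger0_norm; lra.
Qed.

Lemma sstep_distM x y : `|S x - S y| <= delta.
Proof.
have := sstep_ge0 x; have := sstep_ge0 y; have := sstep_leM x.
have := sstep_leM y; have := Md => *.
by rewrite ler_norml; apply/andP; split; lra.
Qed.

Let th_le x y : x <= y -> th x <= th y.
Proof. by case: hth => _ h _ _ /h /andP[]. Qed.
Let th_lip x y : x <= y -> th y <= th x + (y - x).
Proof. by case: hth => _ h _ _ /h /andP[]. Qed.
Let th1 x y : K - 3 * delta <= x -> x <= y -> y <= K + 3 * delta ->
  th y - th x = y - x.
Proof. by case: hth => _ _ _; exact. Qed.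

Let th_dist x y : `|th x - th y| <= `|x - y|.
Proof.
wlog xy : x y / y <= x.
  move=> h; have [|/ltW] := leP y x; first exact: h.
  by move=> /h; rewrite distrC [leRHS]distrC.
have := th_le xy; have := th_lip xy => ? ?.
by rewrite !ger0_norm; lra.
Qed.

Let J x y := `|x - y| * `|th x - th y|.

Let J_ge0 x y : 0 <= J x y. Proof. exact: mulr_ge0. Qed.

Let sqJ x y : `|th x - th y| ^+ 2 <= J x y.
Proof. by rewrite expr2 ler_wpM2r. Qed.

(** As [th] is 1-Lipschitz, [J] dominates the square of the increment of [th]; the mixed product
    then follows from 2xy <= x^2 + y^2. *)
Let mulJ a b c d : `|th a - th b| * `|th c - th d| <= J a b + J c d.
Proof.
have := sqJ a b; have := sqJ c d.
have := sqr_ge0 (`|th a - th b| - `|th c - th d|).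
by rewrite sqrrB; set A := `|th a - th b|; set B := `|th c - th d|; nra.
Qed.

Let thP x y : y <= x -> `|th x - th y| = th x - th y.
Proof. by move=> /th_le h; rewrite ger0_norm// subr_ge0. Qed.

Let thN x y : x <= y -> `|th x - th y| = th y - th x.
Proof. by move=> /thP <-; rewrite distrC. Qed.

Let far x y (z : R) : delta <= `|th x - th y| -> z <= delta -> 
  `|x - y| * z <= J x y.
Proof. by move=> h1 h2; apply: ler_wpM2l => //; lra. Qed.

(** Above [K - 2 * delta] the truncation moves only below K, where [th] has slope one. *)
Let th_trunc x y : K - 2 * delta <= x -> x <= y ->
  trunc K y - trunc K x <= th y - th x.
Proof.
have D0 := d0; have DK := K4.
move=> h1 h2; case: (truncP x K0) => hx; case: (truncP y K0) => hy; try lra.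
- by move=> hx' hy'; rewrite th1//; lra.
- move=> hx'; have := @th1 x K; have := th_le (ltW hy); lra.
- by have := th_le h2; lra.
Qed.

(** Three cases. If both arguments of [S] are beyond delta, the increment of [S] is 0. If
    [th a - th b] or [th c - th d] is at least delta in absolute value, it absorbs the increment of
    [S], which is at most delta. Otherwise a and b lie where [th] has slope one and c, d above
    [K - 2 * delta]; then the Lipschitz bound of [S] gives [|th a - th b| + |th c - th d|] for its
    increment, and [mulJ] concludes. *)
Lemma zone1 a b c d : K < a -> K - delta < c ->
  `|a - b| * `|S (a - trunc K c) - S (b - trunc K d)| <= 2 * (J a b + J c d).
Proof.
move=> aK cK; have D0 := d0; have DK := K4.
have := J_ge0 a b; have := J_ge0 c d => Jcd Jab.
have Tc := trunc_le c K0; have Td := trunc_le d K0.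
rewrite !ler_norml in Tc Td; move: Tc Td => /andP[Tc1 Tc2] /andP[Td1 Td2].
have FAR : delta <= `|th a - th b| ->
  `|a - b| * `|S (a - trunc K c) - S (b - trunc K d)| <= 2 * (J a b + J c d).
  by move=> h; have := far h (sstep_distM (a - trunc K c) (b - trunc K d)); lra.
have [a2|a2] := ltP (K + 2 * delta) a.
  have [b1|b1] := leP (K + delta) b.
    by rewrite !S1 ?subrr ?normr0 ?mulr0; lra.
  apply: FAR; rewrite thP; last by lra.
  have := @th1 (K + delta) (K + 2 * delta); have := th_le (ltW a2).
  by have := th_le (ltW b1); lra.
have [b3|b3] := ltP (K + 3 * delta) b.
  apply: FAR; rewrite thN; last by lra.
  have := @th1 (K + 2 * delta) (K + 3 * delta); have := th_le (ltW b3).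
  by have := th_le a2; lra.
have [b1|b1] := ltP b (K - delta).
  apply: FAR; rewrite thP; last by lra.
  have := @th1 (K - delta) K; have := th_le (ltW b1).
  by have := th_le (ltW aK); lra.
have ab : `|a - b| = `|th a - th b|.
  have [ab|/ltW ab] := leP a b.
    by rewrite distrC [RHS]distrC th1//; lra.
  by rewrite th1//; lra.
have [d2|d2] := ltP d (K - 2 * delta).
  have cd : delta <= `|th c - th d|.
    rewrite thP; last by lra.
    have := @th1 (K - 2 * delta) (K - delta); have := th_le (ltW d2).
    by have := th_le (ltW cK); lra.
  have := mulJ a b c d; rewrite {1}ab.
  have := sstep_distM (a - trunc K c) (b - trunc K d).
  have := normr_ge0 (th a - th b) => h1 h2.
  by have := ler_wpM2l h1 (le_trans h2 cd); lra.
have TT : `|trunc K c - trunc K d| <= `|th c - th d|.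
  have mon x y : x <= y -> trunc K x <= trunc K y by exact: trunc_homo.
  have [e|/ltW e] := leP c d.
    rewrite distrC thN// ger0_norm ?subr_ge0 ?mon//.
    by apply: th_trunc => //; lra.
  by rewrite thP// ger0_norm ?subr_ge0 ?mon//; apply: th_trunc.
have st : `|S (a - trunc K c) - S (b - trunc K d)| <=
          `|th a - th b| + `|th c - th d|.
  apply: (le_trans (sstep_dist _ _)).
  rewrite (_ : _ - _ = (a - b) - (trunc K c - trunc K d)); last by ring.
  by apply: (le_trans (ler_normB _ _)); rewrite ab lerD2l.
rewrite {1}ab; have := mulJ a b c d; have := sqJ a b; rewrite expr2.
have := normr_ge0 (th a - th b) => h1.
by have := ler_wpM2l h1 st; lra.
Qed.

(** The alternative of [zone1] for the term of the other solution. Here [trunc K a] is K, so that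
    the case without increment is the one where both arguments of [S] are nonpositive. *)
Lemma zone2 a b c d : K < a -> K - delta < c ->
  `|c - d| * `|S (trunc K a - c) - S (trunc K b - d)| <= 2 * (J a b + J c d).
Proof.
move=> aK cK; have D0 := d0; have DK := K4.
have := J_ge0 a b; have := J_ge0 c d => Jcd Jab.
have Tb := trunc_le b K0.
rewrite !ler_norml in Tb; move: Tb => /andP[Tb1 Tb2].
rewrite (truncE_hi K0 (ltW aK)).
have FAR : delta <= `|th c - th d| ->
  `|c - d| * `|S (K - c) - S (trunc K b - d)| <= 2 * (J a b + J c d).
  by move=> h; have := far h (sstep_distM (K - c) (trunc K b - d)); lra.
have [c2|c2] := ltP (K + 2 * delta) c.
  have [d1|d1] := leP K d.
    by rewrite !S0 ?subrr ?normr0 ?mulr0; lra.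
  apply: FAR; rewrite thP; last by lra.
  have := @th1 K (K + 2 * delta); have := th_le (ltW c2).
  by have := th_le (ltW d1); lra.
have [d3|d3] := ltP (K + 3 * delta) d.
  apply: FAR; rewrite thN; last by lra.
  have := @th1 (K + 2 * delta) (K + 3 * delta); have := th_le (ltW d3).
  by have := th_le c2; lra.
have [d2|d2] := ltP d (K - 2 * delta).
  apply: FAR; rewrite thP; last by lra.
  have := @th1 (K - 2 * delta) (K - delta); have := th_le (ltW d2).
  by have := th_le (ltW cK); lra.
have cd : `|c - d| = `|th c - th d|.
  have [cd|/ltW cd] := leP c d.
    by rewrite distrC [RHS]distrC th1//; lra.
  by rewrite th1//; lra.
have [b2|b2] := ltP b (K - 2 * delta).
  have ab : delta <= `|th a - th b|.
    rewrite thP; last by lra.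
    have := @th1 (K - 2 * delta) K; have := th_le (ltW b2).
    by have := th_le (ltW aK); lra.
  have := mulJ c d a b; rewrite {1}cd.
  have := sstep_distM (K - c) (trunc K b - d).
  have := normr_ge0 (th c - th d) => h1 h2.
  by have := ler_wpM2l h1 (le_trans h2 ab); lra.
have TT : `|K - trunc K b| <= `|th a - th b|.
  rewrite ger0_norm; last by lra.
  case: (truncP b K0) => hb; [|by rewrite subrr|by lra].
  move=> hb'; rewrite thP; last by lra.
  by have := @th1 b K; have := th_le (ltW aK); lra.
have st : `|S (K - c) - S (trunc K b - d)| <=
          `|th a - th b| + `|th c - th d|.
  apply: (le_trans (sstep_dist _ _)).
  rewrite (_ : _ - _ = (K - trunc K b) - (c - d)); last by ring.
  by apply: (le_trans (ler_normB _ _)); rewrite cd lerD2r.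
rewrite {1}cd; have := mulJ c d a b; have := sqJ c d; rewrite expr2.
have := normr_ge0 (th c - th d) => h1.
by have := ler_wpM2l h1 st; lra.
Qed.

(** The substitution of [(- c, - d, - a, - b)] for [(a, b, c, d)] exchanges the two zones and the
    two terms, so the zone near -K reduces to the one near K. The constant is 2 + 2, one share for
    each term. *)
Lemma energy_zone a b c d :
  (K < a) && (K - delta < c) || (c < - K) && (a < - K + delta) ->
  `|(a - b) * (S (a - trunc K c) - S (b - trunc K d))
    - (c - d) * (S (trunc K a - c) - S (trunc K b - d))|
  <= 4 * (J a b + J c d).
Proof.
move=> h; apply: (le_trans (ler_normB _ _)); rewrite !normrM.
case/orP: h => /andP[h1 h2].
  by have := zone1 b d h1 h2; have := zone2 b d h1 h2; lra.
have JN x y : J (- x) (- y) = J x y.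
  case: hth => _ _ thNN _.
  by rewrite /J !thNN -!opprD !normrN.
have e1 : K < - c by lra.
have e2 : K - delta < - a by lra.
have z1 := zone1 (- d) (- b) e1 e2; have z2 := zone2 (- d) (- b) e1 e2.
rewrite !truncN// !JN -!opprD !normrN !opprB in z1 z2.
rewrite addrC (addrC (J a b)); apply: le_trans (lerD z1 z2) _.
by rewrite le_eqVlt; apply/orP; left; apply/eqP; ring.
Qed.

(** Outside the zones [S] does not notice the truncations: where one of them acts, the arguments
    stay on one side, at most 0 or at least delta, and [S] is constant there. *)
Lemma energy_regular a c :
  ~~ ((K < a) && (K - delta < c) || (c < - K) && (a < - K + delta)) ->
  S (a - trunc K c) = S (a - c) /\ S (trunc K a - c) = S (a - c).
Proof.
have D0 := d0; have DK := K4.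
move=> h; case: (truncP a K0) => ha; case: (truncP c K0) => hc.
- by split.
- by move=> ?; rewrite !S0//; lra.
- move=> ha'; have : - K + delta <= a.
    by rewrite leNgt; apply: contra h => ->; rewrite hc orbT.
  by move=> ?; rewrite !S1//; lra.
- move=> hc'; have : c <= K - delta.
    by rewrite leNgt; apply: contra h => ->; rewrite ha.
  by move=> ?; rewrite !S1//; lra.
- by exfalso; move/negP: h; apply; rewrite ha /=; apply/orP; left; lra.
- by rewrite !S1//; lra.
- by move=> ?; rewrite !S0//; lra.
- by rewrite !S0//; lra.
- by exfalso; move/negP: h; apply; rewrite hc /=; apply/orP; right; lra.
Qed.

(** With a, b the values of one solution at two points and c, d those of the other, this is the
    difference of the two nonlocal integrands. If neither point is in a zone it equals [((a - b) -
    (c - d)) * (S (a - c) - S (b - d))], which is nonnegative as [S] is monotone. A point in a zone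
    costs at most the energy of the band; the second point is handled by symmetry. *)
Lemma energy_lower a b c d :
  - (4 * ((a - b) * (th a - th b) + (c - d) * (th c - th d))) <=
  (a - b) * (S (a - trunc K c) - S (b - trunc K d))
  - (c - d) * (S (trunc K a - c) - S (trunc K b - d)).
Proof.
have JE x y : (x - y) * (th x - th y) = J x y.
  by rewrite /J; have [h|/ltW h] := leP x y;
    [rewrite thN// ler0_norm; [ring|lra]|rewrite thP// ger0_norm; [ring|lra]].
rewrite !JE; have := J_ge0 a b; have := J_ge0 c d => h1 h2.
have [h|h] := boolP ((K < a) && (K - delta < c) || (c < - K) && (a < - K + delta)).
  by have := energy_zone b d h; rewrite ler_norml => /andP[].
have [h'|h'] := boolP ((K < b) && (K - delta < d) || (d < - K) && (b < - K + delta)).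
  have := energy_zone a c h'; rewrite ler_norml => /andP[+ _].
  rewrite /J (distrC b) (distrC (th b)) (distrC d) (distrC (th d)) -!/(J _ _).
  by move=> ?; lra.
have [-> ->] := energy_regular h; have [-> ->] := energy_regular h'.
rewrite -mulrBl; have [e|/ltW e] := leP (a - c) (b - d).
  by have := S_le e => e'; nra.
by have := S_le e => e'; nra.
Qed.

(** A single nonlocal integrand has no sign. For b <= a it is negative only if D < b and a < C +
    delta, so both values lie in the range that the truncation at [K + delta] leaves fixed, and the
    Lipschitz bound of [S] gives the product [(a - b) * (C - D)]. The negative part of the integrand
    is thus controlled by finite energies. *)
Lemma energy_neg a b (C D : R) : `|C| <= K -> `|D| <= K ->
  - ((a - b) * (S (a - C) - S (b - D))) <=
  (trunc (K + delta) a - trunc (K + delta) b) ^+ 2 + (C - D) ^+ 2.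
Proof.
have D0 := d0; have DK := K4; have k0 := K0.
rewrite !ler_norml.
wlog ab : a b C D / b <= a.
  move=> h hC hD; have [e|/ltW e] := leP b a; first exact: h.
  have := h b a D C e hD hC.
  by rewrite -!(opprB b a) -!(opprB D C) -(opprB (S (b - D))) mulrNN sqrrN
    -(opprB (trunc _ b)) sqrrN.
move=> /andP[C1 C2] /andP[E1 E2].
have [pp|pp] := leP (S (b - D)) (S (a - C)).
  apply: (@le_trans _ _ 0); last by rewrite addr_ge0// sqr_ge0.
  by rewrite oppr_le0 mulr_ge0// subr_ge0.
have b1 : 0 < b - D.
  by rewrite ltNge; apply/negP => /S0 e; have := sstep_ge0 (a - C); lra.
have a1 : a - C < delta.
  by rewrite ltNge; apply/negP => /S1 e; have := sstep_leM (b - D); lra.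
rewrite !truncE_in; [|apply/andP; split; lra..].
have cd : a - C <= b - D.
  by rewrite leNgt; apply/negP => /ltW /S_le; lra.
have := S_lip cd => L.
have A0 : 0 <= a - b by lra.
have : S (b - D) - S (a - C) <= C - D by lra.
move=> /(ler_wpM2l A0); have := sqr_ge0 ((a - b) - (C - D)).
have := sqr_ge0 (a - b); have := sqr_ge0 (C - D).
by rewrite !expr2; lra.
Qed.

End pointwise.

End energy.

(** * Functions of the class P *)

Section primitives.
Context (R : realType).
Implicit Types (l : seq (R * R)) (x : R).

(** [sqa] and [cua] are successive primitives of 2|x|. Combinations of their translates yield
    functions S with a continuous piecewise affine derivative, together with an explicit primitive
    of S. *)
Definition sqa (x : R) := x * `|x|.
Definition cua (x : R) := 3^-1 * (x * sqa x).

Lemma is_derive_sqa x : is_derive x 1 sqa (2 * `|x|).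
Proof.
have [x0|x0|->] := ltgtP x 0.
- have e : \near x, (fun y : R => - (y * y)) x = sqa x.
    near=> y; rewrite /sqa ltr0_norm; first by rewrite mulrN.
    by near: y; exact: lt_nbhsl.
  apply: (near_eq_is_derive e).
  by apply: is_derive_eq; rewrite ltr0_norm// -![_ *: _]/(_ * _); ring.
- have e : \near x, (fun y : R => y * y) x = sqa x.
    near=> y; rewrite /sqa gtr0_norm//.
    by near: y; exact: lt_nbhsr.
  apply: (near_eq_is_derive e).
  by apply: is_derive_eq; rewrite gtr0_norm// -![_ *: _]/(_ * _); ring.
rewrite normr0 mulr0.
have h : (fun h : R => h^-1 *: (sqa (h *: 1 + 0) - sqa 0)) @ 0^' --> (0 : R).
  apply: (@cvg_trans _ ((fun h : R => `|h|) @ 0^')).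
    apply: near_eq_cvg; near=> t.
    have t0 : t != 0 by near: t; exact: nbhs_dnbhs_neq.
    by rewrite /sqa addr0 mul0r subr0 /= -![_ *: _]/(_ * _) mulr1 mulKf.
  apply: cvg_trans (_ : (fun h : R => `|h|) @ nbhs (0:R) --> (0:R)).
    by apply: cvg_app; exact: nbhs_dnbhs.
  by rewrite -[X in _ --> X](normr0 R); apply: norm_continuous.
split; last by apply/cvg_lim.
by apply/cvg_ex; exists 0.
Unshelve. all: end_near. Qed.

Lemma is_derive_cua x : is_derive x 1 cua (sqa x).
Proof.
rewrite /cua; have h := is_derive_sqa x; apply: is_derive_eq.
by rewrite /sqa -![_ *: _]/(_ * _); field.
Qed.

Definition comb (F : R -> R) l (x : R) := \sum_(p <- l) p.1 * F (x - p.2).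

Lemma is_derive_sub (F : R -> R) (f b x : R) : is_derive (x - b) 1 F f ->
  is_derive x 1 (fun y => F (y - b)) f.
Proof.
move=> h.
have h1 : is_derive x 1 (fun y : R => y - b) 1.
  by apply: is_derive_eq; rewrite subr0.
by have := @is_derive1_comp _ F (fun y => y - b) x _ _ h h1; rewrite mulr1.
Qed.

Lemma is_derive_comb (F f : R -> R) l x :
  (forall y : R, is_derive y 1 F (f y)) -> is_derive x 1 (comb F l) (comb f l x).
Proof.
move=> h; elim: l => [|[a b] l IH].
  rewrite /comb big_nil (_ : (fun _ => _) = cst 0); first exact: is_derive_cst.
  by apply/funext => y; rewrite big_nil.
rewrite /comb big_cons (_ : (fun _ => _) =
    (fun y => a * F (y - b)) + comb F l); last first.
  by apply/funext => y; rewrite big_cons.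
apply: is_deriveD.
have h2 := is_derive_sub (h (x - b)).
exact: (@is_deriveZ _ _ _ _ a).
Qed.

Lemma comb_cons (F : R -> R) a b l x :
  comb F ((a, b) :: l) x = a * F (x - b) + comb F l x.
Proof. by rewrite /comb big_cons. Qed.

Lemma comb_nil (F : R -> R) x : comb F [::] x = 0.
Proof. by rewrite /comb big_nil. Qed.

Lemma continuous_comb (F : R -> R) l : continuous F -> continuous (comb F l).
Proof.
move=> cF x; elim: l => [|[a b] l IH].
  rewrite (_ : comb F [::] = cst 0); first exact: cst_continuous.
  by apply/funext => y; rewrite comb_nil.
rewrite (_ : comb F _ = (fun y => a * F (y - b)) \+ comb F l); last first.
  by apply/funext => y; rewrite comb_cons.
apply: cvgD => //; apply: cvgMr.
apply: (@continuous_comp _ _ _ (fun y : R => y - b) F); last exact: cF.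
by apply: cvgB; [exact: cvg_id|exact: cvg_cst].
Qed.

(** Besides the derivative [s], a primitive [J] is carried along: the inner integral of the entropy
    inequality, from u0 to u, then is a difference of two values of [J] (see [Pfun_oint]). *)
Record Pfun (S s J : R -> R) : Prop := {
  Pfun_S : forall x, is_derive x 1 S (s x);
  Pfun_J : forall x, is_derive x 1 J (S x);
  Pfun_s : continuous s;
  Pfun_s01 : forall x, 0 <= s x <= 1;
  Pfun_supp : exists M, forall x, M < `|x| -> s x = 0;
  Pfun_S0 : S 0 = 0;
  Pfun_J0 : J 0 = 0 }.

Lemma Pfun_comb l d : (forall x, 0 <= comb (fun y => 2 * `|y|) l x <= 1) ->
  (exists M, forall x, M < `|x| -> comb (fun y => 2 * `|y|) l x = 0) ->
  comb sqa l 0 + d = 0 ->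
  Pfun (fun x => comb sqa l x + d) (comb (fun y => 2 * `|y|) l)
    (fun x => comb cua l x + d * x - comb cua l 0).
Proof.
move=> h1 h2 h3; split => //.
- move=> x; have h := is_derive_comb l x is_derive_sqa.
  by apply: is_derive_eq; rewrite addr0.
- move=> x; have h := is_derive_comb l x is_derive_cua.
  by apply: is_derive_eq; rewrite subr0 -[_ *: _]/(_ * _) mulr1.
- apply: continuous_comb => x; apply: cvgMr; exact: norm_continuous.
- by rewrite mulr0 addr0 subrr.
Qed.

Section Pfun.
Variables S s J : R -> R.
Hypothesis h : Pfun S s J.

Lemma Pfun_derivable x : derivable S x 1.
Proof. by have := Pfun_S h x => ?; exact: ex_derive. Qed.

Lemma Pfun_derive1 : derive1 S = s.
Proof. by apply/funext => x; rewrite derive1E; have := Pfun_S h x => ?; exact: derive_val. Qed.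

Lemma Pfun_classP : classP S.
Proof.
split.
- by split; [exact: Pfun_derivable|rewrite Pfun_derive1; exact: Pfun_s h].
- by rewrite Pfun_derive1; exact: Pfun_s01 h.
- rewrite Pfun_derive1; have [M hM] := Pfun_supp h.
  have sub : closure [set r | s r != 0] `<=` `[(- M), M].
    rewrite [X in _ `<=` X](closure_id _).1; last exact: itv_closed.
    apply: closureS => x /= sx; rewrite in_itv/= -ler_norml leNgt.
    by apply: contra_neqN sx => /hM.
  apply: (subclosed_compact _ (@segment_compact _ (- M) M)) => //.
  exact: closed_closure.
- exact: Pfun_S0 h.
Qed.

Lemma Pfun_contS : continuous S.
Proof.
move=> x; apply: differentiable_continuous; apply/derivable1_diffP.
exact: Pfun_derivable.
Qed.

Lemma Pfun_contJ : continuous J.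
Proof.
move=> x; apply: differentiable_continuous; apply/derivable1_diffP.
by have := Pfun_J h x => ?; exact: ex_derive.
Qed.

Let mvt (F f : R -> R) x y : (forall z : R, is_derive z 1 F (f z)) -> x <= y ->
  exists2 z, x <= z <= y & F y - F x = f z * (y - x).
Proof.
move=> dF xy.
have cF : {within `[x, y], continuous F}.
  apply: continuous_subspaceT => z.
  apply: differentiable_continuous; apply/derivable1_diffP.
  by have := dF z => ?; exact: ex_derive.
by have [z zxy ->] := @MVT_segment _ F f x y xy (fun z _ => dF z) cF; exists z.
Qed.

Lemma Pfun_mono x y : x <= y -> S x <= S y <= S x + (y - x).
Proof.
move=> xy; have [z _] := mvt (Pfun_S h) xy.
have /andP[] := Pfun_s01 h z; have : 0 <= y - x by rewrite subr_ge0.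
by move=> ? ? ? ?; apply/andP; split; nra.
Qed.

Lemma Pfun_bounded : exists C, forall x, `|S x| <= C.
Proof.
(* [S] is constant beyond any radius larger than M, and 1-Lipschitz with value 0 at 0 inside. M may
   be negative, hence the absolute value; adding 1 gives the strict inequality [M < K]. *)
have [M hM] := Pfun_supp h; pose K := `|M| + 1.
have MK : M < K by rewrite (le_lt_trans (ler_norm M))// ltrDl.
have K0 : 0 <= K by rewrite addr_ge0.
have step y : `|y| <= K -> `|S y| <= K.
  move=> yK; apply: le_trans yK; have S0 := Pfun_S0 h.
  have [y0|/ltW y0] := leP 0 y.
    by have := Pfun_mono y0; rewrite S0 => /andP[h1 h2]; rewrite !ger0_norm//; lra.
  by have := Pfun_mono y0; rewrite S0 => /andP[h1 h2]; rewrite !ler0_norm//; lra.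
have out y : M < `|y| -> s y = 0 by exact: hM.
exists K => x; have [xK|xK] := leP `|x| K; first exact: step.
have [x0|x0] := leP 0 x.
  have Kx : K <= x by rewrite ltW//; move: xK; rewrite ger0_norm.
  have [z /andP[z1 z2] E] := mvt (Pfun_S h) Kx.
  have sz : s z = 0 by apply: out; rewrite ger0_norm; lra.
  rewrite (_ : S x = S K); first by apply: step; rewrite ger0_norm.
  by apply/eqP; rewrite -subr_eq0 E sz mul0r.
have xK' : x <= - K by move: xK; rewrite ltr0_norm//; lra.
have [z /andP[z1 z2] E] := mvt (Pfun_S h) xK'.
have sz : s z = 0 by apply: out; rewrite ler0_norm; lra.
rewrite (_ : S x = S (- K)); first by apply: step; rewrite normrN ger0_norm.
by apply/esym/eqP; rewrite -subr_eq0 E sz mul0r.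
Qed.

Lemma Pfun_mvtJ x y : x <= y ->
  exists2 z, x <= z <= y & J y - J x = S z * (y - x).
Proof. exact: mvt (Pfun_J h). Qed.

Lemma Pfun_distJ (C : R) x y : (forall z, `|S z| <= C) ->
  `|J y - J x| <= C * `|y - x|.
Proof.
move=> hC; wlog xy : x y / x <= y.
  move=> H; have [|/ltW] := leP x y; first exact: H.
  by move=> /H; rewrite distrC (distrC x).
have [z _ ->] := Pfun_mvtJ xy; rewrite normrM.
by apply: ler_wpM2r.
Qed.

Lemma Pfun_oint a b c :
  oint a b (fun x => S (x - c)) = J (b - c) - J (a - c).
Proof.
have key a' b' : a' <= b' -> \int[@lebesgue_measure R]_(x in `[a', b']) S (x - c)
    = J (b' - c) - J (a' - c).
  rewrite le_eqVlt => /predU1P[->|ab].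
    by rewrite set_itv1 Rintegral_set1 subrr.
  have hJ (z : R) : is_derive z 1 (fun x => J (x - c)) (S (z - c)).
    exact/is_derive_sub/(Pfun_J h).
  have cS : continuous (fun x => S (x - c)).
    move=> z; apply: (@continuous_comp _ _ _ (fun y : R => y - c) S).
      by apply: cvgB; [exact: cvg_id|exact: cvg_cst].
    exact: Pfun_contS.
  have cJ : continuous (fun x => J (x - c)).
    move=> z; apply: (@continuous_comp _ _ _ (fun y : R => y - c) J).
      by apply: cvgB; [exact: cvg_id|exact: cvg_cst].
    exact: Pfun_contJ.
  rewrite /Rintegral (@continuous_FTC2 _ _ (fun x => J (x - c)))//.
  - exact: continuous_subspaceT.
  - split => //.
    + by apply: cvg_at_right_filter; exact: cJ.
    + by apply: cvg_at_left_filter; exact: cJ.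
  - by move=> z _; rewrite derive1E; have := hJ z => ?; exact: derive_val.
rewrite /oint; case: ifPn => [/key//|]; rewrite -ltNge => /ltW/key ->.
by rewrite opprB.
Qed.

End Pfun.

(** The second solution is tested with [x |-> - S (- x)]: up to sign, its terms then carry the same
    factor [S (u - v)] as those of the first solution. *)
Lemma Pfun_reflect S s J : Pfun S s J ->
  Pfun (fun x => - S (- x)) (fun x => s (- x)) (fun x => J (- x)).
Proof.
case=> h1 h2 h3 h4 [M h5] h6 h7.
have opp (F f : R -> R) x : (forall y : R, is_derive y 1 F (f y)) ->
    is_derive x 1 (fun y => F (- y)) (- f (- x)).
  move=> h; have g : is_derive x 1 (fun y : R => - y) (- 1).
    by apply: is_derive_eq.
  by have := @is_derive1_comp _ F (fun y => - y) x _ _ (h (- x)) g; rewrite mulrN1.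
split => //.
- by move=> x; have h := opp _ _ x h1; apply: is_derive_eq; rewrite opprK.
- by move=> x; exact: opp.
- move=> x; apply: (@continuous_comp _ _ _ (fun y : R => - y) s); last exact: h3.
  exact: opp_continuous.
- by exists M => x xM; apply: h5; rewrite normrN.
- by rewrite oppr0 h6 oppr0.
- by rewrite oppr0.
Qed.

Let nrm (x : R) : (0 <= x /\ `|x| = x) \/ (x <= 0 /\ `|x| = - x).
Proof.
by have [h|/ltW h] := leP 0 x; [left; rewrite ger0_norm|right; rewrite ler0_norm].
Qed.

Ltac nrms := repeat match goal with |- context [ `| ?x | ] =>
  let h := fresh in let e := fresh in have [[h e]|[h e]] := nrm x; rewrite !e; clear e end.

(* The tent on [0, delta] as second difference of the absolute value. *)
Lemma exists_sstep (delta : R) : 0 < delta ->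
  exists S s J, Pfun S s J /\ sstep delta (delta / 2) S.
Proof.
(* The tent has height 1 and base delta, so [S] climbs to the area delta / 2. The constant delta / 4
   makes [S] vanish at 0. *)
move=> d0; pose l := [:: ((4 * delta)^-1 * 2, 0); (- (2 * delta)^-1 * 2, delta / 2);
  ((4 * delta)^-1 * 2, delta)] : seq (R * R).
have ne : delta != 0 by rewrite gt_eqF.
have P : Pfun (fun x => comb sqa l x + delta / 4) (comb (fun y => 2 * `|y|) l)
    (fun x => comb cua l x + delta / 4 * x - comb cua l 0).
  apply: Pfun_comb.
  - move=> x; rewrite /l !comb_cons !comb_nil subr0 addr0.
    rewrite (_ : _ + _ = (`|x| - 2 * `|x - delta / 2| + `|x - delta|) / delta); last by field.
    rewrite ler_pdivrMr// ler_pdivlMr// mul0r mul1r; nrms; apply/andP; split; lra.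
  - exists delta => x; rewrite /l !comb_cons !comb_nil subr0 addr0.
    rewrite (_ : _ + _ = (`|x| - 2 * `|x - delta / 2| + `|x - delta|) / delta); last by field.
    move=> h; rewrite (_ : _ + `|x - delta| = 0) ?mul0r//.
    by move: h; nrms; lra.
  - rewrite /l !comb_cons !comb_nil /sqa !sub0r !normrN.
    by rewrite normr0 !gtr0_norm// ?divr_gt0//; field.
eexists; eexists; eexists; split; first exact: P.
split => //.
- by apply/andP; split; lra.
- exact: Pfun_mono P.
- move=> x x0; rewrite /l !comb_cons !comb_nil /sqa subr0 !ler0_norm; [|lra..].
  by field.
- move=> x x0; rewrite /l !comb_cons !comb_nil /sqa subr0 !ger0_norm; [|lra..].
  by field.
Qed.

(* Second difference of the absolute value on [-1, 1]. *)
Lemma exists_ssign : exists S s J, Pfun S s J /\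
  (forall x, `|S x| <= 2^-1) /\ (forall x, `|x| / 2 - 2^-1 <= J x).
Proof.
pose l := [:: (4^-1, -1); (- 2^-1, 0); (4^-1, 1)] : seq (R * R).
have P : Pfun (fun x => comb sqa l x + 0) (comb (fun y => 2 * `|y|) l)
    (fun x => comb cua l x + 0 * x - comb cua l 0).
  apply: Pfun_comb.
  - move=> x; rewrite /l !comb_cons !comb_nil subr0 addr0 opprK.
    by nrms; apply/andP; split; lra.
  - exists 1 => x; rewrite /l !comb_cons !comb_nil subr0 addr0 opprK.
    by nrms; lra.
  - rewrite /l !comb_cons !comb_nil /sqa !sub0r !normrN normr0 normr1.
    by field.
have S1 x : 1 <= x -> comb sqa l x + 0 = 2^-1.
  move=> x0; rewrite /l !comb_cons !comb_nil /sqa subr0 opprK !ger0_norm; [|lra..].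
  by field.
have SN1 x : x <= -1 -> comb sqa l x + 0 = - 2^-1.
  move=> x0; rewrite /l !comb_cons !comb_nil /sqa subr0 opprK !ler0_norm; [|lra..].
  by field.
have SB x : `|comb sqa l x + 0| <= 2^-1.
  rewrite ler_norml; apply/andP; split.
    have [h|/ltW h] := leP x (-1); first by rewrite SN1.
    by rewrite -(SN1 (-1))//; have /andP[] := Pfun_mono P h.
  have [h|/ltW h] := leP 1 x; first by rewrite S1.
  by rewrite -(S1 1)//; have /andP[] := Pfun_mono P h.
eexists; eexists; eexists; split; first exact: P.
split => // x.
have J0 := Pfun_J0 P; have SS0 := Pfun_S0 P.
have pos y : 0 <= y -> y / 2 - 2^-1 <= comb cua l y + 0 * y - comb cua l 0.
  move=> y0; have [y1|/ltW y1] := leP 1 y.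
    have [z /andP[z1 _]] := Pfun_mvtJ P y1; rewrite (S1 _ z1).
    have [w /andP[w1 _]] := Pfun_mvtJ P (@ler01 R).
    have /andP[+ _] := Pfun_mono P w1; rewrite SS0 J0.
    by move=> ? ? ?; lra.
  have [w /andP[w1 _]] := Pfun_mvtJ P y0.
  by have /andP[+ _] := Pfun_mono P w1; rewrite SS0 J0 => ? ?; nra.
have neg y : y <= 0 -> - y / 2 - 2^-1 <= comb cua l y + 0 * y - comb cua l 0.
  move=> y0; have [y1|/ltW y1] := leP y (-1).
    have [z /andP[_ z1]] := Pfun_mvtJ P y1; rewrite (SN1 _ z1).
    have [w /andP[_ w1]] := Pfun_mvtJ P (@lerN10 R).
    have /andP[+ _] := Pfun_mono P w1; rewrite SS0 J0.
    by move=> ? ? ?; lra.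
  have [w /andP[_ w1]] := Pfun_mvtJ P y0.
  by have /andP[+ _] := Pfun_mono P w1; rewrite SS0 J0 => ? ?; nra.
have [h|/ltW h] := leP 0 x; first by rewrite ger0_norm// pos.
by rewrite ler0_norm// neg.
Qed.

(** The derivative of [th] is a sum of two trapezoids centred at K and -K, of height one up to
    distance [3 * delta] from the centre and zero from [4 * delta] on. The condition
    [4 * delta <= K] keeps them apart. Each has area 7 delta, which bounds [th]. Both [th] and its
    primitive vanish below the band, so they disappear pointwise when K tends to infinity. *)
Lemma exists_band (delta K : R) : 0 < delta -> 4 * delta <= K ->
  exists S s J, [/\ Pfun S s J, band delta K S,
    (forall x, `|S x| <= 8 * delta),
    (forall x, `|x| <= K - 4 * delta -> S x = 0) &
    (forall x, `|x| <= K - 4 * delta -> J x = 0)].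
Proof.
move=> d0 dK; pose c := (4 * delta)^-1 : R.
pose l := [:: (c, K - 4 * delta); (- c, K - 3 * delta); (- c, K + 3 * delta);
  (c, K + 4 * delta); (c, - K - 4 * delta); (- c, - K - 3 * delta);
  (- c, - K + 3 * delta); (c, - K + 4 * delta)] : seq (R * R).
have ne : delta != 0 by rewrite gt_eqF.
pose tr y := `|y + 4 * delta| - `|y + 3 * delta| - `|y - 3 * delta| + `|y - 4 * delta|.
have slopeE x : comb (fun y => 2 * `|y|) l x = (tr (x - K) + tr (x + K)) / (2 * delta).
  rewrite /l /tr /c !comb_cons !comb_nil.
  rewrite (_ : x - (K - 4 * delta) = x - K + 4 * delta); last by ring.
  rewrite (_ : x - (K - 3 * delta) = x - K + 3 * delta); last by ring.
  rewrite (_ : x - (K + 4 * delta) = x - K - 4 * delta); last by ring.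
  rewrite (_ : x - (K + 3 * delta) = x - K - 3 * delta); last by ring.
  rewrite (_ : x - (- K - 4 * delta) = x + K + 4 * delta); last by ring.
  rewrite (_ : x - (- K - 3 * delta) = x + K + 3 * delta); last by ring.
  rewrite (_ : x - (- K + 4 * delta) = x + K - 4 * delta); last by ring.
  rewrite (_ : x - (- K + 3 * delta) = x + K - 3 * delta); last by ring.
  by field.
have trN y : tr (- y) = tr y.
  rewrite /tr (_ : - y + 4 * delta = - (y - 4 * delta)); last by ring.
  rewrite (_ : - y + 3 * delta = - (y - 3 * delta)); last by ring.
  rewrite (_ : - y - 4 * delta = - (y + 4 * delta)); last by ring.
  rewrite (_ : - y - 3 * delta = - (y + 3 * delta)); last by ring.
  by rewrite !normrN; ring.
have tr01 y : 0 <= tr y <= 2 * delta.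
  wlog y0 : y / 0 <= y.
    move=> h; have [/h//|/ltW y0] := leP 0 y.
    by rewrite -trN; apply: h; rewrite oppr_ge0.
  rewrite /tr (@ger0_norm _ (y + _)) ?(@ger0_norm _ (y + 3 * delta)); [|lra..].
  by nrms; apply/andP; split; lra.
have tr0 y : 4 * delta <= `|y| -> tr y = 0.
  wlog y0 : y / 0 <= y.
    move=> h; have [/h//|/ltW y0] := leP 0 y.
    by rewrite -trN -normrN; apply: h; rewrite oppr_ge0.
  rewrite (ger0_norm y0) => y4; rewrite /tr !ger0_norm; [|lra..].
  by ring.
have trR y : 4 * delta <= y -> tr y = 0.
  by move=> h; apply: tr0; rewrite ger0_norm//; lra.
have trL y : y <= - (4 * delta) -> tr y = 0.
  by move=> h; apply: tr0; rewrite ler0_norm; lra.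
have sqaN y : sqa (- y) = - sqa y by rewrite /sqa normrN mulNr.
have odd x : comb sqa l (- x) = - comb sqa l x.
  rewrite /l !comb_cons !comb_nil.
  rewrite (_ : - x - (K - 4 * delta) = - (x - (- K + 4 * delta))); last by ring.
  rewrite (_ : - x - (K - 3 * delta) = - (x - (- K + 3 * delta))); last by ring.
  rewrite (_ : - x - (K + 4 * delta) = - (x - (- K - 4 * delta))); last by ring.
  rewrite (_ : - x - (K + 3 * delta) = - (x - (- K - 3 * delta))); last by ring.
  rewrite (_ : - x - (- K - 4 * delta) = - (x - (K + 4 * delta))); last by ring.
  rewrite (_ : - x - (- K - 3 * delta) = - (x - (K + 3 * delta))); last by ring.
  rewrite (_ : - x - (- K + 4 * delta) = - (x - (K - 4 * delta))); last by ring.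
  rewrite (_ : - x - (- K + 3 * delta) = - (x - (K - 3 * delta))); last by ring.
  rewrite !sqaN.
  move: (sqa (x - (- K + 4 * delta))) (sqa (x - (- K + 3 * delta))) => a1 a2.
  move: (sqa (x - (- K - 4 * delta))) (sqa (x - (- K - 3 * delta))) => a3 a4.
  move: (sqa (x - (K + 4 * delta))) (sqa (x - (K + 3 * delta))) => a5 a6.
  move: (sqa (x - (K - 4 * delta))) (sqa (x - (K - 3 * delta))) => a7 a8.
  by clearbody c; ring.
have P : Pfun (fun x => comb sqa l x + 0) (comb (fun y => 2 * `|y|) l)
    (fun x => comb cua l x + 0 * x - comb cua l 0).
  apply: Pfun_comb.
  - move=> x; rewrite slopeE ler_pdivrMr ?mulr_gt0// ler_pdivlMr ?mulr_gt0// mul0r mul1r.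
    have /andP[h1 h2] := tr01 (x - K); have /andP[h3 h4] := tr01 (x + K).
    have [x0|/ltW x0] := leP 0 x.
      have e : tr (x + K) = 0 by apply: trR; lra.
      by rewrite e addr0 h1.
    have e : tr (x - K) = 0 by apply: trL; lra.
    by rewrite e add0r h3.
  - exists (K + 4 * delta) => x xK; rewrite slopeE.
    have [x0|/ltW x0] := leP 0 x; move: xK.
      by rewrite ger0_norm// => ?; rewrite !trR ?addr0 ?mul0r//; lra.
    by rewrite ler0_norm// => ?; rewrite !trL ?addr0 ?mul0r//; lra.
  - by have := odd 0; rewrite oppr0; lra.
have inn x : `|x| <= K - 4 * delta -> comb sqa l x + 0 = 0.
  rewrite ler_norml => /andP[h1 h2]; rewrite /l !comb_cons !comb_nil.
  rewrite /sqa (@ler0_norm _ (x - (K - 4 * delta))); last by lra.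
  rewrite (@ler0_norm _ (x - (K - 3 * delta))); last by lra.
  rewrite (@ler0_norm _ (x - (K + 4 * delta))); last by lra.
  rewrite (@ler0_norm _ (x - (K + 3 * delta))); last by lra.
  rewrite (@ger0_norm _ (x - (- K - 4 * delta))); last by lra.
  rewrite (@ger0_norm _ (x - (- K - 3 * delta))); last by lra.
  rewrite (@ger0_norm _ (x - (- K + 4 * delta))); last by lra.
  rewrite (@ger0_norm _ (x - (- K + 3 * delta))); last by lra.
  by ring.
have mid x : K - 3 * delta <= x <= K + 3 * delta ->
    comb sqa l x + 0 = x - K + 7 / 2 * delta.
  move=> /andP[h1 h2]; rewrite /l !comb_cons !comb_nil.
  rewrite /sqa (@ger0_norm _ (x - (K - 4 * delta))); last by lra.
  rewrite (@ger0_norm _ (x - (K - 3 * delta))); last by lra.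
  rewrite (@ler0_norm _ (x - (K + 4 * delta))); last by lra.
  rewrite (@ler0_norm _ (x - (K + 3 * delta))); last by lra.
  rewrite (@ger0_norm _ (x - (- K - 4 * delta))); last by lra.
  rewrite (@ger0_norm _ (x - (- K - 3 * delta))); last by lra.
  rewrite (@ger0_norm _ (x - (- K + 4 * delta))); last by lra.
  rewrite (@ger0_norm _ (x - (- K + 3 * delta))); last by lra.
  by rewrite /c; field.
have out x : K + 4 * delta <= x -> comb sqa l x + 0 = 7 * delta.
  move=> h1; rewrite /l !comb_cons !comb_nil.
  rewrite /sqa !ger0_norm; [|lra..].
  by rewrite /c; field.
have up x : comb sqa l x + 0 <= 8 * delta.
  have [h|/ltW h] := leP (K + 4 * delta) x; first by rewrite out//; lra.
  have /andP[+ _] := Pfun_mono P h; rewrite (out _ (lexx _)); lra.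
eexists; eexists; eexists; split; first exact: P.
- split => //.
  + exact: Pfun_mono P.
  + by move=> x; rewrite odd; ring.
  + by move=> x y h1 h2 h3; rewrite !mid; [ring|apply/andP; split; lra..].
- move=> x; rewrite ler_norml up andbT; have := up (- x); rewrite odd; lra.
- exact: inn.
- move=> x xK; have J0 := Pfun_J0 P.
  have [x0|/ltW x0] := leP 0 x.
    have [z /andP[z1 z2]] := Pfun_mvtJ P x0; rewrite J0 inn ?mul0r; first lra.
    by move: xK; rewrite !ger0_norm//; lra.
  have [z /andP[z1 z2]] := Pfun_mvtJ P x0; rewrite J0 inn ?mul0r; first lra.
  by move: xK; rewrite !ler0_norm//; lra.
Qed.

End primitives.

(** * Smooth cut-offs and mollifiers *)

Section smooth_functions.
Context (R : realType).
Implicit Types (f g : R -> R) (p q : {poly R}).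

(** Derivable n + 1 times, by recursion on the derivative, a form in which products and affine
    substitutions pass by induction. *)
Fixpoint smn (n : nat) (f : R -> R) : Prop :=
  (forall t, derivable f t 1) /\
  (if n is n'.+1 then smn n' (derive1 f) else True).

Lemma smn_der n f : smn n f -> forall t, derivable f t 1.
Proof. by case: n => [|n] []. Qed.
Arguments smn_der {n f} _ _.

Lemma smnW n f : smn n.+1 f -> smn n f.
Proof. by elim: n f => [|n IH] f [h1 h2]; split => //; exact: IH. Qed.

Lemma smoothP f : (forall n, smn n f) -> smooth f.
Proof.
move=> h n; have {h} := h n; elim: n f => [|n IH] f; first by case.
by move=> [_ /IH h] t; rewrite derive1Sn.
Qed.

Let ddP f (x : R) : derivable f x 1 -> is_derive x 1 f (derive1 f x).
Proof. by move=> h; rewrite derive1E; exact: derivableP. Qed.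

Lemma smnD n f g : smn n f -> smn n g -> smn n (fun x => f x + g x).
Proof.
elim: n f g => [|n IH] f g [f1 f2] [g1 g2]; split; try exact: I.
- by move=> t; exact: derivableD (f1 t) (g1 t).
- by move=> t; exact: derivableD (f1 t) (g1 t).
rewrite (_ : derive1 _ = (fun x => derive1 f x + derive1 g x)); first exact: IH.
apply/funext => x; have hf := ddP (f1 x); have hg := ddP (g1 x).
rewrite derive1E; have h := is_deriveD hf hg; exact: derive_val.
Qed.

Lemma smnM n f g : smn n f -> smn n g -> smn n (fun x => f x * g x).
Proof.
elim: n f g => [|n IH] f g hf hg.
  by split => // t; apply: derivableM; [exact: smn_der hf t|exact: smn_der hg t].
split.
  by move=> t; apply: derivableM; [exact: smn_der hf t|exact: smn_der hg t].
rewrite (_ : derive1 _ = (fun x => f x * derive1 g x + g x * derive1 f x)).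
  apply: smnD; apply: IH; [exact: smnW|by case: hg|exact: smnW|by case: hf].
apply/funext => x.
have df := ddP (smn_der hf x); have dg := ddP (smn_der hg x).
rewrite derive1E.
have h : is_derive x 1 (fun x => f x * g x) (f x *: derive1 g x + g x *: derive1 f x).
  exact: is_deriveM.
exact: derive_val.
Qed.

Lemma is_derive_affine f (a b df x : R) : is_derive (a * x + b) 1 f df ->
  is_derive x 1 (fun y => f (a * y + b)) (a * df).
Proof.
move=> h; have h1 : is_derive x 1 (fun y : R => a * y + b) a.
  by apply: is_derive_eq; rewrite addr0 -[_ *: _]/(_ * _) mulr1.
have h2 := @is_derive1_comp _ f (fun y : R => a * y + b) x _ _ h h1.
by rewrite mulrC.
Qed.

Lemma smn_affine n f (a b c : R) : smn n f -> smn n (fun x => c * f (a * x + b)).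
Proof.
have dd (f' : R -> R) (c' x : R) : (forall t, derivable f' t 1) ->
    is_derive x 1 (fun y => c' * f' (a * y + b)) (c' * a * derive1 f' (a * x + b)).
  move=> hf; have h := is_derive_affine (ddP (hf (a * x + b))).
  by apply: is_derive_eq; rewrite -[_ *: _]/(_ * _) mulrA.
elim: n f c => [|n IH] f c [f1 f2].
  by split => // t; have := dd f c t f1 => ?; exact: ex_derive.
split; first by move=> t; have := dd f c t f1 => ?; exact: ex_derive.
rewrite (_ : derive1 _ = (fun x => c * a * derive1 f (a * x + b))); first exact: IH.
by apply/funext => x; rewrite derive1E; have := dd f c x f1 => ?; exact: derive_val.
Qed.

Lemma poly_growth p : exists C d, 0 <= C /\ forall y, 1 <= y -> `|p.[y]| <= C * y ^+ d.
Proof.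
elim/poly_ind: p => [|p c [C [d [C0 h]]]].
  by exists 0, 0%N; split => // y _; rewrite horner0 normr0 mul0r.
exists (C + `|c|), d.+1; split; first by rewrite addr_ge0.
move=> y y1; rewrite hornerD hornerC hornerM hornerX.
have y0 : 0 <= y by lra.
apply: (le_trans (ler_normD _ _)); rewrite mulrDl; apply: lerD.
  by rewrite normrM (ger0_norm y0) exprS mulrCA (mulrC y) ler_wpM2r// h.
by rewrite ler_peMr// exprn_ege1.
Qed.

(* These functions are stable under differentiation, hence smooth. *)
Definition flat p (x : R) := if 0 < x then p.[x^-1] * expR (- x^-1) else 0.

Lemma flat_neg p x : x <= 0 -> flat p x = 0.
Proof. by rewrite /flat leNgt => /negbTE ->. Qed.

(** If [p] grows like y^d, the term of order d + 2 of the exponential series leaves a factor x^2.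
    The difference quotient at 0 therefore tends to 0 for every [p], and no compatibility at the
    origin has to be checked. *)
Lemma flat_small p : exists C, forall x, 0 < x <= 1 -> `|flat p x| <= C * x ^+ 2.
Proof.
have [C [d [C0 h]]] := poly_growth p.
exists (C * (d.+2)`!%:R) => x /andP[x0 x1]; rewrite /flat x0 normrM.
have y1 : 1 <= x^-1 by rewrite invr_ge1 ?unitfE ?gt_eqF.
have y0 : 0 < x^-1 by rewrite invr_gt0.
rewrite (@gtr0_norm _ (expR _)) ?expR_gt0// expRN.
rewrite ler_pdivrMr ?expR_gt0//.
have := expR_ge1Dxn d.+1 (ltW y0).
set F := (d.+2)`!%:R; have F0 : 0 < F by rewrite ltr0n fact_gt0.
move=> E; have {}E : x^-1 ^+ d.+2 / F <= expR x^-1 by lra.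
apply: (le_trans (h _ y1)).
rewrite -mulrA -mulrA; apply: ler_wpM2l => //.
have : F * x ^+ 2 * (x^-1 ^+ d.+2 / F) <= F * x ^+ 2 * expR x^-1.
  by apply: ler_wpM2l => //; rewrite mulr_ge0 ?sqr_ge0// ltW.
rewrite mulrA; apply: le_trans.
rewrite -[d.+2]/(2 + d)%N exprD (_ : _ / F = x^-1 ^+ d); first exact: lexx.
move: (x^-1 ^+ d) => z; rewrite !expr2; field; by rewrite !gt_eqF.
Qed.

(** With y = 1/x, the derivative in x of p(y) e^(-y) is y^2 (p - p')(y) e^(-y). *)
Definition dpoly p : {poly R} := 'X ^+ 2 * (p - p^`()).

Lemma is_derive_flat p (x : R) : is_derive x 1 (flat p) (flat (dpoly p) x).
Proof.
have [x0|x0|->] := ltgtP x 0.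
- have e : \near x, (fun _ : R => 0 : R) x = flat p x.
    near=> y; rewrite flat_neg//; apply: ltW.
    by near: y; exact: lt_nbhsl.
  apply: (near_eq_is_derive e); rewrite flat_neg ?ltW//.
  exact: is_derive_cst.
- have e : \near x, (fun y : R => p.[y^-1] * expR (- y^-1)) x = flat p x.
    by near=> y; rewrite /flat ifT//; near: y; exact: lt_nbhsr.
  apply: (near_eq_is_derive e).
  have x0' : x != 0 by rewrite gt_eqF.
  have d1 : is_derive x 1 (fun y : R => y^-1) (- x ^- 2).
    have := @is_deriveV R id x 1 1 x0' (is_derive_id _ _).
    by rewrite -[_ *: _]/(_ * _) mulr1.
  have d2 := @is_derive1_comp _ (horner p) (fun y => y^-1) x _ _ (is_derive_poly p x^-1) d1.
  have d3 : is_derive x 1 (fun y : R => - y^-1) (x ^- 2).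
    by apply: is_derive_eq; rewrite opprK.
  have d4 := @is_derive1_comp _ expR (fun y => - y^-1) x _ _ (is_derive_expR _) d3.
  have d5 := is_deriveM d2 d4.
  rewrite (_ : flat _ x = p.[x^-1] *: (expR (- x^-1) / x ^+ 2) +
     expR (- x^-1) *: (p^`().[x^-1] * - x ^- 2)); first exact: d5.
  rewrite -![_ *: _]/(_ * _) /flat x0 /dpoly hornerM hornerXn hornerD hornerN /=.
  by rewrite exprVn; ring.
rewrite flat_neg//.
have h : (fun h : R => h^-1 *: (flat p (h *: 1 + 0) - flat p 0)) @ 0^' --> (0 : R).
  have [C hC] := flat_small p.
  apply/cvgr0Pnorm_le => // eps e0.
  have C1 : 0 < `|C| + 1 by rewrite ltr_wpDl.
  near=> t.
  have t0 : t != 0 by near: t; exact: nbhs_dnbhs_neq.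
  have t1 : `|t| < Num.min 1 (eps / (`|C| + 1)).
    by near: t; apply: dnbhs0_lt; rewrite lt_min ltr01 divr_gt0.
  rewrite (flat_neg _ (lexx 0)) subr0 addr0 -![_ *: _]/(_ * _) mulr1.
  have [tn|tp] := leP t 0; first by rewrite flat_neg// mulr0 normr0 ltW.
  move: t1; rewrite gtr0_norm// lt_min => /andP[t1 t2].
  rewrite normrM normfV (gtr0_norm tp) mulrC ler_pdivrMr//.
  have := hC t; rewrite tp ltW// => /(_ isT) H.
  apply: (le_trans H).
  rewrite expr2 mulrA ler_wpM2r ?(ltW tp)//.
  move: t2; rewrite ltr_pdivlMr// => t2; have := ler_norm C; nra.
split; last by apply/cvg_lim.
by apply/cvg_ex; exists 0.
Unshelve. all: end_near. Qed.

Lemma smn_flat n p : smn n (flat p).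
Proof.
elim: n p => [|n IH] p.
  by split => // t; have := is_derive_flat p t => ?; exact: ex_derive.
split; first by move=> t; have := is_derive_flat p t => ?; exact: ex_derive.
rewrite (_ : derive1 _ = flat (dpoly p)); first exact: IH.
by apply/funext => x; rewrite derive1E; have := is_derive_flat p x => ?; exact: derive_val.
Qed.

Lemma derivable_cts f : (forall t, derivable f t 1) -> continuous f.
Proof.
by move=> h x; apply: differentiable_continuous; apply/derivable1_diffP.
Qed.

Lemma cts_mfun f : continuous f ->
  measurable_fun setT (f : measurableTypeR R -> measurableTypeR R).
Proof. exact: continuous_measurable_fun. Qed.

Lemma bounded_supp f (a b : R) : continuous f ->
  (forall x, ~~ (a <= x <= b) -> f x = 0) -> exists C, forall x, `|f x| <= C.
Proof.
move=> cf h; have [ab|ab] := leP a b; last first.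
  exists 0 => x; rewrite h ?normr0//; apply/negP => /andP[h1 h2].
  by move: ab; rewrite ltNge (le_trans h1 h2).
have [c _ hc] := @EVT_max _ (fun x => `|f x|) a b ab
  (continuous_subspaceT (fun x => continuous_comp (cf x) (@norm_continuous _ _ (f x)))).
exists `|f c| => x; have [hx|/h ->] := boolP (a <= x <= b); last by rewrite normr0.
by apply: hc; rewrite in_itv.
Qed.

End smooth_functions.

Section bump.
Context (R : realType).
Local Notation mu := (@lebesgue_measure R).

Definition bump0 (t : R) := flat (1 : {poly R}) (1 + t) * flat (1 : {poly R}) (1 - t).

Lemma flat1_ge0 (x : R) : 0 <= flat (1 : {poly R}) x.
Proof. by rewrite /flat; case: ifP => // _; rewrite hornerC mul1r expR_ge0. Qed.

Lemma flat1_le1 (x : R) : flat (1 : {poly R}) x <= 1.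
Proof.
rewrite /flat; case: ifP => // x0; rewrite hornerC mul1r -expR0 ler_expR.
by rewrite oppr_le0 invr_ge0 ltW.
Qed.

Lemma bump0_smn n : smn n bump0.
Proof.
apply: smnM.
  have := smn_affine 1 1 1 (smn_flat n (1 : {poly R})).
  by under eq_fun do rewrite !mul1r addrC.
have := smn_affine (-1) 1 1 (smn_flat n (1 : {poly R})).
by under eq_fun do rewrite mul1r mulN1r addrC.
Qed.

Lemma bump0_ge0 t : 0 <= bump0 t.
Proof. by rewrite mulr_ge0 ?flat1_ge0. Qed.

Lemma bump0_le1 t : bump0 t <= 1.
Proof. by rewrite mulr_ile1 ?flat1_ge0 ?flat1_le1. Qed.

Lemma bump0_supp t : ~~ (-1 <= t <= 1) -> bump0 t = 0.
Proof.
rewrite negb_and -!ltNge /bump0 => /orP[h|h].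
  by rewrite flat_neg ?mul0r//; lra.
by rewrite [X in _ * X]flat_neg ?mulr0//; lra.
Qed.

(** Both 1 + t and 1 - t are at least 1/2 here, so that each factor is at least e^(-2). Integrated,
    this is the origin of the constant [mollC] in the bound [mollC / eps] of the mollifier. *)
Lemma bump0_lower t : - 2^-1 <= t <= 2^-1 -> expR (- 4) <= bump0 t.
Proof.
move=> /andP[h1 h2]; rewrite (_ : - 4 = - 2 + - 2); last by ring.
rewrite expRD /bump0 /flat !ifT ?hornerC ?mul1r; [|lra..].
by apply: ler_pM; rewrite ?expR_ge0// ler_expR lerN2 invf_ple ?posrE; lra.
Qed.

Lemma mu_itv (a b : R) : a <= b -> mu (`[a, b]%classic : set R) = (b - a)%:E.
Proof.
rewrite lebesgue_measure_itv/= lte_fin le_eqVlt => /predU1P[->|->].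
  by rewrite ltxx subrr.
by rewrite EFinB.
Qed.

Lemma ig_indic d (T : measurableType d) (m : {measure set T -> \bar R})
    (A : set T) : measurable A -> (m A < +oo)%E -> ig m (\1_A : T -> R).
Proof.
move=> mA mlt; apply: ig_fin; first exact: measurable_indic.
under eq_integral do rewrite ger0_norm//.
by rewrite (integral_indic _ measurableT)// setIT.
Qed.

Lemma ig_itv (a b : R) :
  ig mu (\1_(`[a, b]%classic : set R) : measurableTypeR R -> R).
Proof.
apply: ig_indic; first exact: measurable_itv.
have [ab|ab] := leP a b; first by have := ltry (b - a); rewrite -(mu_itv ab).
by rewrite set_itv_ge ?measure0// bnd_simp -ltNge.
Qed.

Lemma ig_bounded_supp (f : R -> R) (a b C : R) :
  measurable_fun [set: measurableTypeR R] f ->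
  (forall x, `|f x| <= C) -> (forall x, ~~ (a <= x <= b) -> f x = 0) -> ig mu f.
Proof.
move=> mf fC f0.
apply: (ig_le mf (igZ C (ig_itv a b))) => x; rewrite indicE; case: (boolP (x \in _)) => /= h; first by rewrite mulr1.
rewrite mulr0 f0 ?normr0//; apply: contra h => h.
by rewrite inE/= in_itv.
Qed.

Lemma measurable_bump0 : measurable_fun [set: measurableTypeR R] (@bump0).
Proof. apply: cts_mfun; apply: derivable_cts => t; exact: smn_der (bump0_smn 0) t. Qed.

(** The mass is taken anew at each scale, which makes the normalization immediate without a dilation
    of Lebesgue measure; of its size only the lower bound [mollI_ge] matters. *)
Definition mollI (eps : R) := \int[mu]_x bump0 (eps^-1 * x).

Definition moll (eps t : R) := (mollI eps)^-1 * bump0 (eps^-1 * t).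

Definition mollC : R := expR 4.

Section moll.
Variable eps : R.
Hypothesis e0 : 0 < eps.

Let scaled_supp x : ~~ (- eps <= x <= eps) -> bump0 (eps^-1 * x) = 0.
Proof.
rewrite -ler_norml -ltNge => h; apply: bump0_supp.
apply: contraL h; rewrite -ler_norml -leNgt normrM gtr0_norm ?invr_gt0//.
by rewrite mulrC ler_pdivrMr// mul1r.
Qed.

Let measurable_scaled :
  measurable_fun [set: measurableTypeR R] (fun x => bump0 (eps^-1 * x)).
Proof.
apply: (measurableT_comp measurable_bump0); exact: measurable_funM.
Qed.

Let ig_scaled : ig mu (fun x => bump0 (eps^-1 * x)).
Proof.
apply: (@ig_bounded_supp _ (- eps) eps 1) => //.
by move=> x; rewrite ger0_norm ?bump0_ge0// bump0_le1.
Qed.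

Lemma mollI_ge : eps / mollC <= mollI eps.
Proof.
have E0 := e0; have le2 : - (eps / 2) <= eps / 2 by lra.
apply: (@le_trans _ _ (\int[mu]_x (expR (- 4) *
    \1_(`[- (eps / 2), eps / 2]%classic : set R) x))).
  rewrite int_Z; last exact: ig_itv.
  rewrite /mollC expRN mulrC ler_wpM2l ?invr_ge0 ?expR_ge0//.
  rewrite /Rintegral (integral_indic _ measurableT)// setIT.
  suff : eps <= fine (mu (`[- (eps / 2), eps / 2]%classic : set R)) by [].
  by rewrite mu_itv //=; lra.
apply: int_le; [exact/igZ/ig_itv|exact: ig_scaled|].
move=> x; rewrite indicE; case: (boolP (x \in _)) => /= h; last first.
  by rewrite mulr0 bump0_ge0.
rewrite mulr1 bump0_lower//; move: h; rewrite inE/= in_itv/= => /andP[h1 h2].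
by rewrite ler_pdivlMl// ler_pdivrMl//; apply/andP; split; lra.
Qed.

Lemma mollI_gt0 : 0 < mollI eps.
Proof. by apply: lt_le_trans mollI_ge; rewrite divr_gt0// expR_gt0. Qed.

Lemma moll_ge0 t : 0 <= moll eps t.
Proof. by rewrite mulr_ge0 ?bump0_ge0// invr_ge0 ltW// mollI_gt0. Qed.

Lemma moll_le t : moll eps t <= mollC / eps.
Proof.
apply: (@le_trans _ _ (mollI eps)^-1).
  by rewrite /moll ler_piMr ?bump0_le1// invr_ge0 ltW// mollI_gt0.
rewrite -[_ / _]invrK invf_div lef_pV2 ?posrE ?mollI_gt0 ?divr_gt0 ?expR_gt0//.
exact: mollI_ge.
Qed.

Lemma moll_supp t : eps < `|t| -> moll eps t = 0.
Proof. by move=> h; rewrite /moll scaled_supp ?mulr0// -ler_norml -ltNge. Qed.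

Lemma moll_smn c n : smn n (fun t => moll eps (t - c)).
Proof.
have := smn_affine eps^-1 (- eps^-1 * c) (mollI eps)^-1 (bump0_smn n).
rewrite (_ : (fun x => _) = (fun t => moll eps (t - c)))//.
by apply/funext => x; rewrite /moll mulrBr mulNr.
Qed.

Let moll_smn0 n : smn n (moll eps).
Proof. by have := moll_smn 0 n; under eq_fun do rewrite subr0. Qed.

Lemma moll_cts : continuous (moll eps).
Proof. apply: derivable_cts; exact: smn_der (moll_smn0 0). Qed.

Lemma measurable_moll : measurable_fun [set: measurableTypeR R] (moll eps).
Proof. by apply: cts_mfun; exact: moll_cts. Qed.

(** The bound is uniform in the centre [c], since translation does not change the supremum: the
    estimates at a fixed scale are integrated in [c] later. *)
Lemma moll_der : exists D, forall c t, `|derive1 (fun t => moll eps (t - c)) t| <= D.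
Proof.
have cd : continuous (derive1 (moll eps)).
  by apply: derivable_cts; case: (moll_smn0 1) => _ /= -[h _]; exact: h.
have [D hD] : exists D, forall t, `|derive1 (moll eps) t| <= D.
  apply: (@bounded_supp _ _ (- eps) eps) => // x.
  rewrite -ler_norml -ltNge => h.
  have e : \near x, (cst 0 : R -> R) x = moll eps x.
    near=> y; rewrite moll_supp//.
    by near: y; exact: (@cvgr_norm_gt _ _ _ (nbhs x) _ id x).
  have e' := near_eq_is_derive e (is_derive_cst 0 x (1:R)).
  by rewrite derive1E; exact: derive_val.
exists D => c t; suff -> : derive1 (fun t => moll eps (t - c)) t =
    derive1 (moll eps) (t - c) by [].
have h : is_derive (t - c) 1 (moll eps) (derive1 (moll eps) (t - c)).
  by rewrite derive1E; apply: derivableP; exact: smn_der (moll_smn0 0) _.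
by rewrite [LHS]derive1E; have := is_derive_sub h => ?; exact: derive_val.
Unshelve. all: end_near. Qed.

Lemma ig_moll c : ig mu (fun t => moll eps (t - c)).
Proof.
apply: ig_shift; apply: (@ig_bounded_supp _ (- eps) eps (mollC / eps)).
- exact: measurable_moll.
- by move=> x; rewrite ger0_norm ?moll_ge0// moll_le.
- by move=> x; rewrite -ler_norml -ltNge; exact: moll_supp.
Qed.

Lemma ig_moll0 : ig mu (moll eps).
Proof. by have := ig_moll 0; under [X in ig _ X]eq_fun do rewrite subr0. Qed.

Lemma int_moll c : \int[mu]_t moll eps (t - c) = 1.
Proof.
rewrite (int_shift c ig_moll0) /moll int_Z; last exact: ig_scaled.
by rewrite mulVf// gt_eqF// mollI_gt0.
Qed.

End moll.

(** A test function that does not vanish at time 0: it has the value e^(-1) there and decreases to 0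
    at eps. What matters is that minus its derivative is comparable to 1 / eps on the first half of
    [[0, eps]]. *)
Definition cutoff (eps t : R) := flat (1 : {poly R}) (1 - eps^-1 * t).

Section cutoff.
Variable eps : R.
Hypothesis e0 : 0 < eps.

Lemma cutoff_smn n : smn n (cutoff eps).
Proof.
have := smn_affine (- eps^-1) 1 1 (smn_flat n (1 : {poly R})).
rewrite (_ : (fun x => _) = (cutoff eps))//.
by apply/funext => x; rewrite /cutoff mul1r mulNr addrC.
Qed.

Lemma cutoff_smooth : smooth (cutoff eps).
Proof. by apply: smoothP => n; exact: cutoff_smn. Qed.

Lemma cutoff_ge0 t : 0 <= cutoff eps t. Proof. exact: flat1_ge0. Qed.

Lemma cutoff_le1 t : cutoff eps t <= 1. Proof. exact: flat1_le1. Qed.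

Lemma cutoff_supp t : eps <= t -> cutoff eps t = 0.
Proof. by move=> h; rewrite /cutoff flat_neg// subr_le0 ler_pdivlMl// mulr1. Qed.

Let flat2 : dpoly (1 : {poly R}) = 'X ^+ 2.
Proof. by rewrite /dpoly derivC subr0 mulr1. Qed.

Lemma cutoff_derE t : derive1 (cutoff eps) t = - (eps^-1 * flat ('X ^+ 2) (1 - eps^-1 * t)).
Proof.
have h := is_derive_flat (1 : {poly R}) (- eps^-1 * t + 1).
have h1 := is_derive_affine h.
rewrite derive1E (_ : cutoff eps = (fun y => flat 1 (- eps^-1 * y + 1))); last first.
  by apply/funext => x; rewrite /cutoff mulNr addrC.
by rewrite (@derive_val _ _ _ _ _ _ _ h1) flat2 !mulNr (addrC 1).
Qed.

Let flat2_ge0 (x : R) : 0 <= flat ('X ^+ 2 : {poly R}) x.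
Proof.
by rewrite /flat; case: ifP => // x0; rewrite hornerXn mulr_ge0 ?expR_ge0// sqr_ge0.
Qed.

Let flat2_le (x : R) : flat ('X ^+ 2 : {poly R}) x <= 2.
Proof.
rewrite /flat; case: ifP => // x0; rewrite hornerXn expRN ler_pdivrMr ?expR_gt0//.
have y0 : 0 <= x^-1 by rewrite invr_ge0 ltW.
have := expR_ge1Dxn 1 y0; rewrite (_ : (2`!)%N = 2%N)//.
by move: (expR _) (_ ^+ 2) => a b; lra.
Qed.

(** The upper bound is y^2 e^(-y) <= 2 for y >= 0, from the quadratic term of the exponential
    series. *)
Lemma cutoff_der t : 0 <= - derive1 (cutoff eps) t <= 2 / eps.
Proof.
rewrite cutoff_derE opprK mulr_ge0 ?flat2_ge0 ?invr_ge0 ?(ltW e0)//=.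
by rewrite mulrC ler_wpM2r ?flat2_le ?invr_ge0 ?(ltW e0).
Qed.

Lemma cutoff_der_supp t : eps <= t -> derive1 (cutoff eps) t = 0.
Proof.
by move=> h; rewrite cutoff_derE flat_neg ?mulr0 ?oppr0// subr_le0 ler_pdivlMl// mulr1.
Qed.

Lemma cutoff_der_lower t : 0 <= t <= eps / 2 -> expR (- 2) / eps <= - derive1 (cutoff eps) t.
Proof.
have E0 := e0; move=> /andP[t0 t1]; rewrite cutoff_derE opprK mulrC.
rewrite ler_wpM2l ?invr_ge0 ?(ltW e0)//.
have x1 : 1 - eps^-1 * t <= 1 by rewrite lerBlDr lerDl mulr_ge0// invr_ge0 ltW.
have x2 : 2^-1 <= 1 - eps^-1 * t.
  have h : eps^-1 * t <= 2^-1 by rewrite ler_pdivrMl; lra.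
  by move: (_ * t) h => z; lra.
move: (1 - _) x1 x2 => x x1 x2; have x0 : 0 < x by lra.
rewrite /flat x0 hornerXn -[leLHS]mul1r ler_pM ?expR_ge0//.
  by rewrite exprn_ege1// invr_ge1 ?unitfE ?gt_eqF.
by rewrite ler_expR lerN2 invf_ple ?posrE; lra.
Qed.

Lemma measurable_cutoff_der :
  measurable_fun [set: measurableTypeR R] (derive1 (cutoff eps)).
Proof.
by apply: cts_mfun; apply: derivable_cts; case: (cutoff_smn 1) => _ /= -[h _]; exact: h.
Qed.

Lemma measurable_cutoff : measurable_fun [set: measurableTypeR R] (cutoff eps).
Proof.
by apply: cts_mfun; apply: derivable_cts; exact: (smn_der (cutoff_smn 0)).
Qed.

End cutoff.

Lemma measurable_moll_der eps c :
  measurable_fun [set: measurableTypeR R] (derive1 (fun t => moll eps (t - c))).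
Proof.
apply: cts_mfun; apply: derivable_cts.
by case: (moll_smn eps c 1) => _ /= -[h _]; exact: h.
Qed.

End bump.

(** * Layers of the kernel *)

Lemma int_ext d (T : measurableType d) (R : realType)
    (m : {measure set T -> \bar R}) (f g : T -> R) : (forall x, f x = g x) ->
  \int[m]_x f x = \int[m]_x g x.
Proof. by move=> fg; apply: eq_Rintegral => x _; exact: fg. Qed.

(** * Reflection invariance of Lebesgue measure on the line *)

Section reflection.
Context (R : realType).
Local Notation mu := (@lebesgue_measure R).

Let neg : measurableTypeR R -> measurableTypeR R := fun x => - x.

Let mneg : measurable_fun setT neg.
Proof. exact: oppr_measurable. Qed.

Lemma ge0_integral_neg (f : R -> \bar R) : measurable_fun [set: measurableTypeR R] f ->
  (forall x, 0 <= f x)%E -> (\int[mu]_x f (- x)%R = \int[mu]_x f x)%E.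
Proof.
move=> mf f0; have H := mneg.
transitivity (\int[pushforward mu neg]_x f x)%E.
  by rewrite ge0_integral_pushforward//= preimage_setT.
by apply: eq_measure_integral => //= A mA _; exact: lebesgue_measureN.
Qed.

Lemma ig_neg (f : R -> R) : ig mu f -> ig mu (fun x : R => f (- x)).
Proof.
move=> h; have mf := ig_mfun h; apply: ig_fin.
  exact: (measurableT_comp mf mneg).
rewrite (ge0_integral_neg (f := fun x => `|f x|%:E))//; first exact: ig_lty.
by apply/measurable_EFinP; apply: measurableT_comp.
Qed.

Lemma int_neg (f : R -> R) : ig mu f -> \int[mu]_x f (- x) = \int[mu]_x f x.
Proof.
move=> h; have H := mneg.
have mf : measurable_fun setT (EFin \o f).
  by apply/measurable_EFinP; exact: ig_mfun h.
have : (\int[pushforward mu neg]_x (f x)%:E =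
        \int[mu]_x (f (- x)%R)%:E)%E.
  rewrite (integral_pushforward H)// ?preimage_setT//.
  exact: (ig_neg h).
rewrite /Rintegral => <-; congr fine; apply: eq_measure_integral => //= A mA _.
exact: lebesgue_measureN.
Qed.

Lemma ig_refl (c : R) (f : R -> R) : ig mu f -> ig mu (fun x : R => f (c - x)).
Proof.
move=> h; have := ig_neg (ig_shift (- c) h).
by under [X in ig _ X]eq_fun do rewrite opprK addrC.
Qed.

Lemma int_refl (c : R) (f : R -> R) : ig mu f ->
  \int[mu]_x f (c - x) = \int[mu]_x f x.
Proof.
move=> h; rewrite -[RHS](int_shift (- c) h) -[RHS](int_neg (ig_shift (- c) h)).
by apply: eq_Rintegral => x _; rewrite opprK addrC.
Qed.

End reflection.

Section interval_indicator.
Context (R : realType).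
Local Notation mu := (@lebesgue_measure R).

Definition ioo (a b t : R) : R := ((a < t) && (t < b))%:R.

Lemma ioo_ge0 a b t : 0 <= ioo a b t. Proof. exact: ler0n. Qed.
Lemma ioo_le1 a b t : ioo a b t <= 1. Proof. by rewrite /ioo; case: (_ && _). Qed.
Lemma ioo_norm1 a b t : `|ioo a b t| <= 1.
Proof. by rewrite ger0_norm ?ioo_ge0// ioo_le1. Qed.

Lemma ioo1 a b t : a < t < b -> ioo a b t = 1. Proof. by rewrite /ioo => ->. Qed.
Lemma ioo0 a b t : ~~ (a < t < b) -> ioo a b t = 0.
Proof. by rewrite /ioo => /negbTE ->. Qed.

Lemma iooE a b : ioo a b = \1_(`]a, b[%classic : set R) :> (_ -> R).
Proof. by apply/funext => x; rewrite /ioo indicE mem_setE in_itv. Qed.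

Lemma measurable_ioo a b : measurable_fun [set: measurableTypeR R] (ioo a b).
Proof. by rewrite iooE; exact: measurable_indic. Qed.

Lemma mu_ioo (a b : R) : a <= b -> mu (`]a, b[%classic : set R) = (b - a)%:E.
Proof.
rewrite lebesgue_measure_itv/= lte_fin le_eqVlt => /predU1P[->|->].
  by rewrite ltxx subrr.
by rewrite EFinB.
Qed.

Lemma ig_ioo a b : ig mu (ioo a b).
Proof.
have [ab|/ltW ab] := leP a b.
  rewrite iooE; apply: ig_indic; first exact: measurable_itv.
  by have := ltry (b - a); rewrite -(mu_ioo ab).
rewrite (_ : ioo a b = fun _ => 0); first exact: ig0.
apply/funext => t; rewrite ioo0//; apply/negP => /andP[h1 h2].
by have := lt_le_trans (lt_trans h1 h2) ab; rewrite ltxx.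
Qed.

Lemma int_ioo a b : a <= b -> \int[mu]_t ioo a b t = b - a.
Proof.
move=> ab; rewrite iooE /Rintegral (integral_indic _ measurableT)//= setIT.
suff : fine (mu (`]a, b[%classic : set R)) = b - a by [].
by rewrite mu_ioo.
Qed.

Lemma int_set_ioo (a b : R) (f : R -> R) :
  \int[mu]_(t in `]a, b[) f t = \int[mu]_t (ioo a b t * f t).
Proof.
rewrite Rintegral_mkcond; apply: eq_Rintegral => t _.
rewrite patchE mem_setE in_itv/= /ioo; case: ifP => _; by rewrite ?mul1r ?mul0r.
Qed.

Lemma ig_set_ioo (a b : R) (f : R -> R) : mu.-integrable `]a, b[ (EFin \o f) ->
  ig mu (fun t => ioo a b t * f t).
Proof.
move=> h; have mI : measurable (`]a, b[%classic : set (measurableTypeR R)).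
  exact: measurable_itv.
have {}h := (integrable_mkcond (mu := mu) (EFin \o f : measurableTypeR R -> _) mI).1 h.
rewrite /ig (_ : EFin \o _ = (EFin \o f) \_ `]a, b[)//.
apply/funext => t; rewrite /= patchE mem_setE in_itv/= /ioo.
by case: ifP => _; rewrite ?mul1r ?mul0r.
Qed.

End interval_indicator.

(** * The layer cake decomposition of the bounded part of the kernel *)

Section lag.
Context (R : realType).
Local Notation mu := (@lebesgue_measure R).
Variables (T : R) (kk : R -> R).
Hypothesis T0 : 0 < T.
Hypotheses (kk_ig : ig mu kk) (kk_ge0 : forall t, 0 <= kk t)
  (kk_supp : forall t, ~~ (0 < t < T) -> kk t = 0)
  (kk_mono : forall r t, 0 < r -> r <= t -> kk t <= kk r).

Variable m : R.
Hypothesis m0 : 0 < m.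

Local Notation lam := (ioo 0 m).
Definition chi (l t : R) : R := lam l * (l < kk t)%R%:R.
(* The length of the superlevel set of the kernel: the layers of [min kk m]
   are the intervals ]0, lagt l[, 0 < l < m. *)
Definition lagt (l : R) : R := \int[mu]_t chi l t.
Definition kk2 (t : R) : R := Num.min (kk t) m.

Let mk : measurable_fun [set: measurableTypeR R] kk.
Proof. exact: ig_mfun kk_ig. Qed.

Let chi_le l t : 0 <= chi l t <= lam l * ioo 0 T t.
Proof.
rewrite mulr_ge0 ?ioo_ge0 ?ler0n//=.
rewrite /chi; case: (boolP (0 < l < m)) => h /=; last by rewrite ioo0// !mul0r.
rewrite ioo1// !mul1r; case: (boolP (0 < t < T)) => [ht|/kk_supp ->].
  by rewrite (ioo1 ht); case: (_ < _).
by move: h => /andP[/ltW h _]; rewrite ltNge h ioo_ge0.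
Qed.

Let mchi : measurable_fun setT (fun z : measurableTypeR R * measurableTypeR R => chi z.1 z.2).
Proof.
rewrite /chi; apply: measurable_funM.
  exact: (measurableT_comp (measurable_ioo 0 m)).
have mb : measurable_fun setT (fun z : measurableTypeR R * measurableTypeR R => z.1 < kk z.2).
  apply: measurable_fun_ltr => //.
  exact: (measurableT_comp mk).
rewrite (_ : (fun _ => _) = (fun b : bool => b%:R : R) \o
   (fun z : measurableTypeR R * measurableTypeR R => z.1 < kk z.2))//.
exact: measurableT_comp.
Qed.

Let ig_chi : ig (pm mu mu) (fun z => chi z.1 z.2).
Proof.
apply: (ig_le mchi (ig_tensor (ig_ioo 0 m) (ig_ioo 0 T))) => z.
by case/andP: (chi_le z.1 z.2) => *; rewrite ger0_norm.
Qed.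

Lemma measurable_lagt : measurable_fun [set: measurableTypeR R] lagt.
Proof. exact: ig_mfun (ig_F1 ig_chi). Qed.

Lemma lagt_ge0 l : 0 <= lagt l.
Proof. by apply: int_ge0 => t; rewrite mulr_ge0 ?ioo_ge0. Qed.

Let mchil l : measurable_fun [set: measurableTypeR R] (chi l).
Proof. exact: (measurableT_comp mchi (pair1_measurable l)). Qed.

Let ig_chil l : ig mu (chi l).
Proof.
apply: (ig_le (mchil l) (igZ (lam l) (ig_ioo 0 T))) => t.
by case/andP: (chi_le l t) => *; rewrite ger0_norm.
Qed.

Lemma lagt_le l : lagt l <= T.
Proof.
rewrite -[leRHS]subr0 -(int_ioo (ltW T0)); apply: int_le; [exact: ig_chil|exact: ig_ioo|].
move=> t; case/andP: (chi_le l t) => _ /le_trans; apply.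
by rewrite ler_piMl ?ioo_ge0 ?ioo_le1.
Qed.

Let lag_hi l t : 0 < l < m -> 0 < t -> l < kk t -> t <= lagt l.
Proof.
move=> hl t0 lt; rewrite -[leLHS]subr0 -(int_ioo (ltW t0)).
apply: int_le; [exact: ig_ioo|exact: ig_chil|] => r.
rewrite /chi (ioo1 hl) mul1r /ioo; case: (boolP (0 < r < t)) => //= /andP[r0 rt].
by rewrite (lt_le_trans lt)// kk_mono// ltW.
Qed.

Let lag_lo l t : 0 < l < m -> 0 < t -> kk t <= l -> lagt l <= t.
Proof.
move=> hl t0 lt; rewrite -[leRHS]subr0 -(int_ioo (ltW t0)).
apply: int_le; [exact: ig_chil|exact: ig_ioo|] => r.
rewrite /chi (ioo1 hl) mul1r; case: (boolP (0 < r < t)) => h; first by rewrite (ioo1 h); case: (_ < _).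
rewrite (ioo0 h); case: ltP => // lr; exfalso.
have r0 : 0 < r.
  rewrite ltNge; apply/negP => r0; move: lr; rewrite kk_supp; last first.
    by apply/negP => /andP[]; rewrite ltNge r0.
  by move: hl => /andP[/ltW hl _]; rewrite ltNge hl.
move: h; rewrite r0/= -leNgt => tr.
by have := lt_le_trans lr (le_trans (kk_mono t0 tr) lt); rewrite ltxx.
Qed.

(** The kernel is non-increasing and vanishes for t <= 0, so its superlevel set is an interval that
    starts at 0 and has length [lagt l]. Whether it contains its right end is undecided, hence the
    exceptional point, a null set. *)
Lemma chiE l t : t != lagt l -> chi l t = lam l * ioo 0 (lagt l) t.
Proof.
move=> ne; rewrite /chi; case: (boolP (0 < l < m)) => hl; last by rewrite !(ioo0 hl) !mul0r.
rewrite (ioo1 hl) !mul1r.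
have [t0|t0] := leP t 0.
  rewrite [RHS]ioo0; last by rewrite ltNge t0.
  rewrite kk_supp; last by rewrite ltNge t0.
  by move: hl => /andP[/ltW hl _]; rewrite ltNge hl.
case: (ltP l (kk t)) => h.
  by have := lag_hi hl t0 h; rewrite le_eqVlt (negbTE ne) /= => ta; rewrite ioo1// t0.
have := lag_lo hl t0 h; rewrite le_eqVlt eq_sym (negbTE ne) /= => ta.
by rewrite ioo0// negb_and -!leNgt (ltW ta) orbT.
Qed.

Let int_lam' : \int[mu]_l lam l = m.
Proof. by rewrite int_ioo ?subr0// ltW. Qed.

Lemma int_chi_lam t : \int[mu]_l chi l t = kk2 t.
Proof.
rewrite (_ : (fun l => chi l t) = ioo 0 (kk2 t)); last first.
  apply/funext => l; rewrite /chi /ioo /kk2 lt_min.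
  by case: (0 < l) => //=; case: (l < m) => /=; rewrite ?mul1r ?mul0r ?andbT ?andbF.
by rewrite int_ioo ?subr0// /kk2 le_min kk_ge0 ltW.
Qed.

Lemma kk2_ge0 t : 0 <= kk2 t. Proof. by rewrite /kk2 le_min kk_ge0 ltW. Qed.
Lemma kk2_le t : kk2 t <= m. Proof. by rewrite /kk2 ge_min lexx orbT. Qed.
Lemma kk2_lek t : kk2 t <= kk t. Proof. by rewrite /kk2 ge_min lexx. Qed.

Lemma measurable_kk2 : measurable_fun [set: measurableTypeR R] kk2.
Proof. exact: measurable_minr. Qed.

Lemma ig_kk2 : ig mu kk2.
Proof.
apply: (ig_le measurable_kk2 kk_ig) => t; rewrite ger0_norm ?kk2_ge0//.
exact: kk2_lek.
Qed.

Lemma measurable_ioo_lagt : measurable_fun setT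
  (fun z : measurableTypeR R * measurableTypeR R => ioo 0 (lagt z.1) z.2).
Proof.
rewrite /ioo.
have mb : measurable_fun setT (fun z : measurableTypeR R * measurableTypeR R => (0 < z.2) && (z.2 < lagt z.1)).
  apply: measurable_and.
    by apply: measurable_fun_ltr.
  apply: measurable_fun_ltr => //.
  exact: (measurableT_comp measurable_lagt).
rewrite (_ : (fun _ => _) = (fun b : bool => b%:R : R) \o
   (fun z : measurableTypeR R * measurableTypeR R => (0 < z.2) && (z.2 < lagt z.1)))//.
exact: measurableT_comp.
Qed.

(** Fubini on the subgraph of [kk2]. This replaces the kernel by a superposition of the intervals
    []0, lagt l[], and a convolution by a superposition of translations. *)
Lemma layer_cake (h : R -> R) : ig mu h ->
  \int[mu]_t (kk2 t * h t) =
  \int[mu]_l (lam l * \int[mu]_t (ioo 0 (lagt l) t * h t)).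
Proof.
move=> ih; have mh := ig_mfun ih.
have iF : ig (pm mu mu) (fun z => chi z.1 z.2 * h z.2).
  apply: (ig_le _ (ig_tensor (ig_ioo 0 m) (ig_abs ih))) => [|z].
    by apply: measurable_funM => //; exact: (measurableT_comp mh).
  rewrite normrM; apply: ler_wpM2r => //; case/andP: (chi_le z.1 z.2) => *.
  rewrite ger0_norm//; apply: le_trans (_ : lam z.1 * ioo 0 T z.2 <= _) => //.
  by rewrite ler_piMr ?ioo_ge0 ?ioo_le1.
transitivity (\int[pm mu mu]_z (chi z.1 z.2 * h z.2)).
  rewrite -(int_F2 iF); apply: eq_Rintegral => t _ /=.
  rewrite -int_chi_lam mulrC -int_Z; last first.
    rewrite (_ : (fun l => chi l t) = ioo 0 (kk2 t)); first exact: ig_ioo.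
    apply/funext => l; rewrite /chi /ioo /kk2 lt_min.
    by case: (0 < l) => //=; case: (l < m) => /=; rewrite ?mul1r ?mul0r ?andbT ?andbF.
  by apply: eq_Rintegral => l _; rewrite mulrC.
rewrite -(int_F1 iF); apply: eq_Rintegral => l _ /=.
have i1 : ig mu (fun t => chi l t * h t).
  apply: (ig_bM (c := 1) (mchil l)) => // t; case/andP: (chi_le l t) => h0 h1.
  by rewrite ger0_norm// (le_trans h1)// mulr_ile1 ?ioo_ge0 ?ioo_le1.
have m2 : measurable_fun [set: measurableTypeR R] (fun t => ioo 0 (lagt l) t * h t).
  by apply: measurable_funM => //; exact: measurable_ioo.
have i2 : ig mu (fun t => ioo 0 (lagt l) t * h t).
  by apply: (ig_bM (c := 1)) => //; [exact: measurable_ioo|exact: ioo_norm1].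
rewrite -int_Z//.
have ae : {ae mu, forall t, chi l t * h t = lam l * (ioo 0 (lagt l) t * h t)}.
  exists [set lagt l]; split => //; first exact: lebesgue_measure_set1.
  move=> t /= ht; apply: contrapT => ne; apply: ht.
  by rewrite chiE ?mulrA//; apply/eqP.
by have [_ ->] := int_ae i1 (ig_mfun (igZ (lam l) i2)) ae.
Qed.

Section lag_fubini.
Context dY (Y : measurableType dY) (mY : {sigma_finite_measure set Y -> \bar R}).
Variable sh : R -> Y -> Y.
Hypothesis msh : measurable_fun setT (fun z : Y * measurableTypeR R => sh z.2 z.1).
Hypothesis hsh : forall a (f : Y -> \bar R), measurable_fun setT f ->
  (forall y, 0 <= f y)%E -> (\int[mY]_y f (sh a y) = \int[mY]_y f y)%E.

(** The maps [sh] are kept abstract: measure preservation is all that is needed, for translations of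
    the line, of the time in X x R, and (in [ig_lag_sec]) of two times at once. *)
Lemma ig_lag (g : Y -> R) : ig mY g ->
  ig (pm mY mu) (fun z => lam z.2 * g (sh (lagt z.2) z.1)).
Proof.
move=> ih; have mg := ig_mfun ih.
have ms : measurable_fun setT (fun z : Y * measurableTypeR R => sh (lagt z.2) z.1).
  apply: (measurableT_comp msh (_ : measurable_fun setT
    (fun z : Y * measurableTypeR R => (z.1, lagt z.2)))).
  by apply: measurable_fun_pair => //; exact: (measurableT_comp measurable_lagt).
have mF : measurable_fun setT (fun z : Y * measurableTypeR R => lam z.2 * g (sh (lagt z.2) z.1)).
  apply: measurable_funM; first exact: (measurableT_comp (measurable_ioo 0 m)).
  exact: (measurableT_comp mg ms).
apply: (integrable21ltyP _ _ _).2; first exact/measurable_EFinP.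
have mgn : measurable_fun setT (fun y => `|g y|%:E).
  by apply/measurable_EFinP; apply: measurableT_comp.
rewrite /= (eq_integral (fun l : measurableTypeR R => ((lam l)%:E * \int[mY]_y `|g y|%:E)%E)); last first.
  move=> l _; under eq_integral do rewrite normrM EFinM.
  rewrite ge0_integralZl//.
  - by rewrite ger0_norm ?ioo_ge0//; congr (_ * _)%E; exact: (hsh (lagt l) mgn).
  - apply: (measurableT_comp mgn).
    by apply: (measurableT_comp msh (pair2_measurable (lagt l))).
rewrite ge0_integralZr//.
- apply: lte_mul_pinfty.
  + by apply: integral_ge0 => l _; rewrite lee_fin ioo_ge0.
  + by rewrite -EFin_int; [|exact: ig_ioo].
  + exact: ig_lty.
- by apply/measurable_EFinP; exact: measurable_ioo.
- by move=> l _; rewrite lee_fin ioo_ge0.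
- exact: integral_ge0.
Qed.

Lemma ig_lag_sec (l : R) (g : Y -> R) : ig mY g -> ig mY (fun y => g (sh l y)).
Proof.
move=> ih; have mg := ig_mfun ih.
have m1 : measurable_fun setT (sh l).
  exact: (measurableT_comp msh (pair2_measurable l)).
apply: ig_fin; first exact: (measurableT_comp mg m1).
rewrite (hsh l (f := fun y => `|g y|%:E))//; first exact: ig_lty.
by apply/measurable_EFinP; apply: measurableT_comp.
Qed.

End lag_fubini.

Lemma ig_lag1 (g : R -> R) : ig mu g ->
  ig (pm mu mu) (fun z => lam z.2 * g (z.1 - lagt z.2)).
Proof.
apply: (@ig_lag _ _ mu (fun a y => y - a)); first exact: measurable_funB.
by move=> a f mf f0; exact: ge0_integral_shift.
Qed.

Lemma FTC_ioo (F f : R -> R) (x a : R) : (forall t : R, is_derive t 1 F (f t)) ->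
  continuous f -> 0 <= a -> \int[mu]_t (ioo 0 a t * f (t + x)) = F (x + a) - F x.
Proof.
move=> dF cf; rewrite le_eqVlt => /predU1P[<-|a0].
  rewrite addr0 subrr (int_ext mu (g := fun _ : measurableTypeR R => 0)).
    by rewrite Rintegral_cst// mul0r.
  move=> t; rewrite ioo0 ?mul0r//.
  by apply/negP => /andP[h1 h2]; have := lt_trans h1 h2; rewrite ltxx.
rewrite -int_set_ioo.
have cfx : continuous (fun t => f (t + x)).
  move=> z; apply: (@continuous_comp _ _ _ (fun y : R => y + x) f); last exact: cf.
  by apply: cvgD; [exact: cvg_id|exact: cvg_cst].
have dFx (t : R) : is_derive t 1 (fun t => F (t + x)) (f (t + x)).
  have h : is_derive (t - - x) 1 F (f (t - - x)) by exact: dF.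
  by have := is_derive_sub h; rewrite opprK.
have iO : mu.-integrable `[0, a] (EFin \o (fun t => f (t + x))).
  apply: continuous_compact_integrable; first exact: segment_compact.
  exact: continuous_subspaceT.
rewrite Rintegral_itv_obnd_cbnd; last first.
  by apply: integrableS iO => // t /=; rewrite !in_itv/= => /andP[h1 h2]; rewrite !ltW.
rewrite Rintegral_itv_bndo_bndc; last first.
  by apply: integrableS iO => // t /=; rewrite !in_itv/= => /andP[-> /ltW].
have cF : continuous (fun t => F (t + x)).
  apply: derivable_cts => t; have := dFx t => ?; exact: ex_derive.
rewrite /Rintegral (@continuous_FTC2 _ _ (fun t => F (t + x)))//.
- by rewrite /= add0r (addrC a).
- exact: continuous_subspaceT.
- split => //.
  + by apply: cvg_at_right_filter; exact: cF.
  + by apply: cvg_at_left_filter; exact: cF.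
- by move=> z _; rewrite derive1E; have := dFx z => ?; exact: derive_val.
Qed.

(** By duality. Fubini moves the kernel onto [eta']; layer by layer the integral of [eta'] over an
    interval of length [lagt l] is the increment [eta (r + lagt l) - eta r]; translation invariance
    then carries the lag back to [g]. The factor m in [m * g t] is the total measure of the
    layers. *)
Lemma weak_lag (g eta eta' : R -> R) (a b : R) : ig mu g ->
  (forall t : R, is_derive t 1 eta (eta' t)) -> continuous eta' ->
  (forall t, ~~ (a <= t <= b) -> eta t = 0) ->
  (forall t, ~~ (a <= t <= b) -> eta' t = 0) ->
  \int[mu]_t ((\int[mu]_r (kk2 (t - r) * g r)) * eta' t) =
  - \int[mu]_t ((m * g t - \int[mu]_l (lam l * g (t - lagt l))) * eta t).
Proof.
move=> ih de ce' se se'; have mg := ig_mfun ih.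
have ce : continuous eta.
  by apply: derivable_cts => t; have := de t => ?; exact: ex_derive.
have [Ce hCe] := bounded_supp ce se; have [Cd hCd] := bounded_supp ce' se'.
have me := cts_mfun ce; have me' := cts_mfun ce'.
have ie : ig mu eta := ig_bounded_supp me hCe se.
have ie' : ig mu eta' := ig_bounded_supp me' hCd se'.
have mk2 : measurable_fun setT (fun z : measurableTypeR R * measurableTypeR R => kk2 (z.1 - z.2)).
  by apply: (measurableT_comp measurable_kk2); exact: measurable_funB.
have iF : ig (pm mu mu) (fun z => kk2 (z.1 - z.2) * (eta' z.1 * g z.2)).
  apply: (ig_bM (c := m)) => //; last exact: ig_tensor.
  by move=> z; rewrite ger0_norm ?kk2_ge0 ?kk2_le.
transitivity (\int[mu]_r (g r * (\int[mu]_l (lam l * eta (r + lagt l)) - m * eta r))).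
  transitivity (\int[pm mu mu]_z (kk2 (z.1 - z.2) * (eta' z.1 * g z.2))).
    rewrite -(int_F1 iF); apply: eq_Rintegral => t _ /=.
    rewrite mulrC -int_Z.
      by apply: eq_Rintegral => r _; ring.
    apply: (ig_bM (c := m)) => //; last by move=> z; rewrite ger0_norm ?kk2_ge0 ?kk2_le.
    by apply: (measurableT_comp measurable_kk2); exact: measurable_funB.
  rewrite -(int_F2 iF); apply: eq_Rintegral => r _ /=.
  have is' : ig mu (fun t => eta' (t + r)).
    by have := ig_shift (- r) ie'; under [X in ig _ X]eq_fun do rewrite opprK.
  have ik : ig mu (fun t => kk2 t * eta' (t + r)).
    apply: (ig_bM (c := m)) => //; first exact: measurable_kk2.
    by move=> z; rewrite ger0_norm ?kk2_ge0 ?kk2_le.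
  have e1 : \int[mu]_t (kk2 (t - r) * eta' t) = \int[mu]_t (kk2 t * eta' (t + r)).
    rewrite -(int_shift r ik); apply: eq_Rintegral => t _.
    by rewrite subrK.
  transitivity (g r * \int[mu]_t (kk2 (t - r) * eta' t)).
    rewrite -int_Z; first by apply: eq_Rintegral => t _; ring.
    have := ig_shift r ik; by under [X in ig _ X]eq_fun do rewrite subrK.
  congr (_ * _); rewrite e1 layer_cake//.
  have il : ig mu (fun l => lam l * eta (r + lagt l)).
    apply: (ig_Mb (c := Ce) _ _ (ig_ioo 0 m)) => //.
    apply: (measurableT_comp me); apply: measurable_funD => //.
    exact: measurable_lagt.
  have -> : m * eta r = eta r * \int[mu]_l lam l by rewrite int_lam' mulrC.
  rewrite -int_Z; last exact: ig_ioo.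
  rewrite -int_B//; last exact/igZ/ig_ioo.
  apply: eq_Rintegral => l _; rewrite (FTC_ioo _ de ce') ?lagt_ge0//; ring.
have iG := ig_lag1 ih.
have iGe : ig (pm mu mu) (fun z => eta z.1 * (lam z.2 * g (z.1 - lagt z.2))).
  by apply: (ig_bM (c := Ce)) => //; exact: (measurableT_comp me).
have iH : ig (pm mu mu) (fun z => eta (z.1 + lagt z.2) * (g z.1 * lam z.2)).
  apply: (ig_bM (c := Ce)) => //; last exact: ig_tensor ih (ig_ioo 0 m).
  apply: (measurableT_comp me); apply: measurable_funD => //.
  exact: (measurableT_comp measurable_lagt).
(* The adjoint of the lag: at a fixed layer [l], the variable t is replaced by [r + lagt l]. *)
have key : \int[mu]_t (eta t * \int[mu]_l (lam l * g (t - lagt l))) =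
    \int[mu]_r (g r * \int[mu]_l (lam l * eta (r + lagt l))).
  transitivity (\int[pm mu mu]_z (eta z.1 * (lam z.2 * g (z.1 - lagt z.2)))).
    rewrite -(int_F1 iGe).
    have h := ae_ig1 iG.
    have h1 := ig_F1 iG; have h2 := ig_F1 iGe.
    have ae : {ae mu, forall t, \int[mu]_l (eta t * (lam l * g (t - lagt l))) =
        eta t * \int[mu]_l (lam l * g (t - lagt l))}.
      by apply: filterS h => t ht; rewrite -int_Z.
    by have [_ <-] := int_ae h2 (ig_mfun (ig_bM me hCe h1)) ae.
  transitivity (\int[pm mu mu]_z (eta (z.1 + lagt z.2) * (g z.1 * lam z.2))).
    rewrite -(int_F2 iGe) -(int_F2 iH); apply: eq_Rintegral => l _ /=.
    have ig1 : ig mu (fun r => eta (r + lagt l) * (g r * lam l)).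
      apply: (ig_bM (c := Ce)) => //; last by apply: (ig_Mb (c := 1)) => // ?; exact: ioo_norm1.
      by apply: (measurableT_comp me); exact: measurable_funD.
    rewrite -[RHS](int_shift (lagt l) ig1); apply: eq_Rintegral => t _.
    by rewrite subrK; ring.
  rewrite -(int_F1 iH); apply: eq_Rintegral => r _ /=.
  rewrite -int_Z; first by apply: eq_Rintegral => l _; ring.
  apply: (ig_Mb (c := Ce) _ _ (ig_ioo 0 m)) => //.
  apply: (measurableT_comp me); apply: measurable_funD => //.
  exact: measurable_lagt.
have i1 : ig mu (fun r => g r * eta r) by exact: ig_Mb me hCe ih.
have i2 : ig mu (fun t => eta t * \int[mu]_l (lam l * g (t - lagt l))).
  exact: ig_bM me hCe (ig_F1 iG).
have i3 : ig mu (fun r => g r * \int[mu]_l (lam l * eta (r + lagt l))).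
  have := ig_F1 iH; rewrite (_ : (fun x => _) = (fun r => g r * \int[mu]_l (lam l * eta (r + lagt l))))//.
  apply/funext => r /=; rewrite -int_Z; first by apply: eq_Rintegral => l _; ring.
  apply: (ig_Mb (c := Ce) _ _ (ig_ioo 0 m)) => //.
  apply: (measurableT_comp me); apply: measurable_funD => //.
  exact: measurable_lagt.
rewrite (int_ext mu (g := fun r : measurableTypeR R => g r * (\int[mu]_l (lam l * eta (r + lagt l))) - m * (g r * eta r))); last first.
  by move=> r; ring.
rewrite int_B//; last exact: igZ.
rewrite (int_ext mu
  (f := fun t : measurableTypeR R => (m * g t - \int[mu]_l (lam l * g (t - lagt l))) * eta t)
  (g := fun t : measurableTypeR R => m * (g t * eta t) - eta t * \int[mu]_l (lam l * g (t - lagt l)))); last first.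
  by move=> t; ring.
rewrite int_B//; last exact: igZ.
by rewrite key opprB.
Qed.

End lag.

(** * Iterated integrals of one-sided integrable functions *)

Section iterated.
Context (R : realType).

Section nonneg.
Context d (T : measurableType d) (m : {measure set T -> \bar R}).
Local Open Scope ereal_scope.

Lemma ge0_le_int (f g : T -> \bar R) : measurable_fun setT f ->
  measurable_fun setT g -> (forall x, 0 <= f x) -> (forall x, f x <= g x) ->
  \int[m]_x f x <= \int[m]_x g x.
Proof.
by move=> mf mg f0 fg; apply: ge0_le_integral.
Qed.

Lemma ge0_int_D (f g : T -> \bar R) : measurable_fun setT f ->
  measurable_fun setT g -> (forall x, 0 <= f x) -> (forall x, 0 <= g x) ->
  \int[m]_x (f x + g x) = \int[m]_x f x + \int[m]_x g x.
Proof. by move=> mf mg f0 g0; apply: ge0_integralD. Qed.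

(** The integrals of [a] and [b] may be infinite. The negative part of [c] goes to the left, so that
    only nonnegative functions are integrated, and it is subtracted again as a finite number. *)
Lemma ae_le_int_add (a b : T -> \bar R) (c : T -> R) :
  measurable_fun setT a -> measurable_fun setT b ->
  (forall x, 0 <= a x) -> (forall x, 0 <= b x) -> ig m c ->
  {ae m, forall x, a x <= (c x)%:E + b x} ->
  \int[m]_x a x <= (\int[m]_x c x)%:E + \int[m]_x b x.
Proof.
move=> ma mb a0 b0 ic h.
pose cp x := Num.max (c x) 0%R; pose cn x := Num.max (- c x)%R 0%R.
have mc := ig_mfun ic.
have mcp : measurable_fun setT cp by exact: measurable_maxr.
have mcn : measurable_fun setT cn.
  by apply: measurable_maxr => //; exact: measurableT_comp.
have cE x : (c x = cp x - cn x)%R.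
  by rewrite /cp /cn /Num.max; case: ltP => h1; case: ltP => h2; lra.
have cp0 x : (0 <= cp x)%R by rewrite le_max lexx orbT.
have cn0 x : (0 <= cn x)%R by rewrite le_max lexx orbT.
have icp : ig m cp.
  apply: (ig_le mcp (ig_abs ic)) => x; rewrite ger0_norm//.
  by rewrite /cp ge_max ler_norm normr_ge0.
have icn : ig m cn.
  apply: (ig_le mcn (ig_abs ic)) => x; rewrite ger0_norm//.
  by rewrite /cn ge_max normr_ge0 andbT -normrN ler_norm.
have mE (f : T -> R) : measurable_fun setT f -> measurable_fun setT (EFin \o f).
  by move=> ?; exact/measurable_EFinP.
have le1 : \int[m]_x (a x + (cn x)%:E) <= \int[m]_x ((cp x)%:E + b x).
  apply: ae_ge0_le_integral => //.
  - by move=> x _; rewrite adde_ge0 ?lee_fin.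
  - by apply: emeasurable_funD => //; exact: mE.
  - by move=> x _; rewrite adde_ge0 ?lee_fin.
  - by apply: emeasurable_funD => //; exact: mE.
  apply: filterS h => x /= h _.
  apply: (le_trans (leeD2r _ h)); rewrite cE.
  case: (b x) (b0 x) => [r| |]// _.
  by rewrite -!EFinD lee_fin; lra.
rewrite !ge0_int_D// in le1; [|exact: mE|exact: mE].
rewrite (int_ext m cE) int_B// EFinB -EFin_int// -EFin_int// in le1 *.
move: le1; move: (\int[m]_x cn x)%R => n; move: (\int[m]_x cp x)%R => p.
move: (\int[m]_x a x) (\int[m]_x b x) => A B le1.
rewrite (_ : (p%:E - n%:E + B) = p%:E + B - n%:E); last by rewrite addeAC.
by rewrite leeBrDr.
Qed.

(** The integral of [a] is possibly infinite. Almost everywhere [a + f^-] equals [f^+ + b], and both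
    [f^-], which is at most [b], and [b] have finite integrals that can be cancelled. *)
Lemma le_int_pos (f : T -> \bar R) (a b : T -> \bar R) :
  measurable_fun setT a -> measurable_fun setT b ->
  (forall x, 0 <= a x) -> (forall x, 0 <= b x) ->
  \int[m]_x b x < +oo -> (forall x, f x = a x - b x) ->
  \int[m]_x a x <= \int[m]_x f x + \int[m]_x b x.
Proof.
move=> ma mb a0 b0 bf fE.
have mf : measurable_fun setT f.
  rewrite (_ : f = (fun x => a x - b x)); first exact: emeasurable_funB.
  exact/funext.
have fn_le x : f^\- x <= b x.
  rewrite funenegE fE ge_max b0 andbT.
  have := a0 x; have := b0 x; case: (a x) => [r| |]//; case: (b x) => [s| |]//=.
  - by rewrite !lee_fin => *; lra.
  by move=> *; exact: leNye.
have mfn : measurable_fun setT f^\- by exact: measurable_funeneg.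
have mfp : measurable_fun setT f^\+ by exact: measurable_funepos.
have fn_fin : \int[m]_x f^\- x < +oo.
  by apply: le_lt_trans bf; apply: ge0_le_int.
have ib : m.-integrable setT b.
  apply/integrableP; split => //.
  by under eq_integral do rewrite gee0_abs//.
have E : \int[m]_x (a x + f^\- x) = \int[m]_x (f^\+ x + b x).
  apply: ae_eq_integral => //.
  - exact: emeasurable_funD.
  - exact: emeasurable_funD.
  have := integrable_ae measurableT ib; apply: filterS => x /= /(_ I) hb _.
  rewrite funeposE funenegE fE.
  have := a0 x; have := b0 x; case: (a x) => [r| |]//; case: (b x) hb => [s| |]//= _ b0' a0'.
    rewrite -EFinD -!EFin_max -!EFinD; congr EFin.
    by rewrite /Num.max; case: ltP => h1; case: ltP => h2; lra.
  by rewrite (max_idPr (leNye 0%R)) (max_idPl (leey _)).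
rewrite !ge0_int_D// in E.
rewrite [X in X + _]integralE -(@leeD2rE _ (\int[m]_x f^\- x)); last first.
  by rewrite ge0_fin_numE// integral_ge0.
rewrite E.
have n_fin : \int[m]_x f^\- x \is a fin_num.
  by rewrite ge0_fin_numE// integral_ge0.
have b_fin : \int[m]_x b x \is a fin_num.
  by rewrite ge0_fin_numE// integral_ge0.
rewrite -(fineK n_fin) -(fineK b_fin).
move: (fine _) (fine _) (\int[m]_x f^\+ x) => n B [p| |]//=.
by rewrite -!EFinD lee_fin; lra.
Qed.

End nonneg.

Section split.
Context d1 d2 (T1 : measurableType d1) (T2 : measurableType d2).
Variable m1 : {sigma_finite_measure set T1 -> \bar R}.
Variable m2 : {sigma_finite_measure set T2 -> \bar R}.
Local Open Scope ereal_scope.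

Definition rpos (x : R) : R := Num.max x 0%R.
Definition rneg (x : R) : R := Num.max (- x)%R 0%R.

Lemma rpos_ge0 x : (0 <= rpos x)%R. Proof. by rewrite le_max lexx orbT. Qed.
Lemma rneg_ge0 x : (0 <= rneg x)%R. Proof. by rewrite le_max lexx orbT. Qed.
Lemma rposnegE x : (x = rpos x - rneg x)%R.
Proof. by rewrite /rpos /rneg /Num.max; case: ltP => h1; case: ltP => h2; lra. Qed.

Lemma measurable_rpos d (T : measurableType d) (f : T -> R) :
  measurable_fun setT f -> measurable_fun setT (fun x => rpos (f x)).
Proof. by move=> mf; exact: measurable_maxr. Qed.

Lemma measurable_rneg d (T : measurableType d) (f : T -> R) :
  measurable_fun setT f -> measurable_fun setT (fun x => rneg (f x)).
Proof. by move=> mf; apply: measurable_maxr => //; exact: measurableT_comp. Qed.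

(** The entropy inequality bounds an iterated integral whose integrand is not known to be
    integrable. Once its negative part is, the bound can be written between nonnegative integrals,
    whose order may be changed by Tonelli. The factor 2 undoes the 1/2 in front of the nonlocal
    term. *)
Lemma iterated_split (F : T1 * T2 -> R) (c : R) : measurable_fun setT F ->
  \int[m1]_x \int[m2]_y (rneg (F (x, y)))%:E < +oo ->
  (2^-1)%:E * \int[m1]_x \int[m2]_y (F (x, y))%:E <= c%:E ->
  \int[m1]_x \int[m2]_y (rpos (F (x, y)))%:E <=
  (2 * c)%:E + \int[m1]_x \int[m2]_y (rneg (F (x, y)))%:E.
Proof.
move=> mF fin le.
have mp : measurable_fun setT (fun z => (rpos (F z))%:E).
  by apply/measurable_EFinP; exact: measurable_rpos.
have mn : measurable_fun setT (fun z => (rneg (F z))%:E).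
  by apply/measurable_EFinP; exact: measurable_rneg.
have m1p := measurable_fun_fubini_tonelli_F (m2 := m2) _ mp (fun z => rpos_ge0 (F z)).
have m1n := measurable_fun_fubini_tonelli_F (m2 := m2) _ mn (fun z => rneg_ge0 (F z)).
have := @le_int_pos _ _ m1 (fun x => \int[m2]_y (F (x, y))%:E) _ _ m1p m1n.
move=> H; apply: (le_trans (H _ _ _ _)) => //.
- by move=> x; apply: integral_ge0 => y _; rewrite lee_fin rpos_ge0.
- by move=> x; apply: integral_ge0 => y _; rewrite lee_fin rneg_ge0.
- move=> x; rewrite integralE; congr (_ - _); apply: eq_integral => y _.
    by rewrite funeposE /rpos EFin_max.
  by rewrite funenegE /rneg EFin_max.
apply: leeD2r.
rewrite EFinM -lee_pdivrMl// in le *.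
Qed.

End split.

Section three.
Context d1 d2 d3 (T1 : measurableType d1) (T2 : measurableType d2) (T3 : measurableType d3).
Variable m1 : {sigma_finite_measure set T1 -> \bar R}.
Variable m2 : {sigma_finite_measure set T2 -> \bar R}.
Variable m3 : {sigma_finite_measure set T3 -> \bar R}.

Lemma tonelli3l (F : T1 * T2 * T3 -> \bar R) : measurable_fun setT F ->
  (forall z, 0 <= F z)%E ->
  (\int[m1]_x \int[m2]_y \int[m3]_z F ((x, y), z) =
   \int[pm (pm m1 m2) m3]_w F w)%E.
Proof.
move=> mF F0; rewrite [RHS](fubini_tonelli1 F mF F0).
have mG := measurable_fun_fubini_tonelli_F (m2 := m3) _ mF F0.
by rewrite (fubini_tonelli1 _ mG)// => z; exact: integral_ge0.
Qed.

Lemma tonelli3r (F : T1 * T2 * T3 -> \bar R) : measurable_fun setT F ->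
  (forall z, 0 <= F z)%E ->
  (\int[m2]_y \int[m1]_x \int[m3]_z F ((x, y), z) =
   \int[pm (pm m1 m2) m3]_w F w)%E.
Proof.
move=> mF F0; rewrite [RHS](fubini_tonelli1 F mF F0).
have mG := measurable_fun_fubini_tonelli_F (m2 := m3) _ mF F0.
by rewrite (fubini_tonelli2 _ mG)// => z; exact: integral_ge0.
Qed.

Lemma fubini3r (F : T1 * T2 * T3 -> R) : ig (pm (pm m1 m2) m3) F ->
  ig m2 (fun y => \int[m1]_x \int[m3]_z F ((x, y), z)) /\
  \int[m2]_y \int[m1]_x \int[m3]_z F ((x, y), z) =
   \int[pm (pm m1 m2) m3]_w F w.
Proof.
move=> iF; have iG := ig_F1 iF; split; first exact: (ig_F2 iG).
by rewrite (int_F2 iG) int_F1.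
Qed.

Lemma fubini3l (F : T1 * T2 * T3 -> R) : ig (pm (pm m1 m2) m3) F ->
  ig m1 (fun x => \int[m2]_y \int[m3]_z F ((x, y), z)) /\
  \int[m1]_x \int[m2]_y \int[m3]_z F ((x, y), z) =
   \int[pm (pm m1 m2) m3]_w F w.
Proof.
move=> iF; have iG := ig_F1 iF; split; first exact: (ig_F1 iG).
by rewrite (int_F1 iG) int_F1.
Qed.

Lemma ig_tensor3l (h : T3 -> T1 -> R) (b : T2 -> R) :
  ig (pm m3 m1) (fun z => h z.1 z.2) -> ig m2 b ->
  ig (pm (pm m1 m2) m3) (fun w => h w.2 w.1.1 * b w.1.2).
Proof.
move=> ih ib.
have mh := ig_mfun ih; have mb := ig_mfun ib.
have mF : measurable_fun setT (fun w : T1 * T2 * T3 => h w.2 w.1.1 * b w.1.2).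
  apply: measurable_funM.
    apply: (measurable_comp2 mh) => //.
    exact: (measurableT_comp measurable_fst measurable_fst).
  apply: (measurableT_comp mb).
  exact: (measurableT_comp measurable_snd measurable_fst).
apply: ig_fin => //.
rewrite -(@tonelli3r (fun w => `|h w.2 w.1.1 * b w.1.2|%:E))//; last first.
  by apply/measurable_EFinP; apply: measurableT_comp.
have mhn : measurable_fun setT (fun z : T1 * T3 => `|h z.2 z.1|%:E).
  apply/measurable_EFinP; apply: measurableT_comp => //.
  exact: (measurable_comp2 mh).
have mhF := measurable_fun_fubini_tonelli_F (m2 := m3) _ mhn (fun z => normr_ge0 _).
rewrite /= (eq_integral (fun y => (`|b y|%:E * \int[m1]_x \int[m3]_z `|h z x|%:E)%E)); last first.
  move=> y _; rewrite -ge0_integralZl//; last first.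
    by move=> x _; exact: integral_ge0.
  apply: eq_integral => x _; rewrite -ge0_integralZl//; last first.
    exact: (measurableT_comp mhn (pair1_measurable x)).
  by apply: eq_integral => z _; rewrite normrM EFinM muleC.
rewrite ge0_integralZr//; last 2 first.
- by apply/measurable_EFinP; apply: measurableT_comp.
- by apply: integral_ge0 => x _; exact: integral_ge0.
apply: lte_mul_pinfty.
- exact: integral_ge0.
- by rewrite ge0_fin_numE ?integral_ge0// ig_lty.
have mhs : measurable_fun setT (fun z : T3 * T1 => `|h z.1 z.2|%:E).
  by apply/measurable_EFinP; apply: measurableT_comp.
have := fubini_tonelli2 (m1 := m3) (m2 := m1) _ mhs (fun z => normr_ge0 _).
by rewrite /fubini_G /= => <-; exact: ig_lty ih.
Qed.

End three.

Lemma ig_tensor3r d1 d2 d3 (T1 : measurableType d1) (T2 : measurableType d2)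
    (T3 : measurableType d3) (m1 : {sigma_finite_measure set T1 -> \bar R})
    (m2 : {sigma_finite_measure set T2 -> \bar R})
    (m3 : {sigma_finite_measure set T3 -> \bar R}) (h : T3 -> T2 -> R) (b : T1 -> R) :
  ig (pm m3 m2) (fun z => h z.1 z.2) -> ig m1 b ->
  ig (pm (pm m1 m2) m3) (fun w => h w.2 w.1.2 * b w.1.1).
Proof.
move=> ih ib; have i1 := ig_tensor3l ih ib.
have mF : measurable_fun setT (fun w : T1 * T2 * T3 => h w.2 w.1.2 * b w.1.1).
  apply: measurable_funM.
    apply: (measurable_comp2 (ig_mfun ih)) => //.
    exact: (measurableT_comp measurable_snd measurable_fst).
  apply: (measurableT_comp (ig_mfun ib)).
  exact: (measurableT_comp measurable_fst measurable_fst).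
apply: ig_fin => //.
rewrite -(@tonelli3r _ _ _ _ _ _ m1 m2 m3 (fun w => `|h w.2 w.1.2 * b w.1.1|%:E))//; last first.
  by apply/measurable_EFinP; apply: measurableT_comp.
have := ig_lty i1.
rewrite -(@tonelli3l _ _ _ _ _ _ m2 m1 m3 (fun w => `|h w.2 w.1.1 * b w.1.2|%:E))//.
by apply/measurable_EFinP; apply: measurableT_comp => //; exact: ig_mfun i1.
Qed.

End iterated.

(** * Addition of two one-sided bounds and removal of the truncation *)

Section combine.
Context (R : realType) d (W : measurableType d) (n : {measure set W -> \bar R}).
Implicit Types F G : W -> R.

(** The pointwise lower bound of [F1 + F2] is integrated in the form: negative parts are at most
    positive parts plus four times the band terms. All six integrals are finite by hypothesis, so
    the negative parts cancel against those in the two upper bounds. *)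
Lemma int_combine F1 F2 G1 G2 (c1 c2 e1 e2 : R) :
  measurable_fun setT F1 -> measurable_fun setT F2 ->
  measurable_fun setT G1 -> measurable_fun setT G2 ->
  (forall y, 0 <= G1 y) -> (forall y, 0 <= G2 y) ->
  (forall y, - (4 * (G1 y + G2 y)) <= F1 y + F2 y) ->
  (\int[n]_y (rneg (F1 y))%:E < +oo)%E -> (\int[n]_y (rneg (F2 y))%:E < +oo)%E ->
  (\int[n]_y (rpos (F1 y))%:E <= c1%:E + \int[n]_y (rneg (F1 y))%:E)%E ->
  (\int[n]_y (rpos (F2 y))%:E <= c2%:E + \int[n]_y (rneg (F2 y))%:E)%E ->
  (\int[n]_y (G1 y)%:E <= e1%:E)%E -> (\int[n]_y (G2 y)%:E <= e2%:E)%E ->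
  0 <= c1 + c2 + 4 * (e1 + e2).
Proof.
move=> mF1 mF2 mG1 mG2 G10 G20 FG n1 n2 p1 p2 g1 g2.
have mp F : measurable_fun setT F -> measurable_fun setT (fun y => (rpos (F y))%:E).
  by move=> mF; apply/measurable_EFinP; exact: measurable_rpos.
have mn F : measurable_fun setT F -> measurable_fun setT (fun y => (rneg (F y))%:E).
  by move=> mF; apply/measurable_EFinP; exact: measurable_rneg.
have mE F : measurable_fun setT F -> measurable_fun setT (fun y => (F y)%:E).
  by move=> mF; exact/measurable_EFinP.
have p0 F y : (0 <= (rpos (F y))%:E)%E by rewrite lee_fin rpos_ge0.
have n0 F y : (0 <= (rneg (F y))%:E)%E by rewrite lee_fin rneg_ge0.
have e10 y : (0 <= (G1 y)%:E)%E by rewrite lee_fin.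
have e20 y : (0 <= (G2 y)%:E)%E by rewrite lee_fin.
have mn1 := mn _ mF1; have mn2 := mn _ mF2.
have mp1 := mp _ mF1; have mp2 := mp _ mF2.
have me1 := mE _ mG1; have me2 := mE _ mG2.
have mpp := emeasurable_funD mp1 mp2; have mee := emeasurable_funD me1 me2.
have [c4 c4E] : exists c : R, c = 4 by exists 4.
have mee4 : measurable_fun setT (fun y => c4%:E * ((G1 y)%:E + (G2 y)%:E))%E.
  by apply: emeasurable_funM => //; exact: measurable_cst.
have : (\int[n]_y ((rneg (F1 y))%:E + (rneg (F2 y))%:E) <=
    \int[n]_y (((rpos (F1 y))%:E + (rpos (F2 y))%:E) +
      c4%:E * ((G1 y)%:E + (G2 y)%:E)))%E.
  apply: ge0_le_int.
  - exact: emeasurable_funD.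
  - exact: emeasurable_funD.
  - by move=> y; rewrite adde_ge0.
  move=> y; rewrite -(EFinD (G1 y)) -(EFinM c4) -!EFinD lee_fin c4E.
  by have := FG y; have := rposnegE (F1 y); have := rposnegE (F2 y); lra.
rewrite ge0_int_D// ge0_int_D//; last 2 first.
- by move=> y; rewrite adde_ge0.
- by move=> y; rewrite mule_ge0 ?adde_ge0// lee_fin c4E.
rewrite ge0_int_D// ge0_integralZl//; last 2 first.
- by move=> y _; rewrite adde_ge0.
- by rewrite lee_fin c4E.
rewrite ge0_int_D//.
have fin (x : \bar R) : (0 <= x -> x < +oo -> exists r : R, x = r%:E)%E.
  by case: x => [r| |]// _ _; exists r.
have int0 (F : W -> \bar R) : (forall y, 0 <= F y)%E -> (0 <= \int[n]_y F y)%E.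
  by move=> F0; exact: integral_ge0.
have [N1 E1] := fin _ (int0 _ (n0 F1)) n1.
have [N2 E2] := fin _ (int0 _ (n0 F2)) n2.
rewrite E1 in p1 *; rewrite E2 in p2 *.
have [P1 E3] := fin _ (int0 _ (p0 F1)) (le_lt_trans p1 (ltry _)).
have [P2 E4] := fin _ (int0 _ (p0 F2)) (le_lt_trans p2 (ltry _)).
have [Q1 E5] := fin _ (int0 _ e10) (le_lt_trans g1 (ltry _)).
have [Q2 E6] := fin _ (int0 _ e20) (le_lt_trans g2 (ltry _)).
rewrite E3 in p1 *; rewrite E4 in p2 *; rewrite E5 in g1 *; rewrite E6 in g2 *.
move: p1 p2 g1 g2; rewrite -!EFinD -?EFinM -?EFinD !lee_fin => p1 p2 g1 g2 h.
by rewrite c4E in h; lra.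
Qed.

(** At each point the truncation is the identity as soon as j exceeds [|b y|], and [Cs * |q|]
    dominates. *)
Lemma trunc_limit (q a b : W -> R) (S : R -> R) (Cs : R) (K : nat -> R) : ig n q ->
  measurable_fun setT a -> measurable_fun setT b -> continuous S ->
  (forall x, `|S x| <= Cs) -> (forall j, j%:R <= K j) ->
  (forall j : nat, ig n (fun y => q y * S (a y - trunc (K j) (b y)))) /\
  \int[n]_y (q y * S (a y - trunc (K j) (b y))) @[j --> \oo] -->
  \int[n]_y (q y * S (a y - b y)).
Proof.
move=> iq ma mb cS bS hK.
have mS := cts_mfun cS; have mq := ig_mfun iq.
have mf (b' : W -> R) : measurable_fun setT b' -> measurable_fun setT (fun y => q y * S (a y - b' y)).
  move=> mb'; apply: measurable_funM => //; apply: (measurableT_comp mS).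
  exact: measurable_funB.
have mt (j : nat) : measurable_fun setT (fun y => trunc (K j) (b y)).
  by apply: measurable_maxr => //; exact: measurable_minr.
have le (b' : W -> R) y : `|q y * S (a y - b' y)| <= Cs * `|q y|.
  by rewrite normrM mulrC ler_wpM2r.
have ib := igZ Cs (ig_abs iq).
split.
  move=> j; apply: (ig_le (mf _ (mt j)) ib) => y.
  exact: (le (fun y => trunc (K j) (b y))).
suff cv y : q y * S (a y - trunc (K j) (b y)) @[j --> \oo] --> q y * S (a y - b y).
  by have [] := ig_DCT (fun j => mf _ (mt j)) (mf _ mb) cv ib
    (fun j => le (fun y => trunc (K j) (b y))).
apply: cvg_near_cst; near=> j; congr (_ * S (_ - _)).
apply: truncE_in; rewrite -ler_norml.
by apply: le_trans (hK j); near: j; exact: nbhs_infty_ger.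
Unshelve. all: by end_near. Qed.

End combine.

(** * Doubling of the time variable *)

Section esol.
Context (R : realType) d (X : measurableType d).
Variable m : {sigma_finite_measure set X -> \bar R}.
Local Notation mu := (@lebesgue_measure R).
Local Notation RT := (measurableTypeR R).
Variables (Om : set X) (kap : X * X -> R) (T : R) (kk : R -> R).
Hypotheses (mOm : measurable Om) (Omfin : (m Om < +oo)%E).
Hypotheses (mkap : measurable_fun setT kap) (kap0 : forall z, 0 <= kap z).
Hypothesis T0 : 0 < T.
Hypotheses (kk_ig : ig mu kk) (kk_ge0 : forall t, 0 <= kk t)
  (kk_supp : forall t, ~~ (0 < t < T) -> kk t = 0)
  (kk_mono : forall r t, 0 < r -> r <= t -> kk t <= kk r).

Definition dg (u : X -> R -> R) (u0 : X -> R) x t := ioo 0 T t * (u x t - u0 x).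

(** The density that [weak_lag] yields for the derivative of the convolution of [kk2 kk mm] with
    [g x], restricted to []0, T[]. *)
Definition wlag (mm : R) (g : X -> R -> R) x t :=
  ioo 0 T t * (mm * g x t - \int[mu]_l (ioo 0 mm l * g x (t - lagt kk mm l))).

Definition cvX (k1 : R -> R) (G : X -> R -> R) x t :=
  \int[mu]_r (k1 (t - r) * G x r).

(* The two splittings [k = k1 + k2] that are used: [k2 = 0], and
   [k2 = min k mm], for which [w] is the derivative of [k2 * (u - u0)]. *)
Definition dec (k1 : R -> R) (w g : X -> R -> R) :=
  (k1 = kk /\ w = (fun _ _ => 0)) \/
  (exists2 mm, 0 < mm & k1 = (fun t => kk t - kk2 kk mm t) /\ w = wlag mm g).

(** The entropy inequality over an abstract space with an abstract density [kap]. All functions are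
    extended by 0, so every integral runs over the whole space. The local terms are finite and stand
    on the right; the nonlocal integral, which might be infinite, stands alone on the left. The
    geometry of R^N only returns in [entropy_esol]. *)
Record esol (f : X -> R -> R) (u0 : X -> R) (u : X -> R -> R) : Prop := {
  es_u : ig (pm m mu) (fun z => u z.1 z.2);
  es_f : ig (pm m mu) (fun z => f z.1 z.2);
  es_u0 : ig m u0;
  es_offt : forall x t, ~~ (0 < t < T) -> u x t = 0;
  es_offx : forall x t, ~ Om x -> u x t = 0;
  es_offu0 : forall x, ~ Om x -> u0 x = 0;
  es_en : forall K, 0 < K -> (\int[mu]_t \int[pm m m]_z
    ((trunc K (u z.1 t) - trunc K (u z.2 t)) ^+ 2 * kap z)%:E < +oo)%E;
  es_ineq : forall (phi : X -> R) (M : R) (zeta S s J k1 : R -> R) (w : X -> R -> R),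
    measurable_fun setT phi -> (forall x, `|phi x| <= M) ->
    (forall x, ~ Om x -> phi x = 0) ->
    (\int[pm m m]_z ((phi z.1 - phi z.2) ^+ 2 * kap z)%:E < +oo)%E ->
    test0 T zeta -> (forall t, 0 <= t < T -> 0 <= zeta t) -> Pfun S s J ->
    dec k1 w (dg u u0) ->
    ((2^-1)%:E * \int[mu]_t \int[pm m m]_z
      (ioo 0 T t * zeta t * ((u z.1 t - u z.2 t) *
        (S (u z.1 t - phi z.1) - S (u z.2 t - phi z.2))) * kap z)%:E
     <= (\int[mu]_t \int[m]_x
           (ioo 0 T t * zeta t * (f x t - w x t) * S (u x t - phi x))
         + \int[mu]_t \int[m]_x (ioo 0 T t * derive1 zeta t *
             cvX k1 (fun x t => ioo 0 T t *
               (J (u x t - phi x) - J (u0 x - phi x))) x t))%:E)%E }.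

Section conv_bound.
Variables (k1 : R -> R) (G : X -> R -> R).
Hypotheses (ik1 : ig mu k1) (iG : ig (pm m mu) (fun z => G z.1 z.2)).

Let mF : measurable_fun setT (fun z : X * RT * RT => k1 (z.1.2 - z.2) * G z.1.1 z.2).
Proof.
apply: measurable_funM.
  apply: (measurableT_comp (ig_mfun ik1)); apply: measurable_funB => //.
  exact: (measurableT_comp measurable_snd measurable_fst).
apply: (measurable_comp2 (ig_mfun iG)) => //.
exact: (measurableT_comp measurable_fst measurable_fst).
Qed.

Let intF : (\int[pm (pm m mu) mu]_z `|k1 (z.1.2 - z.2) * G z.1.1 z.2|%:E =
  (\int[mu]_t `|k1 t|)%:E * (\int[pm m mu]_z `|G z.1 z.2|)%:E)%E.
Proof.
have mFn : measurable_fun setT (fun z : X * RT * RT => `|k1 (z.1.2 - z.2) * G z.1.1 z.2|%:E).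
  by apply/measurable_EFinP; apply: measurableT_comp.
have mk1 := ig_mfun ik1; have mG := ig_mfun iG.
rewrite -(@tonelli3l _ _ _ _ _ _ _ m mu mu _ mFn); last by move=> z; rewrite lee_fin.
rewrite /= !EFin_int; [|exact: ig_abs..].
have mGn : measurable_fun setT (fun z : X * RT => `|G z.1 z.2|%:E).
  by apply/measurable_EFinP; apply: measurableT_comp.
have mk1n : measurable_fun setT (fun z : RT => `|k1 z|%:E).
  by apply/measurable_EFinP; apply: measurableT_comp.
rewrite [in RHS](fubini_tonelli1 _ mGn); last by move=> z; rewrite lee_fin.
rewrite -ge0_integralZl//; last 3 first.
- by apply: (measurable_fun_fubini_tonelli_F _ mGn) => z; rewrite lee_fin.
- by move=> x _; exact: integral_ge0.
- exact: integral_ge0.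
apply: eq_integral => x _.
have mGx : measurable_fun setT (fun r : RT => `|G x r|%:E).
  exact: (measurableT_comp mGn (pair1_measurable x)).
have m2 : measurable_fun setT (fun z : RT * RT => `|k1 (z.1 - z.2) * G x z.2|%:E).
  apply/measurable_EFinP; apply: measurableT_comp => //; apply: measurable_funM.
    by apply: (measurableT_comp mk1); exact: measurable_funB.
  exact: (measurable_comp2 mG).
rewrite (fubini_tonelli _ m2); last by move=> z; rewrite lee_fin.
rewrite /fubini_F /= -ge0_integralZl//; last first.
  exact: integral_ge0.
apply: eq_integral => r _.
under eq_integral do rewrite normrM EFinM.
rewrite ge0_integralZr//; last by apply: (measurable_shift (r : R) mk1n).
congr (_ * _)%E.
by rewrite (ge0_integral_shift r (f := fun t => `|k1 t|%:E)).
Qed.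

Lemma ig_cvF : ig (pm (pm m mu) mu) (fun z => k1 (z.1.2 - z.2) * G z.1.1 z.2).
Proof.
by apply: (ig_fin mF); rewrite intF -EFinM ltry.
Qed.

Lemma ig_cvX : ig (pm m mu) (fun z => cvX k1 G z.1 z.2).
Proof. exact: (ig_F1 ig_cvF). Qed.

(** Young's inequality in L^1. It is the only estimate used for the part [k1] of the kernel, whose
    convolution is never differentiated. *)
Lemma cvX_bound (b : R -> R) (D : R) : measurable_fun [set: RT] b ->
  (forall t, `|b t| <= D) ->
  `|\int[mu]_t \int[m]_x (b t * cvX k1 G x t)| <=
  D * (\int[mu]_t `|k1 t|) * (\int[pm m mu]_z `|G z.1 z.2|).
Proof.
move=> mb bD.
have ib : ig (pm m mu) (fun z => b z.2 * cvX k1 G z.1 z.2).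
  by apply: (ig_bM (c := D)) ig_cvX => //; exact: (measurableT_comp mb).
rewrite (int_F2 ib); apply: (le_trans (int_norm ib)).
have ic := ig_abs ig_cvX; have D0 : 0 <= D by exact: le_trans (bD 0).
apply: (@le_trans _ _ (\int[pm m mu]_z (D * `|cvX k1 G z.1 z.2|))).
  apply: int_le => [||z]; [exact: ig_abs|exact: igZ|].
  by rewrite normrM ler_wpM2r.
rewrite int_Z// -mulrA ler_wpM2l// -lee_fin EFinM -intF EFin_int//.
have mFn : measurable_fun setT (fun z : X * RT * RT => `|k1 (z.1.2 - z.2) * G z.1.1 z.2|%:E).
  by apply/measurable_EFinP; apply: measurableT_comp.
rewrite (fubini_tonelli1 _ mFn); last by move=> z; rewrite lee_fin.
apply: ae_ge0_le_integral => //.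
- by apply/measurable_EFinP; exact: ig_mfun ic.
- by move=> z _; exact: integral_ge0.
- by apply: (measurable_fun_fubini_tonelli_F _ mFn) => z; rewrite lee_fin.
have h := ae_ig1 ig_cvF; apply: filterS h => z hz _.
have := int_norm hz; rewrite -lee_fin => /le_trans; apply.
by rewrite EFin_int//; exact: ig_abs.
Qed.

End conv_bound.

Lemma ig_wlag (mm : R) (g : X -> R -> R) : 0 < mm ->
  ig (pm m mu) (fun z => g z.1 z.2) ->
  ig (pm m mu) (fun z => wlag mm g z.1 z.2).
Proof.
move=> m0 ih; apply: (ig_bM (c := 1)).
- exact: (measurableT_comp (measurable_ioo 0 T)).
- by move=> z; exact: ioo_norm1.
apply: igB; first exact: igZ.
have msh : measurable_fun setT (fun z : (X * RT) * RT => (z.1.1, z.1.2 - z.2)).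
  apply: measurable_fun_pair; first exact: (measurableT_comp measurable_fst measurable_fst).
  by apply: measurable_funB => //; exact: (measurableT_comp measurable_snd measurable_fst).
have H := @ig_lag R T kk kk_ig kk_supp mm _ _ (pm m mu)
  (fun a y => (y.1, y.2 - a)) msh.
apply: (ig_F1 (H _ (fun z => g z.1 z.2) ih)).
move=> a f mf f0; rewrite [RHS](fubini_tonelli1 _ mf f0).
  have mfa : measurable_fun setT (fun y : X * RT => f (y.1, y.2 - a)).
    apply: (measurableT_comp mf); apply: measurable_fun_pair => //.
    exact: measurable_funB.
  rewrite [LHS](fubini_tonelli1 _ mfa)//; apply: eq_integral => x _.
  rewrite /fubini_F /=.
  rewrite (ge0_integral_shift a (f := fun t => f (x, t)))//.
  exact: (measurableT_comp mf (pair1_measurable x)).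
Qed.

Lemma ig_dg f u0 u : esol f u0 u -> ig (pm m mu) (fun z => dg u u0 z.1 z.2).
Proof.
move=> h; have iu := es_u h.
have i0 : ig (pm m mu) (fun z => u0 z.1 * ioo 0 T z.2).
  exact: ig_tensor (es_u0 h) (ig_ioo 0 T).
have := igB (ig_bM (c := 1) (_ : measurable_fun setT (fun z : X * RT => ioo 0 T z.2)) _ iu) i0.
move=> /(_ (measurableT_comp (measurable_ioo 0 T) measurable_snd)).
move=> /(_ (fun z => ioo_norm1 0 T z.2)).
rewrite (_ : (fun x => _) = (fun z => dg u u0 z.1 z.2))//.
by apply/funext => z; rewrite /dg; ring.
Qed.

Lemma dec_ig k1 w f u0 u : esol f u0 u -> dec k1 w (dg u u0) ->
  ig mu k1 /\ ig (pm m mu) (fun z => w z.1 z.2).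
Proof.
move=> h [[-> ->]|[mm m0 [-> ->]]]; first by split=> //; exact: ig0.
split; last exact/ig_wlag/(ig_dg h).
by apply: igB => //; exact: ig_kk2.
Qed.

(** * Inequalities localized near a time c *)

Section time_localized.
Variables (eps c D : R).
Hypotheses (e0 : 0 < eps) (hc : eps < c < T - eps)
  (hD : forall c t, `|derive1 (fun t => moll eps (t - c)) t| <= D).

Let rho (t : R) := moll eps (t - c).

Let rho0 t : 0 <= rho t. Proof. exact: moll_ge0. Qed.

Let rho_off t : ~~ (0 < t < T) -> rho t = 0.
Proof.
have E0 := e0; have Hc := hc.
move=> h; apply: moll_supp => //.
have [t0|t0] := leP t 0; first by rewrite ler0_norm; lra.
move: h; rewrite t0 /= -leNgt => tT.
by rewrite ger0_norm; lra.
Qed.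

Let ioo_rho t : ioo 0 T t * rho t = rho t.
Proof.
have [h|h] := boolP (0 < t < T); first by rewrite ioo1// mul1r.
by rewrite rho_off// mulr0.
Qed.

Let mrho : measurable_fun [set: RT] rho.
Proof. exact: ig_mfun (ig_moll e0 c). Qed.

Let irho : ig mu rho. Proof. exact: ig_moll. Qed.

Let rho_le t : `|rho t| <= mollC R / eps.
Proof. by rewrite ger0_norm//; exact: moll_le. Qed.

Let test_rho a : test0 T (fun t => a * rho t).
Proof.
split.
  apply: smoothP => n; have := smn_affine 1 0 a (moll_smn eps c n).
  by under eq_fun do rewrite mul1r addr0.
exists (c + eps); first by have Hc := hc; lra.
move=> t h; rewrite /rho moll_supp ?mulr0// ger0_norm; first lra.
by have E0 := e0; lra.
Qed.

Let der_rho a t : derive1 (fun t => a * rho t) t = a * derive1 rho t.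
Proof.
rewrite !derive1E; have [h0 _] := moll_smn eps c 0%N; have h : derivable rho t 1 by exact: h0.
by have := deriveZ a h.
Qed.

Let bder t := ioo 0 T t * derive1 rho t.

Let mbder : measurable_fun [set: RT] bder.
Proof.
apply: measurable_funM; first exact: measurable_ioo.
exact: measurable_moll_der.
Qed.

Let bder_le t : `|bder t| <= D.
Proof.
rewrite normrM; apply: le_trans (hD c t).
by rewrite ler_piMl// ioo_norm1.
Qed.

Section half.
Variables (f : X -> R -> R) (u0 : X -> R) (u : X -> R -> R).
Hypothesis hu : esol f u0 u.
Variables (S s J : R -> R) (Cs : R).
Hypotheses (hP : Pfun S s J) (hCs : forall x, `|S x| <= Cs).
Variables (k1 : R -> R) (w : X -> R -> R).
Hypothesis hdec : dec k1 w (dg u u0).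
Variables (psi : X -> R -> R) (M L : R).
Hypotheses (mpsi : measurable_fun setT (fun z : X * RT => psi z.1 z.2))
  (bpsi : forall x r, `|psi x r| <= M)
  (psi_off : forall x r, ~ Om x -> psi x r = 0)
  (psi_en : (\int[mu]_r \int[pm m m]_z
    ((psi z.1 r - psi z.2 r) ^+ 2 * kap z)%:E < +oo)%E)
  (L0 : 0 < L)
  (hneg : forall a b C D, `|C| <= M -> `|D| <= M ->
    - ((a - b) * (S (a - C) - S (b - D))) <=
    (trunc L a - trunc L b) ^+ 2 + (C - D) ^+ 2).

Definition pairE (r t : R) (z : X * X) := (u z.1 t - u z.2 t) *
  (S (u z.1 t - psi z.1 r) - S (u z.2 t - psi z.2 r)).

Let mu' := ig_mfun (es_u hu).

Let mS : measurable_fun [set: RT] (S : RT -> RT).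
Proof. exact: cts_mfun (Pfun_contS hP). Qed.

Let mJ : measurable_fun [set: RT] (J : RT -> RT).
Proof. exact: cts_mfun (Pfun_contJ hP). Qed.

Definition dblQ (r t : R) (z : X * X) := rho r * (rho t * (pairE r t z * kap z)).

Let mQ3 : measurable_fun setT (fun y : (RT * RT) * (X * X) => dblQ y.1.2 y.1.1 y.2).
Proof.
have m11 : measurable_fun setT (fun y : (RT * RT) * (X * X) => y.1.1).
  exact: (measurableT_comp measurable_fst measurable_fst).
have m12 : measurable_fun setT (fun y : (RT * RT) * (X * X) => y.1.2).
  exact: (measurableT_comp measurable_snd measurable_fst).
have m21 : measurable_fun setT (fun y : (RT * RT) * (X * X) => y.2.1).
  exact: (measurableT_comp measurable_fst measurable_snd).
have m22 : measurable_fun setT (fun y : (RT * RT) * (X * X) => y.2.2).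
  exact: (measurableT_comp measurable_snd measurable_snd).
have hu1 := measurable_comp2 mu' m21 m11; have hu2 := measurable_comp2 mu' m22 m11.
have hp1 := measurable_comp2 mpsi m21 m12; have hp2 := measurable_comp2 mpsi m22 m12.
apply: measurable_funM; first exact: (measurableT_comp mrho).
apply: measurable_funM; first exact: (measurableT_comp mrho).
apply: measurable_funM; last exact: (measurableT_comp mkap).
apply: measurable_funM; first exact: measurable_funB.
by apply: measurable_funB; apply: (measurableT_comp mS); exact: measurable_funB.
Qed.

Lemma measurable_dblQ :
  measurable_fun setT (fun y : (RT * RT) * (X * X) => dblQ y.1.2 y.1.1 y.2).
Proof. exact: mQ3. Qed.

Let mQ2 r : measurable_fun setT (fun y : RT * (X * X) => dblQ r y.1 y.2).
Proof.
apply: (@measurable_comp2 _ _ _ (RT * (X * X))%type (RT * RT)%type (X * X)%type R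
  (fun a b => dblQ a.2 a.1 b) (fun y => (y.1, r)) snd) => //.
exact: measurable_fun_pair.
Qed.

Let E0 t := (\int[pm m m]_z
  ((trunc L (u z.1 t) - trunc L (u z.2 t)) ^+ 2 * kap z)%:E)%E.
Let E1 r := (\int[pm m m]_z ((psi z.1 r - psi z.2 r) ^+ 2 * kap z)%:E)%E.

Let mtr : measurable_fun [set: RT] (trunc L : RT -> RT).
Proof. by apply: measurable_maxr => //; apply: measurable_minr. Qed.

Let mEn (g : X -> R -> R) : measurable_fun setT (fun z : X * RT => g z.1 z.2) ->
  measurable_fun setT (fun y : RT * (X * X) =>
    ((g y.2.1 y.1 - g y.2.2 y.1) ^+ 2 * kap y.2)%:E).
Proof.
move=> mg; apply/measurable_EFinP.
have m1 : measurable_fun setT (fun y : RT * (X * X) => y.2.1).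
  exact: (measurableT_comp measurable_fst measurable_snd).
have m2 : measurable_fun setT (fun y : RT * (X * X) => y.2.2).
  exact: (measurableT_comp measurable_snd measurable_snd).
apply: measurable_funM; last exact: (measurableT_comp mkap).
by apply: measurable_funX; apply: measurable_funB; exact: (measurable_comp2 mg).
Qed.

Let mtu : measurable_fun setT (fun z : X * RT => trunc L (u z.1 z.2)).
Proof. exact: (measurableT_comp mtr). Qed.

Let en_ge0 (a : R) z : 0 <= a ^+ 2 * kap z.
Proof. by rewrite mulr_ge0// sqr_ge0. Qed.

Let mE0 : measurable_fun [set: RT] E0.
Proof.
have h := measurable_fun_fubini_tonelli_F (m2 := pm m m) _ (mEn (g := fun x t => trunc L (u x t)) mtu) (fun y => en_ge0 _ y.2).
exact: h.
Qed.

Let mE1 : measurable_fun [set: RT] E1.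
Proof.
have h := measurable_fun_fubini_tonelli_F (m2 := pm m m) _ (mEn (g := psi) mpsi) (fun y => en_ge0 _ y.2).
exact: h.
Qed.

Let E0_ge0 t : (0 <= E0 t)%E.
Proof. by apply: integral_ge0 => z _; rewrite lee_fin. Qed.

Let E1_ge0 t : (0 <= E1 t)%E.
Proof. by apply: integral_ge0 => z _; rewrite lee_fin. Qed.

Let msec (g : X -> R -> R) t : measurable_fun setT (fun z : X * RT => g z.1 z.2) ->
  measurable_fun setT (fun z : X * X => ((g z.1 t - g z.2 t) ^+ 2 * kap z)%:E).
Proof. by move=> mg; exact: (measurableT_comp (mEn mg) (pair1_measurable t)). Qed.

Let rnegQ_le r t z : rneg (dblQ r t z) <= rho r * (rho t *
  ((trunc L (u z.1 t) - trunc L (u z.2 t)) ^+ 2 * kap z +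
   (psi z.1 r - psi z.2 r) ^+ 2 * kap z)).
Proof.
rewrite /rneg ge_max; apply/andP; split; last first.
  by rewrite mulr_ge0// mulr_ge0// addr_ge0// en_ge0.
rewrite /dblQ -mulrN -mulrN ler_wpM2l// ler_wpM2l// -mulNr -mulrDl ler_wpM2r//.
exact: hneg.
Qed.

Let inner_neg r : (\int[mu]_t \int[pm m m]_z (rneg (dblQ r t z))%:E <=
  (rho r * (mollC R / eps))%:E * \int[mu]_t E0 t + (rho r)%:E * E1 r)%E.
Proof.
have mrn : measurable_fun setT (fun y : RT * (X * X) => (rneg (dblQ r y.1 y.2))%:E).
  by apply/measurable_EFinP; exact: measurable_rneg.
pose B t := ((rho r * (mollC R / eps))%:E * E0 t + (rho r)%:E * (E1 r * (rho t)%:E))%E.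
have C0 : 0 <= mollC R / eps by exact: le_trans (rho_le 0).
have mB1 : measurable_fun [set: RT] (fun t => (rho r * (mollC R / eps))%:E * E0 t)%E.
  by apply: emeasurable_funM => //; exact: mE0.
have mB2 : measurable_fun [set: RT] (fun t => (rho r)%:E * (E1 r * (rho t)%:E))%E.
  apply: emeasurable_funM => //; apply: emeasurable_funM => //.
  exact/measurable_EFinP.
have B1_ge0 t : (0 <= (rho r * (mollC R / eps))%:E * E0 t)%E.
  by rewrite mule_ge0// lee_fin mulr_ge0.
have B2_ge0 t : (0 <= (rho r)%:E * (E1 r * (rho t)%:E))%E.
  by rewrite !mule_ge0// lee_fin.
apply: (@le_trans _ _ (\int[mu]_t B t)%E).
  apply: ge0_le_int.
  - exact: (measurable_fun_fubini_tonelli_F (m2 := pm m m) _ mrn (fun y => rneg_ge0 _)).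
  - exact: emeasurable_funD.
  - by move=> t; apply: integral_ge0 => z _; rewrite lee_fin rneg_ge0.
  move=> t; rewrite /B.
  apply: (@le_trans _ _ (\int[pm m m]_z ((rho r * rho t)%:E *
    (((trunc L (u z.1 t) - trunc L (u z.2 t)) ^+ 2 * kap z)%:E +
     ((psi z.1 r - psi z.2 r) ^+ 2 * kap z)%:E)))%E).
    apply: ge0_le_int.
    - exact: (measurableT_comp mrn (pair1_measurable t)).
    - apply: emeasurable_funM => //; apply: emeasurable_funD; first [exact: (msec (g := fun x t => trunc L (u x t)))|exact: (msec (g := psi))].
    - by move=> z; rewrite lee_fin rneg_ge0.
    by move=> z; rewrite -EFinD -EFinM lee_fin -mulrA; exact: rnegQ_le.
  rewrite ge0_integralZl//; last 3 first.
  - by apply: emeasurable_funD; first [exact: (msec (g := fun x t => trunc L (u x t)))|exact: (msec (g := psi))].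
  - by move=> z _; rewrite adde_ge0// lee_fin.
  - by rewrite lee_fin mulr_ge0.
  rewrite ge0_int_D//; [|by first [exact: (msec (g := fun x t => trunc L (u x t)))|exact: (msec (g := psi))]|by first [exact: (msec (g := fun x t => trunc L (u x t)))|exact: (msec (g := psi))]
    |by move=> z; rewrite lee_fin|by move=> z; rewrite lee_fin].
  rewrite -/(E0 t) -/(E1 r) ge0_muleDr//.
  apply: leeD.
    rewrite lee_wpmul2r// lee_fin ler_wpM2l//.
    by have := rho_le t; rewrite ger0_norm.
  by rewrite EFinM -muleA lee_wpmul2l ?lee_fin// muleC.
rewrite /B ge0_int_D// ge0_integralZl//; last by rewrite lee_fin mulr_ge0.
apply: leeD2l; rewrite ge0_integralZl//; last 3 first.
- by apply: emeasurable_funM => //; exact/measurable_EFinP.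
- by move=> t _; rewrite mule_ge0// lee_fin.
- by rewrite lee_fin.
apply: lee_wpmul2l; first by rewrite lee_fin.
rewrite ge0_integralZl//; last 2 first.
- exact/measurable_EFinP.
- by move=> t _; rewrite lee_fin.
by rewrite -EFin_int// int_moll// mule1.
Qed.

(** By [hneg] the negative part is at most the energy density of the truncation of [u] at level L
    plus that of [psi], and both energies are finite. *)
Lemma half_neg : (\int[mu]_r \int[mu]_t \int[pm m m]_z (rneg (dblQ r t z))%:E < +oo)%E.
Proof.
have C0 : 0 <= mollC R / eps by exact: le_trans (rho_le 0).
have mrn : measurable_fun setT (fun y : (RT * RT) * (X * X) => (rneg (dblQ y.1.2 y.1.1 y.2))%:E).
  by apply/measurable_EFinP; exact: measurable_rneg.
have mF := measurable_fun_fubini_tonelli_F (m2 := pm m m) _ mrn (fun y => rneg_ge0 _).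
have F0 y : (0 <= \int[pm m m]_z (rneg (dblQ y.2 y.1 z))%:E)%E.
  by apply: integral_ge0 => z _; rewrite lee_fin rneg_ge0.
have mG := measurable_fun_fubini_tonelli_G (m1 := mu) _ mF F0.
have fE0 : (\int[mu]_t E0 t < +oo)%E by exact: (es_en hu).
have E00 : (0 <= \int[mu]_t E0 t)%E by apply: integral_ge0.
pose B r := ((rho r * (mollC R / eps))%:E * \int[mu]_t E0 t + (mollC R / eps)%:E * E1 r)%E.
have mB1 : measurable_fun [set: RT] (fun r => (rho r * (mollC R / eps))%:E * \int[mu]_t E0 t)%E.
  apply: emeasurable_funM; last exact: measurable_cst.
  by apply/measurable_EFinP; apply: measurable_funM; [exact: mrho|exact: measurable_cst].
have mB2 : measurable_fun [set: RT] (fun r => (mollC R / eps)%:E * E1 r)%E.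
  exact: emeasurable_funM.
apply: (@le_lt_trans _ _ (\int[mu]_r B r)%E).
  apply: ge0_le_int => //.
  - exact: emeasurable_funD.
  - by move=> r; apply: integral_ge0 => t _; apply: integral_ge0 => z _; rewrite lee_fin rneg_ge0.
  move=> r; apply: (le_trans (inner_neg r)); apply: leeD2l.
  by rewrite lee_wpmul2r// lee_fin; have := rho_le r; rewrite ger0_norm.
rewrite ge0_int_D//; last 2 first.
- by move=> r; rewrite mule_ge0// lee_fin mulr_ge0.
- by move=> r; rewrite mule_ge0// lee_fin.
rewrite lte_add_pinfty//.
  rewrite ge0_integralZr//; last 2 first.
  - by apply/measurable_EFinP; exact: measurable_funM.
  - by move=> r _; rewrite lee_fin mulr_ge0.
  have ii : ig mu (fun r => rho r * (mollC R / eps)).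
    by under eq_fun do rewrite mulrC; exact: igZ.
  by rewrite -EFin_int// lte_mul_pinfty// ?lee_fin// int_ge0// => r; rewrite mulr_ge0.
by rewrite ge0_integralZl// lte_mul_pinfty// lee_fin.
Qed.

(** The entropy inequality at one frozen time, with [phi = psi^~ r] and [zeta = rho r * rho];
    admissible for the r at which [psi] has finite energy, that is almost all. The kernel term is
    merely estimated: [J] is Lipschitz with constant [Cs], which leaves [|u - u0|], and the
    derivative of the mollifier costs D. *)
Let slice r : (E1 r < +oo)%E -> ((2^-1)%:E * \int[mu]_t \int[pm m m]_z (dblQ r t z)%:E <=
  (\int[mu]_t \int[m]_x (rho r * (rho t * (f x t - w x t) * S (u x t - psi x r)))
   + D * (\int[mu]_t `|k1 t|) * (Cs * \int[pm m mu]_z `|dg u u0 z.1 z.2|) * rho r)%:E)%E.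
Proof.
move=> hr'; have [ik1 iw] := dec_ig hu hdec.
have mpsir : measurable_fun setT (psi^~ r).
  exact: (measurableT_comp mpsi (pair2_measurable (r : RT))).
have := es_ineq hu mpsir (fun x => bpsi x r) (fun x => @psi_off x r) hr'
  (test_rho (rho r)) (fun t _ => mulr_ge0 (rho0 r) (rho0 t)) hP hdec.
set LHS := (X in (_ * X <= _)%E -> _).
have -> : LHS = (\int[mu]_t \int[pm m m]_z (dblQ r t z)%:E)%E.
  apply: eq_integral => t _; apply: eq_integral => z _; congr EFin.
  by rewrite /dblQ -[in RHS](ioo_rho t) /pairE; ring.
move=> h; apply: (le_trans h); rewrite lee_fin; apply: lerD.
  rewrite le_eqVlt; apply/orP; left; apply/eqP.
  apply: (int_ext mu) => t; apply: (int_ext m) => x.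
  by rewrite -[in RHS](ioo_rho t); ring.
pose G (x : X) (t : R) := ioo 0 T t * (J (u x t - psi x r) - J (u0 x - psi x r)).
rewrite -[X in cvX k1 X]/G.
have Gle z : `|G z.1 z.2| <= Cs * `|dg u u0 z.1 z.2|.
  rewrite /G /dg !normrM mulrCA ler_wpM2l//.
  apply: (le_trans (Pfun_distJ hP _ _ hCs)).
  by rewrite (_ : u z.1 z.2 - psi z.1 r - _ = u z.1 z.2 - u0 z.1)//; ring.
have mG : measurable_fun setT (fun z : X * RT => G z.1 z.2).
  apply: measurable_funM; first exact: (measurableT_comp (measurable_ioo 0 T)).
  have mp1 : measurable_fun setT (fun z : X * RT => psi z.1 r).
    exact: (measurableT_comp mpsir).
  apply: measurable_funB; apply: (measurableT_comp mJ); apply: measurable_funB => //.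
  exact: (measurableT_comp (ig_mfun (es_u0 hu))).
have idg := igZ Cs (ig_abs (ig_dg hu)).
have iG : ig (pm m mu) (fun z => G z.1 z.2) by apply: (ig_le mG idg).
have -> : \int[mu]_t \int[m]_x (ioo 0 T t * derive1 (fun t0 => rho r * rho t0) t * cvX k1 G x t)
    = \int[mu]_t \int[m]_x ((rho r * bder t) * cvX k1 G x t).
  apply: (int_ext mu) => t; apply: (int_ext m) => x; rewrite der_rho /bder; ring.
apply: (le_trans (ler_norm _)).
have mb : measurable_fun [set: RT] (fun t => rho r * bder t) by exact: measurable_funM.
have ble t : `|rho r * bder t| <= rho r * D.
  by rewrite normrM ger0_norm// ler_wpM2l.
apply: (le_trans (cvX_bound ik1 iG mb ble)).
have hG : \int[pm m mu]_z `|G z.1 z.2| <= Cs * \int[pm m mu]_z `|dg u u0 z.1 z.2|.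
  rewrite -int_Z; last exact/ig_abs/ig_dg/hu.
  by apply: int_le => //; exact: ig_abs.
move: hG; move: (\int[pm m mu]_z `|G z.1 z.2|) (Cs * _) => a b ab.
have K0 : 0 <= \int[mu]_t `|k1 t| by exact: int_ge0.
have D0 : 0 <= D by exact: le_trans (bder_le 0).
rewrite [leRHS]mulrC mulrA [in leRHS]mulrA ler_wpM2l//.
by apply: mulr_ge0 => //; exact: mulr_ge0.
Qed.

Lemma half_doubling :
  (\int[mu]_r \int[mu]_t \int[pm m m]_z (rpos (dblQ r t z))%:E <=
   (2 * (\int[mu]_r \int[mu]_t \int[m]_x
       (rho r * (rho t * (f x t - w x t) * S (u x t - psi x r)))
     + D * (\int[mu]_t `|k1 t|) * (Cs * \int[pm m mu]_z `|dg u u0 z.1 z.2|)))%:E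
   + \int[mu]_r \int[mu]_t \int[pm m m]_z (rneg (dblQ r t z))%:E)%E.
Proof.
have [ik1 iw] := dec_ig hu hdec.
set beta := D * _ * _.
have ifw : ig (pm m mu) (fun z => rho z.2 * (f z.1 z.2 - w z.1 z.2)).
  apply: (ig_bM (c := mollC R / eps)); first exact: (measurableT_comp mrho).
  - by move=> z; exact: rho_le.
  by apply: igB => //; exact: es_f hu.
have i3 : ig (pm (pm mu mu) m) (fun y => rho y.1.2 *
    (rho y.1.1 * (f y.2 y.1.1 - w y.2 y.1.1) * S (u y.2 y.1.1 - psi y.2 y.1.2))).
  have := ig_tensor3l (h := fun (x : X) (t : RT) => rho t * (f x t - w x t)) ifw irho => i0.
  have mSp : measurable_fun setT (fun y : (RT * RT) * X => S (u y.2 y.1.1 - psi y.2 y.1.2)).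
    apply: (measurableT_comp mS); apply: measurable_funB.
      apply: (measurable_comp2 mu') => //.
      exact: (measurableT_comp measurable_fst measurable_fst).
    apply: (measurable_comp2 mpsi) => //.
    exact: (measurableT_comp measurable_snd measurable_fst).
  have := ig_bM (c := Cs) mSp (fun y => hCs _) i0.
  rewrite (_ : (fun x => _) = (fun y : (RT * RT) * X => rho y.1.2 *
    (rho y.1.1 * (f y.2 y.1.1 - w y.2 y.1.1) * S (u y.2 y.1.1 - psi y.2 y.1.2))))//.
  by apply/funext => y /=; ring.
have [iA AE] := fubini3r i3; rewrite /= in iA AE.
pose A r := \int[mu]_t \int[m]_x (rho r * (rho t * (f x t - w x t) * S (u x t - psi x r))).
have -> : 2 * (\int[mu]_r A r + beta) = \int[mu]_r (2 * (A r + beta * rho r)).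
  have iA' : ig mu A by exact: iA.
  have ib := igZ beta irho.
  by rewrite (int_Z 2 (igD iA' ib)) (int_D iA' ib) (int_Z beta irho) /rho int_moll// mulr1.
have mpn (q : R -> R) : (forall x, 0 <= q x) -> measurable_fun [set: RT] (q : RT -> RT) ->
    measurable_fun [set: RT] (fun r => \int[mu]_t \int[pm m m]_z (q (dblQ r t z))%:E)%E.
  move=> q0 mq.
  have mrn : measurable_fun setT (fun y : (RT * RT) * (X * X) => (q (dblQ y.1.2 y.1.1 y.2))%:E).
    by apply/measurable_EFinP; exact: (measurableT_comp mq mQ3).
  have mF := measurable_fun_fubini_tonelli_F (m2 := pm m m) _ mrn (fun y => q0 _).
  have F0 y : (0 <= \int[pm m m]_z (q (dblQ y.2 y.1 z))%:E)%E.
    by apply: integral_ge0 => z _; rewrite lee_fin.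
  exact: (measurable_fun_fubini_tonelli_G (m1 := mu) _ mF F0).
apply: ae_le_int_add.
- apply: mpn; [exact: rpos_ge0|exact: measurable_rpos].
- apply: mpn; [exact: rneg_ge0|exact: measurable_rneg].
- by move=> r; apply: integral_ge0 => t _; apply: integral_ge0 => z _; rewrite lee_fin rpos_ge0.
- by move=> r; apply: integral_ge0 => t _; apply: integral_ge0 => z _; rewrite lee_fin rneg_ge0.
- by apply: igZ; apply: igD => //; exact: igZ.
have E1fin : mu.-integrable setT E1.
  apply/integrableP; split => //.
  by under eq_integral do rewrite gee0_abs//.
have := integrable_ae measurableT E1fin; apply: filterS => r /= /(_ I) hr.
apply: (iterated_split (m1 := mu) (m2 := pm m m) (F := fun y => dblQ r y.1 y.2)) => //.
  apply: (le_lt_trans (inner_neg r)).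
  have C0 : 0 <= mollC R / eps by exact: le_trans (rho_le 0).
  rewrite lte_add_pinfty//.
      apply: lte_mul_pinfty; [by rewrite lee_fin mulr_ge0|by []|].
    exact: (es_en hu L0).
  by apply: lte_mul_pinfty; [rewrite lee_fin| |rewrite -ge0_fin_numE].
by apply: slice; rewrite -ge0_fin_numE.
Qed.

End half.

Section decay.
Variables (f : X -> R -> R) (u0 : X -> R) (u : X -> R -> R).
Hypothesis hu : esol f u0 u.
Variables (delta : R) (th s J : nat -> R -> R).
Hypotheses (hth : forall n, [/\ Pfun (th n) (s n) (J n),
    (forall x, `|th n x| <= 8 * delta),
    (forall x, `|x| <= n%:R -> th n x = 0) &
    (forall x, `|x| <= n%:R -> J n x = 0)]).

Definition bandE n (t : R) (z : X * X) :=
  rho t * ((u z.1 t - u z.2 t) * (th n (u z.1 t) - th n (u z.2 t)) * kap z).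

(** The inequality with [phi = 0], [S = th n] and the splitting k2 = 0. Its right-hand side contains
    [u] and [u0] only through [th n] and [J n], which vanish below level n; dominated convergence by
    [|f|] and [|u - u0|] sends it to 0. *)
Lemma energy_decay : exists2 e : nat -> R, e n @[n --> \oo] --> 0 &
  forall n, (\int[mu]_t \int[pm m m]_z (bandE n t z)%:E <= (e n)%:E)%E.
Proof.
have mu' := ig_mfun (es_u hu).
have mth n : measurable_fun [set: RT] (th n : RT -> RT).
  by have [hP _ _ _] := hth n; exact: cts_mfun (Pfun_contS hP).
have mJ n : measurable_fun [set: RT] (J n : RT -> RT).
  by have [hP _ _ _] := hth n; exact: cts_mfun (Pfun_contJ hP).
have C0 : 0 <= mollC R / eps by exact: le_trans (rho_le 0).
pose a n (z : X * RT) := rho z.2 * (f z.1 z.2 * th n (u z.1 z.2)).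
pose b n (z : X * RT) := `|ioo 0 T z.2 * (J n (u z.1 z.2) - J n (u0 z.1))|.
have ma n : measurable_fun setT (a n).
  apply: measurable_funM; first exact: (measurableT_comp mrho).
  apply: measurable_funM; first exact: (ig_mfun (es_f hu)).
  exact: (measurableT_comp (mth n)).
have mb0 n : measurable_fun setT (fun z : X * RT => ioo 0 T z.2 * (J n (u z.1 z.2) - J n (u0 z.1))).
  apply: measurable_funM; first exact: (measurableT_comp (measurable_ioo 0 T)).
  apply: measurable_funB; first exact: (measurableT_comp (mJ n)).
  apply: (measurableT_comp (mJ n)).
  exact: (measurableT_comp (ig_mfun (es_u0 hu))).
have mb n : measurable_fun setT (b n) by exact: measurableT_comp.
have ale n z : `|a n z| <= (mollC R / eps * (8 * delta)) * `|f z.1 z.2|.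
  rewrite /a normrM (normrM (f _ _)) -mulrA; apply: ler_pM => //.
  by have [_ h _ _] := hth n; rewrite mulrC ler_wpM2r.
have ble n z : `|b n z| <= (8 * delta) * `|dg u u0 z.1 z.2|.
  rewrite /b /dg normr_id !normrM mulrCA ler_wpM2l//.
  by have [hP hb _ _] := hth n; exact: (Pfun_distJ hP _ _ hb).
have ia := igZ (mollC R / eps * (8 * delta)) (ig_abs (es_f hu)).
have ib := igZ (8 * delta) (ig_abs (ig_dg hu)).
have ian n : ig (pm m mu) (a n) by apply: (ig_le (ma n) ia).
have ca z : a n z @[n --> \oo] --> 0.
  apply: cvg_near_cst; near=> n; rewrite /a; have [_ _ h0 _] := hth n.
  rewrite (h0 (u z.1 z.2)); first by rewrite !mulr0.
  by near: n; exact: nbhs_infty_ger.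
have cb z : b n z @[n --> \oo] --> 0.
  apply: cvg_near_cst; near=> n; rewrite /b; have [_ _ _ hJ] := hth n.
  rewrite (hJ (u z.1 z.2)); last by near: n; exact: nbhs_infty_ger.
  rewrite (hJ (u0 z.1)); last by near: n; exact: nbhs_infty_ger.
  by rewrite subrr mulr0 normr0.
have mz : measurable_fun [set: X * RT] (fun _ => 0 : R) by exact: measurable_cst.
have [_ la] := ig_DCT ma mz ca ia ale.
have [_ lb] := ig_DCT mb mz cb ib ble.
have i00 : \int[pm m mu]_x 0 = 0 :> R by rewrite /Rintegral integral0.
rewrite i00 in la lb.
exists (fun n => 2 * (\int[pm m mu]_z a n z + D * (\int[mu]_t `|kk t|) * \int[pm m mu]_z b n z)).
  rewrite [X in _ --> X](_ : 0 = 2 * (0 + D * (\int[mu]_t `|kk t|) * 0)); last by rewrite mulr0 addr0 mulr0.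
  by apply: cvgM; [exact: cvg_cst|apply: cvgD => //; apply: cvgM => //; exact: cvg_cst].
move=> n; have [hP hb _ _] := hth n.
have mphi : measurable_fun setT (fun _ : X => 0 : R) by exact: measurable_cst.
have phi_en : (\int[pm m m]_z ((0 - 0 : R) ^+ 2 * kap z)%:E < +oo)%E.
  by under eq_integral do rewrite subrr expr0n mul0r; rewrite integral0 ltry.
have := es_ineq hu mphi (M := 0) (fun x => _) (fun x _ => erefl) phi_en
  (test_rho 1) (fun t _ => mulr_ge0 ler01 (rho0 t)) hP (or_introl (conj erefl erefl)).
move=> /(_ (fun=> ltac:(by rewrite normr0))).
set LHS := (X in (_ * X <= _)%E -> _).
have -> : LHS = (\int[mu]_t \int[pm m m]_z (bandE n t z)%:E)%E.
  apply: eq_integral => t _; apply: eq_integral => z _; congr EFin.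
  by rewrite /bandE -[in RHS](ioo_rho t) !subr0; ring.
move=> h; have {h} := lee_wpmul2l (_ : (0 <= 2%:E)%E) h; rewrite lee_fin => /(_ ltac:(by [])).
rewrite muleA -EFinM mulfV// mul1e => /le_trans; apply.
rewrite -EFinM lee_fin ler_wpM2l//; apply: lerD.
  rewrite -(int_F2 (ian n)) le_eqVlt; apply/orP; left; apply/eqP.
  apply: (int_ext mu) => t; apply: (int_ext m) => x.
  by rewrite /a /= -[in RHS](ioo_rho t) !subr0; ring.
have iG : ig (pm m mu) (fun z => ioo 0 T z.2 * (J n (u z.1 z.2 - 0) - J n (u0 z.1 - 0))).
  under eq_fun do rewrite !subr0.
  by apply: (ig_le (mb0 n) ib) => z; have := ble n z; rewrite /b normr_id.
have -> : \int[pm m mu]_z b n z = \int[pm m mu]_z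
    `|ioo 0 T z.2 * (J n (u z.1 z.2 - 0) - J n (u0 z.1 - 0))|.
  by apply: (int_ext (pm m mu)) => z; rewrite !subr0.
have := cvX_bound (k1 := kk) (G := fun x t => ioo 0 T t * (J n (u x t - 0) - J n (u0 x - 0)))
  kk_ig iG mbder bder_le.
apply: le_trans; apply: le_trans (ler_norm _).
rewrite le_eqVlt; apply/orP; left; apply/eqP.
apply: (int_ext mu) => t; apply: (int_ext m) => x.
by rewrite der_rho mul1r.
Unshelve. all: by end_near. Qed.

End decay.

Section doubling.
Variables (f : X -> R -> R) (u0 : X -> R) (u : X -> R -> R).
Variables (h : X -> R -> R) (v0 : X -> R) (v : X -> R -> R).
Hypotheses (hu : esol f u0 u) (hv : esol h v0 v).
Variable mm : R.
Hypothesis mm0 : 0 < mm.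

Let k1 t := kk t - kk2 kk mm t.
Let wu := wlag mm (dg u u0).
Let wv := wlag mm (dg v v0).
Let P := pm (pm mu mu) m.
Let fu (y : RT * RT * X) := rho y.1.2 * (rho y.1.1 * (f y.2 y.1.1 - wu y.2 y.1.1)).
Let fv (y : RT * RT * X) := rho y.1.1 * (rho y.1.2 * (h y.2 y.1.2 - wv y.2 y.1.2)).
Let U (y : RT * RT * X) := u y.2 y.1.1.
Let V (y : RT * RT * X) := v y.2 y.1.2.
Let K1 := \int[mu]_t `|k1 t|.
Let N0 := \int[pm m mu]_z `|dg u u0 z.1 z.2| + \int[pm m mu]_z `|dg v v0 z.1 z.2|.

Let decu : dec k1 wu (dg u u0). Proof. by right; exists mm. Qed.
Let decv : dec k1 wv (dg v v0). Proof. by right; exists mm. Qed.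

Let irw (a : X -> R -> R) : ig (pm m mu) (fun z => a z.1 z.2) ->
  ig (pm m mu) (fun z => rho z.2 * a z.1 z.2).
Proof.
move=> ia; apply: (ig_bM (c := mollC R / eps)) ia.
  exact: (measurableT_comp mrho).
by move=> z; exact: rho_le.
Qed.

Let ifu : ig P fu.
Proof.
have [_ iw] := dec_ig hu decu.
have i0 := irw (a := fun x t => f x t - wu x t) (igB (es_f hu) iw).
have := ig_tensor3l (h := fun (x : X) (t : RT) => rho t * (f x t - wu x t)) i0 irho.
by under eq_fun do rewrite mulrC.
Qed.

Let ifv : ig P fv.
Proof.
have [_ iw] := dec_ig hv decv.
have i0 := irw (a := fun x t => h x t - wv x t) (igB (es_f hv) iw).
have := ig_tensor3r (h := fun (x : X) (t : RT) => rho t * (h x t - wv x t)) i0 irho.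
by under eq_fun do rewrite mulrC.
Qed.

Let m2 : measurable_fun setT (fun y : RT * RT * X => y.1.1).
Proof. exact: (measurableT_comp measurable_fst measurable_fst). Qed.
Let m3 : measurable_fun setT (fun y : RT * RT * X => y.1.2).
Proof. exact: (measurableT_comp measurable_snd measurable_fst). Qed.

Let mU : measurable_fun setT U.
Proof. exact: (measurable_comp2 (ig_mfun (es_u hu)) measurable_snd m2). Qed.

Let mV : measurable_fun setT V.
Proof. exact: (measurable_comp2 (ig_mfun (es_u hv)) measurable_snd m3). Qed.

Let cvg_ge0 (g : nat -> R) (a : R) : g n @[n --> \oo] --> a -> (forall n, 0 <= g n) -> 0 <= a.
Proof.
move=> l g0; rewrite -(cvg_lim (@Rhausdorff R) l).
by apply: limr_ge; [exact: (cvgP _ l)|exact: nearW].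
Qed.

Let sum_bounds (a1 a2 k b g1 g2 e : R) :
  0 <= 2 * (a1 + k * (b * g1)) + 2 * (a2 + k * (b * g2)) + 4 * e ->
  0 <= 2 * (a1 + a2 + k * (b * (g1 + g2))) + 4 * e.
Proof. by rewrite !mulrDr; lra. Qed.

Section step.
Variables (delta : R) (S s J : R -> R).
Hypotheses (hP : Pfun S s J) (hS : sstep delta (delta / 2) S).

Let d0 : 0 < delta. Proof. by case: hS. Qed.

Let S' x := - S (- x).

Let hP' : Pfun S' (fun x => s (- x)) (fun x => J (- x)).
Proof. exact: Pfun_reflect. Qed.

Let bS x : `|S x| <= delta / 2.
Proof. by rewrite ger0_norm ?(sstep_ge0 hS)// (sstep_leM hS). Qed.

Let bS' x : `|S' x| <= delta / 2.
Proof. by rewrite normrN. Qed.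

(** Chosen so that [4 * delta <= K n], as [exists_band] requires, and so that the band function
    vanishes exactly below n = K n - 4 delta, as [energy_decay] requires. *)
Let K (n : nat) := 4 * delta + n%:R.

Let K0 n : 0 < K n.
Proof. by have D0 := d0; rewrite ltr_wpDr// mulr_gt0. Qed.

Let Kj n : n%:R <= K n.
Proof. by have D0 := d0; rewrite lerDr mulr_ge0// ltW. Qed.

Let mtr k : measurable_fun [set: RT] (trunc k : RT -> RT).
Proof. by apply: measurable_maxr => //; apply: measurable_minr. Qed.

Let truncz (k : R) : 0 < k -> trunc k 0 = 0.
Proof. by move=> k0; rewrite truncE_in// oppr_le0 !ltW. Qed.

Let hneg n th : band delta (K n) th -> forall a b C D : R, `|C| <= K n -> `|D| <= K n ->
  - ((a - b) * (S (a - C) - S (b - D))) <=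
    (trunc (K n + delta) a - trunc (K n + delta) b) ^+ 2 + (C - D) ^+ 2.
Proof. by move=> hb a b C' D'; exact: (energy_neg hS hb). Qed.

Let hneg' n th : band delta (K n) th -> forall a b C D : R, `|C| <= K n -> `|D| <= K n ->
  - ((a - b) * (S' (a - C) - S' (b - D))) <=
    (trunc (K n + delta) a - trunc (K n + delta) b) ^+ 2 + (C - D) ^+ 2.
Proof.
move=> hb a b C' D' hC hD'.
have Kd : 0 <= K n + delta by rewrite addr_ge0// ltW.
have := @hneg n th hb (- a) (- b) (- C') (- D'); rewrite !normrN => /(_ hC hD').
rewrite !truncN// /S' -!opprD; move=> hh; apply: le_trans (le_trans hh _).
  rewrite le_eqVlt; apply/orP; left; apply/eqP.
  by rewrite mulrN mulNr.
by rewrite !sqrrN.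
Qed.

Let exth : exists th : nat -> R -> R, exists s' : nat -> R -> R, exists J' : nat -> R -> R,
  forall n, band delta (K n) (th n) /\ [/\ Pfun (th n) (s' n) (J' n),
    (forall x, `|th n x| <= 8 * delta),
    (forall x, `|x| <= n%:R -> th n x = 0) &
    (forall x, `|x| <= n%:R -> J' n x = 0)].
Proof.
have ex n : exists q : (R -> R) * (R -> R) * (R -> R),
  band delta (K n) q.1.1 /\ [/\ Pfun q.1.1 q.1.2 q.2,
    (forall x, `|q.1.1 x| <= 8 * delta),
    (forall x, `|x| <= n%:R -> q.1.1 x = 0) &
    (forall x, `|x| <= n%:R -> q.2 x = 0)].
  have hK : 4 * delta <= K n by rewrite lerDl.
  have [th [s' [J' [a1 a2 a3 a4 a5]]]] := exists_band d0 hK.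
  have E : K n - 4 * delta = n%:R by rewrite /K; ring.
  by exists (th, s', J'); split => //; split => // x hx; [apply: a4|apply: a5]; rewrite E.
have [q hq] := choice ex.
by exists (fun n => (q n).1.1), (fun n => (q n).1.2), (fun n => (q n).2).
Qed.

Let A1 n := \int[P]_y (fu y * S (U y - trunc (K n) (V y))).
Let A2 n := \int[P]_y (fv y * S' (V y - trunc (K n) (U y))).

Let mW11 : measurable_fun setT (fun y : (RT * RT) * (X * X) => y.1.1).
Proof. exact: (measurableT_comp measurable_fst measurable_fst). Qed.
Let mW12 : measurable_fun setT (fun y : (RT * RT) * (X * X) => y.1.2).
Proof. exact: (measurableT_comp measurable_snd measurable_fst). Qed.

Let mbandE g (g0 : X -> R) w (hw : esol g g0 w) n (th : nat -> R -> R) : continuous (th n) ->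
  measurable_fun setT (fun y : RT * (X * X) => bandE w th n y.1 y.2).
Proof.
move=> cth; have mth := cts_mfun cth.
have m1 : measurable_fun setT (fun y : RT * (X * X) => y.2.1).
  exact: (measurableT_comp measurable_fst measurable_snd).
have m2' : measurable_fun setT (fun y : RT * (X * X) => y.2.2).
  exact: (measurableT_comp measurable_snd measurable_snd).
have mw := ig_mfun (es_u hw).
have h1 : measurable_fun setT (fun y : RT * (X * X) => w y.2.1 y.1).
  exact: (measurable_comp2 mw).
have h2 : measurable_fun setT (fun y : RT * (X * X) => w y.2.2 y.1).
  exact: (measurable_comp2 mw).
apply: measurable_funM; first exact: (measurableT_comp mrho).
apply: measurable_funM; last exact: (measurableT_comp mkap).
apply: measurable_funM; first exact: measurable_funB.
by apply: measurable_funB; exact: (measurableT_comp mth).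
Qed.

Let band_ge0 w n (th : nat -> R -> R) k : band delta k (th n) ->
  forall t z, 0 <= bandE w th n t z.
Proof.
move=> [_ hm _ _] t z; apply: mulr_ge0 => //; apply: mulr_ge0 => //.
have [ab|ab] := leP (w z.1 t) (w z.2 t).
  by have /andP[h1 _] := hm _ _ ab; nra.
by have /andP[h1 _] := hm _ _ (ltW ab); nra.
Qed.

Let band_W w n (th : nat -> R -> R) (e : R) :
  measurable_fun setT (fun y : RT * (X * X) => bandE w th n y.1 y.2) ->
  (forall t z, 0 <= bandE w th n t z) ->
  (\int[mu]_t \int[pm m m]_z (bandE w th n t z)%:E <= e%:E)%E ->
  (\int[mu]_r \int[mu]_t \int[pm m m]_z (rho r * bandE w th n t z)%:E <= e%:E)%E.
Proof.
move=> mb b0 le.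
have mbE : measurable_fun setT (fun y : RT * (X * X) => (bandE w th n y.1 y.2)%:E).
  exact/measurable_EFinP.
have mF := measurable_fun_fubini_tonelli_F (m2 := pm m m) _ mbE (fun y => b0 y.1 y.2).
have F0 t : (0 <= \int[pm m m]_z (bandE w th n t z)%:E)%E.
  by apply: integral_ge0 => z _; rewrite lee_fin.
apply: le_trans le.
have -> : (\int[mu]_r \int[mu]_t \int[pm m m]_z (rho r * bandE w th n t z)%:E =
    \int[mu]_r ((rho r)%:E * \int[mu]_t \int[pm m m]_z (bandE w th n t z)%:E))%E.
  apply: eq_integral => r _; rewrite -ge0_integralZl//; last by rewrite lee_fin.
  apply: eq_integral => t _; rewrite -ge0_integralZl//; last 3 first.
  - exact: (measurableT_comp mbE (pair1_measurable t)).
  - by move=> z _; rewrite lee_fin.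
  - by rewrite lee_fin.
rewrite ge0_integralZr//; last 3 first.
- exact/measurable_EFinP.
- by move=> r _; rewrite lee_fin.
- by apply: integral_ge0 => t _; exact: F0.
by rewrite -EFin_int// int_moll// mul1e.
Qed.

Let step_n : exists2 e : nat -> R, e n @[n --> \oo] --> 0 &
  forall n, 0 <= 2 * (A1 n + A2 n + D * K1 * (delta / 2 * N0)) + 4 * e n.
Proof.
have [th [s' [J' hth]]] := exth.
have hth1 n : band delta (K n) (th n) by have [] := hth n.
have [eu eu0 heu] := energy_decay hu (fun n => proj2 (hth n)).
have [ev ev0 hev] := energy_decay hv (fun n => proj2 (hth n)).
exists (fun n => eu n + ev n); first by rewrite -(addr0 0); exact: cvgD.
move=> n.
pose pu (x : X) (r : R) := trunc (K n) (v x r).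
pose pv (x : X) (r : R) := trunc (K n) (u x r).
have mpu : measurable_fun setT (fun z : X * RT => pu z.1 z.2).
  exact: (measurableT_comp (mtr _) (ig_mfun (es_u hv))).
have mpv : measurable_fun setT (fun z : X * RT => pv z.1 z.2).
  exact: (measurableT_comp (mtr _) (ig_mfun (es_u hu))).
have bpu x r : `|pu x r| <= K n by apply: trunc_le; exact: ltW.
have bpv x r : `|pv x r| <= K n by apply: trunc_le; exact: ltW.
have opu x r : ~ Om x -> pu x r = 0 by move=> hx; rewrite /pu (es_offx hv)// truncz.
have opv x r : ~ Om x -> pv x r = 0 by move=> hx; rewrite /pv (es_offx hu)// truncz.
have Kd0 : 0 < K n + delta by rewrite addr_gt0.
have nu := half_neg hu hP mpu bpu (es_en hv (K0 n)) Kd0 (hneg (hth1 n)).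
have nv := half_neg hv hP' mpv bpv (es_en hu (K0 n)) Kd0 (hneg' (hth1 n)).
have du := half_doubling hu hP bS decu mpu bpu opu (es_en hv (K0 n)) Kd0 (hneg (hth1 n)).
have dv := half_doubling hv hP' bS' decv mpv bpv opv (es_en hu (K0 n)) Kd0 (hneg' (hth1 n)).
have mQu := measurable_dblQ hu hP mpu.
have mQv' := measurable_dblQ hv hP' mpv.
pose F1 (y : RT * RT * (X * X)) := dblQ u S pu y.1.2 y.1.1 y.2.
pose F2 (y : RT * RT * (X * X)) := dblQ v S' pv y.1.1 y.1.2 y.2.
have mF1 : measurable_fun setT F1 by exact: mQu.
have mF2 : measurable_fun setT F2.
  apply: (measurableT_comp mQv' (_ : measurable_fun setT
    (fun y : RT * RT * (X * X) => ((y.1.2, y.1.1), y.2)))).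
  by apply: measurable_fun_pair => //; exact: measurable_fun_pair.
pose G1 (y : RT * RT * (X * X)) := rho y.1.2 * bandE u th n y.1.1 y.2.
pose G2 (y : RT * RT * (X * X)) := rho y.1.1 * bandE v th n y.1.2 y.2.
have cth : continuous (th n) by have [_ [/Pfun_contS]] := hth n.
have mbu := mbandE hu cth; have mbv := mbandE hv cth.
have mG1 : measurable_fun setT G1.
  apply: measurable_funM; first exact: (measurableT_comp mrho).
  apply: (measurableT_comp mbu (_ : measurable_fun setT
    (fun y : RT * RT * (X * X) => (y.1.1, y.2)))).
  exact: measurable_fun_pair.
have mG2 : measurable_fun setT G2.
  apply: measurable_funM; first exact: (measurableT_comp mrho).
  apply: (measurableT_comp mbv (_ : measurable_fun setT
    (fun y : RT * RT * (X * X) => (y.1.2, y.2)))).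
  exact: measurable_fun_pair.
have bu0 := band_ge0 u (hth1 n); have bv0 := band_ge0 v (hth1 n).
have E3r (F : RT * RT * (X * X) -> R) : measurable_fun setT F -> (forall y, 0 <= F y) ->
    (\int[mu]_r \int[mu]_t \int[pm m m]_z (F ((t, r), z))%:E =
     \int[pm (pm mu mu) (pm m m)]_y (F y)%:E)%E.
  move=> mF F0.
  apply: (@tonelli3r _ _ _ _ _ _ _ mu mu (pm m m) (fun y => (F y)%:E)).
    exact/measurable_EFinP.
  by move=> y; rewrite lee_fin.
have E3l (F : RT * RT * (X * X) -> R) : measurable_fun setT F -> (forall y, 0 <= F y) ->
    (\int[mu]_t \int[mu]_r \int[pm m m]_z (F ((t, r), z))%:E =
     \int[pm (pm mu mu) (pm m m)]_y (F y)%:E)%E.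
  move=> mF F0.
  apply: (@tonelli3l _ _ _ _ _ _ _ mu mu (pm m m) (fun y => (F y)%:E)).
    exact/measurable_EFinP.
  by move=> y; rewrite lee_fin.
have Pu := E3r _ (measurable_rpos mF1) (fun y => rpos_ge0 _).
have Nu := E3r _ (measurable_rneg mF1) (fun y => rneg_ge0 _).
have Pv := E3l _ (measurable_rpos mF2) (fun y => rpos_ge0 _).
have Nv := E3l _ (measurable_rneg mF2) (fun y => rneg_ge0 _).
have G10 y : 0 <= G1 y by apply: mulr_ge0.
have G20 y : 0 <= G2 y by apply: mulr_ge0.
have Eu := E3r _ mG1 G10; have Ev := E3l _ mG2 G20.
have gu := band_W mbu bu0 (heu n); have gv := band_W mbv bv0 (hev n).
rewrite /F1 /F2 /G1 /G2 /= in Pu Nu Pv Nv Eu Ev.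
rewrite Pu Nu in du; rewrite Pv Nv in dv; rewrite Nu in nu; rewrite Nv in nv.
rewrite Eu in gu; rewrite Ev in gv.
(* The reflected [S'] turns the integrand of [v] into the subtracted term of [energy_lower]; the
   weight is the nonnegative product of both mollifiers with [kap]. *)
have FG y : - (4 * (G1 y + G2 y)) <= F1 y + F2 y.
  pose c0 := rho y.1.1 * rho y.1.2 * kap y.2.
  have c00 : 0 <= c0 by rewrite /c0; apply: mulr_ge0 => //; exact: mulr_ge0.
  have := energy_lower hS (hth1 n) (u y.2.1 y.1.1) (u y.2.2 y.1.1) (v y.2.1 y.1.2) (v y.2.2 y.1.2).
  move/(ler_wpM2l c00); rewrite /F1 /F2 /G1 /G2 /bandE /dblQ /pairE /pu /pv /S' /c0 !opprB.
  by lra.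
have := int_combine mF1 mF2 mG1 mG2 G10 G20 FG nu nv du dv gu gv.
have [ifS _] := trunc_limit ifu mU mV (Pfun_contS hP) bS Kj.
have [ifS' _] := trunc_limit ifv mV mU (Pfun_contS hP') bS' Kj.
have [_ EA1] := fubini3r (ifS n); have [_ EA2] := fubini3l (ifS' n).
rewrite /= in EA1 EA2; rewrite /A1 /A2.
rewrite -EA1 -EA2 /fu /fv /U /V /=.
set a1 := \int[mu]_r \int[mu]_t \int[m]_x _.
set a2 := \int[mu]_r \int[mu]_t \int[m]_x _.
set b1 := \int[mu]_y \int[mu]_x \int[m]_z _.
set b2 := \int[mu]_x \int[mu]_y \int[m]_z _.
have -> : a1 = b1.
  apply: (int_ext mu) => r; apply: (int_ext mu) => t; apply: (int_ext m) => x.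
  by rewrite /pu !mulrA.
have -> : a2 = b2.
  apply: (int_ext mu) => r; apply: (int_ext mu) => t; apply: (int_ext m) => x.
  by rewrite /pv !mulrA.
exact: sum_bounds.
Qed.

(** The limit n to infinity at a fixed width delta: the bands lose their energy and the truncations
    disappear from the arguments of [S]. *)
Lemma doubling_step :
  0 <= \int[P]_y ((fu y - fv y) * S (U y - V y)) + D * K1 * (delta / 2 * N0).
Proof.
have [e e0' he] := step_n.
have [_ l1] := trunc_limit ifu mU mV (Pfun_contS hP) bS Kj.
have [_ l2] := trunc_limit ifv mV mU (Pfun_contS hP') bS' Kj.
set beta := D * _ * _ in he *.
have mS (b a : RT * RT * X -> R) : measurable_fun setT a -> measurable_fun setT b ->
    measurable_fun setT (fun y => S (a y - b y)).
  move=> ma mb; apply: (measurableT_comp (cts_mfun (Pfun_contS hP))).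
  exact: measurable_funB.
have i1 : ig P (fun y => fu y * S (U y - V y)).
  by apply: (ig_Mb (c := delta / 2)) ifu => //; exact: mS.
have i2 : ig P (fun y => fv y * S (U y - V y)).
  by apply: (ig_Mb (c := delta / 2)) ifv => //; exact: mS.
have E1 : \int[P]_y (fv y * S' (V y - U y)) = - \int[P]_y (fv y * S (U y - V y)).
  by rewrite -int_N//; apply: (int_ext P) => y; rewrite /S' opprB mulrN.
have -> : \int[P]_y ((fu y - fv y) * S (U y - V y)) =
    \int[P]_y (fu y * S (U y - V y)) + \int[P]_y (fv y * S' (V y - U y)).
  by rewrite E1 -int_B//; apply: (int_ext P) => y; rewrite mulrBl.
have l : 2 * (A1 n + A2 n + beta) + 4 * e n @[n --> \oo] -->
    2 * (\int[P]_y (fu y * S (U y - V y)) + \int[P]_y (fv y * S' (V y - U y)) + beta) + 4 * 0.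
  apply: cvgD; apply: cvgM => //; try exact: cvg_cst.
  by apply: cvgD; [exact: cvgD|exact: cvg_cst].
have := cvg_ge0 l he; rewrite mulr0 addr0 pmulr_rge0//.
Qed.

End step.

(** The limit delta to 0. The kernel error carries the same factor delta / 2 as the maximum of [S],
    so after division it is independent of delta while the quotient of [S] tends to the indicator of
    [V < U]; the inequality is strict because [S] vanishes at 0. *)
Lemma doubling_raw :
  0 <= \int[P]_y ((fu y - fv y) * (V y < U y)%R%:R) + D * K1 * N0.
Proof.
pose dl (n : nat) : R := n.+1%:R^-1.
have dl0 n : 0 < dl n by rewrite invr_gt0.
have ex n : exists S : R -> R, (exists s J, Pfun S s J) /\ sstep (dl n) (dl n / 2) S.
  by have [S [s [J [h1 h2]]]] := exists_sstep (dl0 n); exists S; split => //; exists s, J.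
have [S hS] := choice ex.
pose b n (y : RT * RT * X) := 2 / dl n * S n (U y - V y).
have b01 n y : 0 <= b n y <= 1.
  have [_ h2] := hS n; have D0 := dl0 n.
  have := sstep_ge0 h2 (U y - V y); have := sstep_leM h2 (U y - V y) => ha hb.
  apply/andP; split; first by apply: mulr_ge0 => //; rewrite divr_ge0// ltW.
  rewrite /b mulrAC ler_pdivrMr// mul1r; lra.
have mb n : measurable_fun setT (b n).
  have [[s [J h1]] _] := hS n; apply: measurable_funM => //.
  apply: (measurableT_comp (cts_mfun (Pfun_contS h1))); exact: measurable_funB.
have ifuv : ig P (fun y => fu y - fv y) by exact: igB.
have mi : measurable_fun setT (fun y => (V y < U y)%R%:R : R).
  have mlt : measurable_fun setT (fun y => (V y < U y)%R) by exact: measurable_fun_ltr.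
  rewrite (_ : (fun y => _) = (fun y => if (V y < U y)%R then 1 else 0)).
    by apply: measurable_fun_ifT.
  by apply/funext => y; case: ifP.
have mfuv := ig_mfun ifuv.
have cv y : (fu y - fv y) * b n y @[n --> \oo] --> (fu y - fv y) * (V y < U y)%R%:R.
  apply: cvgM; first exact: cvg_cst.
  have [UV|UV] := leP (U y) (V y).
    apply: cvg_near_cst; apply: nearW => n; rewrite /b.
    by have [_ [_ _ _ hz _]] := hS n; rewrite hz ?mulr0// subr_le0.
  apply: cvg_near_cst; near=> n; rewrite /b.
  have [_ [_ _ _ _ hz]] := hS n; rewrite hz.
    by have := dl0 n; rewrite lt0r => /andP[dn _]; rewrite -[RHS]/1; field.
  rewrite /dl invf_ple ?posrE ?subr_gt0//.
  apply: (@le_trans _ _ n%:R); last by rewrite ler_nat.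
  by near: n; exact: nbhs_infty_ger.
have ble n y : `|(fu y - fv y) * b n y| <= `|fu y - fv y|.
  rewrite normrM ler_piMr//; have /andP[b0 b1] := b01 n y.
  by rewrite ger0_norm.
have [_ l] := ig_DCT (fun n => measurable_funM mfuv (mb n)) (measurable_funM mfuv mi) cv
  (ig_abs ifuv) ble.
have h0 n : 0 <= \int[P]_y ((fu y - fv y) * b n y) + D * K1 * N0.
  have [[s [J h1]] h2] := hS n.
  have hd := doubling_step h1 h2; have D0 := dl0 n.
  have ii : ig P (fun y => (fu y - fv y) * S n (U y - V y)).
    have mSn : measurable_fun setT (fun y => S n (U y - V y)).
      have mSn0 : measurable_fun [set: RT] (S n : RT -> RT) := cts_mfun (Pfun_contS h1).
      exact: (measurableT_comp mSn0 (measurable_funB mU mV)).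
    apply: (ig_Mb (c := dl n / 2)) ifuv => // y.
    by rewrite ger0_norm ?(sstep_ge0 h2)// (sstep_leM h2).
  have -> : \int[P]_y ((fu y - fv y) * b n y) =
      2 / dl n * \int[P]_y ((fu y - fv y) * S n (U y - V y)).
    by rewrite -int_Z//; apply: (int_ext P) => y; rewrite /b mulrCA.
  have -> : D * K1 * N0 = 2 / dl n * (D * K1 * (dl n / 2 * N0)).
    by have := D0; rewrite lt0r => /andP[dn _]; field.
  by rewrite -mulrDr; apply: mulr_ge0 => //; rewrite divr_ge0// ltW.
apply: (cvg_ge0 (g := fun n => \int[P]_y ((fu y - fv y) * b n y) + D * K1 * N0) _ h0).
by apply: cvgD; [exact: l|exact: cvg_cst].
Unshelve. all: by end_near. Qed.

Lemma doubling : 0 <= \int[pm (pm mu mu) m]_y (moll eps (y.1.1 - c) * moll eps (y.1.2 - c) *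
    ((f y.2 y.1.1 - wlag mm (dg u u0) y.2 y.1.1) -
     (h y.2 y.1.2 - wlag mm (dg v v0) y.2 y.1.2)) *
    (v y.2 y.1.2 < u y.2 y.1.1)%R%:R) +
  D * (\int[mu]_t `|kk t - kk2 kk mm t|) *
  (\int[pm m mu]_z `|dg u u0 z.1 z.2| + \int[pm m mu]_z `|dg v v0 z.1 z.2|).
Proof.
have := doubling_raw; rewrite /K1 /N0 => h0; apply: (le_trans h0); apply: lerD => //.
rewrite le_eqVlt; apply/orP; left; apply/eqP; apply: (int_ext P) => y.
by rewrite /fu /fv /wu /wv /rho; congr (_ * _); ring.
Qed.

End doubling.

End time_localized.

End esol.

(** * Volterra inequalities with a non-increasing kernel *)

Section volterra.
Context (R : realType).
Local Notation mu := (@lebesgue_measure R).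
Local Notation RT := (measurableTypeR R).

Lemma int_leq d (Y : measurableType d) (n : {measure set Y -> \bar R}) (f g : Y -> R) :
  (forall x, f x = g x) -> \int[n]_x f x <= \int[n]_x g x.
Proof. by move=> fg; rewrite le_eqVlt; apply/orP; left; apply/eqP; exact: int_ext. Qed.

Lemma ae_neq (a : R) : {ae mu, forall t, t != a}.
Proof.
exists [set a]; split; [exact: measurable_set1|exact: lebesgue_measure_set1|].
by move=> t /= /negP; rewrite negbK => /eqP.
Qed.

Lemma ae_sub (P Q : R -> Prop) : (forall t, P t -> Q t) ->
  {ae mu, forall t, P t} -> {ae mu, forall t, Q t}.
Proof. by move=> PQ; exact: (@filterS _ _ (ae_filter_ringOfSetsType mu) _ _ PQ). Qed.

Lemma ae_sub2 (P Q W : R -> Prop) : (forall t, P t -> Q t -> W t) ->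
  {ae mu, forall t, P t} -> {ae mu, forall t, Q t} -> {ae mu, forall t, W t}.
Proof. by move=> PQ; exact: (@filterS2 _ _ (ae_filter_ringOfSetsType mu) _ _ _ PQ). Qed.

Lemma null_itv (Z : set RT) (a : R) : measurable Z -> mu Z = 0%E ->
  (`]0, a[%classic : set RT) `<=` Z -> a <= 0.
Proof.
move=> mZ Z0 sub; rewrite leNgt; apply/negP => a0.
pose A : set RT := `]0, a[%classic.
have : (mu A <= mu Z)%E by apply: le_measure => //; rewrite inE //; exact: measurable_itv.
rewrite Z0 /A lebesgue_measure_itv /= lte_fin a0 lee_fin subr0; lra.
Qed.

Lemma iooB (a b t : R) : ioo a b t = (a < t < b)%R%:R.
Proof. by rewrite iooE indicE mem_setE in_itv. Qed.

Lemma int_le_ae d (Y : measurableType d) (n : {measure set Y -> \bar R}) (f g : Y -> R) :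
  ig n f -> ig n g -> {ae n, forall x, f x <= g x} ->
  \int[n]_x f x <= \int[n]_x g x.
Proof.
move=> iF iG h; pose M x := Num.max (f x) (g x).
have iM : ig n M.
  apply: (ig_le _ (igD (ig_abs iF) (ig_abs iG))).
    by apply: measurable_maxr; [exact: (ig_mfun iF)|exact: (ig_mfun iG)].
  move=> x; rewrite /M /Num.max; case: ifP => _; first by rewrite lerDr.
  by rewrite lerDl.
have h' : {ae n, forall x, M x = g x}.
  by apply: filterS h => x fg; rewrite /M max_r.
have [_ <-] := int_ae iM (ig_mfun iG) h'.
by apply: int_le => // x; rewrite /M le_max lexx.
Qed.

Lemma measurable_ltr1 (b : R) : measurable_fun [set: RT] (fun s : RT => (s < b)%R%:R : R).
Proof.
have mlt : measurable_fun [set: RT] (fun s : RT => (s < b)%R) by exact: measurable_fun_ltr.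
rewrite (_ : (fun y => _) = (fun y => if (y < b)%R then 1 else 0)).
  by apply: measurable_fun_ifT.
by apply/funext => y; case: ifP.
Qed.

Lemma ig_ltr1 (b : R) (g : R -> R) : ig mu g -> ig mu (fun s => (s < b)%R%:R * g s).
Proof.
apply: (ig_bM (c := 1)); first exact: measurable_ltr1.
by move=> x; case: (_ < _); rewrite ?normr1 ?normr0.
Qed.

Lemma ig_iooM (a b : R) (g : R -> R) : ig mu g -> ig mu (fun s => ioo a b s * g s).
Proof. by apply: (ig_bM (c := 1)); [exact: measurable_ioo|move=> x; exact: ioo_norm1]. Qed.

Definition prim (g : R -> R) (b : R) := \int[mu]_s ((s < b)%R%:R * g s).

Lemma int_ioo_prim (g : R -> R) (a b : R) : ig mu g -> a <= b ->
  \int[mu]_s (ioo a b s * g s) = prim g b - prim g a.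
Proof.
move=> ig0 ab; rewrite /prim -int_B; [|exact: ig_ltr1..].
have iD : ig mu (fun s => (s < b)%R%:R * g s - (s < a)%R%:R * g s).
  by apply: igB; exact: ig_ltr1.
suff h' : {ae mu, forall s, (s < b)%R%:R * g s - (s < a)%R%:R * g s = ioo a b s * g s}.
  by have [_ ->] := int_ae iD (ig_mfun (ig_iooM a b ig0)) h'.
apply: (ae_sub _ (ae_neq a)) => s sa; rewrite iooB -mulrBl; congr (_ * _).
have [sb|sb] := ltP s b; have [s1|s1] := ltP s a; rewrite ?andbT ?andbF /=.
- by rewrite subrr ltNge ltW.
- by rewrite subr0 lt_neqAle eq_sym sa s1.
- by move: (lt_le_trans s1 ab); rewrite ltNge sb.
- by rewrite subrr.
Qed.

Lemma int_ioo_refl (g : R -> R) (c a : R) : ig mu g -> 0 <= a ->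
  \int[mu]_s (ioo 0 a s * g (c - s)) = prim g c - prim g (c - a).
Proof.
move=> ig0 a0; rewrite -int_ioo_prim//; last by rewrite lerBlDr lerDl.
rewrite -(int_refl c (ig_iooM (c - a) c ig0)); apply: (int_ext mu) => s; congr (_ * _).
by rewrite !iooB; congr (nat_of_bool _)%:R; apply/andP/andP => -[h1 h2]; split; lra.
Qed.

(** The integrated form of d/dc int_(c-a)^c g = g(c) - g(c - a), which asks for no regularity of
    [g]. *)
Lemma lag_increment (g : R -> R) (c0 c1 a : R) : ig mu g -> c0 <= c1 -> 0 <= a ->
  \int[mu]_s (ioo 0 a s * g (c1 - s)) - \int[mu]_s (ioo 0 a s * g (c0 - s)) =
  \int[mu]_c (ioo c0 c1 c * (g c - g (c - a))).
Proof.
move=> ig0 c01 a0; rewrite !int_ioo_refl//.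
have -> : \int[mu]_c (ioo c0 c1 c * (g c - g (c - a))) =
    \int[mu]_c (ioo c0 c1 c * g c) - \int[mu]_c (ioo c0 c1 c * g (c - a)).
  rewrite -int_B; [|exact: ig_iooM|exact: ig_iooM (ig_shift a ig0)].
  by apply: (int_ext mu) => c; rewrite mulrBr.
have -> : \int[mu]_c (ioo c0 c1 c * g (c - a)) =
    \int[mu]_c (ioo (c0 - a) (c1 - a) c * g c).
  rewrite -(int_shift a (ig_iooM (c0 - a) (c1 - a) ig0)); apply: (int_ext mu) => c.
  by rewrite !iooB !ltrD2r.
rewrite !int_ioo_prim ?lerD2r//; ring.
Qed.

Lemma ig_conv (k g : R -> R) : ig mu k -> ig mu g ->
  ig (pm mu mu) (fun z => k z.2 * g (z.1 - z.2)) /\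
  \int[pm mu mu]_z `|k z.2 * g (z.1 - z.2)| = (\int[mu]_t `|k t|) * \int[mu]_t `|g t|.
Proof.
move=> ik igg.
have mk := ig_mfun ik; have mg := ig_mfun igg.
have mF : measurable_fun setT (fun z : RT * RT => k z.2 * g (z.1 - z.2)).
  apply: measurable_funM; first exact: (measurableT_comp mk).
  by apply: (measurableT_comp mg); exact: measurable_funB.
have mFn : measurable_fun setT (fun z : RT * RT => `|k z.2 * g (z.1 - z.2)|%:E).
  by apply/measurable_EFinP; exact: measurableT_comp.
have E : (\int[pm mu mu]_z `|k z.2 * g (z.1 - z.2)|%:E =
    ((\int[mu]_t `|k t|) * \int[mu]_t `|g t|)%:E)%E.
  rewrite (fubini_tonelli2 _ mFn); last by move=> z; rewrite lee_fin.
  rewrite EFinM !EFin_int; [|exact: ig_abs..].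
  rewrite -ge0_integralZr//; last 2 first.
  - by apply/measurable_EFinP; exact: measurableT_comp.
  - exact: integral_ge0.
  apply: eq_integral => r _; rewrite /fubini_G /=.
  under eq_integral do rewrite normrM EFinM.
  have mgn : measurable_fun [set: RT] (fun t : RT => `|g t|%:E).
    by apply/measurable_EFinP; exact: measurableT_comp.
  rewrite ge0_integralZl//; last exact: (measurable_shift (r : R) mgn).
  congr (_ * _)%E.
  by rewrite (ge0_integral_shift r (f := fun t => `|g t|%:E)).
have iF : ig (pm mu mu) (fun z => k z.2 * g (z.1 - z.2)).
  by apply: (ig_fin mF); rewrite E ltry.
by split => //; apply/EFin_inj; rewrite EFin_int//; exact: ig_abs.
Qed.

Lemma ig_conv1 (k g : R -> R) : ig mu k -> ig mu g ->
  ig mu (fun t => \int[mu]_s (k s * g (t - s))) /\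
  \int[mu]_t `|\int[mu]_s (k s * g (t - s))| <= (\int[mu]_t `|k t|) * \int[mu]_t `|g t|.
Proof.
move=> ik igg; have [i2 E2] := ig_conv ik igg; split; first exact: (ig_F1 i2).
rewrite -E2 -(int_F1 (ig_abs i2)).
have ia := ig_abs (ig_F1 i2); have ib := ig_F1 (ig_abs i2).
rewrite -lee_fin !EFin_int//; apply: ae_ge0_le_integral => //.
- by apply/measurable_EFinP; exact: ig_mfun ia.
- by move=> t _; rewrite lee_fin; exact: int_ge0.
- by apply/measurable_EFinP; exact: ig_mfun ib.
have h := ae_ig1 i2; apply: filterS h => t ht _; rewrite lee_fin; exact: int_norm ht.
Qed.

Section kernel.
Variables (T : R) (kk : R -> R).
Hypotheses (T0 : 0 < T) (kk_ig : ig mu kk) (kk_ge0 : forall t, 0 <= kk t)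
  (kk_supp : forall t, ~~ (0 < t < T) -> kk t = 0)
  (kk_mono : forall r t, 0 < r -> r <= t -> kk t <= kk r).

Let nn (n : nat) : R := n.+1%:R.
Let nn0 n : 0 < nn n. Proof. exact: ltr0Sn. Qed.

Lemma kk2_cvg : \int[mu]_t `|kk t - kk2 kk n.+1%:R t| @[n --> \oo] --> 0.
Proof.
have m1 n : measurable_fun [set: RT] (fun t => `|kk t - kk2 kk (nn n) t|).
  apply: measurableT_comp => //; apply: measurable_funB; first exact: (ig_mfun kk_ig).
  exact: (measurable_kk2 kk_ig).
have mz : measurable_fun [set: RT] (fun _ => 0 : R) by exact: measurable_cst.
have le n t : Num.norm (Num.norm (kk t - kk2 kk (nn n) t)) <= kk t.
  rewrite normr_id ger0_norm ?subr_ge0 ?kk2_lek// lerBlDr lerDl.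
  by rewrite /kk2 le_min kk_ge0 ltW.
have cv t : `|kk t - kk2 kk (nn n) t| @[n --> \oo] --> 0.
  apply: cvg_near_cst; near=> n.
  rewrite /kk2 (min_idPl _) ?subrr ?normr0//.
  apply: (@le_trans _ _ n%:R); last by rewrite ler_nat.
  by near: n; exact: nbhs_infty_ger.
have [_] := ig_DCT m1 mz cv kk_ig le.
by rewrite (_ : \int[mu]_x 0 = 0)// /Rintegral integral0.
Unshelve. all: by end_near. Qed.

Definition cvk (g : R -> R) (t : R) := \int[mu]_s (kk s * g (t - s)).

Lemma cvk_ig_bounded (g : R -> R) (B t : R) : ig mu g -> (forall s, `|g s| <= B) ->
  ig mu (fun s => kk s * g (t - s)).
Proof.
move=> ig0 gB; apply: (ig_Mb (c := B)) kk_ig => //.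
exact: (ig_mfun (ig_refl t ig0)).
Qed.

Lemma ig_layer (mm c : R) (g : R -> R) : ig mu g ->
  ig mu (fun l => ioo 0 mm l * \int[mu]_t (ioo 0 (lagt kk mm l) t * g (c - t))).
Proof.
move=> ig0.
have i2 : ig (pm mu mu) (fun z => ioo 0 (lagt kk mm z.1) z.2 * (ioo 0 mm z.1 * g (c - z.2))).
  apply: (ig_bM (c := 1)); first exact: (measurable_ioo_lagt kk_ig kk_supp).
    by move=> z; exact: ioo_norm1.
  exact: ig_tensor (ig_ioo 0 mm) (ig_refl c ig0).
have := ig_F1 i2; rewrite (_ : (fun l => _) = (fun l => ioo 0 mm l *
  \int[mu]_t (ioo 0 (lagt kk mm l) t * g (c - t))))//.
apply/funext => l /=; rewrite -int_Z; last exact: ig_iooM (ig_refl c ig0).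
by apply: (int_ext mu) => s; ring.
Qed.

(** [lag_increment] summed over the layers: an exact formula for the increments of the convolution
    with min(kk, mm), without any differentiation. *)
Lemma kk2_increment (mm : R) (g : R -> R) (B c0 c1 : R) : 0 < mm -> ig mu g ->
  (forall s, `|g s| <= B) -> c0 <= c1 ->
  \int[mu]_s (kk2 kk mm s * g (c1 - s)) - \int[mu]_s (kk2 kk mm s * g (c0 - s)) =
  \int[mu]_c (ioo c0 c1 c * \int[mu]_l (ioo 0 mm l * (g c - g (c - lagt kk mm l)))) /\
  ig mu (fun c => ioo c0 c1 c * \int[mu]_l (ioo 0 mm l * (g c - g (c - lagt kk mm l)))).
Proof.
move=> m0 ig0 gB c01.
have iF : ig (pm mu mu) (fun z => ioo c0 c1 z.1 *
    (ioo 0 mm z.2 * (g z.1 - g (z.1 - lagt kk mm z.2)))).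
  apply: (ig_bM (c := 1)).
  - exact: (measurableT_comp (measurable_ioo c0 c1)).
  - by move=> z; exact: ioo_norm1.
  have i1 : ig (pm mu mu) (fun z => g z.1 * ioo 0 mm z.2).
    exact: ig_tensor ig0 (ig_ioo 0 mm).
  have := igB i1 (ig_lag1 kk_ig kk_supp mm ig0).
  by under eq_fun do rewrite [g _ * _]mulrC -mulrBr.
have E1 c : \int[mu]_l (ioo c0 c1 c * (ioo 0 mm l * (g c - g (c - lagt kk mm l)))) =
    ioo c0 c1 c * \int[mu]_l (ioo 0 mm l * (g c - g (c - lagt kk mm l))).
  have il : ig mu (fun l => ioo 0 mm l * (g c - g (c - lagt kk mm l))).
    apply: (ig_Mb (c := B + B)) (ig_ioo 0 mm).
      apply: measurable_funB => //; apply: (measurableT_comp (ig_mfun ig0)).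
      by apply: measurable_funB => //; exact: (measurable_lagt kk_ig kk_supp).
    by move=> l; apply: le_trans (ler_normB _ _) _; exact: lerD.
  by rewrite int_Z.
split; last by have := ig_F1 iF; under eq_fun do rewrite E1.
rewrite !(layer_cake kk_ig kk_ge0 kk_supp kk_mono m0); [|exact: ig_refl..].
have igo c := ig_layer mm c ig0.
rewrite -int_B//.
have -> : \int[mu]_c (ioo c0 c1 c * \int[mu]_l (ioo 0 mm l * (g c - g (c - lagt kk mm l)))) =
   \int[mu]_c \int[mu]_l (ioo c0 c1 c * (ioo 0 mm l * (g c - g (c - lagt kk mm l)))).
  by apply: (int_ext mu) => c; rewrite E1.
rewrite (int_F1 iF) -(int_F2 iF); apply: (int_ext mu) => l /=.
rewrite -mulrBr lag_increment//; last exact: lagt_ge0.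
rewrite -int_Z; last first.
  by apply: ig_iooM; apply: igB => //; exact: ig_shift.
by apply: (int_ext mu) => c; ring.
Qed.

(** The limit of infinitely many layers. As [g] is bounded, the convolutions with the truncated
    kernels converge uniformly to [cvk g], and the errors [E n] are integrated away. *)
Lemma volterra_increment (g F : R -> R) (E : nat -> R -> R) (B a b c0 c1 : R) :
  ig mu g -> (forall s, `|g s| <= B) -> ig mu F -> (forall n, ig mu (E n)) ->
  (forall n c, 0 <= E n c) -> \int[mu]_c E n c @[n --> \oo] --> 0 ->
  (forall n, {ae mu, forall c, a < c < b ->
    \int[mu]_l (ioo 0 n.+1%:R l * (g c - g (c - lagt kk n.+1%:R l))) <= F c + E n c}) ->
  a <= c0 -> c0 <= c1 -> c1 <= b ->
  cvk g c1 - cvk g c0 <= \int[mu]_c (ioo c0 c1 c * F c).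
Proof.
move=> ig0 gB iF iE E0 Ecv h ac0 c01 c1b.
have err (n : nat) (c : R) : `|cvk g c - \int[mu]_s (kk2 kk (nn n) s * g (c - s))| <=
    B * \int[mu]_t `|kk t - kk2 kk (nn n) t|.
  have ik2 := ig_kk2 kk_ig kk_ge0 (nn0 n).
  have ik2g : ig mu (fun s => kk2 kk (nn n) s * g (c - s)).
    apply: (ig_Mb (c := B)) ik2 => //; exact: (ig_mfun (ig_refl c ig0)).
  have ikg := cvk_ig_bounded c ig0 gB.
  rewrite /cvk -int_B//; apply: (le_trans (int_norm (igB ikg ik2g))).
  have id := ig_abs (igB kk_ig ik2).
  rewrite -int_Z//; apply: int_le; [exact: ig_abs (igB ikg ik2g)|exact: igZ|].
  by move=> s; rewrite -mulrBl normrM mulrC ler_wpM2r.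
have B0 : 0 <= B by exact: le_trans (gB 0).
have step n : cvk g c1 - cvk g c0 <= \int[mu]_c (ioo c0 c1 c * F c) + \int[mu]_c E n c +
    2 * B * \int[mu]_t `|kk t - kk2 kk (nn n) t|.
  have := err n c1; have := err n c0.
  have [+ ii] := kk2_increment (nn0 n) ig0 gB c01.
  set q1 := \int[mu]_s (_ * g (c1 - s)); set q0 := \int[mu]_s (_ * g (c0 - s)).
  set w := \int[mu]_c (_ * \int[mu]_l _); move=> qE e0 e1.
  have w_le : w <= \int[mu]_c (ioo c0 c1 c * F c) + \int[mu]_c E n c.
    have iF' := ig_iooM c0 c1 iF.
    rewrite -int_D//; apply: int_le_ae => //; first exact: igD.
    apply: (ae_sub _ (h n)) => c hc.
    rewrite iooB; case: (boolP (c0 < c < c1)) => [/andP[h1 h2]|_].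
      rewrite !mul1r; apply: hc; apply/andP; split.
        exact: le_lt_trans ac0 h1.
      exact: lt_le_trans h2 c1b.
    by rewrite !mul0r add0r.
  move: e0 e1 qE w_le; rewrite !ler_norml => /andP[+ _] /andP[_].
  move: (\int[mu]_c (_ * F c)) (\int[mu]_c E n c) (\int[mu]_t _) w q0 q1 => y1 y2 y3 y4 y5 y6.
  rewrite -[2 * B * y3]mulrA; move: (B * y3) => y7; lra.
have l : \int[mu]_c (ioo c0 c1 c * F c) + \int[mu]_c E n c +
    2 * B * \int[mu]_t `|kk t - kk2 kk n.+1%:R t| @[n --> \oo] -->
    \int[mu]_c (ioo c0 c1 c * F c) + 0 + 2 * B * 0.
  apply: cvgD; first by apply: cvgD => //; exact: cvg_cst.
  by apply: cvgM; [exact: cvg_cst|exact: kk2_cvg].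
rewrite mulr0 !addr0 in l.
rewrite -(cvg_lim (@Rhausdorff R) l).
by apply: limr_ge; [exact: (cvgP _ l)|exact: nearW].
Qed.

(** * A maximum principle for the increments *)

Section comparison.
Variables (T1 : R) (nu : R -> R).
Hypotheses (T10 : 0 < T1) (inu : ig mu nu)
  (nu_off : forall t, t <= 0 -> nu t = 0)
  (nu_pos : {ae mu, forall t, 0 < t < T1 -> 0 <= cvk nu t}).

Let M := prim nu.

Let L (t : R) := ioo 0 T1 t * M t.
Let N (t : R) := rneg (L t).
Let B := \int[mu]_s `|nu s|.

Let M_le t : `|M t| <= B.
Proof.
apply: (le_trans (int_norm (ig_ltr1 t inu))); apply: int_le.
- exact: ig_abs (ig_ltr1 t inu).
- exact: ig_abs.
- by move=> s; rewrite normrM ler_piMl//; case: (_ < _); rewrite ?normr1 ?normr0.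
Qed.

Let M0 t : t <= 0 -> M t = 0.
Proof.
move=> t0; rewrite /M /prim; transitivity (\int[mu]_s (0 : R)).
  apply: (int_ext mu) => s; have [st|st] := ltP s t; last by rewrite mul0r.
  by rewrite nu_off ?mulr0// (le_trans (ltW st)).
by rewrite /Rintegral integral0.
Qed.

Let iL : ig mu L.
Proof.
have i2 : ig (pm mu mu) (fun z => (z.2 < z.1)%R%:R * (ioo 0 T1 z.1 * nu z.2)).
  apply: (ig_bM (c := 1)); last exact: ig_tensor (ig_ioo 0 T1) inu.
    have mlt : measurable_fun setT (fun s : RT * RT => (s.2 < s.1)%R) by exact: measurable_fun_ltr.
    rewrite (_ : (fun y => _) = (fun y => if (y.2 < y.1)%R then 1 else 0)).
      by apply: measurable_fun_ifT.
    by apply/funext => y; case: ifP.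
  by move=> z; case: (_ < _); rewrite ?normr1 ?normr0.
have := ig_F1 i2; rewrite (_ : (fun t => _) = L)//.
apply/funext => t /=; rewrite /L /M /prim -int_Z; last exact: ig_ltr1.
by apply: (int_ext mu) => s; ring.
Qed.

Let L_le t : `|L t| <= B.
Proof. by rewrite /L normrM (le_trans _ (M_le t))// ler_piMl// ioo_norm1. Qed.

Let N_le t : `|N t| <= `|L t|.
Proof. by rewrite /N /rneg ger0_norm ?le_max ?lexx ?orbT// ge_max normr_ge0 andbT -normrN ler_norm. Qed.

Let iN : ig mu N.
Proof. by apply: (ig_le (measurable_rneg (ig_mfun iL)) (ig_abs iL)) => t; exact: N_le. Qed.

Let N_off t : ~~ (0 < t < T1) -> N t = 0.
Proof. by move=> h; rewrite /N /L ioo0// mul0r /rneg oppr0 maxxx. Qed.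

Let E (n : nat) (c : R) := `|\int[mu]_s ((kk s - kk2 kk (nn n) s) * nu (c - s))|.

Let ikd n : ig mu (fun s => kk s - kk2 kk (nn n) s).
Proof. exact: igB kk_ig (ig_kk2 kk_ig kk_ge0 (nn0 n)). Qed.

Let iE n : ig mu (E n).
Proof. by apply: ig_abs; have [] := ig_conv1 (ikd n) inu. Qed.

Let E_cvg : \int[mu]_c E n c @[n --> \oo] --> 0.
Proof.
apply: (@squeeze_cvgr _ _ _ _ (fun _ => 0) (fun n => (\int[mu]_t `|kk t - kk2 kk n.+1%:R t|) * B)).
- apply: nearW => n; rewrite int_ge0 /=; last by move=> x; exact: normr_ge0.
  by have [_] := ig_conv1 (ikd n) inu.
- exact: cvg_cst.
rewrite [X in _ --> X](_ : 0 = 0 * B); last by rewrite mul0r.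
by apply: cvgM; [exact: kk2_cvg|exact: cvg_cst].
Qed.

(** By [layer_cake], the increments of the primitive [M] sum up to the convolution of [kk2] with
    [nu], which is at least [- E n c] because [cvk nu c] is nonnegative. Where [M c < 0], the
    increments of [N], the negative part of [M], are at most minus those of [M]; where [M c >= 0]
    they are nonpositive, since [N c] vanishes. *)
Let kato_neg n : {ae mu, forall c, 0 < c < T1 ->
  \int[mu]_l (ioo 0 n.+1%:R l * (N c - N (c - lagt kk n.+1%:R l))) <= 0 + E n c}.
Proof.
have [iC _] := ig_conv kk_ig inu; have aeC := ae_ig1 iC.
apply: (ae_sub2 _ aeC nu_pos) => c /= ic hpos cT; rewrite add0r -/(nn n).
have [c0 c1] := andP cT.
have il : ig mu (fun l => ioo 0 (nn n) l * (N c - N (c - lagt kk (nn n) l))).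
  apply: (ig_Mb (c := B + B)) (ig_ioo 0 (nn n)).
    apply: measurable_funB => //; apply: (measurableT_comp (ig_mfun iN)).
    by apply: measurable_funB => //; exact: (measurable_lagt kk_ig kk_supp).
  by move=> l; apply: le_trans (ler_normB _ _) _; apply: lerD; exact: le_trans (N_le _) (L_le _).
have LE : L c = M c by rewrite /L ioo1// mul1r.
have [Mc|Mc] := leP 0 (M c).
  have z0 : \int[mu]_l (0 : R) = 0 by rewrite /Rintegral integral0.
  apply: (@le_trans _ _ 0); last exact: normr_ge0.
  rewrite -[leRHS]z0; apply: int_le => //; first exact: (ig0 mu).
  move=> l; rewrite [N c]/N LE /rneg max_r ?oppr_le0// sub0r mulrN oppr_le0.
  by rewrite mulr_ge0 ?ioo_ge0// le_max lexx orbT.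
have ic2 : ig mu (fun s => kk2 kk (nn n) s * nu (c - s)).
  apply: (ig_le _ (ig_abs ic)).
    apply: measurable_funM; first exact: (measurable_kk2 kk_ig).
    exact: (ig_mfun (ig_refl c inu)).
  move=> s; rewrite !normrM ler_wpM2r// (ger0_norm (kk_ge0 s)) ger0_norm ?kk2_lek//.
  by rewrite /kk2 le_min kk_ge0 ltW.
have iM : ig mu (fun l => ioo 0 (nn n) l * (M c - M (c - lagt kk (nn n) l))).
  have := ig_layer (nn n) c inu.
  rewrite (_ : (fun l => _) = (fun l => ioo 0 (nn n) l * (M c - M (c - lagt kk (nn n) l))))//.
  by apply/funext => l; rewrite int_ioo_refl// lagt_ge0.
apply: (@le_trans _ _ (- \int[mu]_l (ioo 0 (nn n) l * (M c - M (c - lagt kk (nn n) l))))).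
  rewrite -int_N//; apply: int_le => //; first exact: igN.
  move=> l; rewrite -mulrN ler_wpM2l ?ioo_ge0// opprB.
  have -> : N c = - M c by rewrite /N LE /rneg max_l// oppr_ge0 ltW.
  have a0 := lagt_ge0 kk (nn n) l.
  suff : - M (c - lagt kk (nn n) l) <= N (c - lagt kk (nn n) l) by lra.
  have [h|h] := leP (c - lagt kk (nn n) l) 0.
    by rewrite M0// N_off ?oppr0// ltNge h.
  by rewrite /N /L ioo1 ?mul1r ?/rneg ?le_max ?lexx// h; lra.
have -> : \int[mu]_l (ioo 0 (nn n) l * (M c - M (c - lagt kk (nn n) l))) =
    \int[mu]_s (kk2 kk (nn n) s * nu (c - s)).
  rewrite (layer_cake kk_ig kk_ge0 kk_supp kk_mono (nn0 n) (ig_refl c inu)).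
  by apply: (int_ext mu) => l; rewrite int_ioo_refl// lagt_ge0.
apply: le_trans (ler_norm _).
have -> : \int[mu]_s ((kk s - kk2 kk (nn n) s) * nu (c - s)) =
    cvk nu c - \int[mu]_s (kk2 kk (nn n) s * nu (c - s)).
  by rewrite /cvk -int_B//; apply: (int_ext mu) => s; rewrite mulrBl.
by have := hpos cT; lra.
Qed.

(** From [kato_neg], the convolution of [kk] with the negative part of [prim nu] is nonpositive at
    T1. It is an integral of a nonnegative function, so the integrand vanishes almost everywhere;
    [kk] being positive near 0, the negative part cannot be positive throughout an interval that
    ends at T1. *)
Lemma comparison (e : R) : 0 < e -> (exists2 k0, 0 < k0 & forall t, 0 < t < k0 -> 0 < kk t) ->
  exists2 t, T1 - e < t < T1 & 0 <= prim nu t.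
Proof.
move=> e0 [k0 k00 kpos]; apply: contrapT => hno.
have hneg t : T1 - e < t < T1 -> M t < 0.
  by move=> ht; rewrite ltNge; apply/negP => h; apply: hno; exists t.
have NB s : `|N s| <= B by exact: le_trans (N_le s) (L_le s).
have E00 n c : 0 <= E n c by exact: normr_ge0.
have := volterra_increment iN NB (ig0 mu) iE E00 E_cvg kato_neg (lexx 0) (ltW T10) (lexx T1).
have -> : \int[mu]_c (ioo 0 T1 c * 0) = 0.
  by under eq_Rintegral do rewrite mulr0; rewrite /Rintegral integral0.
have -> : cvk N 0 = 0.
  rewrite /cvk (_ : (fun s => _) = (fun _ => 0)); first by rewrite /Rintegral integral0.
  apply/funext => s; have [hs|hs] := boolP (0 < s < T); last by rewrite kk_supp ?mul0r.
  by have [s0 _] := andP hs; rewrite N_off ?mulr0// negb_and -leNgt; apply/orP; left; lra.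
rewrite subr0 => le0.
have iC := cvk_ig_bounded T1 iN NB.
have N0 s : 0 <= N s by rewrite le_max lexx orbT.
have C0 s : 0 <= kk s * N (T1 - s) by exact: mulr_ge0.
have eq0 : (\int[mu]_(s in setT) `|(kk s * N (T1 - s))%:E| = 0)%E.
  under eq_integral do rewrite gee0_abs ?lee_fin//.
  by rewrite -EFin_int//; congr EFin; apply/eqP; rewrite eq_le le0 int_ge0.
have := (ae_eq_integral_abs mu measurableT (measurable_int mu iC)).1 eq0.
(* For 0 < s < eta, [kk s] is positive, and T1 - s lies both in []T1 - e, T1[] and in []0, T1[]. *)
pose eta := Num.min (Num.min k0 e) T1.
have eta0 : 0 < eta by rewrite !lt_min k00 e0.
move=> [Z [mZ Z0 hZ]].
have sub : `]0, eta[%classic `<=` Z.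
  move=> s /=; rewrite in_itv /= !lt_min => /andP[s0 /andP[/andP[s1 s2] s3]].
  apply: hZ => /(_ I) /= h00; have /eqP : kk s * N (T1 - s) = 0 by case: h00.
  rewrite mulf_eq0 => /orP[/eqP h|/eqP h].
    by have := kpos s; rewrite s0 s1 h ltxx => /(_ isT).
  have hM := hneg (T1 - s); have hT : 0 < T1 - s < T1 by apply/andP; split; lra.
  move: h; rewrite /N /L ioo1// mul1r /rneg max_l.
    by have : T1 - e < T1 - s < T1 by [apply/andP; split; lra] => /hM; lra.
  by have : T1 - e < T1 - s < T1 by [apply/andP; split; lra] => /hM; lra.
by have := null_itv mZ Z0 sub; lra.
Qed.

End comparison.

(** The comparison is applied to [B * l - g], whose convolution with [kk] is B minus that of [g].
    The identity for [l] also shows that [kk] is positive near 0. *)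
Lemma volterra_bound (T1 B e : R) (g l : R -> R) : 0 < T1 -> T1 <= T -> 0 < e ->
  ig mu g -> (forall t, t <= 0 -> g t = 0) -> ig mu l -> (forall t, t <= 0 -> l t = 0) ->
  {ae mu, forall c, 0 < c < T -> cvk l c = 1} ->
  {ae mu, forall c, 0 < c < T1 -> cvk g c <= B} ->
  exists2 t, T1 - e < t < T1 & prim g t <= B * prim l t.
Proof.
move=> T10 T1T e0 ig0 g0 il l0 hl hg.
(* A non-increasing kernel without such a neighbourhood is identically 0; its convolution with [l]
   would be 0 instead of 1 on an interval of positive length. *)
have pos : exists2 k0, 0 < k0 & forall t, 0 < t < k0 -> 0 < kk t.
  apply: contrapT => hno.
  have kz t : kk t = 0.
    have [h|h] := boolP (0 < t < T); last exact: kk_supp.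
    have [t0 tT] := andP h; apply: contrapT => kt; apply: hno; exists t => // s /andP[s0 st].
    apply: lt_le_trans (kk_mono s0 (ltW st)).
    by rewrite lt_neqAle kk_ge0 andbT; apply/eqP => h'; apply: kt.
  have [Z [mZ Z0 hZ]] := hl.
  have sub : `]0, T[%classic `<=` Z.
    move=> s /=; rewrite in_itv /= => sT; apply: hZ => /= /(_ sT).
    rewrite /cvk; under eq_Rintegral do rewrite kz mul0r.
    by rewrite /Rintegral integral0 /= => /eqP; rewrite eq_sym oner_eq0.
  by have := null_itv mZ Z0 sub; have := T0; lra.
pose nu t := B * l t - g t.
have inu : ig mu nu by apply: igB => //; exact: igZ.
have nu0 t : t <= 0 -> nu t = 0 by move=> t0; rewrite /nu g0// l0// mulr0 subr0.
have [iCl _] := ig_conv kk_ig il; have [iCg _] := ig_conv kk_ig ig0.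
have h1 := ae_sub2 (fun t a b => conj a b) hl hg.
have h2 := ae_sub2 (fun t a b => conj a b) (ae_ig1 iCl) (ae_ig1 iCg).
have hp : {ae mu, forall t, 0 < t < T1 -> 0 <= cvk nu t}.
  apply: (ae_sub2 _ h1 h2) => c [hl1 hg1] [i1 i2] cT.
  have -> : cvk nu c = B * cvk l c - cvk g c.
    rewrite /cvk -int_Z// -int_B//; last exact: igZ.
    by apply: (int_ext mu) => s; rewrite /nu; ring.
  rewrite hl1 ?mulr1 ?subr_ge0; first exact: hg1.
  by have [c0 c1] := andP cT; rewrite c0 (lt_le_trans c1).
have [t ht pt] := comparison T10 inu nu0 hp e0 pos.
exists t => //; rewrite -subr_ge0; apply: (le_trans pt).
rewrite /prim -int_Z ?ig_ltr1// -int_B ?igZ ?ig_ltr1//.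
by apply: int_leq => s; rewrite /nu; ring.
Qed.

End kernel.

End volterra.

(** * The inequality for the mollified distance of two solutions *)

Lemma itv_near (R : realType) (T x c e : R) : - e <= x - c -> x - c <= e ->
  e < c < T - e -> 0 < x < T.
Proof. by move=> h1 h2 /andP[h3 h4]; apply/andP; split; lra. Qed.

Section sections.
Context (R : realType).

Lemma ae_imp d (Y : measurableType d) (n : {measure set Y -> \bar R}) (P Q : Y -> Prop) :
  (forall t, P t -> Q t) -> {ae n, forall t, P t} -> {ae n, forall t, Q t}.
Proof. by move=> PQ; exact: (@filterS _ _ (ae_filter_ringOfSetsType n) _ _ PQ). Qed.

Lemma ig_by_sections d1 d2 (T1 : measurableType d1) (T2 : measurableType d2)
    (m1 : {sigma_finite_measure set T1 -> \bar R})
    (m2 : {sigma_finite_measure set T2 -> \bar R}) (F : T1 * T2 -> R) (b : T1 -> R) :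
  measurable_fun setT F -> ig m1 b ->
  {ae m1, forall x, (\int[m2]_y `|F (x, y)|%:E <= (b x)%:E)%E} -> ig (pm m1 m2) F.
Proof.
move=> mF ib hb; pose b' x := Num.max (b x) 0.
have ib' : ig m1 b'.
  apply: (ig_le _ (ig_abs ib)); first exact: measurable_maxr (ig_mfun ib) (measurable_cst _).
  by move=> x; rewrite /b' /Num.max; case: ltP => // ?; rewrite normr0.
have mFn : measurable_fun setT (fun z : T1 * T2 => `|F z|%:E).
  by apply/measurable_EFinP; exact: measurableT_comp.
apply: (ig_fin mF); rewrite (fubini_tonelli1 _ mFn); last by move=> z; rewrite lee_fin.
apply: (@le_lt_trans _ _ (\int[m1]_x (b' x)%:E)%E); last by rewrite -EFin_int// ltry.
apply: ae_ge0_le_integral => //.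
- by move=> x _; exact: integral_ge0.
- by apply: (measurable_fun_fubini_tonelli_F _ mFn) => z; rewrite lee_fin.
- by move=> x _; rewrite lee_fin le_max lexx orbT.
- by apply/measurable_EFinP; exact: ig_mfun ib'.
apply: (ae_imp _ hb) => x hx _; apply: (le_trans hx).
by rewrite lee_fin le_max lexx.
Qed.

End sections.

(** * Integration over space and two times *)

Section two_times.
Context (R : realType) d (X : measurableType d).
Variable m : {sigma_finite_measure set X -> \bar R}.
Local Notation mu := (@lebesgue_measure R).
Local Notation RT := (measurableTypeR R).
Local Notation Y := (RT * RT * X)%type.

Definition P3 := pm (pm mu mu) m.

Lemma m3t : measurable_fun setT (fun y : Y => y.1.1).
Proof. exact: (measurableT_comp measurable_fst measurable_fst). Qed.

Lemma m3r : measurable_fun setT (fun y : Y => y.1.2).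
Proof. exact: (measurableT_comp measurable_snd measurable_fst). Qed.

Lemma mYt (a : X -> R -> R) : measurable_fun setT (fun z : X * RT => a z.1 z.2) ->
  measurable_fun setT (fun y : Y => a y.2 y.1.1).
Proof. by move=> ma; exact: (measurable_comp2 ma measurable_snd m3t). Qed.

Lemma mYr (a : X -> R -> R) : measurable_fun setT (fun z : X * RT => a z.1 z.2) ->
  measurable_fun setT (fun y : Y => a y.2 y.1.2).
Proof. by move=> ma; exact: (measurable_comp2 ma measurable_snd m3r). Qed.

(** Both times move together, so that the weight [w2] only changes its centre (see [w2_sh3]) and a
    lag of the solutions becomes a lag in [c]. *)
Definition sh3 (a : R) (y : Y) : Y := ((y.1.1 - a, y.1.2 - a), y.2).

Lemma measurable_sh3 : measurable_fun setT (fun z : Y * RT => sh3 z.2 z.1).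
Proof.
apply: measurable_fun_pair; last exact: (measurableT_comp measurable_snd measurable_fst).
apply: measurable_fun_pair; apply: measurable_funB => //.
  exact: (measurableT_comp m3t measurable_fst).
exact: (measurableT_comp m3r measurable_fst).
Qed.

Lemma measurable_sh3l a : measurable_fun setT (sh3 a).
Proof. exact: (measurableT_comp measurable_sh3 (pair2_measurable (a : RT))). Qed.

Lemma integral_sh3 (a : R) (f : Y -> \bar R) : measurable_fun setT f ->
  (forall y, 0 <= f y)%E -> (\int[P3]_y f (sh3 a y) = \int[P3]_y f y)%E.
Proof.
move=> mf f0.
have mfa : measurable_fun setT (fun y => f (sh3 a y)).
  exact: (measurableT_comp mf (measurable_sh3l a)).
rewrite -(@tonelli3l _ _ _ _ _ _ _ mu mu m _ mf f0).
rewrite -(@tonelli3l _ _ _ _ _ _ _ mu mu m _ mfa (fun y => f0 _)).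
have mF := measurable_fun_fubini_tonelli_F (m2 := m) _ mf f0.
pose G t := (\int[mu]_r \int[m]_x f ((t, r), x))%E.
have F0 y : (0 <= \int[m]_x f (y, x))%E by exact: integral_ge0.
have mG : measurable_fun [set: RT] G.
  exact: (measurable_fun_fubini_tonelli_F (m2 := mu) _ mF F0).
have G0 t : (0 <= G t)%E by apply: integral_ge0 => r _; exact: F0.
rewrite -[RHS](ge0_integral_shift a mG G0); apply: eq_integral => t _; rewrite /G.
have ms : measurable_fun [set: RT] (fun r : RT => (\int[m]_x f (((t - a)%R, r), x))%E).
  exact: (measurableT_comp mF (pair1_measurable (t - a : RT))).
by rewrite -[RHS](ge0_integral_shift a ms (fun r => F0 (t - a, r))).
Qed.

Lemma int_sh3 (a : R) (f : Y -> R) : ig P3 f -> (forall y, 0 <= f y) ->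
  \int[P3]_y f (sh3 a y) = \int[P3]_y f y.
Proof.
move=> iF f0; have mF := ig_mfun iF.
have iFa : ig P3 (fun y => f (sh3 a y)).
  by apply: (ig_lag_sec (sh := sh3)) iF; [exact: measurable_sh3|exact: integral_sh3].
apply/EFin_inj; rewrite !EFin_int//.
apply: (integral_sh3 a (f := fun y => (f y)%:E)); first exact/measurable_EFinP.
by move=> y; rewrite lee_fin.
Qed.

Lemma integral_tensor3l (g : X -> R -> R) (b : R -> R) :
  measurable_fun setT (fun z : X * RT => g z.1 z.2) -> measurable_fun [set: RT] (b : RT -> R) ->
  (forall x t, 0 <= g x t) -> (forall t, 0 <= b t) ->
  (\int[P3]_y (g y.2 y.1.1 * b y.1.2)%:E =
   (\int[pm m mu]_z (g z.1 z.2)%:E) * \int[mu]_r (b r)%:E)%E.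
Proof.
move=> mg mb g0 b0.
have mF : measurable_fun setT (fun y : Y => (g y.2 y.1.1 * b y.1.2)%:E).
  apply/measurable_EFinP; apply: measurable_funM; last exact: (measurableT_comp mb m3r).
  exact: (measurable_comp2 mg measurable_snd m3t).
rewrite -(@tonelli3r _ _ _ _ _ _ _ mu mu m _ mF); last by move=> y; rewrite lee_fin mulr_ge0.
have mgE : measurable_fun setT (fun z : X * RT => (g z.1 z.2)%:E) by exact/measurable_EFinP.
have mbE : measurable_fun [set: RT] (fun r => (b r)%:E) by exact/measurable_EFinP.
rewrite (fubini_tonelli2 _ mgE); last by move=> z; rewrite lee_fin.
have G0 t : (0 <= \int[m]_x (g x t)%:E)%E by apply: integral_ge0 => x _; rewrite lee_fin.
have mG : measurable_fun [set: RT] (fun t => (\int[m]_x (g x t)%:E)%E).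
  by apply: (measurable_fun_fubini_tonelli_G _ mgE) => z; rewrite lee_fin.
rewrite -ge0_integralZl//; last 2 first.
- by move=> r _; rewrite lee_fin.
- by apply: integral_ge0 => t _; exact: G0.
apply: eq_integral => r _.
transitivity (\int[mu]_t ((\int[m]_x (g x t)%:E) * (b r)%:E))%E; last first.
  by rewrite ge0_integralZr// lee_fin.
apply: eq_integral => t _; rewrite -ge0_integralZr//; last 3 first.
- exact: (measurableT_comp mgE (pair2_measurable (t : RT))).
- by move=> x _; rewrite lee_fin.
- by rewrite lee_fin.
Qed.

Lemma integral_tensor3r (g : X -> R -> R) (b : R -> R) :
  measurable_fun setT (fun z : X * RT => g z.1 z.2) -> measurable_fun [set: RT] (b : RT -> R) ->
  (forall x t, 0 <= g x t) -> (forall t, 0 <= b t) ->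
  (\int[P3]_y (g y.2 y.1.2 * b y.1.1)%:E =
   (\int[pm m mu]_z (g z.1 z.2)%:E) * \int[mu]_r (b r)%:E)%E.
Proof.
move=> mg mb g0 b0; rewrite -(integral_tensor3l mg mb g0 b0).
have mF : measurable_fun setT (fun y : Y => (g y.2 y.1.1 * b y.1.2)%:E).
  apply/measurable_EFinP; apply: measurable_funM; last exact: (measurableT_comp mb m3r).
  exact: (measurable_comp2 mg measurable_snd m3t).
have mF' : measurable_fun setT (fun y : Y => (g y.2 y.1.2 * b y.1.1)%:E).
  apply/measurable_EFinP; apply: measurable_funM; last exact: (measurableT_comp mb m3t).
  exact: (measurable_comp2 mg measurable_snd m3r).
rewrite -(@tonelli3r _ _ _ _ _ _ _ mu mu m _ mF); last by move=> y; rewrite lee_fin mulr_ge0.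
by rewrite -(@tonelli3l _ _ _ _ _ _ _ mu mu m _ mF')// => y; rewrite lee_fin mulr_ge0.
Qed.

Section weight.
Variable eps : R.
Hypothesis e0 : 0 < eps.
Let C := mollC R / eps.

Definition w2 (c : R) (y : Y) := moll eps (y.1.1 - c) * moll eps (y.1.2 - c).

Lemma w2_ge0 c y : 0 <= w2 c y.
Proof. by apply: mulr_ge0; exact: moll_ge0. Qed.

Lemma measurable_w2 : measurable_fun setT (fun z : RT * Y => w2 z.1 z.2).
Proof.
have mm := measurable_moll eps.
apply: measurable_funM; apply: (measurableT_comp mm); apply: measurable_funB => //.
  exact: (measurableT_comp m3t measurable_snd).
exact: (measurableT_comp m3r measurable_snd).
Qed.

Lemma measurable_w2l c : measurable_fun setT (w2 c).
Proof. exact: (measurableT_comp measurable_w2 (pair1_measurable (c : RT))). Qed.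

Lemma w2_sh3 c a y : w2 (c - a) (sh3 a y) = w2 c y.
Proof. by rewrite /w2 /sh3 /=; congr (moll _ _ * moll _ _); ring. Qed.

Lemma w2_supp c y : w2 c y != 0 ->
  (`|y.1.1 - c| <= eps) /\ (`|y.1.2 - c| <= eps).
Proof.
rewrite mulf_eq0 negb_or => /andP[h1 h2]; split; rewrite leNgt; apply/negP => h.
  by move: h1; rewrite moll_supp ?eqxx.
by move: h2; rewrite moll_supp ?eqxx.
Qed.

Let C0 : 0 <= C. Proof. exact: le_trans (moll_ge0 e0 0) (moll_le e0 0). Qed.

Lemma w2_normL (a : X -> R -> R) c : measurable_fun setT (fun z : X * RT => a z.1 z.2) ->
  (\int[P3]_y (w2 c y * `|a y.2 y.1.1|)%:E =
   \int[pm m mu]_z (moll eps (z.2 - c) * `|a z.1 z.2|)%:E)%E.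
Proof.
move=> ma; have mm := ig_mfun (ig_moll e0 c).
have mg : measurable_fun setT (fun z : X * RT => moll eps (z.2 - c) * `|a z.1 z.2|).
  apply: measurable_funM; first exact: (measurableT_comp mm).
  exact: measurableT_comp.
have := integral_tensor3l (g := fun x t => moll eps (t - c) * `|a x t|) mg mm
  (fun x t => mulr_ge0 (moll_ge0 e0 _) (normr_ge0 _)) (fun t => moll_ge0 e0 _).
rewrite -(EFin_int (ig_moll e0 c)) int_moll// mule1 => <-.
by apply: eq_integral => y _; rewrite /w2; congr EFin; ring.
Qed.

Lemma w2_normR (a : X -> R -> R) c : measurable_fun setT (fun z : X * RT => a z.1 z.2) ->
  (\int[P3]_y (w2 c y * `|a y.2 y.1.2|)%:E =
   \int[pm m mu]_z (moll eps (z.2 - c) * `|a z.1 z.2|)%:E)%E.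
Proof.
move=> ma; have mm := ig_mfun (ig_moll e0 c).
have mg : measurable_fun setT (fun z : X * RT => moll eps (z.2 - c) * `|a z.1 z.2|).
  apply: measurable_funM; first exact: (measurableT_comp mm).
  exact: measurableT_comp.
have := integral_tensor3r (g := fun x t => moll eps (t - c) * `|a x t|) mg mm
  (fun x t => mulr_ge0 (moll_ge0 e0 _) (normr_ge0 _)) (fun t => moll_ge0 e0 _).
rewrite -(EFin_int (ig_moll e0 c)) int_moll// mule1 => <-.
by apply: eq_integral => y _; rewrite /w2; congr EFin; ring.
Qed.

Lemma ig_mollM (a : X -> R -> R) c : ig (pm m mu) (fun z => a z.1 z.2) ->
  ig (pm m mu) (fun z => moll eps (z.2 - c) * `|a z.1 z.2|) /\
  \int[pm m mu]_z (moll eps (z.2 - c) * `|a z.1 z.2|) <= C * \int[pm m mu]_z `|a z.1 z.2|.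
Proof.
move=> ia; have mm := ig_mfun (ig_moll e0 c).
have i1 : ig (pm m mu) (fun z => moll eps (z.2 - c) * `|a z.1 z.2|).
  apply: (ig_bM (c := C)) (ig_abs ia); first exact: (measurableT_comp mm).
  by move=> z; rewrite ger0_norm ?moll_ge0//; exact: moll_le.
split => //; rewrite -int_Z; last exact: ig_abs.
apply: int_le => //; first by apply: igZ; exact: ig_abs.
by move=> z; rewrite ler_wpM2r//; exact: moll_le.
Qed.

(** Each of the two bounding functions depends on one time only, and the mollifier of the other time
    integrates to one. *)
Lemma w2_bound (G : Y -> R) (a b : X -> R -> R) c : measurable_fun setT G ->
  ig (pm m mu) (fun z => a z.1 z.2) -> ig (pm m mu) (fun z => b z.1 z.2) ->
  (forall y, `|G y| <= `|a y.2 y.1.1| + `|b y.2 y.1.2|) ->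
  [/\ ig P3 (fun y => w2 c y * G y),
    \int[P3]_y `|w2 c y * G y| <=
      \int[pm m mu]_z (moll eps (z.2 - c) * `|a z.1 z.2|) +
      \int[pm m mu]_z (moll eps (z.2 - c) * `|b z.1 z.2|) &
    (\int[P3]_y `|w2 c y * G y|%:E <=
      (C * (\int[pm m mu]_z `|a z.1 z.2| + \int[pm m mu]_z `|b z.1 z.2|))%:E)%E].
Proof.
move=> mG ia ib hG.
have [ia' la] := ig_mollM c ia; have [ib' lb] := ig_mollM c ib.
have mw := measurable_w2l c.
have mF : measurable_fun setT (fun y => w2 c y * G y) by exact: measurable_funM.
have ma1 : measurable_fun setT (fun y : Y => w2 c y * `|a y.2 y.1.1|).
  apply: measurable_funM => //; apply: measurableT_comp => //.
  exact: (measurable_comp2 (ig_mfun ia) measurable_snd m3t).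
have mb1 : measurable_fun setT (fun y : Y => w2 c y * `|b y.2 y.1.2|).
  apply: measurable_funM => //; apply: measurableT_comp => //.
  exact: (measurable_comp2 (ig_mfun ib) measurable_snd m3r).
have key : (\int[P3]_y `|w2 c y * G y|%:E <=
    (\int[pm m mu]_z (moll eps (z.2 - c) * `|a z.1 z.2|) +
     \int[pm m mu]_z (moll eps (z.2 - c) * `|b z.1 z.2|))%:E)%E.
  rewrite EFinD (EFin_int ia') (EFin_int ib') -(w2_normL c (ig_mfun ia)) -(w2_normR c (ig_mfun ib)).
  rewrite -ge0_int_D//; last 4 first.
  - exact/measurable_EFinP.
  - exact/measurable_EFinP.
  - by move=> y; rewrite lee_fin mulr_ge0 ?w2_ge0.
  - by move=> y; rewrite lee_fin mulr_ge0 ?w2_ge0.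
  apply: ge0_le_int.
  - by apply/measurable_EFinP; exact: measurableT_comp.
  - by apply: emeasurable_funD; exact/measurable_EFinP.
  - by move=> y; rewrite lee_fin.
  move=> y; rewrite -EFinD lee_fin normrM ger0_norm ?w2_ge0// -mulrDr.
  by rewrite ler_wpM2l// w2_ge0.
have iF : ig P3 (fun y => w2 c y * G y).
  by apply: (ig_fin mF); apply: le_lt_trans key _; rewrite ltry.
split => //; first by rewrite -lee_fin EFin_int//; exact: ig_abs.
by apply: (le_trans key); rewrite lee_fin mulrDr; exact: lerD.
Qed.

End weight.

End two_times.

(** * Kato's inequality for the increments *)

Section kato.
Context (R : realType) d (X : measurableType d).
Variable m : {sigma_finite_measure set X -> \bar R}.
Local Notation mu := (@lebesgue_measure R).
Local Notation RT := (measurableTypeR R).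
Local Notation Y := (RT * RT * X)%type.
Variables (Om : set X) (kap : X * X -> R) (T : R) (kk : R -> R).
Hypotheses (mkap : measurable_fun setT kap) (kap0 : forall z, 0 <= kap z).
Hypothesis T0 : 0 < T.
Hypotheses (kk_ig : ig mu kk) (kk_ge0 : forall t, 0 <= kk t)
  (kk_supp : forall t, ~~ (0 < t < T) -> kk t = 0)
  (kk_mono : forall r t, 0 < r -> r <= t -> kk t <= kk r).

(* The solution continued by its initial value to negative times (cut off at
   -2T, to remain integrable). *)
Definition extn (u : X -> R -> R) (u0 : X -> R) x t :=
  u x t + (ioo (- (2 * T)) T t * (1 - ioo 0 T t)) * u0 x.

Lemma ig_extn f u0 u : esol m Om kap T kk f u0 u ->
  ig (pm m mu) (fun z => extn u u0 z.1 z.2).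
Proof.
move=> hu; apply: igD; first exact: es_u hu.
have ij : ig mu (fun t => ioo (- (2 * T)) T t * (1 - ioo 0 T t)).
  apply: (ig_Mb (c := 1)) (ig_ioo _ _).
    by apply: measurable_funB => //; exact: measurable_ioo.
  by move=> t; rewrite iooB; case: (_ < _ < _); rewrite ?subrr ?subr0 ?normr0 ?normr1.
by have := ig_tensor (es_u0 hu) ij; under eq_fun do rewrite mulrC.
Qed.

(** The lags are at most T, so a lagged time never comes near the cut-off at -2T. For times up to 0
    both sides vanish. *)
Lemma extnE f u0 u : esol m Om kap T kk f u0 u -> forall x t, - (2 * T) < t < T ->
  dg T u u0 x t = extn u u0 x t - u0 x.
Proof.
move=> hu x t ht; rewrite /dg /extn (ioo1 ht) mul1r.
have [h|h] := boolP (0 < t < T); first by rewrite ioo1//; ring.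
by rewrite ioo0// (es_offt hu)//; ring.
Qed.

Section fixed_scale.
Variables (eps D : R).
Hypotheses (e0 : 0 < eps) (eT : eps < T)
  (hD : forall c t, `|derive1 (fun t => moll eps (t - c)) t| <= D).
Variables (f : X -> R -> R) (u0 : X -> R) (u : X -> R -> R).
Variables (h : X -> R -> R) (v0 : X -> R) (v : X -> R -> R).
Hypotheses (hu : esol m Om kap T kk f u0 u) (hv : esol m Om kap T kk h v0 v).

Let P := P3 m.
Let C := mollC R / eps.
Let ub := extn u u0.
Let vb := extn v v0.
Let iu : ig (pm m mu) (fun z => ub z.1 z.2). Proof. exact: ig_extn hu. Qed.
Let iv : ig (pm m mu) (fun z => vb z.1 z.2). Proof. exact: ig_extn hv. Qed.
Let w := @w2 R d X eps.

Definition Upos (y : Y) := rpos (ub y.2 y.1.1 - vb y.2 y.1.2).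
Definition Phi (c : R) := \int[P]_y (w c y * Upos y).
Definition Fpos (y : Y) := rpos (f y.2 y.1.1 - h y.2 y.1.2).
Definition Fc (c : R) := \int[P]_y (w c y * Fpos y).

Lemma rpos_le (x a b : R) : `|x| <= a + b -> `|rpos x| <= a + b.
Proof.
move=> le; rewrite ger0_norm ?rpos_ge0//; apply: le_trans le.
by rewrite /rpos ge_max ler_norm normr_ge0.
Qed.

Lemma measurable_Upos : measurable_fun setT Upos.
Proof.
apply: measurable_rpos; apply: measurable_funB.
  exact: (mYt (ig_mfun iu)).
exact: (mYr (ig_mfun iv)).
Qed.

Lemma Upos_le y : `|Upos y| <= `|ub y.2 y.1.1| + `|vb y.2 y.1.2|.
Proof. by apply: rpos_le; exact: ler_normB. Qed.

Lemma measurable_Fpos : measurable_fun setT Fpos.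
Proof.
apply: measurable_rpos; apply: measurable_funB.
  exact: (mYt (ig_mfun (es_f hu))).
exact: (mYr (ig_mfun (es_f hv))).
Qed.

Lemma Fpos_le y : `|Fpos y| <= `|f y.2 y.1.1| + `|h y.2 y.1.2|.
Proof. by apply: rpos_le; exact: ler_normB. Qed.

Let bPhi c := w2_bound e0 c measurable_Upos iu iv Upos_le.
Let bF c := w2_bound e0 c measurable_Fpos (es_f hu) (es_f hv) Fpos_le.

Let msh := @measurable_sh3 R d X.
Let hsh := @integral_sh3 R d X m.

Lemma Phi_shift c a : \int[P]_y (w c y * Upos (sh3 a y)) = Phi (c - a).
Proof.
have [i1 _ _] := bPhi (c - a).
rewrite /Phi -(int_sh3 a i1); first by apply: (int_ext P) => y; rewrite /w w2_sh3.
by move=> y; rewrite mulr_ge0 ?rpos_ge0// w2_ge0.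
Qed.

Section lag.
Variables (mm c : R).
Hypotheses (mm0 : 0 < mm) (hc : eps < c < T - eps).

Let A (l : R) := lagt kk mm l.
Let mA : measurable_fun [set: RT] (A : RT -> RT).
Proof. exact: (measurable_lagt kk_ig kk_supp). Qed.
Let A0 l : 0 <= A l. Proof. exact: lagt_ge0. Qed.
Let AT l : A l <= T. Proof. exact: (lagt_le T0 kk_ig kk_supp). Qed.

Let mshA : measurable_fun setT (fun z : RT * Y => sh3 (A z.1) z.2).
Proof.
apply: (measurableT_comp msh (_ : measurable_fun setT (fun z : RT * Y => (z.2, A z.1)))).
by apply: measurable_fun_pair => //; exact: (measurableT_comp mA).
Qed.

Let ig_lagged (G : Y -> R) (a b : X -> R -> R) : measurable_fun setT G ->
  ig (pm m mu) (fun z => a z.1 z.2) -> ig (pm m mu) (fun z => b z.1 z.2) ->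
  (forall y, `|G y| <= `|a y.2 y.1.1| + `|b y.2 y.1.2|) ->
  ig (pm mu P) (fun z => ioo 0 mm z.1 * (w c z.2 * G (sh3 (A z.1) z.2))).
Proof.
move=> mG ia ib hG.
set K := C * (\int[pm m mu]_z `|a z.1 z.2| + \int[pm m mu]_z `|b z.1 z.2|).
have mF : measurable_fun setT (fun z : RT * Y => w c z.2 * G (sh3 (A z.1) z.2)).
  apply: measurable_funM; last exact: (measurableT_comp mG mshA).
  exact: (measurableT_comp (@measurable_w2l R d X eps c) measurable_snd).
apply: (ig_by_sections (b := fun l : RT => K * ioo 0 mm l)).
- apply: measurable_funM => //; exact: (measurableT_comp (measurable_ioo 0 mm)).
- by apply: igZ; exact: ig_ioo.
apply/aeW => l /=; under eq_integral do rewrite normrM EFinM (ger0_norm (ioo_ge0 _ _ _)).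
have ml : measurable_fun setT (fun y : Y => w c y * G (sh3 (A l) y)).
  exact: (measurableT_comp mF (pair1_measurable (l : RT))).
rewrite ge0_integralZl//; last 2 first.
- by apply/measurable_EFinP; exact: measurableT_comp.
- by rewrite lee_fin ioo_ge0.
rewrite mulrC EFinM lee_wpmul2l ?lee_fin ?ioo_ge0//.
have [i1 _ le1] := w2_bound e0 (c - A l) mG ia ib hG.
have mn : measurable_fun setT (fun y : Y => `|w2 eps (c - A l) y * G y|%:E).
  by apply/measurable_EFinP; apply: measurableT_comp => //; exact: ig_mfun i1.
have := hsh (A l) mn (fun y => normr_ge0 _) => E.
apply: le_trans le1; rewrite -E le_eqVlt; apply/orP; left; apply/eqP.
by apply: eq_integral => y _; rewrite w2_sh3.
Qed.

Let iH : ig (pm mu P) (fun z => ioo 0 mm z.1 * (w c z.2 * (Upos z.2 - Upos (sh3 (A z.1) z.2)))).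
Proof.
have i2 := ig_lagged measurable_Upos iu iv Upos_le.
have [i1 _ _] := bPhi c.
have i0 := ig_tensor (ig_ioo 0 mm) i1.
have := igB i0 i2; rewrite (_ : (fun x => _) = (fun z : RT * Y => ioo 0 mm z.1 *
  (w c z.2 * (Upos z.2 - Upos (sh3 (A z.1) z.2)))))//.
by apply/funext => z; rewrite /w; ring.
Qed.

Let gu := dg T u u0.
Let gv := dg T v v0.
Let igu : ig (pm m mu) (fun z => gu z.1 z.2). Proof. exact: (ig_dg hu). Qed.
Let igv : ig (pm m mu) (fun z => gv z.1 z.2). Proof. exact: (ig_dg hv). Qed.
Let G0 (y : Y) := gu y.2 y.1.1 - gv y.2 y.1.2.
Let one (y : Y) : R := (v y.2 y.1.2 < u y.2 y.1.1)%R%:R.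

Let mG0 : measurable_fun setT G0.
Proof.
apply: measurable_funB.
  exact: (mYt (ig_mfun igu)).
exact: (mYr (ig_mfun igv)).
Qed.

Let G0_le y : `|G0 y| <= `|gu y.2 y.1.1| + `|gv y.2 y.1.2|.
Proof. exact: ler_normB. Qed.

Let mone : measurable_fun setT one.
Proof.
have mU : measurable_fun setT (fun y : Y => u y.2 y.1.1).
  exact: (mYt (ig_mfun (es_u hu))).
have mV : measurable_fun setT (fun y : Y => v y.2 y.1.2).
  exact: (mYr (ig_mfun (es_u hv))).
have mlt : measurable_fun setT (fun y : Y => (v y.2 y.1.2 < u y.2 y.1.1)%R).
  exact: measurable_fun_ltr.
rewrite /one (_ : (fun y => _) = (fun y => if (v y.2 y.1.2 < u y.2 y.1.1)%R then 1 else 0)).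
  by apply: measurable_fun_ifT.
by apply/funext => y; case: ifP.
Qed.

Let one1 y : `|one y| <= 1.
Proof. by rewrite /one; case: (_ < _); rewrite ?normr1 ?normr0. Qed.

Let iK : ig (pm mu P) (fun z => one z.2 *
  (ioo 0 mm z.1 * (w c z.2 * (G0 z.2 - G0 (sh3 (A z.1) z.2))))).
Proof.
apply: (ig_bM (c := 1)); [exact: (measurableT_comp mone)|by move=> z; exact: one1|].
have i2 := ig_lagged mG0 igu igv G0_le.
have [i1 _ _] := w2_bound e0 c mG0 igu igv G0_le.
have i0 := ig_tensor (ig_ioo 0 mm) i1.
have := igB i0 i2; rewrite (_ : (fun x => _) = (fun z : RT * Y => ioo 0 mm z.1 *
  (w c z.2 * (G0 z.2 - G0 (sh3 (A z.1) z.2)))))//.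
by apply/funext => z; rewrite /w; ring.
Qed.

(** On [v < u], the value of [Upos] is the difference itself, while its lagged value is at least the
    lagged difference; elsewhere [Upos] vanishes now and is nonnegative before. The initial values
    cancel, because [extnE] holds at the current and at the lagged times alike. *)
Let HK z : ioo 0 mm z.1 * (w c z.2 * (Upos z.2 - Upos (sh3 (A z.1) z.2))) <=
  one z.2 * (ioo 0 mm z.1 * (w c z.2 * (G0 z.2 - G0 (sh3 (A z.1) z.2)))).
Proof.
case: z => l y /=; rewrite [leRHS]mulrCA ler_wpM2l ?ioo_ge0//.
have [wz|wz] := eqVneq (w c y) 0; first by rewrite wz !mul0r mulr0.
have [] := w2_supp e0 wz; rewrite !ler_norml => /andP[t1 t2] /andP[r1 r2].
have [c1 c2] := andP hc; have E0 := e0; have a0 := A0 l; have aT := AT l.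
rewrite [leRHS]mulrCA ler_wpM2l ?w2_ge0//.
have ht : 0 < y.1.1 < T by apply/andP; split; lra.
have hr : 0 < y.1.2 < T by apply/andP; split; lra.
rewrite /G0 /gu /gv /sh3 /=.
rewrite !(extnE hu) ?(extnE hv); [|apply/andP; split; lra..].
have uE : u y.2 y.1.1 = ub y.2 y.1.1 by rewrite /ub /extn (ioo1 ht); ring.
have vE : v y.2 y.1.2 = vb y.2 y.1.2 by rewrite /vb /extn (ioo1 hr); ring.
rewrite /one uE vE /Upos /sh3 /= -/(ub y.2 _) -/(vb y.2 _) -/ub -/vb.
move: (ub _ _) (vb _ _) (ub _ _) (vb _ _) => a b a' b'.
rewrite /rpos; case: ltP => ab; rewrite ?mul1r ?mul0r.
  by rewrite max_l; [rewrite /Num.max; case: ltP; lra|lra].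
by rewrite max_r; [rewrite sub0r oppr_le0 le_max lexx orbT|lra].
Qed.

Let lhsE : \int[pm mu P]_z (ioo 0 mm z.1 * (w c z.2 * (Upos z.2 - Upos (sh3 (A z.1) z.2)))) =
  \int[mu]_l (ioo 0 mm l * (Phi c - Phi (c - A l))).
Proof.
rewrite -(int_F1 iH); apply: (int_ext mu) => l /=.
have [i1 _ _] := bPhi c; have [i1' _ _] := bPhi (c - A l).
have i2 : ig P (fun y => w c y * Upos (sh3 (A l) y)).
  have := ig_lag_sec msh hsh (A l) i1'.
  by under eq_fun do rewrite /= w2_sh3.
rewrite int_Z; last first.
  by under eq_fun do rewrite mulrBr; exact: igB.
congr (_ * _); rewrite -Phi_shift -int_B//.
by apply: (int_ext P) => y; rewrite mulrBr.
Qed.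

Let wu := wlag T kk mm gu.
Let wv := wlag T kk mm gv.

Let iwu : ig (pm m mu) (fun z => wu z.1 z.2).
Proof. exact: (ig_wlag kk_ig kk_supp mm0 igu). Qed.
Let iwv : ig (pm m mu) (fun z => wv z.1 z.2).
Proof. exact: (ig_wlag kk_ig kk_supp mm0 igv). Qed.

Let Wd (y : Y) := wu y.2 y.1.1 - wv y.2 y.1.2.

Let mWd : measurable_fun setT Wd.
Proof.
apply: measurable_funB.
  exact: (mYt (ig_mfun iwu)).
exact: (mYr (ig_mfun iwv)).
Qed.

Let iWd : ig P (fun y => w c y * Wd y * one y).
Proof.
have [i1 _ _] := w2_bound e0 c mWd iwu iwv (fun y => ler_normB _ _).
exact: (ig_Mb (c := 1) mone one1 i1).
Qed.

Let igu_l : ig (pm mu P) (fun z => ioo 0 mm z.1 * (w c z.2 * gu z.2.2 (z.2.1.1 - A z.1))).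
Proof.
have i0' : ig (pm m mu) (fun z => (fun (_ : X) (_ : R) => 0 : R) z.1 z.2) by exact: ig0.
apply: (ig_lagged (G := fun y => gu y.2 y.1.1) (b := fun _ _ => 0) _ igu i0').
  exact: (mYt (ig_mfun igu)).
by move=> y; rewrite normr0 addr0.
Qed.

Let igv_l : ig (pm mu P) (fun z => ioo 0 mm z.1 * (w c z.2 * gv z.2.2 (z.2.1.2 - A z.1))).
Proof.
have i0' : ig (pm m mu) (fun z => (fun (_ : X) (_ : R) => 0 : R) z.1 z.2) by exact: ig0.
apply: (ig_lagged (G := fun y => gv y.2 y.1.2) (a := fun _ _ => 0) _ i0' igv).
  exact: (mYr (ig_mfun igv)).
by move=> y; rewrite normr0 add0r.
Qed.

Let rhsE : \int[pm mu P]_z (one z.2 *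
    (ioo 0 mm z.1 * (w c z.2 * (G0 z.2 - G0 (sh3 (A z.1) z.2))))) =
  \int[P]_y (w c y * Wd y * one y).
Proof.
rewrite -(int_F2 iK).
have h1 := ae_ig2 igu_l; have h2 := ae_ig2 igv_l.
have h12 : {ae P, forall y, \int[mu]_l (one y *
    (ioo 0 mm l * (w c y * (G0 y - G0 (sh3 (A l) y))))) = w c y * Wd y * one y}.
  apply: (@filterS2 _ _ (ae_filter_ringOfSetsType P) _ _ _ _ h1 h2) => y /= i1 i2.
  have [wz|wz] := eqVneq (w c y) 0.
    rewrite wz !mul0r; under eq_Rintegral do rewrite mul0r !mulr0.
    by rewrite /Rintegral integral0.
  have [] := w2_supp e0 wz; rewrite !ler_norml => /andP[t1 t2] /andP[r1 r2].
  have [c1 c2] := andP hc; have E0 := e0.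
  have ht : 0 < y.1.1 < T := itv_near t1 t2 hc.
  have hr : 0 < y.1.2 < T := itv_near r1 r2 hc.
  (* Integrability in [l] is known almost everywhere only for the product with the weight, which is
     nonzero at this point and can be divided out. *)
  have j1 : ig mu (fun l => ioo 0 mm l * gu y.2 (y.1.1 - A l)).
    have := igZ (w c y)^-1 i1; rewrite (_ : (fun l => _) =
      (fun l => ioo 0 mm l * gu y.2 (y.1.1 - A l)))//.
    by apply/funext => l; rewrite mulrCA mulKf.
  have j2 : ig mu (fun l => ioo 0 mm l * gv y.2 (y.1.2 - A l)).
    have := igZ (w c y)^-1 i2; rewrite (_ : (fun l => _) =
      (fun l => ioo 0 mm l * gv y.2 (y.1.2 - A l)))//.
    by apply/funext => l; rewrite mulrCA mulKf.
  have jm : ig mu (fun l => G0 y * ioo 0 mm l) by apply: igZ; exact: ig_ioo.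
  transitivity (\int[mu]_l ((one y * w c y) * ((G0 y * ioo 0 mm l -
      ioo 0 mm l * gu y.2 (y.1.1 - A l)) + ioo 0 mm l * gv y.2 (y.1.2 - A l)))).
    by apply: (int_ext mu) => l; rewrite /G0 /sh3 /=; ring.
  rewrite int_Z; last by apply: igD => //; exact: igB.
  rewrite int_D//; last exact: igB.
  rewrite int_B// int_Z; last exact: ig_ioo.
  rewrite int_ioo ?subr0; last exact: ltW.
  rewrite /Wd /wu /wv /wlag (ioo1 ht) (ioo1 hr) /G0 /A; ring.
by have [_ ->] := int_ae (ig_F2 iK) (ig_mfun iWd) h12.
Qed.

(** Kato's inequality bounds the left side by the weighted integral of the difference of the two
    [wlag] terms over [v < u], and [doubling] bounds this by the integral of [f - h] over the same
    set, up to the kernel error. *)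
Lemma Phi_lag : \int[mu]_l (ioo 0 mm l * (Phi c - Phi (c - lagt kk mm l))) <=
  Fc c + D * (\int[mu]_t `|kk t - kk2 kk mm t|) *
  (\int[pm m mu]_z `|dg T u u0 z.1 z.2| + \int[pm m mu]_z `|dg T v v0 z.1 z.2|).
Proof.
have := int_le iH iK HK; rewrite lhsE rhsE => /le_trans; apply.
have hd := doubling mkap kap0 kk_ig kk_ge0 kk_supp e0 hc hD hu hv mm0.
have mfh : measurable_fun setT (fun y : Y => f y.2 y.1.1 - h y.2 y.1.2).
  apply: measurable_funB.
    exact: (mYt (ig_mfun (es_f hu))).
  exact: (mYr (ig_mfun (es_f hv))).
have [if1 _ _] := w2_bound e0 c mfh (es_f hu) (es_f hv) (fun y => ler_normB _ _).
have if2 := ig_Mb (c := 1) mone one1 if1.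
have [iFc _ _] := bF c.
have le1 : \int[P]_y (w c y * (f y.2 y.1.1 - h y.2 y.1.2) * one y) <= Fc c.
  apply: int_le => // y; rewrite -mulrA ler_wpM2l ?w2_ge0// /one /Fpos /rpos.
  by case: (_ < _); rewrite ?mulr1 ?mulr0 le_max lexx ?orbT.
move: hd; rewrite [X in 0 <= X + _](_ : _ = \int[P]_y (w c y * (f y.2 y.1.1 - h y.2 y.1.2) * one y)
   - \int[P]_y (w c y * Wd y * one y)); last first.
  rewrite -int_B//; apply: (int_ext P) => y.
  by rewrite /w /w2 /Wd /wu /wv /gu /gv /one; ring.
move: le1; move: (\int[P]_y (_ * one y)) (\int[P]_y (_ * one y)) (Fc c) (D * _ * _) => a b e g.
lra.
Qed.

End lag.

End fixed_scale.

End kato.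

(** * Convergence of the mollified distance *)

Lemma drift_out (R : realType) (T x y e : R) : - e <= y -> y <= e -> e < 2^-1 ->
  - 2^-1 < x < T + 2^-1 -> - 1 < x - y < T + 1 /\ - 1 < x < T + 1.
Proof. by move=> h1 h2 h3 /andP[h4 h5]; split; apply/andP; split; lra. Qed.

Lemma drift_in (R : realType) (T x y e : R) : - e <= y -> y <= e -> e < 2^-1 ->
  (0 < x - y < T -> - 2^-1 < x < T + 2^-1) /\ (0 < x < T -> - 2^-1 < x < T + 2^-1).
Proof. by move=> h1 h2 h3; split => /andP[h4 h5]; apply/andP; split; lra. Qed.

Section translation1.
Context (R : realType).
Local Notation mu := (@lebesgue_measure R).
Local Notation RT := (measurableTypeR R).

Lemma ig_DCT_ae d (Y : measurableType d) (n : {measure set Y -> \bar R})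
    (f_ : nat -> Y -> R) (f g : Y -> R) :
  (forall n, measurable_fun setT (f_ n)) -> measurable_fun setT f ->
  {ae n, forall x, f_ k x @[k --> \oo] --> f x} -> ig n g ->
  {ae n, forall x, forall k, `|f_ k x| <= g x} ->
  \int[n]_x f_ k x @[k --> \oo] --> \int[n]_x f x.
Proof.
move=> mf_ mf cf gi dom.
have [] := @dominated_convergence _ _ _ n setT measurableT
  (fun k => EFin \o f_ k) (EFin \o f) (EFin \o g).
- by move=> k; exact/measurable_EFinP.
- exact/measurable_EFinP.
- by apply: (ae_imp _ cf) => x cx _; apply: cvg_EFin cx; exact: nearW.
- exact: gi.
- by apply: (ae_imp _ dom) => x dx k _ /=; rewrite lee_fin.
move=> fi _ cv; by apply: fine_cvg; rewrite EFin_int.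
Qed.

(** The modulus of continuity of [phi] in L^1, averaged over translations of length at most eps. *)
Definition Om1 (eps : R) (phi : R -> R) :=
  \int[pm mu mu]_z (moll eps z.2 * `|phi (z.1 - z.2) - phi z.1|).

Lemma ig_Om1 (eps : R) (phi : R -> R) : 0 < eps -> ig mu phi ->
  [/\ ig (pm mu mu) (fun z => moll eps z.2 * `|phi (z.1 - z.2) - phi z.1|),
      ig (pm mu mu) (fun z => moll eps z.2 * `|phi (z.1 - z.2)|) /\
      \int[pm mu mu]_z (moll eps z.2 * `|phi (z.1 - z.2)|) = \int[mu]_t `|phi t| &
      ig (pm mu mu) (fun z => moll eps z.2 * `|phi z.1|) /\
      \int[pm mu mu]_z (moll eps z.2 * `|phi z.1|) = \int[mu]_t `|phi t| ].
Proof.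
move=> e0 ip; have im := ig_moll0 e0; have ia := ig_abs ip.
have m0 t : 0 <= moll eps t by exact: moll_ge0.
have im1 : \int[mu]_t moll eps t = 1.
  by rewrite -[RHS](int_moll e0 0); apply: (int_ext mu) => t; rewrite subr0.
have [i1 E1] := ig_conv im ia.
have i2 : ig (pm mu mu) (fun z => moll eps z.2 * `|phi z.1|).
  by have := ig_tensor ia im; under eq_fun do rewrite mulrC.
have mD : measurable_fun setT (fun z : RT * RT => moll eps z.2 * `|phi (z.1 - z.2) - phi z.1|).
  have mphi := ig_mfun ip.
  apply: measurable_funM; first exact: (measurableT_comp (ig_mfun im)).
  apply: measurableT_comp => //; apply: measurable_funB.
    by apply: (measurableT_comp mphi); exact: measurable_funB.
  exact: (measurableT_comp mphi).
split.
- apply: (ig_le mD (igD i1 i2)) => z; rewrite -mulrDr ger0_norm; last exact: mulr_ge0.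
  by rewrite ler_wpM2l//; exact: ler_normB.
- split => //; rewrite (_ : \int[mu]_t `|phi t| = (\int[mu]_t `|moll eps t|) * \int[mu]_t `| `|phi t| | ).
    by rewrite -E1; apply: (int_ext (pm mu mu)) => z; rewrite (normrM (moll _ _)) normr_id ger0_norm.
  have -> : \int[mu]_t `|moll eps t| = 1.
    by rewrite -im1; apply: (int_ext mu) => t; rewrite ger0_norm.
  by rewrite mul1r; apply: (int_ext mu) => t; rewrite normr_id.
- split => //; rewrite -(int_F1 i2); apply: (int_ext mu) => c /=.
  have -> : \int[mu]_s (moll eps s * `|phi c|) = \int[mu]_s (`|phi c| * moll eps s).
    by apply: (int_ext mu) => s; rewrite mulrC.
  by rewrite int_Z// im1 mulr1.
Qed.

Lemma Om1_ge0 eps phi : 0 < eps -> 0 <= Om1 eps phi.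
Proof. by move=> e0; apply: int_ge0 => z; apply: mulr_ge0 => //; exact: moll_ge0. Qed.

Lemma Om1_le eps phi : 0 < eps -> ig mu phi -> Om1 eps phi <= 2 * \int[mu]_t `|phi t|.
Proof.
move=> e0 ip; have [i0 [i1 E1] [i2 E2]] := ig_Om1 e0 ip.
rewrite (_ : 2 * _ = \int[mu]_t `|phi t| + \int[mu]_t `|phi t|); last ring.
rewrite -{1}E1 -E2 -int_D//; apply: int_le => //; first exact: igD.
by move=> z; rewrite -mulrDr ler_wpM2l ?moll_ge0//; exact: ler_normB.
Qed.

Variables (T : R) (e : nat -> R).
Hypotheses (T0 : 0 < T) (e_gt0 : forall n, 0 < e n) (e_cvg : e n @[n --> \oo] --> 0).

(** Two windows with margins 1/2 and 1 around []0, T[]. A translation by less than 1/2 keeps points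
    of [J] inside [EI], where [phi] is approximated, and outside of [J] both [phi] and its
    translates vanish. *)
Let J : R -> R := ioo (- 2^-1) (T + 2^-1).
Let EI : R -> R := ioo (- 1) (T + 1).

Let approx (phi : R -> R) (eta : R) : ig mu phi -> 0 < eta ->
  exists g : R -> R, [/\ continuous g, ig mu (fun t => EI t * (phi t - g t)) &
    \int[mu]_t `|EI t * (phi t - g t)| <= eta].
Proof.
move=> ip eta0; pose E : set RT := `]- 1, T + 1[%classic.
have mE : measurable E by exact: measurable_itv.
have fE : (mu E < +oo)%E.
  by rewrite /E lebesgue_measure_itv /=; case: ifP => _; rewrite -?EFinB ltry.
have ipE : mu.-integrable E (EFin \o phi).
  exact: (integrableS measurableT mE (@subsetT _ _) ip).
have [g_ [cg igE lg]] := approximation_continuous_integrable mE fE ipE.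
have ig1 n : ig mu (fun t => EI t * (phi t - g_ n t)).
  have i1 : mu.-integrable E (EFin \o (fun t => phi t - g_ n t)).
    have := integrableB mE ipE (igE n).
    by apply: eq_integrable => // t _ /=; rewrite EFinB.
  exact/ig_set_ioo.
have E1 n : (\int[mu]_(z in E) `|(phi z - g_ n z)%:E| =
    (\int[mu]_t `|EI t * (phi t - g_ n t)|)%:E)%E.
  rewrite EFin_int; last exact: ig_abs.
  rewrite [LHS]integral_mkcond; apply: eq_integral => t _.
  rewrite patchE /EI iooE indicE -/E; case: (t \in E); first by rewrite mul1r.
  by rewrite mul0r normr0.
move: lg; rewrite (_ : (fun n => _) = (fun n => (\int[mu]_t `|EI t * (phi t - g_ n t)|)%:E)); last first.
  by apply/funext => n; exact: E1.
move=> lg; have lr : \int[mu]_t `|EI t * (phi t - g_ n t)| @[n --> \oo] --> (0 : R) by exact: (fine_cvg lg).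
have /cvgr0Pnorm_le/(_ _ eta0) [n _ hn] := lr.
exists (g_ n); split => //; apply: le_trans (hn n (leqnn n)) => /=.
exact: ler_norm.
Qed.

Let bounded_on (g : R -> R) : continuous g -> exists M, forall c, -1 <= c <= T + 1 -> `|g c| <= M.
Proof.
move=> cg; have h : - 1 <= T + 1 :> R by have := T0; lra.
have [c _ hc] := @EVT_max _ (fun x => `|g x|) (-1) (T + 1) h
  (continuous_subspaceT (fun x => continuous_comp (cg x) (@norm_continuous _ _ (g x)))).
by exists `|g c| => x hx; apply: hc; rewrite in_itv.
Qed.

Let J_moll n c s : e n < 2^-1 -> J c * moll (e n) s != 0 -> -1 < c < T + 1 /\ -1 < c - s < T + 1.
Proof.
move=> en; rewrite mulf_eq0 negb_or /J iooB => /andP[h1 h2].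
move: h1; case: (boolP (- 2^-1 < c < T + 2^-1)); last by rewrite eqxx.
move=> /andP[c1 c2] _.
have : `|s| <= e n by rewrite leNgt; apply: contra h2 => h; rewrite moll_supp.
rewrite ler_norml => /andP[s1 s2].
by split; apply/andP; split; lra.
Qed.

Let e_small (eta : R) : 0 < eta -> \forall n \near \oo, e n < eta.
Proof.
move=> eta0; have /cvgr0Pnorm_lt/(_ _ eta0) := e_cvg.
by apply: filterS => n; apply: le_lt_trans; exact: ler_norm.
Qed.

Let osc n (g : R -> R) (z : RT * RT) := J z.1 * (moll (e n) z.2 * `|g (z.1 - z.2) - g z.1|).

Let mosc n g : continuous g -> measurable_fun setT (osc n g).
Proof.
move=> cg; have mg := cts_mfun cg.
apply: measurable_funM; first exact: (measurableT_comp (measurable_ioo _ _)).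
apply: measurable_funM; first exact: (measurableT_comp (measurable_moll _)).
apply: measurableT_comp => //; apply: measurable_funB.
  by apply: (measurableT_comp mg); exact: measurable_funB.
exact: (measurableT_comp mg).
Qed.

Let osc_le n (g : R -> R) (M : R) z : e n < 2^-1 -> (forall c, -1 <= c <= T + 1 -> `|g c| <= M) ->
  `|osc n g z| <= (2 * M) * (J z.1 * moll (e n) z.2).
Proof.
move=> en hM; rewrite /osc [in leLHS]mulrA (normrM (J z.1 * moll (e n) z.2)) normr_id.
have [->|nz] := eqVneq (J z.1 * moll (e n) z.2) 0; first by rewrite normr0 mul0r mulr0.
have [/andP[c1 c2] /andP[s1 s2]] := J_moll en nz.
have Jm0 : 0 <= J z.1 * moll (e n) z.2 by apply: mulr_ge0; [exact: ioo_ge0|exact: moll_ge0].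
rewrite ger0_norm// mulrC ler_wpM2r//.
apply: (le_trans (ler_normB _ _)).
have h1 : `|g z.1| <= M by apply: hM; rewrite (ltW c1) ltW.
have h2 : `|g (z.1 - z.2)| <= M by apply: hM; rewrite (ltW s1) ltW.
by lra.
Qed.

Let ig_osc n g : continuous g -> e n < 2^-1 -> ig (pm mu mu) (osc n g).
Proof.
move=> cg en; have [M hM] := bounded_on cg.
have i0 := igZ (2 * M) (ig_tensor (ig_ioo (- 2^-1) (T + 2^-1)) (ig_moll0 (e_gt0 n))).
by apply: (ig_le (mosc n cg) i0) => z; exact: osc_le.
Qed.

Let osc_cvg (g : R -> R) (eta : R) : continuous g -> 0 < eta ->
  \forall n \near \oo, \int[pm mu mu]_z osc n g z <= eta.
Proof.
move=> cg eta0; have [M hM] := bounded_on cg.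
have half0 : 0 < 2^-1 :> R by rewrite invr_gt0.
(* The first factor is a truth value. It switches off the n with [e n >= 1/2], for which the
   translates are not under control, so that the domination holds for every n. *)
pose H n c := (e n < 2^-1)%R%:R * \int[mu]_s osc n g (c, s).
have mH n : measurable_fun [set: RT] (H n).
  rewrite /H; case: (boolP (e n < 2^-1)) => en.
    by under eq_fun do rewrite mul1r; exact: (ig_mfun (ig_F1 (ig_osc cg en))).
  by under eq_fun do rewrite mul0r; exact: measurable_cst.
have secE n c : e n < 2^-1 -> ig mu (fun s => osc n g (c, s)).
  move=> en; have i0 := igZ (2 * M) (igZ (J c) (ig_moll0 (e_gt0 n))).
  apply: (ig_le (measurableT_comp (mosc n cg) (pair1_measurable (c : RT))) i0) => s.
  exact: (osc_le (c, s) en hM).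
have int_m n : \int[mu]_t moll (e n) t = 1.
  by rewrite -[RHS](int_moll (e_gt0 n) 0); apply: (int_ext mu) => t; rewrite subr0.
have Hle n c : `|H n c| <= (2 * M) * J c.
  have J0 : 0 <= J c by exact: ioo_ge0.
  have M0 : 0 <= M.
    by apply: le_trans (hM 0 _); [exact: normr_ge0|apply/andP; split; have := T0; lra].
  rewrite /H; case: (boolP (e n < 2^-1)) => en; last by rewrite mul0r normr0 !mulr_ge0.
  rewrite mul1r; apply: (le_trans (int_norm (secE n c en))).
  have -> : 2 * M * J c = \int[mu]_s (2 * M * (J c * moll (e n) s)).
    rewrite int_Z; last exact: igZ (ig_moll0 (e_gt0 n)).
    by rewrite int_Z ?int_m ?mulr1//; exact: ig_moll0.
  apply: int_le; first exact: ig_abs (secE n c en).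
    by apply: igZ; exact: igZ (ig_moll0 (e_gt0 n)).
  by move=> s; exact: (osc_le (c, s) en hM).
have Hcv c : H n c @[n --> \oo] --> 0.
  apply/cvgr0Pnorm_le => eta' eta'0.
  have := cg c => /cvgrPdist_le /(_ _ eta'0) /nbhs_ballP[del /= del0 hdel].
  near=> n.
  have en : e n < 2^-1 by near: n; exact: e_small.
  have ed : e n < del by near: n; exact: e_small.
  rewrite /H en mul1r; apply: (le_trans (int_norm (secE n c en))).
  have -> : eta' = \int[mu]_s (eta' * moll (e n) s).
    by rewrite int_Z ?int_m ?mulr1//; exact: ig_moll0.
  apply: int_le; [exact: ig_abs (secE n c en)|exact: igZ (ig_moll0 (e_gt0 n))|].
  move=> s; rewrite /osc /= mulrA (normrM (J c * moll (e n) s)) normr_id.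
  have m0 : 0 <= moll (e n) s by exact: moll_ge0.
  have Jm0 : 0 <= J c * moll (e n) s by apply: mulr_ge0 => //; exact: ioo_ge0.
  have [->|nz] := eqVneq (J c * moll (e n) s) 0.
    by rewrite normr0 mul0r; apply: mulr_ge0 => //; exact: ltW.
  have sn : `|s| <= e n.
    by rewrite leNgt; apply: contra nz => h; rewrite moll_supp// mulr0.
  rewrite mulrC; apply: ler_pM => //.
    rewrite distrC; apply: hdel; rewrite /ball /= opprB addrC subrK.
    exact: le_lt_trans sn ed.
  by rewrite ger0_norm// ler_piMl// /J ioo_le1.
have mz : measurable_fun [set: RT] (fun _ => 0 : R) by exact: measurable_cst.
have [_] := ig_DCT mH mz Hcv (igZ (2 * M) (ig_ioo (- 2^-1) (T + 2^-1))) Hle.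
rewrite [X in _ --> X](_ : _ = 0); last by rewrite /Rintegral integral0.
move=> /cvgr0Pnorm_le /(_ _ eta0) hn; near=> n.
have en : e n < 2^-1 by near: n; exact: e_small.
have : `|\int[mu]_c H n c| <= eta by near: n.
rewrite (int_ext mu (g := fun c => \int[mu]_s osc n g (c, s))); last first.
  by move=> c; rewrite /H en mul1r.
by rewrite (int_F1 (ig_osc cg en)) => /(le_trans (ler_norm _)).
Unshelve. all: by end_near. Qed.

(** Continuity of translations in L^1: one third of [eta] for the approximation error, one for its
    translates, and one for the oscillation of the continuous approximant on [J]. *)
Lemma Om1_cvg (phi : R -> R) : ig mu phi -> (forall t, ~~ (0 < t < T) -> phi t = 0) ->
  Om1 (e n) phi @[n --> \oo] --> 0.
Proof.
move=> ip off; apply/cvgr0Pnorm_le => eta eta0.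
have eta3 : 0 < eta / 3 by rewrite divr_gt0.
have half0 : 0 < 2^-1 :> R by rewrite invr_gt0.
have [g [cg ig1 le1]] := approx ip eta3.
near=> n.
have en : e n < 2^-1 by near: n; exact: e_small.
have hosc : \int[pm mu mu]_z osc n g z <= eta / 3 by near: n; exact: osc_cvg.
rewrite ger0_norm ?Om1_ge0//.
have [i0 _ _] := ig_Om1 (e_gt0 n) ip.
have [_ [i1 E1] [i2 E2]] := ig_Om1 (e_gt0 n) ig1.
have i3 := ig_osc cg en.
have le : Om1 (e n) phi <= \int[pm mu mu]_z
    ((moll (e n) z.2 * `|EI (z.1 - z.2) * (phi (z.1 - z.2) - g (z.1 - z.2))| +
     moll (e n) z.2 * `|EI z.1 * (phi z.1 - g z.1)|) + osc n g z).
  apply: int_le => //; first by apply: igD => //; exact: igD.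
  move=> z; have m0 : 0 <= moll (e n) z.2 by exact: moll_ge0.
  have [mz|mz] := eqVneq (moll (e n) z.2) 0; first by rewrite /osc mz !mul0r mulr0 !addr0.
  have zs : `|z.2| <= e n by rewrite leNgt; apply: contra mz => h; rewrite moll_supp.
  move: zs; rewrite ler_norml => /andP[z1 z2].
  rewrite /osc mulrCA -!mulrDr ler_wpM2l//.
  have [hc|hc] := boolP (- 2^-1 < z.1 < T + 2^-1).
    rewrite /J ioo1// mul1r; have [c1 c2] := andP hc.
    have [d1 d2] := drift_out z1 z2 en hc; rewrite /EI (ioo1 d1) (ioo1 d2) !mul1r.
    rewrite (_ : phi (z.1 - z.2) - phi z.1 = ((phi (z.1 - z.2) - g (z.1 - z.2)) -
      (phi z.1 - g z.1)) + (g (z.1 - z.2) - g z.1)); last ring.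
    apply: (le_trans (ler_normD _ _)); rewrite lerD2r; exact: ler_normB.
  have J0 : 0 <= J z.1 by exact: ioo_ge0.
  rewrite !off ?subrr ?normr0; first by apply: addr_ge0; [exact: addr_ge0|exact: mulr_ge0].
    by apply: contra hc; exact: (drift_in T z.1 z1 z2 en).2.
  by apply: contra hc; exact: (drift_in T z.1 z1 z2 en).1.
apply: (le_trans le); rewrite int_D//; last exact: igD.
rewrite int_D// E1 E2; move: le1 hosc.
move: (\int[mu]_t _) (\int[pm mu mu]_z _) => a b; lra.
Unshelve. all: by end_near. Qed.

End translation1.

(** * Mollified norms and mollified positive parts *)

Section Gm.
Context (R : realType) d (X : measurableType d).
Variable m : {sigma_finite_measure set X -> \bar R}.
Local Notation mu := (@lebesgue_measure R).
Local Notation RT := (measurableTypeR R).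
Local Notation Y := (RT * RT * X)%type.

Section mollnorm.
Variables (eps : R) (a : X -> R -> R).
Hypotheses (e0 : 0 < eps) (ia : ig (pm m mu) (fun z => a z.1 z.2)).

Lemma ig_mollnorm : ig (pm (pm m mu) mu) (fun z => moll eps (z.1.2 - z.2) * `|a z.1.1 z.1.2|).
Proof.
have mm := measurable_moll eps.
have mF : measurable_fun setT (fun z : X * RT * RT => moll eps (z.1.2 - z.2) * `|a z.1.1 z.1.2|).
  apply: measurable_funM.
    apply: (measurableT_comp mm); apply: measurable_funB => //.
    exact: (measurableT_comp measurable_snd measurable_fst).
  apply: measurableT_comp => //; exact: (measurableT_comp (ig_mfun ia) measurable_fst).
apply: (ig_by_sections mF (ig_abs ia)); apply/aeW => z /=.
have i1 : ig mu (fun c => moll eps (z.2 - c)) by exact: (ig_refl z.2 (ig_moll0 e0)).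
have E : \int[mu]_c moll eps (z.2 - c) = 1.
  by rewrite (int_refl z.2 (ig_moll0 e0)) -[RHS](int_moll e0 0); apply: (int_ext mu) => t; rewrite subr0.
have -> : (\int[mu]_c `|moll eps (z.2 - c) * `|a z.1 z.2| |%:E =
    (\int[mu]_c (`|a z.1 z.2| * moll eps (z.2 - c)))%:E)%E.
  rewrite EFin_int; last exact: igZ.
  apply: eq_integral => c _; rewrite ger0_norm; first by rewrite mulrC.
  by apply: mulr_ge0 => //; exact: moll_ge0.
by rewrite int_Z// E mulr1.
Qed.

Definition mollnorm (c : R) := \int[pm m mu]_z (moll eps (z.2 - c) * `|a z.1 z.2|).

Lemma ig_mollnormF : ig mu mollnorm.
Proof. exact: (ig_F2 ig_mollnorm). Qed.

Lemma int_mollnorm : \int[mu]_c mollnorm c = \int[pm m mu]_z `|a z.1 z.2|.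
Proof.
rewrite (int_F2 ig_mollnorm) -(int_F1 ig_mollnorm); apply: (int_ext (pm m mu)) => z /=.
have E : \int[mu]_c moll eps (z.2 - c) = 1.
  by rewrite (int_refl z.2 (ig_moll0 e0)) -[RHS](int_moll e0 0); apply: (int_ext mu) => t; rewrite subr0.
rewrite (_ : \int[mu]_c _ = \int[mu]_c (`|a z.1 z.2| * moll eps (z.2 - c))).
  by rewrite int_Z ?E ?mulr1//; exact: (ig_refl z.2 (ig_moll0 e0)).
by apply: (int_ext mu) => c; rewrite mulrC.
Qed.

End mollnorm.

Lemma w2_cst eps c (q : X -> R) : 0 < eps -> ig m q -> (forall x, 0 <= q x) ->
  ig (P3 m) (fun y => w2 eps c y * q y.2) /\ \int[P3 m]_y (w2 eps c y * q y.2) = \int[m]_x q x.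
Proof.
move=> e0 iq q0; have im := ig_moll e0 c; have mm := ig_mfun im.
have i1 := ig_tensor iq im.
have mg : measurable_fun setT (fun z : X * RT => q z.1 * moll eps (z.2 - c)) by exact: ig_mfun i1.
have m0 t : 0 <= moll eps (t - c) by exact: moll_ge0.
have E := @integral_tensor3l R d X m (fun x t => q x * moll eps (t - c)) _ mg mm
  (fun x t => mulr_ge0 (q0 x) (m0 t)) m0.
have mF : measurable_fun setT (fun y : Y => w2 eps c y * q y.2).
  apply: measurable_funM; first exact: measurable_w2l.
  exact: (measurableT_comp (ig_mfun iq)).
have E2 : (\int[P3 m]_y (w2 eps c y * q y.2)%:E = (\int[m]_x q x)%:E)%E.
  rewrite -[in RHS](mulr1 (\int[m]_x q x)) -[in RHS](int_moll e0 c) EFinM.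
  rewrite (EFin_int im); transitivity (\int[P3 m]_y (q y.2 * moll eps (y.1.1 - c) * moll eps (y.1.2 - c))%:E)%E.
    by apply: eq_integral => y _; rewrite /w2; congr EFin; ring.
  rewrite E; congr (_ * _)%E; rewrite -(EFin_int i1) -(int_F1 i1) /=; congr EFin.
  by apply: (int_ext m) => x; rewrite int_Z// int_moll// mulr1.
have iF : ig (P3 m) (fun y => w2 eps c y * q y.2).
  apply: (ig_fin mF); rewrite (eq_integral (fun y => (w2 eps c y * q y.2)%:E)) ?E2 ?ltry//.
  by move=> y _; rewrite ger0_norm//; apply: mulr_ge0 => //; exact: w2_ge0.
by split => //; apply/EFin_inj; rewrite EFin_int.
Qed.

Variables (a b : X -> R -> R).
Hypotheses (ia : ig (pm m mu) (fun z => a z.1 z.2)) (ib : ig (pm m mu) (fun z => b z.1 z.2)).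

Definition Gpos (y : Y) := rpos (a y.2 y.1.1 - b y.2 y.1.2).
Definition Gm eps c := \int[P3 m]_y (w2 eps c y * Gpos y).

(** The mollifier sees only times within eps of [c], so restricting [c] to a window allows the
    function to be cut off on the window enlarged by eps. *)
Lemma mollnorm_window eps (a' : X -> R -> R) (p q c : R) : 0 < eps ->
  ig (pm m mu) (fun z => a' z.1 z.2) ->
  ioo p q c * mollnorm eps a' c <= mollnorm eps (fun x t => ioo (p - eps) (q + eps) t * a' x t) c.
Proof.
move=> e0 ia'.
have iW : ig (pm m mu) (fun z => (fun x t => ioo (p - eps) (q + eps) t * a' x t) z.1 z.2).
  apply: (ig_bM (c := 1)) ia'; first exact: (measurableT_comp (measurable_ioo _ _)).
  by move=> z; exact: ioo_norm1.
have [i1 _] := ig_mollM e0 c ia'; have [i2 _] := ig_mollM (a := fun x t => ioo (p - eps) (q + eps) t * a' x t) e0 c iW.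
rewrite /mollnorm -int_Z//; apply: int_le => //; first exact: igZ.
move=> z; rewrite mulrCA; have m0 : 0 <= moll eps (z.2 - c) by exact: moll_ge0.
have [->|mz] := eqVneq (moll eps (z.2 - c)) 0; first by rewrite !mul0r.
rewrite ler_wpM2l// normrM ler_wpM2r//.
have : `|z.2 - c| <= eps by rewrite leNgt; apply: contra mz => h; rewrite moll_supp.
rewrite ler_norml => /andP[h1 h2].
rewrite [leRHS]ger0_norm ?ioo_ge0// iooB; case: (boolP (p < c < q)) => [/andP[c1 c2]|_].
  by rewrite ioo1//; apply/andP; split; lra.
exact: ioo_ge0.
Qed.

Lemma mGpos : measurable_fun setT Gpos.
Proof.
apply: measurable_rpos; apply: measurable_funB.
  exact: (mYt (ig_mfun ia)).
exact: (mYr (ig_mfun ib)).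
Qed.

Lemma Gpos_le y : `|Gpos y| <= `|a y.2 y.1.1| + `|b y.2 y.1.2|.
Proof.
rewrite /Gpos ger0_norm ?rpos_ge0// /rpos ge_max addr_ge0// andbT.
exact: le_trans (ler_norm _) (ler_normB _ _).
Qed.

Lemma Gm_ge0 eps c : 0 < eps -> 0 <= Gm eps c.
Proof. by move=> e0; apply: int_ge0 => y; rewrite mulr_ge0 ?rpos_ge0// w2_ge0. Qed.

Lemma Gm_sec eps c : 0 < eps ->
  [/\ ig (P3 m) (fun y => w2 eps c y * Gpos y),
    Gm eps c <= mollnorm eps a c + mollnorm eps b c &
    Gm eps c <= mollC R / eps * (\int[pm m mu]_z `|a z.1 z.2| + \int[pm m mu]_z `|b z.1 z.2|)].
Proof.
move=> e0; have [i1 le1 le2] := w2_bound e0 c mGpos ia ib Gpos_le.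
have le0 : Gm eps c <= \int[P3 m]_y `|w2 eps c y * Gpos y|.
  by apply: int_le => //; [exact: ig_abs|move=> y; exact: ler_norm].
split => //; first exact: le_trans le1.
apply: (le_trans le0); rewrite -lee_fin EFin_int//; exact: ig_abs.
Qed.

Lemma ig_Gm eps : 0 < eps -> ig mu (Gm eps).
Proof.
move=> e0.
have mF : measurable_fun setT (fun z : RT * Y => w2 eps z.1 z.2 * Gpos z.2).
  apply: measurable_funM; first exact: measurable_w2.
  exact: (measurableT_comp mGpos).
have iF : ig (pm mu (P3 m)) (fun z => w2 eps z.1 z.2 * Gpos z.2).
  apply: (ig_by_sections mF (igD (ig_mollnormF e0 ia) (ig_mollnormF e0 ib))).
  apply/aeW => c /=; have [i1 le1 _] := w2_bound e0 c mGpos ia ib Gpos_le.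
  by rewrite -EFin_int ?lee_fin//; exact: ig_abs.
exact: (ig_F1 iF).
Qed.

End Gm.

Section Gm_local.
Context (R : realType) d (X : measurableType d).
Variable m : {sigma_finite_measure set X -> \bar R}.
Variables (eps : R) (a b : X -> R -> R) (c : R).
Hypothesis e0 : 0 < eps.

Lemma Gm_local (a' b' : X -> R -> R) :
  (forall x t, `|t - c| <= eps -> a x t = a' x t /\ b x t = b' x t) ->
  Gm m a b eps c = Gm m a' b' eps c.
Proof.
move=> h; apply: (int_ext (P3 m)) => y.
have [->|wz] := eqVneq (w2 eps c y) 0; first by rewrite !mul0r.
have [h1 h2] := w2_supp e0 wz.
by rewrite /Gpos (h y.2 _ h1).1 (h y.2 _ h2).2.
Qed.

Lemma Gm_cst (q p : X -> R) : ig m q -> ig m p ->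
  (forall x t, `|t - c| <= eps -> a x t = q x /\ b x t = p x) ->
  Gm m a b eps c = \int[m]_x rpos (q x - p x).
Proof.
move=> iq ip h; rewrite (Gm_local (a' := fun x _ => q x) (b' := fun x _ => p x) h).
have ir : ig m (fun x => rpos (q x - p x)).
  apply: (ig_le (measurable_rpos (ig_mfun (igB iq ip))) (ig_abs (igB iq ip))) => x.
  by rewrite ger0_norm ?rpos_ge0// /rpos ge_max ler_norm normr_ge0.
by have [_ <-] := w2_cst c e0 ir (fun x => rpos_ge0 _).
Qed.

End Gm_local.

(** * The two times merge *)

Section Gm_cvg.
Context (R : realType) d (X : measurableType d).
Variable m : {sigma_finite_measure set X -> \bar R}.
Local Notation mu := (@lebesgue_measure R).
Local Notation RT := (measurableTypeR R).
Local Notation Y := (RT * RT * X)%type.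

Section osc2.
Variables (eps : R) (a : X -> R -> R).
Hypotheses (e0 : 0 < eps) (ia : ig (pm m mu) (fun z => a z.1 z.2)).

Let oscF (z : X * RT * RT) := moll eps (z.1.2 - z.2) * `|a z.1.1 z.1.2 - a z.1.1 z.2|.

Lemma ig_osc2F : ig (pm (pm m mu) mu) oscF.
Proof.
have i1 := ig_mollnorm e0 ia.
have i2 := ig_cvF (ig_moll0 e0) (G := fun x t => `|a x t|) (ig_abs ia).
have mF : measurable_fun setT oscF.
  apply: measurable_funM.
    apply: (measurableT_comp (measurable_moll eps)); apply: measurable_funB => //.
    exact: (measurableT_comp measurable_snd measurable_fst).
  apply: measurableT_comp => //; apply: measurable_funB.
    exact: (measurableT_comp (ig_mfun ia) measurable_fst).
  apply: (measurable_comp2 (ig_mfun ia)) => //.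
  exact: (measurableT_comp measurable_fst measurable_fst).
apply: (ig_le mF (igD i1 i2)) => z; have m0 : 0 <= moll eps (z.1.2 - z.2) by exact: moll_ge0.
rewrite -mulrDr ger0_norm; last by apply: mulr_ge0.
by rewrite ler_wpM2l//; exact: ler_normB.
Qed.

Definition osc2 (c : R) := \int[pm m mu]_z oscF (z, c).

Lemma ig_osc2 : ig mu osc2. Proof. exact: (ig_F2 ig_osc2F). Qed.

Lemma ae_osc2 : {ae mu, forall c, ig (pm m mu) (fun z => moll eps (z.2 - c) * `|a z.1 z.2 - a z.1 c|)}.
Proof. exact: (ae_ig2 ig_osc2F). Qed.

Definition osc1 (x : X) := \int[mu]_t \int[mu]_c oscF ((x, t), c).

Lemma ig_osc1 : ig m osc1.
Proof. exact: (ig_F1 (ig_F1 ig_osc2F)). Qed.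

Lemma int_osc2 : \int[mu]_c osc2 c = \int[m]_x osc1 x.
Proof. by rewrite (int_F2 ig_osc2F) -(int_F1 ig_osc2F) -(int_F1 (ig_F1 ig_osc2F)). Qed.

Lemma osc1_Om1 x : ig mu (a x) -> osc1 x = Om1 eps (a x).
Proof.
move=> iax; have [i0 _ _] := ig_Om1 e0 iax; rewrite /Om1 -(int_F1 i0).
apply: (int_ext mu) => t /=.
transitivity (fine (\int[mu]_c (oscF ((x, t), c))%:E)%E); first by [].
pose k (s : RT) := moll eps s * `|a x (t - s) - a x t|.
have mk : measurable_fun [set: RT] (fun s => (k s)%:E).
  apply/measurable_EFinP; apply: measurable_funM; first exact: measurable_moll.
  apply: measurableT_comp => //; apply: measurable_funB => //.
  by apply: (measurableT_comp (ig_mfun iax)); exact: measurable_funB.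
have k0 s : (0 <= (k s)%:E)%E by rewrite lee_fin; apply: mulr_ge0 => //; exact: moll_ge0.
rewrite -[RHS]/(fine (\int[mu]_s (k s)%:E)%E); congr fine.
have mkn : measurable_fun [set: RT] (fun s : RT => (k (- s))%:E).
  have mo : measurable_fun [set: RT] (fun s : RT => - s : RT) by exact: oppr_measurable.
  exact: (measurableT_comp mk mo).
have kn0 s : (0 <= (k (- s))%:E)%E by exact: k0.
rewrite -(ge0_integral_neg mk k0) -(ge0_integral_shift t mkn kn0).
apply: eq_integral => c _; rewrite /k /oscF /=.
have -> : - (c - t) = t - c by ring.
have -> : t - (t - c) = c by ring.
by rewrite distrC.
Qed.

End osc2.

Lemma osc2_cvg (T : R) (e : nat -> R) (a : X -> R -> R) : 0 < T ->
  (forall n, 0 < e n) -> e n @[n --> \oo] --> 0 ->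
  ig (pm m mu) (fun z => a z.1 z.2) -> (forall x t, ~~ (0 < t < T) -> a x t = 0) ->
  \int[mu]_c osc2 (e n) a c @[n --> \oo] --> 0.
Proof.
move=> T0 e0 ecv ia off.
have z0 : \int[m]_x (0 : R) = 0 by rewrite /Rintegral integral0.
rewrite -[X in _ --> X]z0.
under eq_fun do rewrite int_osc2//.
apply: (ig_DCT_ae (g := fun x => 2 * \int[mu]_t `|a x t|)).
- by move=> n; exact: (ig_mfun (ig_osc1 (e0 n) ia)).
- exact: measurable_cst.
- apply: (ae_imp _ (ae_ig1 ia)) => x /= iax.
  have E : forall n, osc1 (e n) a x = Om1 (e n) (a x) by move=> n; exact: osc1_Om1.
  by under eq_fun do rewrite E; apply: (Om1_cvg T0) => // t; exact: off.
- by apply: igZ; exact: (ig_F1 (ig_abs ia)).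
apply: (ae_imp _ (ae_ig1 ia)) => x /= iax n.
rewrite osc1_Om1// ger0_norm ?Om1_ge0//; exact: Om1_le.
Qed.

Variables (a b : X -> R -> R).
Hypotheses (ia : ig (pm m mu) (fun z => a z.1 z.2)) (ib : ig (pm m mu) (fun z => b z.1 z.2)).

Definition gpos (c : R) := \int[m]_x rpos (a x c - b x c).

Lemma rpos_dist (x y : R) : `|rpos x - rpos y| <= `|x - y|.
Proof.
rewrite /rpos /Num.max; case: ltP => x0; case: ltP => y0;
  rewrite ?subrr ?normr0 ?subr0 ?sub0r ?normrN//.
  by rewrite (ger0_norm y0) distrC ger0_norm; lra.
by rewrite (ger0_norm x0) ger0_norm; lra.
Qed.

Lemma ig_gposF : ig (pm m mu) (fun z => rpos (a z.1 z.2 - b z.1 z.2)).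
Proof.
have iB := igB ia ib.
apply: (ig_le (measurable_rpos (ig_mfun iB)) (ig_abs iB)) => x.
by rewrite ger0_norm ?rpos_ge0// /rpos ge_max ler_norm normr_ge0.
Qed.

Lemma ig_gpos : ig mu gpos. Proof. exact: (ig_F2 ig_gposF). Qed.

Lemma int_gpos : \int[mu]_c gpos c = \int[pm m mu]_z rpos (a z.1 z.2 - b z.1 z.2).
Proof. exact: (int_F2 ig_gposF). Qed.

(** The positive part is 1-Lipschitz, so replacing both times by [c] costs the oscillation of [a]
    plus that of [b]. *)
Lemma Gm_gpos (eps : R) : 0 < eps ->
  {ae mu, forall c, `|Gm m a b eps c - gpos c| <= osc2 eps a c + osc2 eps b c}.
Proof.
move=> e0.
have h1 := ae_osc2 e0 ia; have h2 := ae_osc2 e0 ib.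
have h12 := ae_sub2 (fun t p q => conj p q) h1 h2.
apply: (ae_sub2 _ h12 (ae_ig2 ig_gposF)) => c [/= ja jb] ig_c.
have [ic Ec] := w2_cst c e0 ig_c (fun x => rpos_ge0 _).
have [iG _ _] := Gm_sec ia ib c e0.
have -> : Gm m a b eps c - gpos c =
    \int[P3 m]_y (w2 eps c y * (Gpos a b y - rpos (a y.2 c - b y.2 c))).
  by rewrite /gpos -Ec /Gm -int_B//; apply: (int_ext (P3 m)) => y; rewrite mulrBr.
have iD : ig (P3 m) (fun y => w2 eps c y * (Gpos a b y - rpos (a y.2 c - b y.2 c))).
  by under eq_fun do rewrite mulrBr; exact: igB.
have mac (a' : X -> R -> R) : measurable_fun setT (fun z : X * RT => a' z.1 z.2) ->
    measurable_fun setT (fun z : X * RT => a' z.1 z.2 - a' z.1 c).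
  move=> ma; apply: measurable_funB => //.
  exact: (measurable_comp2 ma measurable_fst (measurable_cst _)).
have ma := mac _ (ig_mfun ia); have mb := mac _ (ig_mfun ib).
apply: (le_trans (int_norm iD)); rewrite -lee_fin (EFin_int (ig_abs iD)) EFinD.
rewrite /osc2 (EFin_int ja) (EFin_int jb).
rewrite -(w2_normL m e0 (a := fun x t => a x t - a x c) c ma).
rewrite -(w2_normR m e0 (a := fun x t => b x t - b x c) c mb).
have mw := measurable_w2l (X := X) eps c.
have mF1 : measurable_fun setT (fun y : Y => (w2 eps c y * `|a y.2 y.1.1 - a y.2 c|)%:E).
  apply/measurable_EFinP; apply: measurable_funM => //; apply: measurableT_comp => //.
  exact: (mYt (a := fun x t => a x t - a x c) ma).
have mF2 : measurable_fun setT (fun y : Y => (w2 eps c y * `|b y.2 y.1.2 - b y.2 c|)%:E).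
  apply/measurable_EFinP; apply: measurable_funM => //; apply: measurableT_comp => //.
  exact: (mYr (a := fun x t => b x t - b x c) mb).
rewrite -ge0_int_D//; last 2 first.
- by move=> y; rewrite lee_fin mulr_ge0// w2_ge0.
- by move=> y; rewrite lee_fin mulr_ge0// w2_ge0.
apply: ge0_le_int.
- by apply/measurable_EFinP; exact: (ig_mfun (ig_abs iD)).
- exact: emeasurable_funD.
- by move=> y; rewrite lee_fin.
move=> y; rewrite -EFinD lee_fin normrM ger0_norm ?w2_ge0// -mulrDr ler_wpM2l ?w2_ge0//.
apply: (le_trans (rpos_dist _ _)).
rewrite (_ : _ - _ - _ = (a y.2 y.1.1 - a y.2 c) - (b y.2 y.1.2 - b y.2 c)); last ring.
exact: ler_normB.
Qed.

Lemma Gm_cvg (T : R) (e : nat -> R) : 0 < T ->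
  (forall n, 0 < e n) -> e n @[n --> \oo] --> 0 ->
  (forall x t, ~~ (0 < t < T) -> a x t = 0) -> (forall x t, ~~ (0 < t < T) -> b x t = 0) ->
  \int[mu]_c `|Gm m a b (e n) c - gpos c| @[n --> \oo] --> 0.
Proof.
move=> T0 e0 ecv offa offb.
have la := osc2_cvg T0 e0 ecv ia offa; have lb := osc2_cvg T0 e0 ecv ib offb.
apply: (@squeeze_cvgr _ _ _ _ (fun _ => 0) (fun n => \int[mu]_c osc2 (e n) a c + \int[mu]_c osc2 (e n) b c)).
- apply: nearW => n; rewrite int_ge0 /=; last by move=> x; exact: normr_ge0.
  rewrite -int_D; [|exact: ig_osc2..].
  apply: int_le_ae; last exact: Gm_gpos.
    by apply: ig_abs; apply: igB; [exact: ig_Gm|exact: ig_gpos].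
  by apply: igD; exact: ig_osc2.
- exact: cvg_cst.
by have h := cvgD la lb; rewrite addr0 in h; exact: h.
Qed.

End Gm_cvg.

(** * Behaviour of a solution at the initial time *)

Section swap.
Context (R : realType) d1 d2 d3 (T1 : measurableType d1) (T2 : measurableType d2)
  (T3 : measurableType d3).
Variable m1 : {sigma_finite_measure set T1 -> \bar R}.
Variable m2 : {sigma_finite_measure set T2 -> \bar R}.
Variable m3 : {sigma_finite_measure set T3 -> \bar R}.

Let sw (z : T1 * T3 * T2) : T1 * T2 * T3 := ((z.1.1, z.2), z.1.2).

Let msw : measurable_fun setT sw.
Proof.
apply: measurable_fun_pair; last exact: (measurableT_comp measurable_snd measurable_fst).
by apply: measurable_fun_pair => //; exact: (measurableT_comp measurable_fst measurable_fst).
Qed.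

Let ge0_swap (F : T1 * T2 * T3 -> \bar R) : measurable_fun setT F -> (forall z, 0 <= F z)%E ->
  (\int[pm (pm m1 m3) m2]_z F (sw z) = \int[pm (pm m1 m2) m3]_z F z)%E.
Proof.
move=> mF F0.
rewrite -(@tonelli3l _ _ _ _ _ _ _ m1 m2 m3 F mF F0).
rewrite -(@tonelli3l _ _ _ _ _ _ _ m1 m3 m2 _ (measurableT_comp mF msw) (fun z => F0 _)).
apply: eq_integral => x _; rewrite /sw /=.
have mFx : measurable_fun setT (fun p : T2 * T3 => F ((x, p.1), p.2)).
  apply: (measurableT_comp mF); apply: measurable_fun_pair => //.
  exact: measurable_fun_pair.
by rewrite (fubini_tonelli _ mFx).
Qed.

Lemma int_swap23 (F : T1 * T2 * T3 -> R) : ig (pm (pm m1 m2) m3) F ->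
  ig (pm (pm m1 m3) m2) (fun z => F ((z.1.1, z.2), z.1.2)) /\
  \int[pm (pm m1 m3) m2]_z F ((z.1.1, z.2), z.1.2) = \int[pm (pm m1 m2) m3]_z F z.
Proof.
move=> iF; have mF := ig_mfun iF.
have nn (G : T1 * T2 * T3 -> R) : ig (pm (pm m1 m2) m3) G -> (forall z, 0 <= G z) ->
    ig (pm (pm m1 m3) m2) (fun z => G (sw z)) /\
    \int[pm (pm m1 m3) m2]_z G (sw z) = \int[pm (pm m1 m2) m3]_z G z.
  move=> iG G0; have mGE : measurable_fun setT (fun z => (G z)%:E).
    by apply/measurable_EFinP; exact: ig_mfun iG.
  have E := ge0_swap mGE (fun z => G0 z).
  have i' : ig (pm (pm m1 m3) m2) (fun z => G (sw z)).
    apply: ig_fin; first exact: (measurableT_comp (ig_mfun iG) msw).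
    rewrite (eq_integral (fun z => (G (sw z))%:E)) ?E -?(EFin_int iG) ?ltry//.
    by move=> z _; rewrite ger0_norm.
  by split => //; apply/EFin_inj; rewrite !EFin_int.
have ip : ig (pm (pm m1 m2) m3) (fun z => rpos (F z)).
  apply: (ig_le (measurable_rpos mF) (ig_abs iF)) => z.
  by rewrite ger0_norm ?rpos_ge0// /rpos ge_max ler_norm normr_ge0.
have iN : ig (pm (pm m1 m2) m3) (fun z => rneg (F z)).
  apply: (ig_le (measurable_rneg mF) (ig_abs iF)) => z.
  by rewrite ger0_norm ?rneg_ge0// /rneg ge_max normr_ge0 andbT -normrN ler_norm.
have [ip' Ep] := nn _ ip (fun z => rpos_ge0 _); have [in' En] := nn _ iN (fun z => rneg_ge0 _).
have FE z : F z = rpos (F z) - rneg (F z) by exact: rposnegE.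
have FE' z : F ((z.1.1, z.2), z.1.2) = rpos (F (sw z)) - rneg (F (sw z)) by exact: rposnegE.
split; first by have := igB ip' in'; under eq_fun do rewrite -FE'.
rewrite (int_ext _ FE') (int_ext _ FE) !int_B//.
by rewrite Ep En.
Qed.

End swap.

Section initial.
Context (R : realType) d (X : measurableType d).
Variable m : {sigma_finite_measure set X -> \bar R}.
Local Notation mu := (@lebesgue_measure R).
Local Notation RT := (measurableTypeR R).
Variables (Om : set X) (kap : X * X -> R) (T : R) (kk : R -> R).
Hypotheses (mOm : measurable Om) (Omfin : (m Om < +oo)%E).
Hypotheses (mkap : measurable_fun setT kap) (kap0 : forall z, 0 <= kap z).
Hypothesis T0 : 0 < T.
Hypotheses (kk_ig : ig mu kk) (kk_ge0 : forall t, 0 <= kk t)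
  (kk_supp : forall t, ~~ (0 < t < T) -> kk t = 0)
  (kk_mono : forall r t, 0 < r -> r <= t -> kk t <= kk r).

Definition kapp (x : R) := \int[mu]_t (ioo 0 x t * kk t).

Lemma kapp_ge0 x : 0 <= kapp x.
Proof. by apply: int_ge0 => t; rewrite mulr_ge0 ?ioo_ge0. Qed.

Variables (f : X -> R -> R) (u0 : X -> R) (u : X -> R -> R).
Hypothesis hu : esol m Om kap T kk f u0 u.

Definition Au (x : R) := \int[pm m mu]_z (ioo 0 x z.2 * `|u z.1 z.2|).

Section eps.
Variable eps : R.
Hypotheses (e0 : 0 < eps) (eT : eps < T).

Let z := cutoff eps.
Let be (t : R) := ioo 0 T t * derive1 z t.
(** By Fubini the kernel term is the integral of [Q r * G x r]: the convolution is moved from the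
    solution to the derivative of the cut-off, where it can be bounded from both sides. *)
Let Q (r : R) := \int[mu]_t (- be t * kk (t - r)).

Let mz : measurable_fun [set: RT] (z : RT -> RT). Proof. exact: measurable_cutoff. Qed.

Let mbe : measurable_fun [set: RT] be.
Proof. by apply: measurable_funM; [exact: measurable_ioo|exact: measurable_cutoff_der]. Qed.

Let be_bnd t : 0 <= - be t <= 2 / eps * ioo 0 eps t.
Proof.
have /andP[h1 h2] := cutoff_der e0 t; rewrite /be -mulrN.
apply/andP; split; first by rewrite mulr_ge0 ?ioo_ge0.
have [h|h] := boolP (0 < t < eps).
  by rewrite [ioo 0 eps t]ioo1// mulr1 (le_trans _ h2)// ler_piMl// ioo_le1.
rewrite [ioo 0 eps t]ioo0// mulr0.
have [h'|h'] := boolP (0 < t < T); last by rewrite ioo0// mul0r.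
rewrite cutoff_der_supp ?oppr0 ?mulr0//.
by have [t0 _] := andP h'; move: h; rewrite t0 /= -leNgt.
Qed.

Let be_abs t : `|be t| <= 2 / eps.
Proof.
rewrite -normrN; have /andP[h1 h2] := be_bnd t; rewrite ger0_norm//; apply: (le_trans h2).
by rewrite ler_piMr ?ioo_le1// divr_ge0// ltW.
Qed.

Let ibk r : ig mu (fun t => - be t * kk (t - r)).
Proof.
apply: (ig_bM (c := 2 / eps)); last exact: ig_shift.
  exact: measurableT_comp.
by move=> t; rewrite normrN; exact: be_abs.
Qed.

Let Q0 r : 0 <= Q r.
Proof. by apply: int_ge0 => t; apply: mulr_ge0 => //; have /andP[] := be_bnd t. Qed.

(** Q vanishes from eps on, because [kk (t - r)] requires r < t and the derivative of the cut-off
    requires t < eps. The interval starts at -1 so as to contain r = 0. *)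
Let Q_le r : 0 <= r -> Q r <= 2 / eps * kapp eps * ioo (-1) eps r.
Proof.
move=> r0; have E0 := e0; have [re|re] := ltP r eps; last first.
  rewrite [ioo _ _ r]ioo0 ?mulr0; last by rewrite negb_and orbC -leNgt re.
  rewrite /Q (_ : (fun t => _) = (fun _ => 0)); first by rewrite /Rintegral integral0.
  apply/funext => t; have [tr|tr] := ltP r t.
    have /andP[h1 h2] := be_bnd t.
    have h3 : - be t <= 0 by move: h2; rewrite ioo0 ?mulr0// negb_and orbC -leNgt (le_trans re)// ltW.
    by rewrite (_ : - be t = 0) ?mul0r//; apply/le_anti; rewrite h1 h3.
  by rewrite kk_supp ?mulr0// negb_and -leNgt subr_le0 tr.
rewrite [ioo _ _ r]ioo1 ?mulr1; last by apply/andP; split; lra.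
rewrite /kapp -(int_shift r (ig_iooM 0 eps kk_ig)) -int_Z; last first.
  exact: (ig_shift r (ig_iooM 0 eps kk_ig)).
apply: int_le; first exact: ibk.
  by apply: igZ; exact: (ig_shift r (ig_iooM 0 eps kk_ig)).
move=> t; rewrite mulrA; have /andP[h1 h2] := be_bnd t.
have [tr|tr] := ltP r t; last by rewrite kk_supp ?mulr0// negb_and -leNgt subr_le0 tr.
rewrite ler_wpM2r//; have [h|h] := boolP (0 < t - r < eps).
  by rewrite [ioo 0 eps (t - r)]ioo1// mulr1 (le_trans h2)// ler_piMr ?ioo_le1// divr_ge0// ltW.
rewrite [ioo 0 eps (t - r)]ioo0// mulr0.
move: h2; rewrite [ioo 0 eps t]ioo0 ?mulr0//.
apply/negP => /andP[a b]; move/negP: h; apply; apply/andP; split; lra.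
Qed.

(** If r and t - r are both below eps / 4, then t is below eps / 2, in the range of
    [cutoff_der_lower]. *)
Let Q_ge r : 0 < r < eps / 4 -> expR (- 2) / eps * kapp (eps / 4) <= Q r.
Proof.
move=> /andP[r0 r1]; have E0 := e0; have ET := eT.
rewrite /kapp -(int_shift r (ig_iooM 0 (eps / 4) kk_ig)) -int_Z; last first.
  exact: (ig_shift r (ig_iooM 0 (eps / 4) kk_ig)).
apply: int_le; last 1 first.
- move=> t; rewrite mulrA.
  have [h|h] := boolP (0 < t - r < eps / 4); last first.
    rewrite [ioo 0 _ (t - r)]ioo0// mulr0 mul0r; apply: mulr_ge0 => //.
    by have /andP[] := be_bnd t.
  rewrite [ioo 0 _ (t - r)]ioo1// mulr1; have /andP[h1 h2] := h.
  rewrite ler_wpM2r// /be ioo1; last by apply/andP; split; lra.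
  by rewrite mul1r; apply: cutoff_der_lower => //; apply/andP; split; lra.
- by apply: igZ; exact: (ig_shift r (ig_iooM 0 (eps / 4) kk_ig)).
- exact: ibk.
Qed.

Let ibe : ig mu be.
Proof.
rewrite /be; under eq_fun do rewrite mulrC; apply: (ig_bM (c := 2 / eps)) (ig_ioo 0 T).
  exact: measurable_cutoff_der.
move=> t; have /andP[h1 h2] := cutoff_der e0 t.
by rewrite -normrN ger0_norm.
Qed.

Let iQ : ig mu Q.
Proof.
have i2 : ig mu (fun x : R => kk (- x)).
  by have := ig_refl 0 kk_ig; under eq_fun do rewrite sub0r.
have [h _] := ig_conv (igN ibe) i2; have := ig_F1 h.
rewrite (_ : (fun x : R => _) = Q)//; apply/funext => r; apply: (int_ext mu) => t /=.
by rewrite opprB.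
Qed.

Let iQT : ig mu (fun r => ioo 0 T r * Q r). Proof. exact: ig_iooM. Qed.

Let QT_le : \int[mu]_r (ioo 0 T r * Q r) <= 2 * kapp eps.
Proof.
have E0 := e0; have ET := eT.
apply: (@le_trans _ _ (\int[mu]_r (2 / eps * kapp eps * ioo 0 eps r))).
  apply: int_le => //; first by apply: igZ; exact: ig_ioo.
  move=> r; have [h|h] := boolP (0 < r < T); last first.
    rewrite ioo0// mul0r mulr_ge0 ?ioo_ge0// mulr_ge0 ?kapp_ge0// divr_ge0// ltW//.
  have /andP[h1 h2] := h; rewrite [ioo 0 T r]ioo1// mul1r (le_trans (Q_le (ltW h1)))//.
  have [h3|h3] := ltP r eps.
    by rewrite [ioo 0 eps r]ioo1 ?h1// [ioo (-1) eps r]ioo1// h3 andbT; lra.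
  by rewrite !ioo0// negb_and -!leNgt h3 orbT.
rewrite int_Z; last exact: ig_ioo.
rewrite (int_ioo (ltW e0)) subr0 (_ : 2 / eps * kapp eps * eps = 2 * kapp eps)//.
by field; rewrite gt_eqF.
Qed.

Let O (x : X) : R := \1_Om x.

Let O0 x : 0 <= O x.
Proof. by rewrite /O indicE ler0n. Qed.

Let iO : ig m O.
Proof.
apply: ig_fin; first exact: measurable_indic.
under eq_integral do rewrite ger0_norm ?O0//.
by rewrite integral_indic// setIT.
Qed.

Let OE x : Om x -> O x = 1.
Proof. by move=> h; rewrite /O indicE mem_set. Qed.

Let OE0 x : ~ Om x -> O x = 0.
Proof. by move=> h; rewrite /O indicE memNset. Qed.

Let Q0K r : 0 < r < T -> expR (- 2) / eps * kapp (eps / 4) * ioo 0 (eps / 4) r <= Q r.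
Proof.
move=> h; have [h2|h2] := boolP (0 < r < eps / 4).
  by rewrite ioo1// mulr1; exact: Q_ge.
by rewrite ioo0// mulr0.
Qed.

(** The inequality with [phi = 0], the cut-off as [zeta], and a smoothed sign. The nonlocal term is
    nonnegative and is dropped. As [J x] lies between [|x| / 2 - 2^-1] and [|x| / 2], the kernel
    term controls [|u|] up to [|u0| + 1] on [Om]; this is where the measure of [Om] enters. [Q_ge]
    and [QT_le] weigh the two contributions. *)
Lemma initial_estimate :
  expR (- 2) / eps * kapp (eps / 4) * Au (eps / 4) <=
  \int[pm m mu]_z (ioo 0 eps z.2 * `|f z.1 z.2|) +
  2 * kapp eps * (\int[m]_x `|u0 x| + \int[m]_x \1_Om x).
Proof.
have aux1 (a b c e : R) : a / 2 - 2^-1 <= c -> e <= b / 2 -> 2^-1 * (a - (b + 1)) <= c - e by lra.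
have aux2 (K g a b c q : R) : K * g * a <= q * a ->
    2^-1 * (K * (g * a)) - 2^-1 * ((b + c) * q) <= q * (2^-1 * (a - (b + c))) by nra.
have aux3 (p q a b c : R) : p <= 2^-1 * a -> 2^-1 * b - 2^-1 * c <= q -> q <= p -> b <= a + c by lra.
have E0 := e0; have ET := eT.
have [S [s [J [hP [hS hJ]]]]] := exists_ssign R.
have S0 : S 0 = 0 by case: hP.
have J0 : J 0 = 0 by case: hP.
have Jge x : 0 <= J x.
  have SS y : 0 <= y -> 0 <= S y by move=> y0; have /andP[] := Pfun_mono hP y0; rewrite S0.
  have SS' y : y <= 0 -> S y <= 0 by move=> y0; have /andP[] := Pfun_mono hP y0; rewrite S0.
  have [x0|x0] := leP 0 x.
    have [y /andP[y0 _]] := Pfun_mvtJ hP x0; rewrite J0 !subr0 => ->.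
    by rewrite mulr_ge0// SS.
  have [y /andP[_ y0]] := Pfun_mvtJ hP (ltW x0); rewrite J0 !sub0r => /(congr1 -%R).
  by rewrite opprK => ->; rewrite -mulrN opprK mulr_le0 ?SS' // ltW.
have Jle x : J x <= `|x| / 2.
  by have := Pfun_distJ hP 0 x hS; rewrite J0 !subr0 ger0_norm// mulrC.
pose G x t := ioo 0 T t * (J (u x t - 0) - J (u0 x - 0)).
have mu' := ig_mfun (es_u hu); have mu0' := ig_mfun (es_u0 hu).
have mJ : measurable_fun [set: RT] (J : RT -> RT) by exact: cts_mfun (Pfun_contJ hP).
have mS : measurable_fun [set: RT] (S : RT -> RT) by exact: cts_mfun (Pfun_contS hP).
have iG : ig (pm m mu) (fun y => G y.1 y.2).
  apply: (ig_le _ (igZ 2^-1 (ig_abs (ig_dg hu)))).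
    apply: measurable_funM; first exact: (measurableT_comp (measurable_ioo 0 T)).
    apply: measurable_funB; apply: (measurableT_comp mJ); apply: measurable_funB => //.
    exact: (measurableT_comp mu0').
  move=> y; rewrite /G /dg !subr0 !normrM mulrCA ler_wpM2l//.
  exact: (Pfun_distJ hP _ _ hS).
have iLc : ig (pm m mu) (fun y => be y.2 * cvX kk G y.1 y.2).
  apply: (ig_bM (c := 2 / eps)) (ig_cvX kk_ig iG) => //.
  exact: (measurableT_comp mbe).
have iA : ig (pm m mu) (fun y => ioo 0 T y.2 * z y.2 * (f y.1 y.2 - 0) * S (u y.1 y.2 - 0)).
  have h1 : ig (pm m mu) (fun y => (ioo 0 T y.2 * z y.2 * S (u y.1 y.2)) * f y.1 y.2).
    apply: (ig_bM (c := 1)) (es_f hu).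
      apply: measurable_funM; last exact: (measurableT_comp mS).
      by apply: measurable_funM; apply: measurableT_comp => //; exact: measurable_ioo.
    move=> y; rewrite !normrM -[leRHS](mulr1 1) ler_pM//.
      rewrite -[leRHS](mulr1 1) ler_pM// ?ioo_norm1// ger0_norm ?cutoff_ge0//.
      exact: cutoff_le1.
    by apply: (le_trans (hS _)); lra.
  move: h1; rewrite (_ : (fun y => _) = (fun y => ioo 0 T y.2 * z y.2 * (f y.1 y.2 - 0) * S (u y.1 y.2 - 0)))//.
  by apply/funext => y; rewrite !subr0 mulrAC.
have H : \int[pm m mu]_y (- (be y.2 * cvX kk G y.1 y.2)) <=
    \int[pm m mu]_y (ioo 0 T y.2 * z y.2 * (f y.1 y.2 - 0) * S (u y.1 y.2 - 0)).
  rewrite int_N// -subr_ge0 opprK -(int_F2 iA) -(int_F2 iLc) -lee_fin.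
  have := es_ineq hu (phi := fun _ => 0) (M := 0) (zeta := z) (S := S) (s := s) (J := J)
    (k1 := kk) (w := fun _ _ => 0).
  move/(_ _ _ _ _ _ _ hP (or_introl (conj erefl erefl))) => hineq.
  apply: (le_trans _ (hineq _ _ _ _ _ _)) => //.
  - apply: mule_ge0 => //; apply: integral_ge0 => t _; apply: integral_ge0 => y _.
    rewrite lee_fin; apply: mulr_ge0 => //; apply: mulr_ge0.
      by apply: mulr_ge0; [exact: ioo_ge0|exact: cutoff_ge0].
    rewrite !subr0; have [h|/ltW h] := leP (u y.1 t) (u y.2 t).
      by apply: mulr_le0; rewrite subr_le0//; have /andP[] := Pfun_mono hP h.
    by apply: mulr_ge0; rewrite subr_ge0//; have /andP[] := Pfun_mono hP h.
  - by move=> x; rewrite normr0.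
  - by under eq_integral do rewrite subrr expr0n mul0r; rewrite integral0 ltry.
  - by split; [exact: cutoff_smooth|exists eps => // t /ltW h; exact: cutoff_supp].
  - by move=> t _; exact: cutoff_ge0.
have iL : ig (pm (pm m mu) mu) (fun y => - be y.1.2 * (kk (y.1.2 - y.2) * G y.1.1 y.2)).
  apply: (ig_bM (c := 2 / eps)) (ig_cvF kk_ig iG).
    apply: measurableT_comp => //.
    by apply: (measurableT_comp mbe); exact: (measurableT_comp measurable_snd measurable_fst).
  by move=> y; rewrite normrN.
have i2 := (int_swap23 iL).1; have E2 := (int_swap23 iL).2.
have QGE y : \int[mu]_t (- be t * (kk (t - y.2) * G y.1 y.2)) = Q y.2 * G y.1 y.2.
  rewrite [RHS]mulrC /Q -int_Z; last exact: ibk.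
  by apply: (int_ext mu) => t; ring.
have iQG : ig (pm m mu) (fun y => Q y.2 * G y.1 y.2).
  by have := ig_F1 i2; rewrite /=; under eq_fun do rewrite QGE.
have LE : \int[pm m mu]_y (- (be y.2 * cvX kk G y.1 y.2)) = \int[pm m mu]_y (Q y.2 * G y.1 y.2).
  transitivity (\int[pm (pm m mu) mu]_y (- be y.1.2 * (kk (y.1.2 - y.2) * G y.1.1 y.2))).
    rewrite -(int_F1 iL).
    have h := ae_ig1 (ig_cvF kk_ig iG).
    have := @int_ae _ _ _ (pm m mu) _ _ (igN iLc) (ig_mfun (ig_F1 iL)).
    case=> //; apply: (ae_imp _ h) => y hy.
    by rewrite /cvX /= -mulNr -(int_Z _ hy).
  rewrite -E2 -(int_F1 i2); apply: int_ext => y /=; exact: QGE.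
set K := expR (- 2) / eps * kapp (eps / 4).
have K0 : 0 <= K by rewrite mulr_ge0 ?kapp_ge0// divr_ge0 ?expR_ge0// ltW.
have iU0 : ig m (fun x => `|u0 x| + O x) by apply: igD => //; exact: ig_abs (es_u0 hu).
have iU0Q := ig_tensor iU0 iQT.
have iAu : ig (pm m mu) (fun y => ioo 0 (eps / 4) y.2 * `|u y.1 y.2|).
  apply: (ig_bM (c := 1)) (ig_abs (es_u hu)) => [|y]; last exact: ioo_norm1.
  exact: (measurableT_comp (measurable_ioo 0 (eps / 4))).
have iAf : ig (pm m mu) (fun y => ioo 0 eps y.2 * `|f y.1 y.2|).
  apply: (ig_bM (c := 1)) (ig_abs (es_f hu)) => [|y]; last exact: ioo_norm1.
  exact: (measurableT_comp (measurable_ioo 0 eps)).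
have up : \int[pm m mu]_y (ioo 0 T y.2 * z y.2 * (f y.1 y.2 - 0) * S (u y.1 y.2 - 0)) <=
    2^-1 * \int[pm m mu]_y (ioo 0 eps y.2 * `|f y.1 y.2|).
  rewrite -int_Z//; apply: int_le => //; first exact: igZ.
  move=> y; rewrite !subr0; have [h|h] := boolP (0 < y.2 < T); last first.
    by rewrite ioo0// !mul0r mulr_ge0// mulr_ge0 ?ioo_ge0.
  rewrite [ioo 0 T _]ioo1// mul1r; have [h1|h1] := ltP y.2 eps; last first.
    by rewrite /z cutoff_supp// !mul0r mulr_ge0// mulr_ge0 ?ioo_ge0.
  rewrite [ioo 0 eps _]ioo1; last by rewrite h1 andbT; have /andP[] := h.
  rewrite mul1r; apply: le_trans (ler_norm _) _; rewrite !normrM mulrC ler_pM ?mulr_ge0//.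
  by rewrite ler_piMl// ger0_norm ?cutoff_ge0// cutoff_le1.
have low : 2^-1 * (K * Au (eps / 4)) - 2^-1 * \int[pm m mu]_y ((`|u0 y.1| + O y.1) * (ioo 0 T y.2 * Q y.2))
    <= \int[pm m mu]_y (Q y.2 * G y.1 y.2).
  rewrite /Au -!int_Z//; [|exact: igZ..].
  rewrite -int_B; [|do ?exact: igZ..]; last by apply: igZ; exact: igZ.
  apply: int_le => //; first by apply: igB; apply: igZ => //; exact: igZ.
  case=> x r /=; have [h|h] := boolP (0 < r < T); last first.
    by rewrite /G (es_offt hu)// normr0 [ioo 0 T r]ioo0// !(mul0r, mulr0) subrr.
  rewrite /G [ioo 0 T r]ioo1// !mul1r !subr0.
  (* Outside [Om] both u and u0 vanish, so the additive constant is charged on [Om] only. *)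
  have hG : 2^-1 * (`|u x r| - (`|u0 x| + O x)) <= J (u x r) - J (u0 x).
    have [hx|hx] := pselect (Om x).
      by rewrite OE//; exact: aux1 (hJ _) (Jle _).
    by rewrite OE0// (es_offx hu)// (es_offu0 hu)// normr0 subrr addr0 subrr mulr0.
  have q1 := ler_wpM2l (Q0 r) hG.
  have q2 := ler_wpM2r (normr_ge0 (u x r)) (Q0K h).
  rewrite -/K in q2; apply: le_trans q1.
  exact: aux2.
have tens : \int[pm m mu]_y ((`|u0 y.1| + O y.1) * (ioo 0 T y.2 * Q y.2)) <=
    (\int[m]_x `|u0 x| + \int[m]_x O x) * (2 * kapp eps).
  rewrite -(int_F1 iU0Q) /=.
  have E x : \int[mu]_y ((`|u0 x| + O x) * (ioo 0 T y * Q y)) =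
      (\int[mu]_y (ioo 0 T y * Q y)) * (`|u0 x| + O x) by rewrite int_Z// mulrC.
  rewrite (int_ext m E) int_Z// mulrC int_D//; last exact: ig_abs (es_u0 hu).
  rewrite ler_wpM2l//; apply: addr_ge0; apply: int_ge0 => x //.
rewrite LE in H; apply: le_trans (aux3 _ _ _ _ _ up low H) _.
by rewrite lerD2l mulrC.
Qed.

End eps.

End initial.

(** * The contraction estimate *)

Section window.
Context (R : realType).
Local Notation mu := (@lebesgue_measure R).
Local Notation RT := (measurableTypeR R).
Variables (T : R) (kk : R -> R).
Hypotheses (kk_ig : ig mu kk) (kk_ge0 : forall t, 0 <= kk t)
  (kk_supp : forall t, ~~ (0 < t < T) -> kk t = 0)
  (kk_mono : forall r t, 0 < r -> r <= t -> kk t <= kk r).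

Lemma kk_le0 t : t <= 0 -> kk t = 0.
Proof. by move=> t0; rewrite kk_supp// negb_and -leNgt t0. Qed.

Lemma ig_kkioo a b : ig mu (fun s => kk s * ioo a b s).
Proof. by under eq_fun do rewrite mulrC; exact: ig_iooM. Qed.

(* A non-increasing kernel has the largest mass next to the origin. *)
Lemma kapp_window a de : \int[mu]_s (kk s * ioo a (a + de) s) <= kapp kk de.
Proof.
have [a0|a0] := leP 0 a.
  have E s : kk s * ioo a (a + de) s = kk (s - a + a) * ioo 0 de (s - a).
    by rewrite subrK !iooB ltrBlDl subr_gt0 (addrC a).
  have i1 : ig mu (fun s => kk (s + a) * ioo 0 de s).
    have := ig_shift (- a) kk_ig; under eq_fun do rewrite opprK.
    by move/(ig_iooM 0 de); under eq_fun do rewrite mulrC.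
  rewrite (int_ext mu E) (int_shift a i1) /kapp; apply: int_le => //.
    exact: ig_iooM.
  move=> s; rewrite mulrC; have [h|h] := boolP (0 < s < de); last first.
    by rewrite ioo0// !mul0r.
  rewrite ioo1// !mul1r kk_mono//; first by have /andP[] := h.
  by rewrite lerDl.
rewrite /kapp; apply: int_le; [exact: ig_kkioo|exact: ig_iooM|].
move=> s; rewrite mulrC; have [s0|s0] := leP s 0; first by rewrite kk_le0// !mulr0.
rewrite ler_wpM2r// !iooB s0 /= ler_nat; case h : (s < de) => //=.
  exact: leq_b1.
rewrite (_ : s < a + de = false) ?andbF//; apply/negbTE.
by rewrite -leNgt; move/negbT: h; rewrite -leNgt; lra.
Qed.

(** Otherwise the integral over []e, 2 * e[] alone would be at least that of [X] plus e^2. The slack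
    e spares the discussion of equality. *)
Lemma exists_le_average (X : R -> R) (e : R) : 0 < e -> ig mu X -> (forall s, 0 <= X s) ->
  exists2 c, e < c < 2 * e & X c <= (\int[mu]_s X s) / e + e.
Proof.
move=> e0 iX X0; apply: contrapT => hno.
set M := (\int[mu]_s X s) / e + e in hno.
have hM s : e < s < 2 * e -> M < X s.
  by move=> hs; rewrite ltNge; apply/negP => h; apply: hno; exists s.
have : \int[mu]_s (M * ioo e (2 * e) s) <= \int[mu]_s X s.
  apply: int_le => //; first by apply: igZ; exact: ig_ioo.
  move=> s; have [h|h] := boolP (e < s < 2 * e); last by rewrite ioo0// mulr0.
  by rewrite ioo1// mulr1 ltW// hM.
rewrite int_Z; last exact: ig_ioo.
rewrite int_ioo; last lra.
rewrite (_ : M * (2 * e - e) = \int[mu]_s X s + e ^+ 2); last first.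
  by rewrite /M; field; rewrite gt_eqF.
by rewrite gerDl leNgt exprn_gt0.
Qed.

Lemma int_ioo_cvg0 d (Y : measurableType d) (n : {measure set Y -> \bar R}) (g : Y -> R)
  (p : Y -> RT) (e : nat -> R) : measurable_fun setT p -> ig n g -> (forall k, 0 < e k) ->
  e k @[k --> \oo] --> 0 ->
  \int[n]_z (ioo 0 (e k) (p z) * g z) @[k --> \oo] --> 0.
Proof.
move=> mp iG e0 ecv.
have i1 k : ig n (fun z => ioo 0 (e k) (p z) * g z).
  apply: (ig_bM (c := 1)) iG => [|y]; last exact: ioo_norm1.
  exact: (measurableT_comp (measurable_ioo 0 (e k))).
have [] := @ig_DCT _ _ _ n (fun k z => ioo 0 (e k) (p z) * g z) (fun _ => 0) (fun z => `|g z|).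
- by move=> k; exact: ig_mfun (i1 k).
- exact: measurable_cst.
- move=> z; apply: cvg_near_cst; have [p0|p0] := leP (p z) 0.
    by apply: nearW => k; rewrite iooB ltNge p0 mul0r.
  have h0 : \forall k \near \oo, e k < p z by exact: (cvgr_lt _ ecv).
  apply: filterS h0 => k /ltW h.
  by rewrite iooB (ltNge (p z)) h andbF mul0r.
- exact: ig_abs.
- by move=> k z; rewrite normrM ler_piMl// ioo_norm1.
by move=> _; rewrite [X in _ --> X](_ : _ = 0)// /Rintegral integral0.
Qed.

End window.

(** * The estimate at a fixed scale of the mollifier *)

Section fixed_scale_bound.
Context (R : realType) d (X : measurableType d).
Variable m : {sigma_finite_measure set X -> \bar R}.
Local Notation mu := (@lebesgue_measure R).
Local Notation RT := (measurableTypeR R).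
Variables (Om : set X) (kap : X * X -> R) (T : R) (kk : R -> R).
Hypotheses (mkap : measurable_fun setT kap) (kap0 : forall z, 0 <= kap z).
Hypothesis T0 : 0 < T.
Hypotheses (kk_ig : ig mu kk) (kk_ge0 : forall t, 0 <= kk t)
  (kk_supp : forall t, ~~ (0 < t < T) -> kk t = 0)
  (kk_mono : forall r t, 0 < r -> r <= t -> kk t <= kk r).

Lemma extn_window (f : X -> R -> R) (u0 : X -> R) (u : X -> R -> R) e : 0 < e -> 3 * e < T ->
  esol m Om kap T kk f u0 u ->
  \int[pm m mu]_z `|ioo (- e - e) (2 * e + e) z.2 * extn T u u0 z.1 z.2| <=
  Au m u (3 * e) + 3 * e * \int[m]_x `|u0 x|.
Proof.
move=> e0 eT hu; have iu := es_u hu; have iu0 := ig_abs (es_u0 hu).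
have i1 : ig (pm m mu) (fun z => ioo 0 (3 * e) z.2 * `|u z.1 z.2|).
  apply: (ig_bM (c := 1)) (ig_abs iu) => [|y]; last exact: ioo_norm1.
  exact: (measurableT_comp (measurable_ioo _ _)).
(* The continued initial value is met on []-2e, 0]]. The larger window []-2e, e[] also contains the
   end point 0 and explains the factor 3 e. *)
have i2 := ig_tensor iu0 (ig_ioo (- (2 * e)) e).
have E2 : \int[pm m mu]_z (`|u0 z.1| * ioo (- (2 * e)) e z.2) = 3 * e * \int[m]_x `|u0 x|.
  rewrite -(int_F1 i2) /= -int_Z//; apply: int_ext => x.
  rewrite int_Z; last exact: ig_ioo.
  by rewrite int_ioo; [ring|lra].
rewrite -E2 /Au -int_D//; apply: int_le; last 1 first.
- move=> z; rewrite /extn; have [h|h] := boolP (0 < z.2 < T).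
    rewrite [ioo 0 T _]ioo1// subrr mulr0 mul0r addr0 normrM.
    rewrite (_ : `|ioo (- e - e) (2 * e + e) z.2| = ioo 0 (3 * e) z.2).
      by rewrite lerDl mulr_ge0// ioo_ge0.
    have /andP[h1 h2] := h; rewrite ger0_norm ?ioo_ge0// !iooB h1.
    by congr ((_ : bool)%:R); apply/andP/idP; [case; lra|split; lra].
  rewrite (es_offt hu)// normr0 mulr0 !add0r [ioo 0 T _]ioo0// subr0 mulr1.
  rewrite mulrA normrM mulrC ler_wpM2l//.
  have [h1|h1] := boolP (- (2 * e) < z.2 < e).
    by rewrite [ioo _ e _]ioo1// normrM mulr_ile1// ioo_norm1.
  rewrite [ioo (- e - e) _ _]ioo0 ?mul0r ?normr0 ?ioo_ge0//.
  apply: contra h1 => /andP[a b]; apply/andP; split; first lra.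
  have [t0|t0] := leP z.2 0; first lra.
  by move: h; rewrite t0 /= -leNgt => ?; lra.
- apply: ig_abs; apply: (ig_bM (c := 1)) (ig_extn hu) => [|y]; last exact: ioo_norm1.
  exact: (measurableT_comp (measurable_ioo _ _)).
- exact: igD.
Qed.

Variables (eps : R) (f : X -> R -> R) (u0 : X -> R) (u : X -> R -> R).
Variables (h : X -> R -> R) (v0 : X -> R) (v : X -> R -> R).
Hypotheses (e0 : 0 < eps) (eT : 4 * eps < T).
Hypotheses (hu : esol m Om kap T kk f u0 u) (hv : esol m Om kap T kk h v0 v).

Let ub := extn T u u0.
Let vb := extn T v v0.
Let iu : ig (pm m mu) (fun z => ub z.1 z.2). Proof. exact: ig_extn hu. Qed.
Let iv : ig (pm m mu) (fun z => vb z.1 z.2). Proof. exact: ig_extn hv. Qed.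
Let G := Gm m ub vb eps.
Let U0 := \int[m]_x rpos (u0 x - v0 x).
Let C := mollC R / eps * (\int[pm m mu]_z `|ub z.1 z.2| + \int[pm m mu]_z `|vb z.1 z.2|).

Let U00 : 0 <= U0. Proof. by apply: int_ge0 => x; exact: rpos_ge0. Qed.
Let iG : ig mu G. Proof. exact: ig_Gm. Qed.
Let G0 c : 0 <= G c. Proof. exact: Gm_ge0. Qed.
Let GC c : G c <= C. Proof. by have [] := Gm_sec iu iv c e0. Qed.

(** Before -eps the mollifiers see only the initial values, so the mollified distance starts from
    the constant [U0]. *)
Let G_past c : - T <= c <= - eps -> G c = U0.
Proof.
have E0 := e0; have ET := eT.
move=> /andP[c1 c2]; apply: Gm_cst => //; [exact: es_u0 hu|exact: es_u0 hv|].
move=> x t; rewrite ler_norml => /andP[t1 t2].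
have h1 : ioo (- (2 * T)) T t = 1 by apply: ioo1; apply/andP; split; lra.
have h2 : ~~ (0 < t < T) by rewrite negb_and -leNgt; apply/orP; left; lra.
by rewrite /ub /vb /extn h1 (es_offt hu)// (es_offt hv)// [ioo 0 T t]ioo0// subr0 !mul1r !add0r.
Qed.

Let G_future c : eps < c < T - eps -> G c = Gm m u v eps c.
Proof.
move=> /andP[c1 c2]; apply: Gm_local => // x t; rewrite ler_norml => /andP[t1 t2].
have h2 : 0 < t < T by apply/andP; split; lra.
by rewrite /ub /vb /extn [ioo 0 T t]ioo1// subrr mulr0 !mul0r !addr0.
Qed.

Let win (a b : R) c := ioo a b c * (G c - U0).

Let iwin a b : ig mu (win a b).
Proof.
rewrite /win; under eq_fun do rewrite mulrBr.
apply: igB; first exact: ig_iooM.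
by under eq_fun do rewrite mulrC; apply: igZ; exact: ig_ioo.
Qed.

Let win_le a b c : `|win a b c| <= C + U0.
Proof.
rewrite normrM; apply: (@le_trans _ _ `|G c - U0|); first by rewrite ler_piMl// ioo_norm1.
by apply: (le_trans (ler_normB _ _)); rewrite !ger0_norm// lerD2r.
Qed.

Let g := win (- eps) (T - eps).
Let FF := \int[mu]_c Gm m f h eps c.

Let iF : ig mu (Gm m f h eps). Proof. by apply: ig_Gm => //; [exact: es_f hu|exact: es_f hv]. Qed.

(** [G - U0] vanishes between -T and -eps, hence cutting it off at -eps changes none of the lagged
    increments of [Phi_lag], and [volterra_increment] applies with the kernel errors as [E n]. *)
Let increment c0 c1 : eps <= c0 -> c0 <= c1 -> c1 <= T - eps ->
  cvk kk g c1 - cvk kk g c0 <= FF.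
Proof.
have E0 := e0; have ET := eT.
move=> h0 h01 h1; have [D hD] := moll_der e0.
have D0 : 0 <= D by exact: le_trans (hD 0 0).
pose N := \int[pm m mu]_z `|dg T u u0 z.1 z.2| + \int[pm m mu]_z `|dg T v v0 z.1 z.2|.
have N0 : 0 <= N by apply: addr_ge0; apply: int_ge0.
pose en (n : nat) := \int[mu]_t `|kk t - kk2 kk n.+1%:R t|.
have en0 n : 0 <= en n by apply: int_ge0.
have iE (n : nat) : ig mu (fun c : R => D * en n * N * ioo 0 T c) by apply: igZ; exact: ig_ioo.
have step : cvk kk g c1 - cvk kk g c0 <= \int[mu]_c (ioo c0 c1 c * Gm m f h eps c).
  apply: (volterra_increment kk_ig kk_ge0 kk_supp kk_mono (iwin _ _) (win_le _ _) iF iE) h0 h01 h1.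
  - by move=> n c; rewrite mulr_ge0 ?ioo_ge0// !mulr_ge0.
  - have E n : \int[mu]_c (D * en n * N * ioo 0 T c) = D * en n * N * T.
      by rewrite int_Z ?int_ioo ?subr0 ?(ltW T0)//; exact: ig_ioo.
    under eq_fun do rewrite E.
    have := kk2_cvg kk_ig kk_ge0; rewrite -/en => l0.
    have l1 : D * en n * N * T @[n --> \oo] --> D * 0 * N * T.
      by apply: cvgMl; apply: cvgMl; apply: cvgMr.
    by rewrite mulr0 !mul0r in l1.
  move=> n; apply/aeW => c hc; have /andP[c1' c2'] := hc.
  have mm0 : 0 < n.+1%:R :> R by rewrite ltr0n.
  have := Phi_lag mkap kap0 T0 kk_ig kk_ge0 kk_supp e0 hD hu hv mm0 hc.
  rewrite [ioo 0 T c]ioo1; last by apply/andP; split; lra.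
  rewrite mulr1; apply: le_trans; rewrite le_eqVlt; apply/orP; left; apply/eqP.
  apply: (int_ext mu) => l; congr (_ * _).
  have A0 := lagt_ge0 kk n.+1%:R l; have AT := lagt_le T0 kk_ig kk_supp n.+1%:R l.
  have gE c' : - T < c' < T - eps -> g c' = G c' - U0.
    move=> /andP[a b]; rewrite /g /win; have [hh|hh] := ltP (- eps) c'.
      by rewrite ioo1 ?mul1r// hh b.
    by rewrite G_past ?subrr ?mulr0//; apply/andP; split; lra.
  rewrite -/g !gE; [|by apply/andP; split; lra..].
  by rewrite /G /Phi /Gm opprB addrA subrK.
apply: (le_trans step); apply: int_le => //; first exact: ig_iooM.
by move=> c; rewrite ler_piMl ?ioo_le1// Gm_ge0.
Qed.

Let I := kapp kk (3 * eps) *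
  (Au m u (3 * eps) + Au m v (3 * eps) +
   3 * eps * (\int[m]_x `|u0 x| + \int[m]_x `|v0 x|)) / eps + eps.

(** [Phi_lag] requires c > eps, so the increments are summed from some c0 in []eps, 2 * eps[],
    chosen by averaging. There the convolution involves only kernel arguments below [3 * eps] and
    solution times between -2 eps and 3 eps, which is what [initial_estimate] makes small. *)
Let start : exists2 c0, eps < c0 < 2 * eps & cvk kk g c0 <= I.
Proof.
have E0 := e0; have ET := eT.
pose p c := ioo (- eps) (2 * eps) c * G c.
pose q s := ioo 0 (3 * eps) s * kk s.
have ip : ig mu p by exact: ig_iooM.
have iq : ig mu q by exact: ig_iooM.
have p0 c : 0 <= p c by rewrite mulr_ge0 ?ioo_ge0.
have q0 c : 0 <= q c by rewrite mulr_ge0 ?ioo_ge0.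
have [iX leX] := ig_conv1 iq ip.
have X0 c : 0 <= \int[mu]_s (q s * p (c - s)) by apply: int_ge0 => s; rewrite mulr_ge0.
have [c0 hc0 lec0] := exists_le_average e0 iX X0; exists c0 => //.
have /andP[c01 c02] := hc0.
have pB s : `|p s| <= C by rewrite normrM ger0_norm ?ioo_ge0// ger0_norm// (le_trans _ (GC s))// ler_piMl ?ioo_le1.
have le1 : cvk kk g c0 <= \int[mu]_s (q s * p (c0 - s)).
  apply: int_le.
  - exact: (cvk_ig_bounded kk_ig c0 (iwin _ _) (win_le _ _)).
  - exact: (cvk_ig_bounded iq c0 ip pB).
  move=> s; have [s0|s0] := leP s 0.
    by rewrite (kk_le0 kk_supp)// mul0r mulr_ge0.
  rewrite /q /p /g /win; have [h1|h1] := boolP (- eps < c0 - s < T - eps); last first.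
    by rewrite ioo0// mul0r mulr0 mulr_ge0// mulr_ge0// ioo_ge0.
  have /andP[h2 h3] := h1.
  rewrite [ioo (- eps) (T - eps) _]ioo1// [ioo _ (2 * eps) _]ioo1; last by apply/andP; split; lra.
  rewrite [ioo 0 _ _]ioo1; last by apply/andP; split; lra.
  by rewrite !mul1r ler_wpM2l// gerBl.
apply: (le_trans le1); apply: (le_trans lec0); rewrite /I lerD2r ler_wpM2r ?invr_ge0 ?(ltW e0)//.
have -> : \int[mu]_s (\int[mu]_x (q x * p (s - x))) =
    \int[mu]_s `|\int[mu]_x (q x * p (s - x))|.
  by apply: (int_ext mu) => s; rewrite (ger0_norm (X0 s)).
apply: (le_trans leX).
have -> : \int[mu]_t `|q t| = kapp kk (3 * eps).
  by apply: (int_ext mu) => s; rewrite (ger0_norm (q0 s)).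
rewrite ler_wpM2l ?kapp_ge0//.
have imn a : ig (pm m mu) (fun z => a z.1 z.2) -> ig mu (mollnorm m eps a).
  by move=> ia; exact: (ig_F2 (ig_mollnorm e0 ia)).
have iwd (a : X -> R -> R) : ig (pm m mu) (fun z => a z.1 z.2) ->
    ig (pm m mu) (fun z => ioo (- eps - eps) (2 * eps + eps) z.2 * a z.1 z.2).
  apply: (ig_bM (c := 1)) => [|y]; last exact: ioo_norm1.
  exact: (measurableT_comp (measurable_ioo _ _)).
have iu' := iwd _ iu; have iv' := iwd _ iv.
have iu'' := imn (fun x t => ioo (- eps - eps) (2 * eps + eps) t * ub x t) iu'.
have iv'' := imn (fun x t => ioo (- eps - eps) (2 * eps + eps) t * vb x t) iv'.
apply: (@le_trans _ _ (\int[mu]_c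
   (mollnorm m eps (fun x t => ioo (- eps - eps) (2 * eps + eps) t * ub x t) c +
    mollnorm m eps (fun x t => ioo (- eps - eps) (2 * eps + eps) t * vb x t) c))).
  apply: int_le; [exact: ig_abs|exact: igD|].
  move=> c; rewrite ger0_norm//.
  apply: (@le_trans _ _ (ioo (- eps) (2 * eps) c * (mollnorm m eps ub c + mollnorm m eps vb c))).
    by rewrite ler_wpM2l ?ioo_ge0//; have [] := Gm_sec iu iv c e0.
  by rewrite mulrDr lerD// mollnorm_window.
rewrite int_D// !int_mollnorm//.
have e3 : 3 * eps < T by lra.
have wu := extn_window e0 e3 hu; have wv := extn_window e0 e3 hv.
by move: wu wv; rewrite -/ub -/vb mulrDr; move=> a b; apply: le_trans (lerD a b) _; lra.
Qed.

Variables (l : R -> R).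
Hypotheses (il : ig mu l) (l0 : forall t, t <= 0 -> l t = 0)
  (hl : {ae mu, forall c, 0 < c < T -> cvk kk l c = 1}).

Let B := FF + I + U0 * kapp kk (4 * eps).

(** The convolution of [kk] with [g] is bounded on [[c0, T - eps]] only. Cutting off before c0 makes
    it vanish up to c0; since [G >= 0], this raises the function by at most [U0] on an interval of
    length at most 4 eps, at the price [U0 * kapp kk (4 * eps)]. *)
Lemma fixed_scale_bound :
  \int[mu]_c (ioo (2 * eps) (T - 2 * eps) c * Gm m u v eps c) <=
  T * U0 + B * \int[mu]_t `|l t|.
Proof.
have E0 := e0; have ET := eT.
have [c0 /andP[c01 c02] hc0] := start.
have kap4 := kapp_ge0 kk_ge0 (4 * eps).
have FF0 : 0 <= FF by apply: int_ge0 => c; exact: Gm_ge0.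
have I0 : 0 <= I.
  rewrite addr_ge0 ?(ltW e0)// divr_ge0 ?(ltW e0)// mulr_ge0 ?kapp_ge0//.
  have A (w : X -> R -> R) : 0 <= Au m w (3 * eps).
    by apply: int_ge0 => z; rewrite mulr_ge0 ?ioo_ge0.
  by rewrite !addr_ge0// mulr_ge0 ?addr_ge0 ?int_ge0// mulr_ge0// ltW.
have B0 : 0 <= B by rewrite /B; apply: addr_ge0; [exact: addr_ge0|exact: mulr_ge0].
pose ga := win c0 (T - eps).
have low c : ga c <= g c + U0 * ioo (- eps) (3 * eps) c.
  rewrite /ga /g /win; have [h1|h1] := boolP (c0 < c < T - eps).
    have /andP[a b] := h1; rewrite [ioo c0 _ c]ioo1// [ioo _ (T - eps) c]ioo1; last by rewrite b andbT; lra.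
    by rewrite lerDl mulr_ge0 ?ioo_ge0.
  rewrite ioo0// mul0r; have [h2|h2] := boolP (- eps < c < T - eps).
    have /andP[a b] := h2; rewrite !ioo1//; first by rewrite mul1r mulr1 subrK.
    by rewrite a /=; move: h1; rewrite b andbT -leNgt; lra.
  by rewrite [ioo _ (T - eps) _]ioo0// mul0r add0r mulr_ge0 ?ioo_ge0.
have cB c : 0 < c < T - eps -> cvk kk ga c <= B.
  move=> /andP[c1 c2]; have [cc|cc] := leP c c0.
    rewrite [cvk _ _ _](_ : _ = 0)//.
    rewrite /cvk (_ : (fun s => _) = fun _ => 0); first by rewrite /Rintegral integral0.
    apply/funext => s; have [s0|s0] := leP s 0; first by rewrite (kk_le0 kk_supp)// mul0r.
    rewrite /ga /win ioo0 ?mul0r ?mulr0//.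
    by rewrite negb_and -leNgt; apply/orP; left; lra.
  have i1 := cvk_ig_bounded kk_ig c (iwin c0 (T - eps)) (win_le c0 (T - eps)).
  have i2 := cvk_ig_bounded kk_ig c (iwin (- eps) (T - eps)) (win_le (- eps) (T - eps)).
  have i3 := ig_kkioo kk_ig (c - 3 * eps) (c - 3 * eps + 4 * eps).
  have s1 : cvk kk ga c <= cvk kk g c + U0 * kapp kk (4 * eps).
    have := ler_wpM2l U00 (kapp_window kk_ig kk_ge0 kk_supp kk_mono (c - 3 * eps) (4 * eps)).
    rewrite -int_Z// => s2; apply: le_trans (lerD (lexx _) s2).
    rewrite /cvk -int_D//; last exact: igZ.
    apply: int_le => //; first by apply: igD => //; exact: igZ.
    move=> s; rewrite (mulrCA U0 (kk s)) -mulrDr ler_wpM2l//.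
    rewrite (_ : ioo (c - 3 * eps) _ s = ioo (- eps) (3 * eps) (c - s))//.
    by rewrite !iooB; congr ((_ : bool)%:R); apply/andP/andP; case; split; lra.
  apply: (le_trans s1); rewrite /B lerD2r.
  have := increment (ltW c01) (ltW cc) (ltW c2).
  by move: hc0; move: (cvk kk g c0) (cvk kk g c) => y z; lra.
have T1 : 0 < T - eps by lra.
have T1T : T - eps <= T by lra.
have ga0 t : t <= 0 -> ga t = 0.
  by move=> t0; rewrite /ga /win ioo0 ?mul0r// negb_and -leNgt; apply/orP; left; lra.
have cBae : {ae mu, forall c, 0 < c < T - eps -> cvk kk (win c0 (T - eps)) c <= B}.
  by apply/aeW => c; exact: cB.
(* The time t lies in []T - 2 * eps, T - eps[], to the right of the interval of integration in the
   claim. *)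
have [t /andP[t1 t2] ht] := volterra_bound T0 kk_ig kk_ge0 kk_supp kk_mono T1 T1T e0
  (iwin c0 (T - eps)) ga0 il l0 hl cBae.
have pl : prim l t <= \int[mu]_t `|l t|.
  apply: int_le => //; [exact: ig_ltr1|exact: ig_abs|].
  move=> s; apply: le_trans (ler_norm _) _; rewrite normrM ler_piMl//.
  by case: (_ < _); rewrite ?normr1 ?normr0.
have := ler_wpM2l B0 pl; move=> /(le_trans ht) ht2.
have iuv : ig mu (fun c => ioo (2 * eps) (T - 2 * eps) c * Gm m u v eps c).
  by apply: ig_iooM; apply: ig_Gm => //; [exact: es_u hu|exact: es_u hv].
have : \int[mu]_c (ioo (2 * eps) (T - 2 * eps) c * Gm m u v eps c - U0 * ioo 0 T c) <= prim ga t.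
  apply: int_le.
  - by apply: igB => //; apply: igZ; exact: ig_ioo.
  - exact: ig_ltr1 (iwin _ _).
  move=> c; rewrite /ga /win.
  have [h1|h1] := boolP (2 * eps < c < T - 2 * eps).
    have /andP[a b] := h1; rewrite (_ : c < t); last lra.
    rewrite !ioo1//; [|apply/andP; split; lra..].
    rewrite mulr1 !mul1r G_future//; apply/andP; split; lra.
  rewrite [ioo _ (T - 2 * eps) c]ioo0// mul0r sub0r.
  have [h2|h2] := boolP (c0 < c < T - eps).
    have /andP[a b] := h2; rewrite !ioo1//; last by apply/andP; split; lra.
    rewrite mulr1 mul1r; case: (_ < _); rewrite ?mul1r ?mul0r; last by rewrite oppr_le0.
    by rewrite lerDr.
  by rewrite [ioo c0 _ _]ioo0// mul0r mulr0 oppr_le0 mulr_ge0// ioo_ge0.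
rewrite int_B//; last by apply: igZ; exact: ig_ioo.
rewrite int_Z; last exact: ig_ioo.
rewrite int_ioo ?(ltW T0)// subr0.
by move: ht2; move: (\int[mu]_c _) (prim ga t) (B * _) => y z w; rewrite (mulrC T); lra.
Qed.

End fixed_scale_bound.

(** * Removal of the mollifier *)

Section contraction.
Context (R : realType) d (X : measurableType d).
Variable m : {sigma_finite_measure set X -> \bar R}.
Local Notation mu := (@lebesgue_measure R).
Local Notation RT := (measurableTypeR R).
Variables (Om : set X) (kap : X * X -> R) (T : R) (kk : R -> R).
Hypotheses (mOm : measurable Om) (Omfin : (m Om < +oo)%E).
Hypotheses (mkap : measurable_fun setT kap) (kap0 : forall z, 0 <= kap z).
Hypothesis T0 : 0 < T.
Hypotheses (kk_ig : ig mu kk) (kk_ge0 : forall t, 0 <= kk t)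
  (kk_supp : forall t, ~~ (0 < t < T) -> kk t = 0)
  (kk_mono : forall r t, 0 < r -> r <= t -> kk t <= kk r).

(** The divisor 13 ensures [12 * e n < T], which [initial_estimate] needs at the scale
    [12 * e n]. *)
Let e (n : nat) : R := T / 13 / n.+1%:R.

Let e_gt0 n : 0 < e n. Proof. by rewrite !divr_gt0. Qed.

Let e_le n : 12 * e n < T.
Proof.
have h : e n <= T / 13 by rewrite ler_pdivrMr ?ltr0n// ler_peMr ?ler1n// ltW// divr_gt0.
by have t0 := T0; lra.
Qed.

Let e_cvg c : 0 <= c -> c * e n @[n --> \oo] --> 0.
Proof.
move=> _; have h : (c * (T / 13)) * n.+1%:R^-1 @[n --> \oo] --> (c * (T / 13)) * 0.
  apply: cvgMr; exact: cvg_harmonic.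
by rewrite mulr0 in h; under eq_fun do rewrite /e mulrA.
Qed.

Lemma kapp_cvg c : 0 < c -> kapp kk (c * e n) @[n --> \oo] --> 0.
Proof.
move=> c0; apply: (int_ioo_cvg0 (p := fun x => x)) => //; last exact: e_cvg (ltW c0).
by move=> k; rewrite mulr_gt0.
Qed.

(** [initial_estimate] at the scale [12 * e n] speaks about a quarter of it, the window [3 * e n] of
    the starting time. Its right side consists of an integral of [|f|] over a shrinking interval and
    of the mass of the kernel near 0. *)
Lemma initial_cvg (f : X -> R -> R) (u0 : X -> R) (u : X -> R -> R) :
  esol m Om kap T kk f u0 u ->
  kapp kk (3 * e n) * Au m u (3 * e n) / e n @[n --> \oo] --> 0.
Proof.
move=> hu; set N := \int[m]_x `|u0 x| + \int[m]_x \1_Om x.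
pose b n := 12 * expR 2 * (\int[pm m mu]_z (ioo 0 (12 * e n) z.2 * `|f z.1 z.2|) +
  2 * kapp kk (12 * e n) * N).
have p0 : (0 : R) < 12 by [].
have bcv : b n @[n --> \oo] --> 12 * expR 2 * (0 + 2 * 0 * N).
  apply: cvgMr; apply: cvgD; last by apply: cvgMl; apply: cvgMr; exact: kapp_cvg.
  apply: (int_ioo_cvg0 (p := snd)) => //; first exact: ig_abs (es_f hu).
  - by move=> k; rewrite mulr_gt0.
  - exact: e_cvg (ltW p0).
rewrite mulr0 mul0r addr0 mulr0 in bcv.
apply: (@squeeze_cvgr _ _ _ _ (fun _ => 0) b) => //; last exact: cvg_cst.
apply: nearW => n; have en := e_gt0 n.
rewrite divr_ge0 ?(ltW en)//=; last first.
  rewrite mulr_ge0 ?kapp_ge0//.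
  by apply: int_ge0 => z; rewrite mulr_ge0 ?ioo_ge0.
have e12 : 0 < 12 * e n by rewrite mulr_gt0.
have := initial_estimate mOm Omfin kap0 kk_ig kk_ge0 kk_supp hu e12 (e_le n).
rewrite (_ : 12 * e n / 4 = 3 * e n); last by field.
have E : kapp kk (3 * e n) * Au m u (3 * e n) / e n =
    12 * expR 2 * (expR (- 2) / (12 * e n) * kapp kk (3 * e n) * Au m u (3 * e n)).
  have x2 : expR 2 * expR (- 2) = 1 :> R by rewrite -expRD subrr expR0.
  transitivity (expR 2 * expR (- 2) * (kapp kk (3 * e n) * Au m u (3 * e n)) / e n).
    by rewrite x2 mul1r.
  by field; rewrite gt_eqF.
by rewrite E /b => h; rewrite ler_wpM2l// mulr_ge0// expR_ge0.
Qed.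

Variables (f : X -> R -> R) (u0 : X -> R) (u : X -> R -> R).
Variables (h : X -> R -> R) (v0 : X -> R) (v : X -> R -> R).
Hypotheses (hu : esol m Om kap T kk f u0 u) (hv : esol m Om kap T kk h v0 v).
Hypotheses (offf : forall x t, ~~ (0 < t < T) -> f x t = 0)
  (offh : forall x t, ~~ (0 < t < T) -> h x t = 0).
Variables (l : R -> R).
Hypotheses (il : ig mu l) (l0 : forall t, t <= 0 -> l t = 0)
  (hl : {ae mu, forall c, 0 < c < T -> cvk kk l c = 1}).

Let U0 := \int[m]_x rpos (u0 x - v0 x).
Let FF := \int[pm m mu]_z rpos (f z.1 z.2 - h z.1 z.2).
Let L := \int[mu]_t `|l t|.

Let I n := kapp kk (3 * e n) *
  (Au m u (3 * e n) + Au m v (3 * e n) +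
   3 * e n * (\int[m]_x `|u0 x| + \int[m]_x `|v0 x|)) / e n + e n.

Let I_cvg : I n @[n --> \oo] --> 0.
Proof.
set N := \int[m]_x `|u0 x| + \int[m]_x `|v0 x|.
have E n : I n = kapp kk (3 * e n) * Au m u (3 * e n) / e n +
    kapp kk (3 * e n) * Au m v (3 * e n) / e n + kapp kk (3 * e n) * (3 * N) + 1 * e n.
  by rewrite /I -/N; field; rewrite gt_eqF.
under eq_fun do rewrite E.
have cv : kapp kk (3 * e n) * Au m u (3 * e n) / e n +
    kapp kk (3 * e n) * Au m v (3 * e n) / e n + kapp kk (3 * e n) * (3 * N) + 1 * e n
    @[n --> \oo] --> 0 + 0 + 0 * (3 * N) + 0.
  apply: cvgD; last exact: e_cvg.
  apply: cvgD; first by apply: cvgD; [exact: initial_cvg hu|exact: initial_cvg hv].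
  by apply: cvgMl; exact: kapp_cvg.
by rewrite mul0r !addr0 in cv.
Qed.

Theorem contraction :
  \int[pm m mu]_z rpos (u z.1 z.2 - v z.1 z.2) <= T * U0 + L * FF.
Proof.
have iu := es_u hu; have iv := es_u hv; have jf := es_f hu; have jh := es_f hv.
have iG := ig_gpos iu iv; have iGm n := ig_Gm iu iv (e_gt0 n).
have ecv : e n @[n --> \oo] --> 0.
  by have := e_cvg (ler01 : 0 <= 1 :> R); under eq_fun do rewrite mul1r.
pose df n := \int[mu]_c `|Gm m f h (e n) c - gpos m f h c|.
pose du n := \int[mu]_c `|Gm m u v (e n) c - gpos m u v c|.
have dfcv : df n @[n --> \oo] --> 0 by exact: (Gm_cvg jf jh T0 e_gt0 ecv offf offh).
have ducv : du n @[n --> \oo] --> 0.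
  exact: (Gm_cvg iu iv T0 e_gt0 ecv (es_offt hu) (es_offt hv)).
pose lhs n := \int[mu]_c (ioo (2 * e n) (T - 2 * e n) c * gpos m u v c).
have lhscv : lhs n @[n --> \oo] --> \int[pm m mu]_z rpos (u z.1 z.2 - v z.1 z.2).
  rewrite -int_gpos//.
  have [] := @ig_DCT _ _ _ mu (fun n c => ioo (2 * e n) (T - 2 * e n) c * gpos m u v c)
    (gpos m u v) (fun c => `|gpos m u v c|) => //.
  - by move=> n; exact: ig_mfun (ig_iooM _ _ iG).
  - exact: ig_mfun iG.
  - move=> c; apply: cvg_near_cst; have [hc|hc] := boolP (0 < c < T); last first.
      apply: nearW => n; rewrite [gpos _ _ _ _](_ : _ = 0) ?mulr0//.
      rewrite /gpos (_ : (fun x => _) = (fun _ => 0)); first by rewrite /Rintegral integral0.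
      by apply/funext => x; rewrite (es_offt hu)// (es_offt hv)// subrr /rpos maxxx.
    have /andP[h1 h2] := hc.
    have c1 : \forall k \near \oo, 2 * e k < c by exact: (cvgr_lt _ (e_cvg (ler0n _ 2))).
    have c2 : \forall k \near \oo, 2 * e k < T - c.
      by apply: (cvgr_lt _ (e_cvg (ler0n _ 2))); rewrite subr_gt0.
    apply: filterS2 c1 c2 => k k1 k2; rewrite ioo1 ?mul1r//; apply/andP; split; lra.
  - exact: ig_abs.
  by move=> n c; rewrite normrM ler_piMl// ioo_norm1.
(* [df n] and [du n] are the costs of merging the two times in the data and in the solutions; the
   remaining errors are those of [fixed_scale_bound]. *)
pose rhs n := T * U0 + (FF + df n + I n + U0 * kapp kk (4 * e n)) * L + du n.
have rhscv : rhs n @[n --> \oo] --> T * U0 + (FF + 0 + 0 + U0 * 0) * L + 0.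
  apply: cvgD; last exact: ducv.
  apply: cvgD; first exact: cvg_cst.
  apply: cvgMl; apply: cvgD; last by apply: cvgMr; exact: kapp_cvg.
  apply: cvgD; last exact: I_cvg.
  by apply: cvgD; [exact: cvg_cst|exact: dfcv].
rewrite !addr0 mulr0 addr0 (mulrC FF) in rhscv.
rewrite -(cvg_lim (@Rhausdorff R) lhscv) -(cvg_lim (@Rhausdorff R) rhscv).
apply: ler_lim; [exact: (cvgP _ lhscv)|exact: (cvgP _ rhscv)|].
apply: nearW => n.
have e4 : 4 * e n < T by have := e_le n; have := e_gt0 n; lra.
have key := fixed_scale_bound mkap kap0 T0 kk_ig kk_ge0 kk_supp kk_mono (e_gt0 n) e4 hu hv il l0 hl.
have L0 : 0 <= L by apply: int_ge0.
have s1 : lhs n <= \int[mu]_c (ioo (2 * e n) (T - 2 * e n) c * Gm m u v (e n) c) + du n.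
  rewrite /lhs /du -int_D; [|exact: ig_iooM|by apply: ig_abs; exact: igB].
  apply: int_le; [exact: ig_iooM|by apply: igD; [exact: ig_iooM|by apply: ig_abs; exact: igB]|].
  move=> c; rewrite -lerBlDl -mulrBr.
  apply: (@le_trans _ _ `|ioo (2 * e n) (T - 2 * e n) c * (gpos m u v c - Gm m u v (e n) c)|).
    exact: ler_norm.
  by rewrite normrM distrC ler_piMl// ioo_norm1.
have s2 : \int[mu]_c Gm m f h (e n) c <= FF + df n.
  have iGf := ig_gpos jf jh; have iGmf := ig_Gm jf jh (e_gt0 n).
  have iD := ig_abs (igB iGmf iGf).
  rewrite /FF -(int_gpos jf jh) /df -(int_D iGf iD).
  apply: int_le; [exact: iGmf|exact: igD|].
  by move=> c; rewrite -lerBlDl ler_norm.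
apply: (le_trans s1); rewrite /rhs lerD2r; apply: (le_trans key).
by rewrite lerD2l ler_wpM2r// !lerD2r.
Qed.

End contraction.

(** * Transfer to the entropy solutions *)

Section rV_geometry.
Context (R : realType) (N : nat).
Local Notation mu := (@lebesgue_measure R).

Let box (a : 'I_N -> set (measurableTypeR R)) : set 'rV[R]_N :=
  [set x | forall i, a i (x ord0 i)].

Let measurable_box a : (forall i, measurable (a i)) -> measurable (box a).
Proof.
move=> ma; rewrite (_ : box a = \bigcap_(i in [set: 'I_N])
    ((fun x : 'rV[R]_N => x ord0 i) @^-1` a i)).
  apply: fin_bigcap_measurable => // i _.
  rewrite -[X in measurable X]setTI; apply: measurable_coord => //; exact: ma.
by apply/seteqP; split => x Ax i; [move=> _; exact: Ax|exact: (Ax i I)].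
Qed.

(** The sigma-algebra of R^N is generated by the coordinates, so open sets have to be recovered as
    countable unions of boxes with rational centres and radii 1 / (k + 1). *)
Lemma open_rV_measurable (O : set 'rV[R]_N) : open O -> measurable O.
Proof.
move=> oO.
pose b (q : 'rV[rat]_N * nat) := box (fun i =>
  `]ratr (q.1 ord0 i) - q.2.+1%:R^-1, ratr (q.1 ord0 i) + q.2.+1%:R^-1[%classic).
pose F q := [set x | b q `<=` O /\ b q x].
have -> : O = \bigcup_q F q.
  apply/seteqP; split => [x Ox|x [q _ [sub bx]]]; last exact: sub.
  have /nbhs_ballP[e /= e0 sub] : nbhs x O by exact: open_nbhs_nbhs.
  (* A box that contains x may have x near its boundary, so its other points are only within twice
     the radius of x. *)
  have [k hk] : exists k : nat, 2 * k.+1%:R^-1 < e.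
    have h : \forall k \near \oo, k.+1%:R^-1 < e / 2 :> R.
      by apply: (cvgr_lt _ (@cvg_harmonic R)); rewrite divr_gt0.
    have [k _ /(_ k (leqnn k)) hk] := h; exists k.
    by rewrite mulrC -ltr_pdivlMr.
  have rat_near i : exists q : rat, `|x ord0 i - ratr q| < k.+1%:R^-1.
    have /rat_in_itvoo[q] : x ord0 i - k.+1%:R^-1 < x ord0 i + k.+1%:R^-1.
      by rewrite ltrBlDr -addrA ltrDl addr_gt0// invr_gt0 ltr0n.
    by rewrite in_itv /= => h; exists q; rewrite ltr_distlC.
  have [q hq] := choice rat_near.
  have bE y : b (\row_i q i, k) y <-> forall i, `|y ord0 i - ratr (q i)| < k.+1%:R^-1.
    by split => h i; have := h i; rewrite /= in_itv /= mxE ltr_distl.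
  exists (\row_i q i, k) => //; split; last exact/bE.
  move=> y /bE hy; apply: sub; split=> // i j; rewrite (ord1 i) /ball /=.
  apply: (le_lt_trans (ler_distD (ratr (q j)) _ _)); apply: lt_trans hk.
  by rewrite mulr_natl mulr2n (distrC (ratr _)) ltrD.
apply: countable_bigcupT_measurable; first exact: countableP.
move=> q; have [s|s] := pselect (b q `<=` O).
  rewrite (_ : F q = b q); last by apply/seteqP; split => x //= [].
  by apply: measurable_box => i; exact: measurable_itv.
by rewrite (_ : F q = set0)//; apply/seteqP; split => x //= [].
Qed.

Lemma leb_bounded (O : set 'rV[R]_N) : measurable O -> bounded_set O -> (leb N O < +oo)%E.
Proof.
move=> mO [M [Mr hM]]; pose K := `|M| + 1.
have MK : M < K by rewrite (le_lt_trans (ler_norm M))// ltrDl.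
pose a (i : 'I_N) : set (measurableTypeR R) := `[- K, K]%classic.
have sub : O `<=` box a.
  move=> x Ox i; have h := hM _ MK x Ox.
  have : `|x ord0 i| <= K; last by rewrite ler_norml /a /= in_itv.
  apply: le_trans h; rewrite /Num.Def.normr /= mx_normrE.
  exact: (le_bigmax _ (fun ij : 'I_1 * 'I_N => `|x ij.1 ij.2|) (ord0, i)).
have ma i : measurable (a i) by exact: measurable_itv.
apply: (@le_lt_trans _ _ (leb N (box a))).
  by apply: le_measure => //; rewrite inE//; exact: measurable_box.
rewrite /box leb_box//.
suff /andP[] : (0 <= \prod_(i < N) mu (a i) < +oo)%E by [].
elim/big_ind : _ => //= [|x y /andP[x0 xy] /andP[y0 yy]|i _].
- by rewrite ltry lee_fin ler01.
- by rewrite mule_ge0//= lte_mul_pinfty// ge0_fin_numE.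
rewrite measure_ge0 /= lebesgue_measure_itv/=; case: ifP => _; last exact: ltry.
by rewrite -EFinB ltry.
Qed.

Lemma measurable_enorm : measurable_fun setT (@enorm R N).
Proof.
apply: (measurableT_comp (cts_mfun (@sqrt_continuous R))).
apply: measurable_sum => i; apply: measurable_funX; exact: measurable_coord.
Qed.

Lemma measurable_rVB : measurable_fun setT (fun z : 'rV[R]_N * 'rV[R]_N => z.1 - z.2).
Proof.
apply: measurable_fun_rowP => i; under eq_fun do rewrite !mxE.
apply: measurable_funB.
  exact: (measurableT_comp (measurable_coord i) measurable_fst).
exact: (measurableT_comp (measurable_coord i) measurable_snd).
Qed.

Definition kappa (s : R) (z : 'rV[R]_N * 'rV[R]_N) : R :=
  (enorm (z.1 - z.2) `^ (N%:R + 2 * s))^-1.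

Lemma kappa_ge0 s z : 0 <= kappa s z.
Proof. by rewrite invr_ge0 powR_ge0. Qed.

Lemma measurable_kappa s : measurable_fun setT (kappa s).
Proof.
rewrite /kappa; under eq_fun do rewrite -powRN.
apply: (measurableT_comp (measurable_powR _)).
exact: (measurableT_comp measurable_enorm measurable_rVB).
Qed.

End rV_geometry.

(** * From the definition of entropy solutions to the abstract inequality *)

Section bridge.
Context (R : realType) (N : nat).
Local Notation mu := (@lebesgue_measure R).
Local Notation RT := (measurableTypeR R).
Local Notation X := 'rV[R]_N.
Local Notation m := (@leb R N).
Variables (Om : set X) (T : R).
Hypotheses (mOm : measurable Om) (Omfin : (m Om < +oo)%E) (T0 : 0 < T).

Definition cutX (g : X -> R) (x : X) : R := \1_Om x * g x.
Definition cutXT (g : X -> R -> R) (x : X) (t : R) : R := \1_Om x * ioo 0 T t * g x t.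

Lemma cutX_off g x : ~ Om x -> cutX g x = 0.
Proof. by move=> h; rewrite /cutX indicE memNset// mul0r. Qed.

Lemma cutX_in g x : Om x -> cutX g x = g x.
Proof. by move=> h; rewrite /cutX indicE mem_set// mul1r. Qed.

Lemma cutXT_offx g x t : ~ Om x -> cutXT g x t = 0.
Proof. by move=> h; rewrite /cutXT indicE memNset// !mul0r. Qed.

Lemma cutXT_offt g x t : ~~ (0 < t < T) -> cutXT g x t = 0.
Proof. by move=> h; rewrite /cutXT ioo0// mulr0 mul0r. Qed.

Lemma cutXT_in g x t : Om x -> 0 < t < T -> cutXT g x t = g x t.
Proof. by move=> h h'; rewrite /cutXT indicE mem_set// ioo1// !mul1r. Qed.

Let mC : measurable (cylinder Om T).
Proof. by apply: measurableX => //; exact: measurable_itv. Qed.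

Let cylE (z : X * RT) : (z \in cylinder Om T) = (z.1 \in Om) && (0 < z.2 < T).
Proof.
apply/idP/idP => [/set_mem[h1]|/andP[/set_mem h1 h2]]; last first.
  by apply/mem_set; split => //=; rewrite in_itv.
by rewrite /= in_itv /= => ->; rewrite andbT; exact/mem_set.
Qed.

Let patch_cyl (f : R -> \bar R) (g : X -> R -> R) : f 0 = 0%E ->
  ((fun z : X * RT => f (g z.1 z.2)) \_ (cylinder Om T)) =
  (fun z => f (cutXT g z.1 z.2)).
Proof.
move=> f0; apply/funext => -[x t]; rewrite patchE cylE /cutXT /= indicE /ioo.
by case: (x \in Om); case: (0 < t < T); rewrite /= ?mulr1 ?mul1r ?mul0r ?f0.
Qed.

Lemma ig_cutXT g : (m \x mu)%E.-integrable (cylinder Om T) (fun z => (g z.1 z.2)%:E) ->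
  ig (pm m mu) (fun z => cutXT g z.1 z.2).
Proof. by move/(integrable_mkcond _ mC).1; rewrite (patch_cyl (f := EFin)). Qed.

Lemma ig_cutX g : m.-integrable Om (EFin \o g) -> ig m (cutX g).
Proof.
move/(integrable_mkcond _ mOm).1; rewrite /ig (_ : (EFin \o g) \_ Om = EFin \o cutX g)//.
apply/funext => x; rewrite patchE /= /cutX indicE.
by case: (x \in Om); rewrite ?mul1r ?mul0r.
Qed.

Lemma int_cutX g : (forall x, 0 <= g x) -> ig m (cutX g) ->
  (\int[m]_(x in Om) (g x)%:E = (\int[m]_x cutX g x)%:E)%E.
Proof.
move=> g0 ic; rewrite EFin_int// [LHS]integral_mkcond; apply: eq_integral => x _.
rewrite patchE /= /cutX indicE.
by case: (x \in Om); rewrite ?mul1r ?mul0r.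
Qed.

Lemma int_cylE g : ig (pm m mu) (fun z => cutXT g z.1 z.2) ->
  int_cyl Om T g = (\int[pm m mu]_z cutXT g z.1 z.2)%:E.
Proof.
move=> ic; rewrite EFin_int// -(integral21_prod_meas1 ic) /int_cyl [LHS]integral_mkcond.
apply: eq_integral => t _; rewrite patchE mem_setE in_itv /= /fubini_G.
case: ifP => ht.
  rewrite [LHS]integral_mkcond; apply: eq_integral => x _.
  rewrite patchE /cutXT /= indicE [ioo 0 T t]ioo1// mulr1.
  by case: (x \in Om); rewrite ?mul1r ?mul0r.
apply/esym; apply: integral0_eq => x _ /=.
by rewrite cutXT_offt ?ht.
Qed.

Lemma L1norm_cylE g : ig (pm m mu) (fun z => cutXT g z.1 z.2) ->
  L1norm (m \x mu)%E (cylinder Om T) (fun z => g z.1 z.2) =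
  (\int[pm m mu]_z `|cutXT g z.1 z.2|)%:E.
Proof.
move=> ic; rewrite EFin_int; last exact: ig_abs.
rewrite /L1norm [LHS]integral_mkcond -(patch_cyl (f := fun r => `|r|%:E))//.
by rewrite normr0.
Qed.

Variable s : R.

(** An integrand that vanishes when both points are outside of [Om] does not distinguish the domain
    [dom_D] from the whole space. *)
Lemma int_nuE (g : X -> X -> R) : (forall x y, ~ Om x -> ~ Om y -> g x y = 0) ->
  (int_nu s Om g = \int[pm m m]_z (g z.1 z.2 * kappa s z)%:E)%E.
Proof.
move=> g0; rewrite /int_nu [LHS]integral_mkcond; apply: eq_integral => z _.
rewrite patchE; case: ifPn => // /negP h.
have [h1 h2] : ~ Om z.1 /\ ~ Om z.2.
  by apply: contrapT => h3; apply: h; apply/mem_set => h4; apply: h3.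
by rewrite g0// mul0r.
Qed.

Variables (k : R -> R).
Hypotheses (k_loc : mu.-integrable `]0, T[ (EFin \o k)) (k_ge0 : forall t, 0 < t -> 0 <= k t)
  (k_mono : forall r t, 0 < r -> r <= t -> k t <= k r).

Let kk t := ioo 0 T t * k t.

Lemma kk_ig : ig mu kk. Proof. exact: ig_set_ioo. Qed.

Lemma kk_ge0 t : 0 <= kk t.
Proof.
have [h|h] := boolP (0 < t < T); last by rewrite /kk ioo0// mul0r.
by rewrite mulr_ge0 ?ioo_ge0// k_ge0//; have /andP[] := h.
Qed.

Lemma kk_supp t : ~~ (0 < t < T) -> kk t = 0.
Proof. by move=> h; rewrite /kk ioo0// mul0r. Qed.

Lemma kk_mono r t : 0 < r -> r <= t -> kk t <= kk r.
Proof.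
move=> r0 rt; have [tT|tT] := ltP t T; last first.
  by rewrite (kk_supp (t := t)) ?kk_ge0// negb_and -!leNgt tT orbT.
rewrite /kk !ioo1 ?mul1r ?k_mono//; first by rewrite r0 (le_lt_trans rt).
by rewrite tT (lt_le_trans r0).
Qed.

Lemma smooth_derivable (g : R -> R) t : smooth g -> derivable g t 1.
Proof. by move=> sg; exact: (sg 0%N t). Qed.

Lemma smooth_der (g : R -> R) : smooth g -> smooth (derive1 g).
Proof. by move=> sg n t; have := sg n.+1 t; rewrite derive1Sn. Qed.

Lemma smooth_cts (g : R -> R) : smooth g -> continuous g.
Proof. by move=> sg; apply: derivable_cts => t; exact: smooth_derivable. Qed.

Lemma smooth_bounded (g : R -> R) : smooth g -> exists C, forall t, `|ioo 0 T t * g t| <= C.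
Proof.
move=> sg; have cg := smooth_cts sg.
have cn : {within `[0, T], continuous (fun t => `|g t|)}.
  apply: continuous_subspaceT => t; apply: (@continuous_comp _ _ _ g (fun y : R => `|y|)); first exact: cg.
  exact: norm_continuous.
have [c _ hc] := EVT_max (ltW T0) cn; exists `|g c| => t.
have [h|h] := boolP (0 < t < T); last by rewrite ioo0// mul0r normr0.
rewrite ioo1// mul1r; apply: hc; have /andP[h1 h2] := h.
by rewrite in_itv /= !ltW.
Qed.

Lemma derive1_off (g : R -> R) (a b : R) : (forall t, ~~ (a <= t <= b) -> g t = 0) ->
  forall t, ~~ (a <= t <= b) -> derive1 g t = 0.
Proof.
move=> off t ht; rewrite derive1E.
have near0 : \near t, g t = cst 0 t.
  have : \forall y \near t, ~~ (a <= y <= b).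
    have [ta|ta] := ltP t a.
      have h : \forall y \near t, y < a by exact: (open_nbhs_nbhs (conj (@open_lt R a) ta)).
      by apply: filterS h => y ya; rewrite negb_and -ltNge ya.
    have bt : b < t by move: ht; rewrite ta /= -ltNge.
    have h : \forall y \near t, b < y by exact: (open_nbhs_nbhs (conj (@open_gt R b) bt)).
    by apply: filterS h => y ya; rewrite negb_and -!ltNge ya orbT.
  by apply: filterS => y /off.
by rewrite (near_eq_derive _ near0) ?derive_cst// oner_neq0.
Qed.

Variables (f : X -> R -> R) (u0 : X -> R) (u : X -> R -> R).
Hypotheses (f_ig : (m \x mu)%E.-integrable (cylinder Om T) (fun z => (f z.1 z.2)%:E))
  (u0_ig : m.-integrable Om (EFin \o u0))
  (hu : entropy_solution s T Om k f u0 u).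

Let uu := cutXT u.
Let uu0 := cutX u0.
Let ff := cutXT f.

Let iu : ig (pm m mu) (fun z => uu z.1 z.2).
Proof. by case: hu => h _ _ _; exact: ig_cutXT. Qed.

Let iu0 : ig m uu0. Proof. exact: ig_cutX. Qed.

Let iff : ig (pm m mu) (fun z => ff z.1 z.2). Proof. exact: ig_cutXT. Qed.

Let uE x t : uu x t = ioo 0 T t * u x t.
Proof.
have [ht|ht] := boolP (0 < t < T); last by rewrite /uu cutXT_offt// ioo0// mul0r.
rewrite ioo1// mul1r; have [hx|hx] := pselect (Om x); first by rewrite /uu cutXT_in.
by rewrite /uu cutXT_offx//; case: hu => _ h _ _; rewrite h.
Qed.

Let g := dg T uu uu0.

Let ig_g : ig (pm m mu) (fun z => g z.1 z.2).
Proof.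
have i2 := ig_tensor iu0 (ig_ioo 0 T); have := igB iu i2.
rewrite (_ : (fun z => _) = (fun z => g z.1 z.2))//; apply/funext => z; rewrite /g /dg.
have [ht|ht] := boolP (0 < z.2 < T); first by rewrite ioo1// mulr1 mul1r.
by rewrite ioo0// mulr0 mul0r subr0 /uu cutXT_offt.
Qed.

Lemma entropy_energy K : 0 < K -> (\int[mu]_t \int[pm m m]_z
    ((trunc K (uu z.1 t) - trunc K (uu z.2 t)) ^+ 2 * kappa s z)%:E < +oo)%E.
Proof.
move=> K0; case: hu => _ hoff h _; have [_ _ _] := h K K0; apply: le_lt_trans.
rewrite [leRHS]integral_mkcond le_eqVlt; apply/orP; left; apply/eqP.
apply: eq_integral => t _; rewrite patchE mem_setE in_itv /=; case: ifP => ht.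
  rewrite int_nuE; last first.
    by move=> x y hx hy; rewrite !hoff// subrr normr0 expr0n.
  apply: eq_integral => z _; rewrite !uE ioo1// !mul1r.
  by rewrite real_normK// num_real.
apply: integral0_eq => z _; rewrite !uE ioo0 ?ht// !mul0r subrr expr0n mul0r//.
Qed.

(** The convolution of the definition runs over []0, t[], that of [cvX] over the whole line. They
    agree inside []0, T[] since the kernel vanishes at nonpositive arguments. *)
Let conv_cvX (k1 : R -> R) (v G : R -> R) t : (forall r, r <= 0 -> k1 r = 0) -> 0 < t < T ->
  (forall r, 0 < r < T -> G r = v r) -> (forall r, ~~ (0 < r < T) -> G r = 0) ->
  conv k1 v t = \int[mu]_r (k1 (t - r) * G r).
Proof.
move=> k10 /andP[t0 tT] Gin Gout; rewrite /conv int_set_ioo; apply: (int_ext mu) => r.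
have [/andP[r0 rt]|h] := boolP (0 < r < t).
  by rewrite ioo1 ?r0// mul1r Gin// r0 (lt_trans rt).
rewrite ioo0// mul0r; have [r0|r0] := leP r 0.
  by rewrite Gout ?mulr0// negb_and -leNgt r0.
by rewrite k10 ?mul0r// subr_le0; move: h; rewrite r0 /= -leNgt.
Qed.

Section splitting.
Variable mm : R.
Hypothesis mm0 : 0 < mm.

Let k2 := kk2 kk mm.
Let w := wlag T kk mm g.

Let ik2 : ig mu k2. Proof. exact: (ig_kk2 kk_ig kk_ge0 mm0). Qed.

Let k2_le0 r : r <= 0 -> k2 r = 0.
Proof.
move=> r0; rewrite /k2 /kk2 kk_supp; first by rewrite (min_idPl _) ?ltW.
by rewrite negb_and -leNgt r0.
Qed.

Lemma kk2_nonincreasing r t : 0 < r -> r <= t -> kk2 kk mm t <= kk2 kk mm r /\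
  kk t - kk2 kk mm t <= kk r - kk2 kk mm r.
Proof.
move=> r0 rt; have := kk_mono r0 rt; rewrite /kk2.
by move: (kk t) (kk r) => a b ab; case: (leP a mm); case: (leP b mm) => *; split; lra.
Qed.

Lemma kk2_at_right : exists c : R, kk2 kk mm t @[t --> 0^'+] --> c.
Proof.
eexists; apply: (@nonincreasing_at_right_cvgr _ _ _ (BLeft T)).
- by rewrite bnd_simp.
- move=> x y; rewrite !in_itv /= => /andP[x0 _] /andP[y0 _] xy.
  by have [] := kk2_nonincreasing x0 xy.
by exists mm => _ [x _ <-]; exact: kk2_le.
Qed.

(** [weak_lag] is applied for almost every x. The test function is supported in a compact part of
    []0, T[], where the cut-off functions and convolutions agree with the original ones. *)
Lemma weak_dt_wlag : weak_dt T Om (fun x => conv (kk2 kk mm) (fun tau => u x tau - u0 x))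
  (wlag T kk mm g).
Proof.
split.
  have iw : ig (pm m mu) (fun z => w z.1 z.2).
    exact: (@ig_wlag _ _ _ _ _ _ kk_ig kk_supp mm g mm0 ig_g).
  exact: (integrableS _ _ _ iw).
move=> eta [seta [a [b [a0 bT off]]]].
apply: (ae_imp _ (ae_ig1 ig_g)) => x igx Omx.
have off' := derive1_off off.
have de (t : R) : is_derive t 1 eta (derive1 eta t).
  by split; [exact: smooth_derivable|rewrite derive1E].
have cde := smooth_cts (smooth_der seta).
have H := @weak_lag _ _ _ kk_ig kk_ge0 kk_supp kk_mono mm mm0 _ _ _ a b igx de cde off off'.
have inT t : a <= t <= b -> 0 < t < T.
  by move=> /andP[h1 h2]; rewrite (lt_le_trans a0 h1) (le_lt_trans h2 bT).
rewrite !int_set_ioo; transitivity (- \int[mu]_t ((mm * g x t -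
    \int[mu]_l (ioo 0 mm l * g x (t - lagt kk mm l))) * eta t)).
  rewrite -H; apply: (int_ext mu) => t.
  have [h|h] := boolP (a <= t <= b); last by rewrite off'// !mulr0.
  rewrite ioo1 ?inT// mul1r; congr (_ * _).
  apply: (conv_cvX (G := g x) k2_le0 (inT _ h)) => r hr.
    by rewrite /g /dg ioo1// mul1r /uu /uu0 cutXT_in// cutX_in.
  by rewrite /g /dg ioo0// mul0r.
congr (- _); apply: (int_ext mu) => t.
have [h|h] := boolP (a <= t <= b); last by rewrite off// !mulr0.
by rewrite /wlag ioo1 ?inT// !mul1r.
Qed.

End splitting.

(** The finite local terms change sides. An infinite nonlocal term would contradict the finite upper
    bound. *)
Let ee_move (a b c : R) (x : \bar R) : (- a%:E + b%:E + x <= c%:E)%E -> (x <= (c - b + a)%:E)%E.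
Proof.
case: x => [x| |]; [|by rewrite -EFinN -EFinD addey// leye_eq|by move=> _; exact: leNye].
by rewrite -EFinN -!EFinD !lee_fin => h; lra.
Qed.

Lemma entropy_ineq (phi : X -> R) (M : R) (zeta S sS J k1 k2 : R -> R) (w : X -> R -> R) :
  measurable_fun setT phi -> (forall x, `|phi x| <= M) -> (forall x, ~ Om x -> phi x = 0) ->
  (\int[pm m m]_z ((phi z.1 - phi z.2) ^+ 2 * kappa s z)%:E < +oo)%E ->
  test0 T zeta -> (forall t, 0 <= t < T -> 0 <= zeta t) -> Pfun S sS J ->
  ig mu k1 -> ig mu k2 -> (forall t, t <= 0 -> k1 t = 0) ->
  (forall t, 0 <= k1 t) -> (forall t, 0 <= k2 t) ->
  (forall r t, 0 < r -> r <= t -> k1 t <= k1 r /\ k2 t <= k2 r) ->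
  (forall t, kk t = k1 t + k2 t) -> (exists c : R, k2 t @[t --> 0^'+] --> c) ->
  weak_dt T Om (fun x => conv k2 (fun tau => u x tau - u0 x)) w ->
  ig (pm m mu) (fun z => w z.1 z.2) ->
  ((2^-1)%:E * \int[mu]_t \int[pm m m]_z
      (ioo 0 T t * zeta t * ((uu z.1 t - uu z.2 t) *
        (S (uu z.1 t - phi z.1) - S (uu z.2 t - phi z.2))) * kappa s z)%:E
     <= (\int[mu]_t \int[m]_x
           (ioo 0 T t * zeta t * (ff x t - w x t) * S (uu x t - phi x))
         + \int[mu]_t \int[m]_x (ioo 0 T t * derive1 zeta t *
             cvX k1 (fun x t => ioo 0 T t *
               (J (uu x t - phi x) - J (uu0 x - phi x))) x t))%:E)%E.
Proof.
move=> mphi bphi phi0 ephi tz z0 hP ik1 ik2 k10 k1p k2p km kE k2l wdt iw.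
have [_ uoff _ H] := hu.
have X0phi : X0 s Om phi.
  (* A bounded function is square integrable on [Om] because [Om] has finite measure. *)
  split => //; first by apply/aeW => x; exact: phi0.
  apply: lte_add_pinfty.
    have M0 : 0 <= M by exact: le_trans (bphi (0 : X)).
    apply: (@le_lt_trans _ _ (\int[m]_(x in Om) (cst ((M ^+ 2)%:E) x))%E).
      apply: ge0_le_integral => //.
      - by move=> x _; rewrite lee_fin sqr_ge0.
      - apply/measurable_EFinP; apply: measurable_funTS.
        exact: measurable_funX.
      - by move=> x _; rewrite lee_fin -(real_normK (num_real (phi x))) lerXn2r ?nnegrE.
    by rewrite integral_cst// lte_mul_pinfty// ?lee_fin ?sqr_ge0.
  rewrite int_nuE; last by move=> x y hx hy; rewrite !phi0// subrr normr0 expr0n.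
  by under eq_integral do rewrite real_normK ?num_real//.
have Linf : Linfty Om phi by exists M; apply/aeW => x _; exact: bphi.
have iT (h : R -> R) : ig mu h -> mu.-integrable `]0, T[ (EFin \o h).
  by apply: integrableS => //; exact: measurable_itv.
have {}H := H phi zeta S k1 k2 w X0phi Linf tz z0 (Pfun_classP hP) (fun t _ => conj (k1p t) (k2p t))
  (fun r t r0 rt _ => km r t r0 rt) (iT _ ik1) (iT _ ik2).
have kE' t : 0 < t < T -> k t = k1 t + k2 t.
  by move=> ht; rewrite -kE /kk ioo1// mul1r.
have {}H := H kE' k2l wdt.
have [sz _] := tz; have [Cz hCz] := smooth_bounded sz.
have [Cd hCd] := smooth_bounded (smooth_der sz).
have mz (h : R -> R) : smooth h -> measurable_fun setT (fun y : X * RT => ioo 0 T y.2 * h y.2).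
  move=> sh; apply: (measurableT_comp (f := fun t : RT => ioo 0 T t * h t)) => //.
  apply: measurable_funM; first exact: measurable_ioo.
  exact: cts_mfun (smooth_cts sh).
have [CS hCS] := Pfun_bounded hP.
have mS : measurable_fun [set: RT] (S : RT -> RT) by exact: cts_mfun (Pfun_contS hP).
have mJ : measurable_fun [set: RT] (J : RT -> RT) by exact: cts_mfun (Pfun_contJ hP).
have muu := ig_mfun iu; have muu0 := ig_mfun iu0.
pose G x t := ioo 0 T t * (J (uu x t - phi x) - J (uu0 x - phi x)).
have mphi1 : measurable_fun setT (fun y : X * RT => phi y.1) by exact: (measurableT_comp mphi).
have iG : ig (pm m mu) (fun y => G y.1 y.2).
  apply: (ig_le _ (igZ CS (ig_abs ig_g))).
    apply: measurable_funM; first exact: (measurableT_comp (measurable_ioo 0 T)).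
    apply: measurable_funB; apply: (measurableT_comp mJ); apply: measurable_funB => //.
    exact: (measurableT_comp muu0).
  move=> y; rewrite /G /g /dg !normrM mulrCA ler_wpM2l//.
  apply: (le_trans (Pfun_distJ hP _ _ hCS)).
  by rewrite opprB addrA subrK.
pose A1 x t := ioo 0 T t * derive1 zeta t * cvX k1 G x t.
have iA1 : ig (pm m mu) (fun y => A1 y.1 y.2).
  by apply: (ig_bM (c := Cd)) (ig_cvX ik1 iG) => //; exact: mz (smooth_der sz).
have mSu : measurable_fun setT (fun y : X * RT => S (uu y.1 y.2 - phi y.1)).
  by apply: (measurableT_comp mS); exact: measurable_funB.
have iZS (h : X -> R -> R) : ig (pm m mu) (fun y => h y.1 y.2) ->
    ig (pm m mu) (fun y => ioo 0 T y.2 * zeta y.2 * h y.1 y.2 * S (uu y.1 y.2 - phi y.1)).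
  move=> ih; apply: (ig_Mb (c := CS)) => //.
  by apply: (ig_bM (c := Cz)) => //; exact: mz.
have E1 : cutXT (fun x t => derive1 zeta t * conv k1 (fun tau => oint (u0 x) (u x tau)
    (fun sigma => S (sigma - phi x))) t) = A1.
  apply/funext => x; apply/funext => t.
  have [ht|ht] := boolP (0 < t < T); last first.
    by rewrite cutXT_offt// /A1 ioo0// !mul0r.
  have [hx|hx] := pselect (Om x); last first.
    rewrite cutXT_offx// /A1 /cvX (_ : (fun r => _) = (fun _ => 0)).
      by rewrite /Rintegral integral0 mulr0.
    apply/funext => r; rewrite /G /uu /uu0 cutXT_offx// cutX_off// subrr !mulr0//.
  rewrite cutXT_in// /A1 ioo1// mul1r; congr (_ * _).
  apply: (conv_cvX (G := G x)) => // r hr; last by rewrite /G ioo0// mul0r.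
  by rewrite (Pfun_oint hP) /G ioo1// mul1r /uu /uu0 cutXT_in// cutX_in.
have cutE (h h' : X -> R -> R) : (forall x t, Om x -> 0 < t < T -> h x t = h' x t) ->
    cutXT (fun x t => zeta t * h x t * S (u x t - phi x)) =
    (fun x t => ioo 0 T t * zeta t * h' x t * S (uu x t - phi x)).
  move=> hh; apply/funext => x; apply/funext => t.
  have [ht|ht] := boolP (0 < t < T); last by rewrite cutXT_offt// ioo0// !mul0r.
  have [hx|hx] := pselect (Om x); last first.
    by rewrite cutXT_offx// /uu cutXT_offx// phi0// subrr (Pfun_S0 hP) mulr0.
  by rewrite cutXT_in// [ioo 0 T t]ioo1// mul1r /uu cutXT_in// hh.
have Ew := cutE w w (fun _ _ _ _ => erefl).
have Ef : cutXT (fun x t => zeta t * f x t * S (u x t - phi x)) =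
    (fun x t => ioo 0 T t * zeta t * ff x t * S (uu x t - phi x)).
  by apply: cutE => x t hx ht; rewrite /ff cutXT_in.
have iZw := iZS _ iw; have iZf := iZS _ iff.
rewrite int_cylE in H; last by rewrite E1.
rewrite int_cylE in H; last by rewrite Ew.
rewrite int_cylE in H; last by rewrite Ef.
rewrite E1 Ew Ef in H.
have -> : \int[mu]_t \int[m]_x (ioo 0 T t * zeta t * (ff x t - w x t) * S (uu x t - phi x)) =
    \int[pm m mu]_z (ioo 0 T z.2 * zeta z.2 * ff z.1 z.2 * S (uu z.1 z.2 - phi z.1)) -
    \int[pm m mu]_z (ioo 0 T z.2 * zeta z.2 * w z.1 z.2 * S (uu z.1 z.2 - phi z.1)).
  rewrite -int_B// -(int_F2 (igB iZf iZw)); apply: (int_ext mu) => t; apply: int_ext => x.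
  by rewrite mulrBr mulrBl.
have -> : \int[mu]_t \int[m]_x (ioo 0 T t * derive1 zeta t * cvX k1 G x t) =
    \int[pm m mu]_z A1 z.1 z.2 by exact: (int_F2 iA1).
apply: ee_move; apply: le_trans H; apply: leeD2l.
rewrite le_eqVlt; apply/orP; left; apply/eqP; congr (_ * _)%E.
rewrite [RHS]integral_mkcond; apply: eq_integral => t _.
rewrite patchE mem_setE in_itv /=; case: ifP => ht.
  rewrite int_nuE; last by move=> x y hx hy; rewrite !uoff// subrr !mul0r.
  apply: eq_integral => z _; rewrite !uE [ioo 0 T t]ioo1// !mul1r.
  by congr (_ * _)%:E; rewrite mulrC.
by apply: integral0_eq => z _; rewrite [ioo 0 T t]ioo0 ?ht// !mul0r.
Qed.

(** For k2 = 0 the weak derivative is 0. For k2 = min(k, mm) it is [wlag]; both parts of the kernel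
    are non-increasing, and k2 has a limit at 0 as a bounded monotone function. *)
Lemma entropy_esol : esol m Om (kappa s) T kk ff uu0 uu.
Proof.
split => //.
- by move=> x t ht; exact: cutXT_offt.
- by move=> x t hx; exact: cutXT_offx.
- by move=> x hx; exact: cutX_off.
- exact: entropy_energy.
move=> phi M zeta S sS J k1 w mphi bphi phi0 ephi tz z0 hP [[-> ->]|[mm mm0 [-> ->]]].
- apply: (entropy_ineq (k2 := fun _ => 0) mphi bphi phi0 ephi tz z0 hP kk_ig (ig0 mu)) => //.
  + by move=> t t0; rewrite kk_supp// negb_and -leNgt t0.
  + exact: kk_ge0.
  + by move=> r t r0 rt; split => //; exact: kk_mono.
  + by move=> t; rewrite addr0.
  + by exists 0; exact: cvg_cst.
  + split; first by apply: (integrableS _ _ _ (ig0 (pm m mu))) => //.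
    move=> eta _; apply/aeW => x _.
    rewrite !int_set_ioo (_ : (fun t => _) = (fun _ => 0)).
      rewrite (_ : (fun t => _) = (fun _ => 0)); first by rewrite /Rintegral integral0 oppr0.
      by apply/funext => t; rewrite mul0r mulr0.
    apply/funext => t; rewrite /conv (_ : (fun t => _) = (fun _ => 0)).
      by rewrite /Rintegral integral0 mul0r mulr0.
    by apply/funext => r; rewrite mul0r.
  + exact: ig0.
- have ik2 := ig_kk2 kk_ig kk_ge0 mm0.
  apply: (entropy_ineq (k2 := kk2 kk mm) mphi bphi phi0 ephi tz z0 hP (igB kk_ig ik2) ik2) => //.
  + move=> t t0; rewrite /kk2 kk_supp; last by rewrite negb_and -leNgt t0.
    by rewrite (min_idPl _) ?subrr// ltW.
  + by move=> t; rewrite subr_ge0 kk2_lek.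
  + by move=> t; exact: (kk2_ge0 kk_ge0 mm0).
  + by move=> r t r0 rt; have [h1 h2] := kk2_nonincreasing mm r0 rt.
  + by move=> t; rewrite subrK.
  + exact: kk2_at_right.
  + exact: weak_dt_wlag.
  + exact: (@ig_wlag _ _ _ _ _ _ kk_ig kk_supp mm g mm0 ig_g).
Qed.

End bridge.

Lemma rpos_abs (R : realType) (x : R) : `|x| = rpos x + rpos (- x).
Proof.
rewrite /rpos; have [x0|/ltW x0] := leP 0 x.
  by rewrite ger0_norm// [Num.max (- x) 0]max_r ?addr0// oppr_le0.
by rewrite ler0_norm// [Num.max (- x) 0]max_l ?add0r// oppr_ge0.
Qed.

(** * The two estimates for entropy solutions *)

Section conclusion.
Context (R : realType) (N : nat).
Local Notation mu := (@lebesgue_measure R).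
Local Notation RT := (measurableTypeR R).
Local Notation X := 'rV[R]_N.
Local Notation m := (@leb R N).

(** For a time below T the convolution only uses values on []0, T[], so both kernels may be cut off
    there; a reflection exchanges the roles of the two factors. *)
Lemma conv_cvk (T : R) (k l : R -> R) : L1loc k -> L1loc l -> 0 < T ->
  {ae mu, forall t, 0 < t -> conv k l t = 1} ->
  {ae mu, forall c, 0 < c < T ->
    cvk (fun t => ioo 0 T t * k t) (fun t => ioo 0 T t * l t) c = 1}.
Proof.
move=> kl ll T0 h; set kk := fun t => ioo 0 T t * k t; set l' := fun t => ioo 0 T t * l t.
have ik : ig mu kk by exact/ig_set_ioo/kl.
have il : ig mu l' by exact/ig_set_ioo/ll.
have isec := ae_ig1 (ig_conv ik il).1.
have isec1 : {ae mu, forall c, ig mu (fun s => kk s * l' (c - s)) -> 0 < c < T -> cvk kk l' c = 1}.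
  apply: (ae_imp _ h) => c hc ic /andP[c0 cT]; rewrite -(hc c0) /conv int_set_ioo /cvk.
  rewrite -(int_refl c ic); apply: (int_ext mu) => r /=.
  have -> : c - (c - r) = r by ring.
  have [/andP[r0 rc]|hr] := boolP (0 < r < c).
    rewrite [ioo 0 c r]ioo1 ?r0// /kk /l' [ioo 0 T r]ioo1; last by rewrite r0 (lt_trans rc).
    by rewrite [ioo 0 T _]ioo1 ?mul1r//; apply/andP; split; lra.
  rewrite [ioo 0 c r]ioo0// mul0r /kk /l'; have [r0|r0] := leP r 0.
    by rewrite [ioo 0 T r]ioo0 ?mul0r ?mulr0// negb_and -leNgt r0.
  rewrite [ioo 0 T (c - r)]ioo0 ?mul0r// negb_and -leNgt subr_le0.
  by move: hr; rewrite r0 /= -leNgt => ->.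
exact: (@filterS2 _ _ (ae_filter_ringOfSetsType mu) _ _ _ (fun c h1 h2 => h2 h1) isec isec1).
Qed.

Variables (Om : set X) (T s : R) (k l : R -> R).
Hypotheses (bOm : bounded_domain Om) (T0 : 0 < T) (hk : Hk T k l).

Let mOm : measurable Om. Proof. by case: bOm => _ oO _ _; exact: open_rV_measurable. Qed.
Let Omfin : (m Om < +oo)%E. Proof. by case: bOm => _ _ _ bO; exact: leb_bounded. Qed.

Let ll t := ioo 0 T t * l t.

Let ill : ig mu ll. Proof. by case: hk => -[_ lloc] _ _ _ _; exact/ig_set_ioo/lloc. Qed.

Local Notation cut := (@cutXT R N Om T).

Let cut_rpos (a b : X -> R -> R) : cut (fun x t => Num.max (a x t - b x t) 0) =
  fun x t => rpos (cut a x t - cut b x t).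
Proof.
apply/funext => x; apply/funext => t.
have [hx|hx] := pselect (Om x); last by rewrite !cutXT_offx// subrr /rpos maxxx.
have [ht|ht] := boolP (0 < t < T); first by rewrite !cutXT_in.
by rewrite !cutXT_offt// subrr /rpos maxxx.
Qed.

Let cut_B (a b : X -> R -> R) : cut (fun x t => a x t - b x t) =
  fun x t => cut a x t - cut b x t.
Proof. by apply/funext => x; apply/funext => t; rewrite /cutXT mulrBr. Qed.

Let ig_rposB d (Y : measurableType d) (n : {measure set Y -> \bar R}) (a b : Y -> R) :
  ig n a -> ig n b -> ig n (fun y => rpos (a y - b y)).
Proof.
move=> ia ib; have iB := igB ia ib.
apply: (ig_le (measurable_rpos (ig_mfun iB)) (ig_abs iB)) => y.
by rewrite ger0_norm ?rpos_ge0// /rpos ge_max ler_norm normr_ge0.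
Qed.

Lemma int_cyl_rpos (a b : X -> R -> R) : ig (pm m mu) (fun z => cut a z.1 z.2) ->
  ig (pm m mu) (fun z => cut b z.1 z.2) ->
  int_cyl Om T (fun x t => Num.max (a x t - b x t) 0) =
  (\int[pm m mu]_z rpos (cut a z.1 z.2 - cut b z.1 z.2))%:E.
Proof.
move=> ia ib; rewrite int_cylE//; last by rewrite cut_rpos; exact: ig_rposB.
by rewrite cut_rpos.
Qed.

Lemma L1norm_rpos (a b : X -> R -> R) : ig (pm m mu) (fun z => cut a z.1 z.2) ->
  ig (pm m mu) (fun z => cut b z.1 z.2) ->
  L1norm (m \x mu)%E (cylinder Om T) (fun z => (a z.1 z.2 - b z.1 z.2)%R) =
  (\int[pm m mu]_z rpos (cut a z.1 z.2 - cut b z.1 z.2) +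
   \int[pm m mu]_z rpos (cut b z.1 z.2 - cut a z.1 z.2))%:E.
Proof.
move=> ia ib.
rewrite (L1norm_cylE (g := fun x t => a x t - b x t))//; last by rewrite cut_B; exact: igB.
rewrite cut_B -int_D; [|exact: ig_rposB..].
by congr _%:E; apply: int_ext => z; rewrite -(opprB (cut a z.1 z.2)) rpos_abs.
Qed.

Let cutX_rpos (a b : X -> R) : cutX Om (fun x => Num.max (a x - b x) 0) =
  fun x => rpos (cutX Om a x - cutX Om b x).
Proof.
apply/funext => x; have [hx|hx] := pselect (Om x); first by rewrite !cutX_in.
by rewrite !cutX_off// subrr /rpos maxxx.
Qed.

Lemma int_Om_rpos (a b : X -> R) : ig m (cutX Om a) -> ig m (cutX Om b) ->
  (\int[m]_(x in Om) (Num.max (a x - b x) 0)%:E =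
  (\int[m]_x rpos (cutX Om a x - cutX Om b x))%:E)%E.
Proof.
move=> ia ib; rewrite (int_cutX (g := fun x => Num.max (a x - b x) 0)).
- by rewrite cutX_rpos.
- by move=> x; exact: rpos_ge0.
- by rewrite cutX_rpos; exact: ig_rposB.
Qed.

Lemma L1norm_Om (a b : X -> R) : ig m (cutX Om a) -> ig m (cutX Om b) ->
  L1norm m Om (fun x => (a x - b x)%R) =
  (\int[m]_x rpos (cutX Om a x - cutX Om b x) + \int[m]_x rpos (cutX Om b x - cutX Om a x))%:E.
Proof.
move=> ia ib; rewrite /L1norm (int_cutX (g := fun x => `|a x - b x|)); last 1 first.
- rewrite (_ : cutX Om _ = fun x => `|cutX Om a x - cutX Om b x|); first exact/ig_abs/igB.
  apply/funext => x; have [hx|hx] := pselect (Om x); first by rewrite !cutX_in.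
  by rewrite !cutX_off// subrr normr0.
- rewrite -int_D; [|exact: ig_rposB..].
  congr _%:E; apply: int_ext => x; have [hx|hx] := pselect (Om x).
    by rewrite !cutX_in// -(opprB (a x)) rpos_abs.
  by rewrite !cutX_off// subrr /rpos maxxx addr0.
by [].
Qed.

Lemma L1norm_l : L1norm mu `]0%R, T[ l = (\int[mu]_t `|ll t|)%:E.
Proof.
rewrite EFin_int; last exact: ig_abs.
rewrite /L1norm [LHS]integral_mkcond; apply: eq_integral => t _.
by rewrite patchE mem_setE in_itv /= /ll /ioo; case: ifP => _; rewrite ?mul1r// mul0r normr0.
Qed.

Lemma entropy_contraction (f1 f2 : X -> R -> R) (u01 u02 : X -> R) (u1 u2 : X -> R -> R) :
  (m \x mu)%E.-integrable (cylinder Om T) (fun z => (f1 z.1 z.2)%:E) ->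
  (m \x mu)%E.-integrable (cylinder Om T) (fun z => (f2 z.1 z.2)%:E) ->
  m.-integrable Om (EFin \o u01) -> m.-integrable Om (EFin \o u02) ->
  entropy_solution s T Om k f1 u01 u1 -> entropy_solution s T Om k f2 u02 u2 ->
  \int[pm m mu]_z rpos (cut u1 z.1 z.2 - cut u2 z.1 z.2) <=
  T * \int[m]_x rpos (cutX Om u01 x - cutX Om u02 x) +
  (\int[mu]_t `|ll t|) * \int[pm m mu]_z rpos (cut f1 z.1 z.2 - cut f2 z.1 z.2).
Proof.
move=> if1 if2 i01 i02 hu1 hu2; have [[kloc lloc] k0 km _ hconv] := hk.
have kT := kloc T T0.
have e1 := entropy_esol mOm Omfin T0 kT k0 km if1 i01 hu1.
have e2 := entropy_esol mOm Omfin T0 kT k0 km if2 i02 hu2.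
have kk0 t : 0 <= ioo 0 T t * k t by exact: kk_ge0.
have kks t : ~~ (0 < t < T) -> ioo 0 T t * k t = 0 by exact: kk_supp.
have kkm r t : 0 < r -> r <= t -> ioo 0 T t * k t <= ioo 0 T r * k r by exact: kk_mono.
have C := contraction mOm Omfin (@measurable_kappa R N s) (@kappa_ge0 R N s) T0 (kk_ig kT)
  kk0 kks kkm e1 e2.
apply: (C _ _ ll ill _ (conv_cvk kloc lloc T0 hconv)).
- by move=> x t ht; exact: cutXT_offt.
- by move=> x t ht; exact: cutXT_offt.
- by move=> t t0; rewrite /ll ioo0 ?mul0r// negb_and -leNgt t0.
Qed.

End conclusion.

Theorem proposition1p3 (R : realType) (N : nat) (Omega : set 'rV[R]_N)
    (T s : R) (k l : R -> R)
    (f1 f2 : 'rV[R]_N -> R -> R) (u01 u02 : 'rV[R]_N -> R)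
    (u1 u2 : 'rV[R]_N -> R -> R)
    (hN : (2 < N)%N) (hOmega : bounded_domain Omega) (hT : 0 < T)
    (hs : 0 < s < 1) (hk : Hk T k l)
    (hf1 : (leb N \x lebesgue_measure)%E.-integrable (cylinder Omega T)
             (fun z => (f1 z.1 z.2)%:E))
    (hf2 : (leb N \x lebesgue_measure)%E.-integrable (cylinder Omega T)
             (fun z => (f2 z.1 z.2)%:E))
    (hu01 : (leb N).-integrable Omega (EFin \o u01))
    (hu02 : (leb N).-integrable Omega (EFin \o u02))
    (hu1 : entropy_solution s T Omega k f1 u01 u1)
    (hu2 : entropy_solution s T Omega k f2 u02 u2) :
  (int_cyl Omega T (fun x t => Num.max (u1 x t - u2 x t) 0)%R
   <= T%:E * (\int[leb N]_(x in Omega) (Num.max (u01 x - u02 x) 0)%:E)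
      + L1norm lebesgue_measure `]0%R, T[ l *
        int_cyl Omega T (fun x t => Num.max (f1 x t - f2 x t) 0)%R)%E
  /\
  (L1norm (leb N \x lebesgue_measure) (cylinder Omega T)
     (fun z => (u1 z.1 z.2 - u2 z.1 z.2)%R)
   <= T%:E * L1norm (leb N) Omega (fun x => (u01 x - u02 x)%R)
      + L1norm lebesgue_measure `]0%R, T[ l *
        L1norm (leb N \x lebesgue_measure) (cylinder Omega T)
          (fun z => (f1 z.1 z.2 - f2 z.1 z.2)%R))%E.
Proof.
have mO : measurable Omega by case: hOmega => _ oO _ _; exact: open_rV_measurable.
have [iu1 _ _ _] := hu1; have [iu2 _ _ _] := hu2.
have c1 := ig_cutXT mO iu1; have c2 := ig_cutXT mO iu2.
have d1 := ig_cutXT mO hf1; have d2 := ig_cutXT mO hf2.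
have b1 := ig_cutX mO hu01; have b2 := ig_cutX mO hu02.
have E1 := entropy_contraction hOmega hT hk hf1 hf2 hu01 hu02 hu1 hu2.
have E2 := entropy_contraction hOmega hT hk hf2 hf1 hu02 hu01 hu2 hu1.
split.
  rewrite !int_cyl_rpos// int_Om_rpos// (L1norm_l hT hk)//.
(* The absolute value is the sum of the positive parts of both differences; the first estimate is
   added to the one with the solutions exchanged. *)
rewrite !L1norm_rpos// L1norm_Om// (L1norm_l hT hk)// -!EFinM -EFinD lee_fin.
by apply: le_trans (lerD E1 E2) _; rewrite le_eqVlt; apply/orP; left; apply/eqP; ring.
Qed.
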